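(* Let $(V_k)_{k\in\mathbb{N}}\subset C^0(B)$ be a sequence of functions such that $\lim_{k\to+\infty}V_k=1$ in $C^0_{loc}(B)$. Let $(u_k)_{k\in\mathbb{N}}\subset C^4(B)$ be such that $\Delta^2u_k=V_ke^{4u_k}$ in $B$ for all $k\in\mathbb{N}$. Assume that there exists $\Lambda\in\mathbb{R}$ such that $\int_BV_ke^{4u_k}\,dx\le\Lambda$ for all $k\in\mathbb{N}$, that $(u_k)$ blows up, that is, no subsequence of $(u_k)$ converges in $C^3_{loc}(B)$ to a function $u\in C^3(B)$, and that $u_k$ is radially symmetrical for all $k\in\mathbb{N}$. Then, up to a subsequence, there exists $\alpha\in[0,16\pi^2]$ such that $$V_ke^{4u_k}\,dx\rightharpoonup\alpha\,\mathrm{Dirac}_0\quad\text{when }k\to+\infty$$ for the convergence of measures on $B$, where $\mathrm{Dirac}_0$ is the Dirac mass at $0$. More precisely (up to a subsequence): (i) either there exists $C>0$ such that, up to a subsequence, $u_k(0)\le C$ for all $k$; then $\alpha=0$ and $\lim_{k\to+\infty}u_k=-\infty$ locally uniformly on $B\setminus\{0\}$; (ii) or $\lim_{k\to+\infty}u_k(0)=+\infty$. In this situation, for any $\delta\in(0,1)$, $$\lim_{R\to+\infty}\lim_{k\to+\infty}\int_{B_\delta(0)\setminus B_{Re^{-u_k(0)}}(0)}V_ke^{4u_k}\,dx=0.$$ In addition, still in case (ii), the asymptotic behavior at the scale $e^{-u_k(0)}$ is as follows: (ii.a) if $\alpha=16\pi^2$, then $$\lim_{k\to+\infty}\left(u_k(e^{-u_k(0)}x)-u_k(0)\right)=\ln\frac{\sqrt{96}}{\sqrt{96}+|x|^2}$$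 for all $x\in\mathbb{R}^4$, and this convergence holds in $C^3_{loc}(\mathbb{R}^4)$; (ii.b) if $\alpha\in(0,16\pi^2)$, then there exists $v\in C^4(\mathbb{R}^4)$ such that $e^{4v}\in L^1(\mathbb{R}^4)$ and $$\lim_{k\to+\infty}\left(u_k(e^{-u_k(0)}x)-u_k(0)\right)=v(x)$$ for all $x\in\mathbb{R}^4$; moreover, this convergence holds in $C^3_{loc}(\mathbb{R}^4)$ and there exists $\lambda>0$ such that $\lim_{|x|\to+\infty}\frac{v(x)}{|x|^2}=-\lambda$; (ii.c) if $\alpha=0$, then $\lim_{k\to+\infty}e^{-2u_k(0)}\Delta u_k(0)=+\infty$ and $$\lim_{k\to+\infty}\frac{u_k(e^{-u_k(0)}x)-u_k(0)}{e^{-2u_k(0)}\Delta u_k(0)}=-\frac{|x|^2}{8}$$ for all $x\in\mathbb{R}^4$, and this convergence holds in $C^3_{loc}(\mathbb{R}^4)$.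
   Context: $B=B_1(0)$ is the open unit ball of $\mathbb{R}^4$ centered at $0$, and $B_r(0)$ is the open ball of radius $r$ centered at $0$. $\Delta=-\sum_i\partial_{ii}$ is the Laplacian with the minus sign convention and $\Delta^2=\Delta\circ\Delta$. Radially symmetrical means radially symmetrical with respect to $0$. Convergence of measures on $B$ is weak convergence tested against continuous functions with compact support in $B$. All convergence statements are understood up to extraction of a subsequence. The function $x\mapsto u_k(e^{-u_k(0)}x)-u_k(0)$ is defined on $B_{e^{u_k(0)}}(0)$, which contains any given compact subset of $\mathbb{R}^4$ for $k$ large when $u_k(0)\to+\infty$. *)

(* Defs.v *)
From HB Require Import structures.
From mathcomp Require Import all_boot all_order all_algebra.
From mathcomp Require Import all_classical all_reals all_analysis.

Set Implicit Arguments.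
Unset Strict Implicit.
Unset Printing Implicit Defensive.
Import Order.TTheory GRing.Theory Num.Theory.
Import numFieldNormedType.Exports.
Local Open Scope classical_set_scope.
Local Open Scope ring_scope.

(* The library norm on 'rV[R]_4 is the sup norm: it only provides the topology
   and the uniform structure. *)
Definition enorm (R : realType) (x : 'rV[R]_4) : R :=
  Num.sqrt (\sum_(i < 4) x 0 i ^+ 2).

Definition eball (R : realType) (r : R) : set 'rV[R]_4 :=
  [set x | enorm x < r].

(* Filter for |x| --> +oo. *)
Definition at_infinity (R : realType) : set_system 'rV[R]_4 :=
  filter_from [set: R] (fun M => [set x | M < enorm x]).

(* Row vectors are equipped with the sigma-algebra generated by the coordinates,
   following the library's instance for tuples. *)
Section measurable_rV.
Variables (R : realType) (n : nat).

Definition rV_coord (i : 'I_n) (x : 'rV[R]_n) : measurableTypeR R := x 0 i.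

Let rV_set0 : g_sigma_preimage rV_coord set0.
Proof. exact: sigma_algebra0. Qed.

Let rV_setC A : g_sigma_preimage rV_coord A -> g_sigma_preimage rV_coord (~` A).
Proof. exact: sigma_algebraC. Qed.

Let rV_bigcup (F : _^nat) : (forall i, g_sigma_preimage rV_coord (F i)) ->
  g_sigma_preimage rV_coord (\bigcup_i (F i)).
Proof. exact: sigma_algebra_bigcup. Qed.

HB.instance Definition _ := @isMeasurable.Build default_measure_display 'rV[R]_n
  (g_sigma_preimage rV_coord) rV_set0 rV_setC rV_bigcup.

End measurable_rV.

Section lebesgue4.
Variable R : realType.
Let T := measurableTypeR R.
Let mu := @lebesgue_measure R.

Definition row4 (p : T * T * T * T) : 'rV[R]_4 :=
  \row_(j < 4) [:: p.1.1.1; p.1.1.2; p.1.2; p.2]`_j.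

Lemma measurable_row4 : measurable_fun [set: T * T * T * T] row4.
Proof.
have mc (i : 'I_4) : measurable_fun [set: T * T * T * T] (rV_coord i \o row4).
  have -> : rV_coord i \o row4 =
      (fun p => [:: p.1.1.1; p.1.1.2; p.1.2; p.2]`_i).
    by apply/funext => p; rewrite /rV_coord /= mxE.
  case: i => -[|[|[|[|//]]]] /= _.
  - apply: measurableT_comp => //; exact: measurableT_comp.
  - apply: measurableT_comp => //; exact: measurableT_comp.
  - exact: measurableT_comp.
  - exact: measurable_snd.
move=> _ A mA; rewrite setTI; move: A mA.
apply: smallest_sub.
  split=> [|B /= mB|F /= mF].
  - by rewrite /= preimage_set0.
  - by rewrite setTD preimage_setC; exact: measurableC.
  - by rewrite preimage_bigcup; exact: bigcupT_measurable.
rewrite -bigcup_mkord_ord => A [i /= i4] [B mB <-].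
by rewrite setTI -comp_preimage -[X in measurable X]setTI; exact: mc.
Qed.

Definition lebesgue4 : set 'rV[R]_4 -> \bar R :=
  pushforward (mu \x mu \x mu \x mu)%E row4.

Let nu : {measure set 'rV[R]_4 -> \bar R} :=
  measure_function_pushforward__canonical__measure_function_Measure
    (mu \x mu \x mu \x mu)%E measurable_row4.

HB.instance Definition _ := isMeasure.Build _ _ _ lebesgue4
  (measure0 nu) (measure_ge0 nu) (@measure_semi_sigma_additive _ _ _ nu).

End lebesgue4.
Arguments lebesgue4 {R}.

Definition partial (R : realType) (i : 'I_4) (f : 'rV[R]_4 -> R) :
  'rV[R]_4 -> R := 'D_(delta_mx 0 i) f.

Definition partials (R : realType) (s : seq 'I_4) (f : 'rV[R]_4 -> R) :
  'rV[R]_4 -> R := foldr (@partial R) f s.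

Definition laplacian (R : realType) (f : 'rV[R]_4 -> R) : 'rV[R]_4 -> R :=
  fun x => - \sum_(i < 4) partial i (partial i f) x.

(* f \in C^k(D), for D open: all the iterated partial derivatives of order at
   most k exist and are continuous on D. The values of f outside D are
   irrelevant. *)
Definition Ck (R : realType) (k : nat) (D : set 'rV[R]_4)
    (f : 'rV[R]_4 -> R) : Prop :=
  forall s : seq 'I_4, (size s <= k)%N -> forall x, D x ->
    {for x, continuous (partials s f)} /\
    ((size s < k)%N -> forall i, derivable (partials s f) x (delta_mx 0 i)).

(* f_ n --> g in C^k_loc(D), for D open. *)
Definition Ckloc_cvg (R : realType) (k : nat) (D : set 'rV[R]_4)
    (f_ : nat -> 'rV[R]_4 -> R) (g : 'rV[R]_4 -> R) : Prop :=
  forall s : seq 'I_4, (size s <= k)%N ->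
    {family (fun K => compact K /\ K `<=` D),
      (fun n => partials s (f_ n)) @ \oo --> partials s g}.

Definition Nycvg_loc (R : realType) (D : set 'rV[R]_4)
    (f_ : nat -> 'rV[R]_4 -> R) : Prop :=
  forall K, compact K -> K `<=` D ->
    forall A : R, \forall n \near \oo, forall x, K x -> f_ n x <= A.

Definition subsequence (s : nat -> nat) : Prop :=
  {homo s : i j / (i < j)%N >-> (i < j)%N}.

Definition blows_up (R : realType) (D : set 'rV[R]_4)
    (f_ : nat -> 'rV[R]_4 -> R) : Prop :=
  ~ exists (s : nat -> nat) (g : 'rV[R]_4 -> R),
      [/\ subsequence s, Ck 3 D g & Ckloc_cvg 3 D (f_ \o s) g].

Definition radial_on (R : realType) (D : set 'rV[R]_4)
    (f : 'rV[R]_4 -> R) : Prop :=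
  forall x y, D x -> D y -> enorm x = enorm y -> f x = f y.

Definition test_function (R : realType) (D : set 'rV[R]_4)
    (phi : 'rV[R]_4 -> R) : Prop :=
  let supp := closure [set x | phi x != 0] in
  [/\ continuous phi, compact supp & supp `<=` D].

(* In the library (+oo) - (+oo) = -oo, so that an upper bound on an integral is
   only meaningful if the positive and the negative parts of the integrand do
   not both have an infinite integral. *)
Definition has_integral d (T : measurableType d) (R : realType)
    (mu : {measure set T -> \bar R}) (D : set T) (f : T -> \bar R) : Prop :=
  (\int[mu]_(x in D) f^\+ x < +oo)%E \/ (\int[mu]_(x in D) f^\- x < +oo)%E.

Definition rescale (R : realType) (f : 'rV[R]_4 -> R) : 'rV[R]_4 -> R :=
  fun x => f (expR (- f 0) *: x) - f 0.

(* Main.v *)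
(** Along a ray a radial solution becomes a first order system in
    g = u, a = r^3 u', w = -(Laplacian u), P = -r^3 (Laplacian u)', whose
    nonlinearity f = V exp (4 u) is positive, so that P is nondecreasing and
    the mass of the ball of radius r is 2 pi^2 P r.  Gronwall estimates give
    compactness wherever u and its Laplacian at 0 are controlled, so the whole
    behaviour at the scale exp (- u(0)) is governed by the limit b of
    exp (- 2 u(0)) * (Laplacian u)(0).  The system is cooperative, and comparison
    with the bubbles ln (c / (c + r^2)), which solve it exactly for c = sqrt 96,
    forces b >= 8 / sqrt 96.  If b = 8 / sqrt 96, the limit is the bubble, of mass
    16 pi^2, and a convexity argument in the variable r^2 bounds u by
    - (3 / 2) ln r at larger radii, which rules out residual mass.  If b is larger
    and finite, the limit lies below the bubble by a quadratic amount, whence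
    both the quadratic decay and the absence of residual mass; if b is infinite
    there is no mass at all.  When u(0) stays bounded above, either u(0) and
    the Laplacian at 0 stay bounded, and compactness contradicts the blow-up
    assumption, or u tends to -oo away from 0. *)
From HB Require Import structures.
Require Import Defs.
From mathcomp Require Import all_boot all_order all_algebra.
From mathcomp Require Import all_classical all_reals all_analysis.
From mathcomp Require Import measurable_realfun.
From mathcomp Require Import ring lra.

Set Implicit Arguments.
Unset Strict Implicit.
Unset Printing Implicit Defensive.
Import Order.TTheory GRing.Theory Num.Theory.
Import numFieldNormedType.Exports.
Local Open Scope classical_set_scope.
Local Open Scope ring_scope.

(** For [u = - beta * ln r] the system gives [P = 4 * beta], and [r ^ 3 * exp (4 * u)] is integrable
    at infinity as soon as [beta > 1]. Bubbles have [beta = 2], hence [P = 8] and mass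
    [2 * pi ^ 2 * 8]; the exponent [3 / 2], that is [P = 6], lies midway between integrability and
    the bubble. The constant [8 / sqrt 96] is the Laplacian at 0 of the bubble that solves the
    equation with [V = 1], and it is the delicate case: to absorb the error in [V], a bubble lying
    above must have weight [96 / c ^ 2 > 1], and then its Laplacian at 0 exceeds the critical one.
    Only convergence on bounded sets is left there, and the tail is controlled from both ends:
    inside, [P] is almost 8; at a fixed fraction of the outer radius, an increasing solution
    explodes within the remaining distance unless [exp (4 * u)] is small. The same explosion
    excludes a Laplacian at 0 below the critical one. Radial symmetry replaces elliptic estimates:
    partial derivatives up to order four are explicit in the system, so a bound on the bilaplacian
    and on the data at 0 suffices. *)

(** * Monotonicity from derivatives *)

Lemma is_derive_cvg_right (R : realType) (f : R -> R) (a d : R) :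
  is_derive a 1 f d -> f x @[x --> a^'+] --> f a.
Proof.
move=> h; apply: cvg_at_right_filter.
by apply/differentiable_continuous/derivable1_diffP; exact: ex_derive.
Qed.

Lemma is_derive_cvg (R : realType) (f : R -> R) (a d : R) :
  is_derive a 1 f d -> f x @[x --> a] --> f a.
Proof.
move=> h; by apply/differentiable_continuous/derivable1_diffP; exact: ex_derive.
Qed.

(** The mean value theorem for [G - F]. Differentiability is asked only on []a, b]], with right
    continuity at [a], because the coefficients of the radial system are singular at [0]. *)
Lemma le_of_deriv (R : realType) (F G dF dG : R -> R) (a b : R) :
  a <= b ->
  (forall x : R, a < x <= b -> is_derive x 1 F (dF x)) ->
  (forall x : R, a < x <= b -> is_derive x 1 G (dG x)) ->
  F x @[x --> a^'+] --> F a -> G x @[x --> a^'+] --> G a ->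
  (forall x : R, a < x < b -> dF x <= dG x) ->
  F b - F a <= G b - G a.
Proof.
rewrite le_eqVlt => /predU1P[<- *|ab hF hG cF cG hle]; first by rewrite !subrr.
have hH x : a < x <= b -> is_derive x 1 (G - F) (dG x - dF x).
  by move=> hx; have := hF _ hx; have := hG _ hx => ? ?; exact: is_deriveB.
have cH : {within `[a, b], continuous (G - F)}.
  apply/continuous_within_itvP => //; split.
  - move=> x; rewrite in_itv /= => /andP[ax xb].
    by apply: is_derive_cvg (hH x _); rewrite ax ltW.
  - exact: cvgB.
  - apply: cvg_at_left_filter; apply: is_derive_cvg (hH b _).
    by rewrite ab lexx.
have [|c] := @MVT R (G - F) (fun x => dG x - dF x) a b ab _ cH.
  by move=> x; rewrite in_itv /= => /andP[ax xb]; apply: hH; rewrite ax ltW.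
rewrite in_itv /= => /hle; rewrite -subr_ge0 => h0.
rewrite !fctE => e.
have : 0 <= (dG c - dF c) * (b - a) by rewrite mulr_ge0 // subr_ge0 ltW.
rewrite -e; lra.
Qed.

Lemma le_of_deriv_cc (R : realType) (F G dF dG : R -> R) (a b : R) :
  a <= b ->
  (forall x : R, a <= x <= b -> is_derive x 1 F (dF x)) ->
  (forall x : R, a <= x <= b -> is_derive x 1 G (dG x)) ->
  (forall x : R, a <= x <= b -> dF x <= dG x) ->
  F b - F a <= G b - G a.
Proof.
move=> ab hF hG h; apply: (@le_of_deriv R F G dF dG) => //.
- by move=> x /andP[? ?]; apply: hF; rewrite ltW.
- by move=> x /andP[? ?]; apply: hG; rewrite ltW.
- by apply: is_derive_cvg_right (hF a _); rewrite lexx.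
- by apply: is_derive_cvg_right (hG a _); rewrite lexx.
- by move=> x /andP[? ?]; apply: h; rewrite !ltW.
Qed.

(** * The radial first order system and its comparison principle *)

(** For a radial [g] in dimension four this is [bilaplacian g = f]. The fluxes [a] and [P] are
    unknowns of their own, so that each equation has a single source term, and [f] is a free
    parameter, so that differences of solutions and barriers are again instances. *)
Record radsol (R : realType) (rho : R) (g a w P f : R -> R) : Prop := RadSol {
  rs_g : forall r : R, 0 < r < rho -> is_derive r 1 g (a r / r ^+ 3);
  rs_a : forall r : R, 0 < r < rho -> is_derive r 1 a (r ^+ 3 * w r);
  rs_w : forall r : R, 0 < r < rho -> is_derive r 1 w (P r / r ^+ 3);
  rs_P : forall r : R, 0 < r < rho -> is_derive r 1 P (r ^+ 3 * f r);
  rs_g0 : g x @[x --> 0^'+] --> g 0;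
  rs_a0 : a x @[x --> 0^'+] --> a 0;
  rs_w0 : w x @[x --> 0^'+] --> w 0;
  rs_P0 : P x @[x --> 0^'+] --> P 0;
  rs_a00 : a 0 = 0;
  rs_P00 : P 0 = 0 }.

Lemma radsol_comb (R : realType) (rho c1 c2 : R) (g1 a1 w1 P1 f1 g2 a2 w2 P2 f2 : R -> R) :
  radsol rho g1 a1 w1 P1 f1 -> radsol rho g2 a2 w2 P2 f2 ->
  radsol rho (fun r => c1 * g1 r + c2 * g2 r) (fun r => c1 * a1 r + c2 * a2 r)
    (fun r => c1 * w1 r + c2 * w2 r) (fun r => c1 * P1 r + c2 * P2 r)
    (fun r => c1 * f1 r + c2 * f2 r).
Proof.
move=> [hg1 ha1 hw1 hP1 cg1 ca1 cw1 cP1 a10 P10] [hg2 ha2 hw2 hP2 cg2 ca2 cw2 cP2 a20 P20].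
have dc (F1 F2 : R -> R) (d1 d2 r : R) : is_derive r 1 F1 d1 -> is_derive r 1 F2 d2 ->
    is_derive r 1 (fun x => c1 * F1 x + c2 * F2 x) (c1 * d1 + c2 * d2).
  by move=> h1 h2; apply: is_derive_eq.
have cc (F1 F2 : R -> R) (l1 l2 : R) : F1 x @[x --> 0^'+] --> l1 -> F2 x @[x --> 0^'+] --> l2 ->
    (fun x => c1 * F1 x + c2 * F2 x) x @[x --> 0^'+] --> c1 * l1 + c2 * l2.
  by move=> h1 h2; apply: cvgD; apply: cvgMr.
split.
- by move=> r hr; apply: is_derive_eq (dc _ _ _ _ _ (hg1 r hr) (hg2 r hr)) _; rewrite mulrDl !mulrA.
- by move=> r hr; apply: is_derive_eq (dc _ _ _ _ _ (ha1 r hr) (ha2 r hr)) _; ring.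
- by move=> r hr; apply: is_derive_eq (dc _ _ _ _ _ (hw1 r hr) (hw2 r hr)) _; rewrite mulrDl !mulrA.
- by move=> r hr; apply: is_derive_eq (dc _ _ _ _ _ (hP1 r hr) (hP2 r hr)) _; ring.
- exact: cc.
- exact: cc.
- exact: cc.
- exact: cc.
- by rewrite a10 a20; ring.
- by rewrite P10 P20; ring.
Qed.

Lemma radsol_neg (R : realType) (rho : R) (g a w P f : R -> R) :
  radsol rho g a w P f ->
  radsol rho (fun r => - g r) (fun r => - a r) (fun r => - w r) (fun r => - P r)
    (fun r => - f r).
Proof.
move=> h; have := radsol_comb (-1) 0 h h.
by congr radsol; apply/funext => r; ring.
Qed.

Lemma radsol_sub (R : realType) (rho : R) (g1 a1 w1 P1 f1 g2 a2 w2 P2 f2 : R -> R) :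
  radsol rho g1 a1 w1 P1 f1 -> radsol rho g2 a2 w2 P2 f2 ->
  radsol rho (fun r => g1 r - g2 r) (fun r => a1 r - a2 r) (fun r => w1 r - w2 r)
    (fun r => P1 r - P2 r) (fun r => f1 r - f2 r).
Proof.
move=> h1 h2; have := radsol_comb 1 (-1) h1 h2.
by congr radsol; apply/funext => r; ring.
Qed.

(** Four outward integrations from the data at [0]; the right-hand sides solve the system with
    [f = K]. *)
Lemma radsol_le (R : realType) (rho : R) (g a w P f : R -> R) (r1 K : R) :
  radsol rho g a w P f -> r1 < rho -> (forall r : R, 0 < r < r1 -> f r <= K) ->
  forall r : R, 0 <= r <= r1 ->
  [/\ P r <= K * r ^+ 4 / 4, w r <= w 0 + K * r ^+ 2 / 8,
      a r <= w 0 * r ^+ 4 / 4 + K * r ^+ 6 / 48 &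
      g r <= g 0 + w 0 * r ^+ 2 / 8 + K * r ^+ 4 / 192].
Proof.
move=> [hg ha hw hP cg ca cw cP a0 P0] r1rho hf.
have lt (r x : R) : 0 <= r <= r1 -> 0 < x <= r -> 0 < x < rho.
  by move=> /andP[_ rr1] /andP[-> xr] /=; lra.
have lt' (r x : R) : 0 <= r <= r1 -> 0 < x < r -> 0 < x <= r1.
  by move=> /andP[_ rr1] /andP[-> xr] /=; lra.
have st (r : R) (F G dF dG : R -> R) : 0 <= r <= r1 ->
    (forall x : R, 0 < x < rho -> is_derive x 1 F (dF x)) ->
    (forall x : R, is_derive x 1 G (dG x)) -> F x @[x --> 0^'+] --> F 0 ->
    (forall x : R, 0 < x < r -> dF x <= dG x) -> F r - F 0 <= G r - G 0.
  move=> hr hF hG cF hle; apply: (le_of_deriv (dF := dF) (dG := dG)) => //.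
  - by case/andP: hr.
  - by move=> x hx; apply/hF/(lt r).
  - exact: is_derive_cvg_right (hG 0).
have HP (r : R) : 0 <= r <= r1 -> P r <= K * r ^+ 4 / 4.
  move=> hr; have := st r P (fun r => K * r ^+ 4 / 4) _ (fun r => K * r ^+ 3) hr hP _ cP _.
  rewrite P0 expr0n /= !mulr0 !mul0r !subr0; apply => [x|x hx].
    by apply: is_derive_eq; rewrite /GRing.scale /= -!exprVn; field.
  rewrite mulrC ler_wpM2r ?hf //; first by rewrite exprn_ge0 // ltW //; case/andP: hx.
  by case/andP: hx => -> /= ?; case/andP: hr => *; lra.
have Hw (r : R) : 0 <= r <= r1 -> w r <= w 0 + K * r ^+ 2 / 8.
  move=> hr; have := st r w (fun r => K * r ^+ 2 / 8) _ (fun r => K * r / 4) hr hw _ cw _.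
  rewrite expr0n /= !mulr0 !mul0r !subr0 lerBlDl; apply => [x|x hx].
    by apply: is_derive_eq; rewrite /GRing.scale /= -!exprVn; field.
  have [x0 _] := andP hx; rewrite ler_pdivrMr ?exprn_gt0 //.
  have /HP : 0 <= x <= r1 by have /andP[? ?] := lt' _ _ hr hx; lra.
  by move/le_trans; apply; rewrite le_eqVlt; apply/orP; left; apply/eqP; field.
have Ha (r : R) : 0 <= r <= r1 -> a r <= w 0 * r ^+ 4 / 4 + K * r ^+ 6 / 48.
  move=> hr; have := st r a (fun r => w 0 * r ^+ 4 / 4 + K * r ^+ 6 / 48) _
    (fun r => r ^+ 3 * (w 0 + K * r ^+ 2 / 8)) hr ha _ ca _.
  rewrite a0 !expr0n /= !mulr0 !mul0r addr0 !subr0; apply => [x|x hx].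
    by apply: is_derive_eq; rewrite /GRing.scale /= -!exprVn; field.
  have [x0 _] := andP hx; apply: ler_wpM2l; first by rewrite exprn_ge0 // ltW.
  by apply: Hw; have /andP[? ?] := lt' _ _ hr hx; lra.
move=> r hr; split; [exact: HP|exact: Hw|exact: Ha|].
have := st r g (fun r => w 0 * r ^+ 2 / 8 + K * r ^+ 4 / 192) _
    (fun r => w 0 * r / 4 + K * r ^+ 3 / 48) hr hg _ cg _.
rewrite !expr0n /= !mulr0 !mul0r addr0 !subr0 -addrA lerBlDl; apply => [x|x hx].
  by apply: is_derive_eq; rewrite /GRing.scale /= -!exprVn; field.
have [x0 _] := andP hx; rewrite ler_pdivrMr ?exprn_gt0 //.
have /Ha : 0 <= x <= r1 by have /andP[? ?] := lt' _ _ hr hx; lra.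
by move/le_trans; apply; rewrite le_eqVlt; apply/orP; left; apply/eqP; field.
Qed.

Lemma radsol_ge (R : realType) (rho : R) (g a w P f : R -> R) (r1 K : R) :
  radsol rho g a w P f -> r1 < rho -> (forall r : R, 0 < r < r1 -> K <= f r) ->
  forall r : R, 0 <= r <= r1 ->
  [/\ K * r ^+ 4 / 4 <= P r, w 0 + K * r ^+ 2 / 8 <= w r,
      w 0 * r ^+ 4 / 4 + K * r ^+ 6 / 48 <= a r &
      g 0 + w 0 * r ^+ 2 / 8 + K * r ^+ 4 / 192 <= g r].
Proof.
move=> hs hr1 hf r hr.
have hf' : forall r : R, 0 < r < r1 -> - f r <= - K.
  by move=> x hx; rewrite lerN2 hf.
have [H1 H2 H3 H4] := radsol_le (radsol_neg hs) hr1 hf' hr.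
by split; move: H1 H2 H3 H4; rewrite !mulNr; lra.
Qed.

Lemma radsol_w_le (R : realType) (rho : R) (g a w P f : R -> R) (r1 K : R) :
  radsol rho g a w P f -> r1 < rho -> (forall r : R, 0 < r < r1 -> w r <= K) ->
  forall r : R, 0 <= r <= r1 -> a r <= K * r ^+ 4 / 4 /\ g r <= g 0 + K * r ^+ 2 / 8.
Proof.
move=> [hg ha hw hP cg ca cw cP a0 P0] r1rho hf.
have Ha (r : R) : 0 <= r <= r1 -> a r <= K * r ^+ 4 / 4.
  move=> /andP[r0 rr1].
  have := @le_of_deriv R a (fun r => K * r ^+ 4 / 4) (fun r => r ^+ 3 * w r)
    (fun r => r ^+ 3 * K) 0 r r0.
  rewrite a0 expr0n /= !mulr0 !mul0r !subr0; apply => //.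
  - by move=> x /andP[x0 xr]; apply: ha; rewrite x0 /=; lra.
  - by move=> x _; apply: is_derive_eq; rewrite /GRing.scale /= -!exprVn; field.
  - by rewrite -{2}a0.
  - rewrite -[X in _ --> X](_ : K * 0 ^+ 4 / 4 = 0); last by rewrite expr0n /= mulr0 mul0r.
    exact: is_derive_cvg_right.
  - move=> x /andP[x0 xr]; apply: ler_wpM2l; first by rewrite exprn_ge0 // ltW.
    by apply: hf; rewrite x0; lra.
move=> r hr; split; first exact: Ha.
have /andP[r0 rr1] := hr.
have := @le_of_deriv R g (fun r => K * r ^+ 2 / 8) (fun r => a r / r ^+ 3)
    (fun r => K * r / 4) 0 r r0.
rewrite expr0n /= !mulr0 !mul0r !subr0 lerBlDl; apply => //.
- by move=> x /andP[x0 xr]; apply: hg; rewrite x0 /=; lra.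
- by move=> x _; apply: is_derive_eq; rewrite /GRing.scale /= -!exprVn; field.
- rewrite -[X in _ --> X](_ : K * 0 ^+ 2 / 8 = 0); last by rewrite expr0n /= mulr0 mul0r.
  exact: is_derive_cvg_right.
- move=> x /andP[x0 xr]; rewrite ler_pdivrMr ?exprn_gt0 //.
  have /Ha : 0 <= x <= r1 by lra.
  by move/le_trans; apply; rewrite le_eqVlt; apply/orP; left; apply/eqP; field.
Qed.

(** When [g 0 = 0] the sign comes from [w 0 < 0], since [g] behaves like [g 0 + w 0 * r ^ 2 / 8]
    near [0]. *)
Lemma radsol_neg_near0 (R : realType) (rho : R) (g a w P f : R -> R) :
  0 < rho -> radsol rho g a w P f -> g 0 <= 0 -> w 0 <= 0 -> g 0 < 0 \/ w 0 < 0 ->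
  \forall r \near 0^'+, g r < 0.
Proof.
move=> rho0 hs g0 w0 [g00|w00].
  by move/cvgr_lt: (rs_g0 hs); exact.
have hw : \forall r \near 0^'+, w r < w 0 / 2.
  by move/cvgr_lt: (rs_w0 hs); apply; lra.
have [/= e e0 he] := hw.
near=> r.
have r0 : 0 < r by near: r; exact: nbhs_right_gt.
have re : r < e by near: r; exact: nbhs_right_lt.
have rrho : r < rho by near: r; exact: nbhs_right_lt.
have [||_] := @radsol_w_le R rho g a w P f r (w 0 / 2) hs rrho _ r.
- move=> x /andP[x0 xr]; apply/ltW/he => //=.
  by rewrite sub0r normrN gtr0_norm //; lra.
- by rewrite lexx ltW.
move/le_lt_trans; apply.
have : 0 < r ^+ 2 by rewrite exprn_gt0.
nra.
Unshelve. all: by end_near.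
Qed.

(** While both functions are negative their sources are nonpositive, and integration from [0] keeps
    them below [g 0 + w 0 * r ^ 2 / 8 < 0]: there is no first radius of exit. Two solutions are
    treated together because a bound on an absolute value consists of two inequalities, neither of
    which propagates alone. *)
Lemma radsol_cmp2 (R : realType) (rho : R) (g1 a1 w1 P1 f1 g2 a2 w2 P2 f2 : R -> R) :
  radsol rho g1 a1 w1 P1 f1 -> radsol rho g2 a2 w2 P2 f2 ->
  g1 0 <= 0 -> w1 0 <= 0 -> g1 0 < 0 \/ w1 0 < 0 ->
  g2 0 <= 0 -> w2 0 <= 0 -> g2 0 < 0 \/ w2 0 < 0 ->
  (forall r : R, 0 < r < rho -> g1 r <= 0 -> g2 r <= 0 -> f1 r <= 0 /\ f2 r <= 0) ->
  forall r : R, 0 < r < rho -> [/\ g1 r < 0, g2 r < 0, f1 r <= 0 & f2 r <= 0].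
Proof.
move=> h1 h2 g10 w10 n1 g20 w20 n2 hf.
suff H (r : R) : 0 < r < rho -> g1 r < 0 /\ g2 r < 0.
  move=> r hr; have [? ?] := H r hr.
  by have [||? ?] := hf r hr; [exact/ltW..|split].
move=> /andP[r0 rrho]; apply: contrapT => nr.
have rho0 : 0 < rho by lra.
pose S := [set t | 0 < t <= r /\ ~ (g1 t < 0 /\ g2 t < 0)].
have Sr : S r by split => //; rewrite r0 /=.
have lbS : has_lbound S by exists 0 => t [/andP[/ltW]].
have infS : has_inf S by split => //; exists r.
(* [T] is the first radius where a sign fails. The signs hold at [T] when [T > 0], by integration up
   to [T], and just after [T] by continuity, so [T] cannot be an infimum of failures. *)
set T := inf S.
have T0 : 0 <= T by apply: lb_le_inf; [exists r|move=> t [/andP[/ltW]]].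
have Tr : T <= r by apply: ge_inf.
have ltT (t : R) : 0 < t < T -> g1 t < 0 /\ g2 t < 0.
  move=> /andP[t0 tT]; apply: contrapT => nt.
  have : T <= t by apply: ge_inf => //; split => //; rewrite t0 /=; lra.
  lra.
have stepT : 0 < T -> g1 T < 0 /\ g2 T < 0.
  move=> T0'.
  have fT (t : R) : 0 < t < T -> f1 t <= 0 /\ f2 t <= 0.
    move=> ht; have [? ?] := ltT t ht; apply: hf; [|exact/ltW..].
    by case/andP: ht => -> ?; lra.
  have TT : 0 <= T <= T by rewrite T0 lexx.
  have T1 : T < rho by lra.
  have TT2 : 0 < T ^+ 2 by rewrite exprn_gt0.
  split.
    have [|_ _ _] := @radsol_le R rho g1 a1 w1 P1 f1 T 0 h1 T1 _ T TT.
      by move=> t /fT[].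
    by move/le_lt_trans; apply; case: n1; nra.
  have [|_ _ _] := @radsol_le R rho g2 a2 w2 P2 f2 T 0 h2 T1 _ T TT.
    by move=> t /fT[].
  by move/le_lt_trans; apply; case: n2; nra.
have right : \forall t \near T^'+, g1 t < 0 /\ g2 t < 0.
  have [T0'|] := ltP 0 T; last first.
    move=> T0'; have -> : T = 0 by apply/eqP; rewrite eq_le T0' T0.
    near=> t; split; near: t.
    - exact: radsol_neg_near0 h1 _ _ _.
    - exact: radsol_neg_near0 h2 _ _ _.
  have [gT1 gT2] := stepT T0'.
  have Trho : 0 < T < rho by rewrite T0' /=; lra.
  have c1 := is_derive_cvg_right (rs_g h1 Trho).
  have c2 := is_derive_cvg_right (rs_g h2 Trho).
  near=> t; split; near: t.
  - by move/cvgr_lt: c1; exact.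
  - by move/cvgr_lt: c2; exact.
have [/= e e0 he] := right.
have [s Ss sT] := inf_adherent e0 infS.
have Ts : T <= s by apply: ge_inf.
have [sr ns] := Ss.
case: (ltgtP T s) Ts => // [Ts _|Ts _].
  apply: ns; apply: he => //=.
  by rewrite distrC gtr0_norm ?subr_gt0 // ltrBlDl -/T.
by apply: ns; rewrite -Ts; apply: stepT; rewrite Ts; case/andP: sr.
Unshelve. all: by end_near.
Qed.

Lemma radsol_cmp (R : realType) (rho : R) (g a w P f : R -> R) :
  radsol rho g a w P f -> g 0 <= 0 -> w 0 <= 0 -> g 0 < 0 \/ w 0 < 0 ->
  (forall r : R, 0 < r < rho -> g r <= 0 -> f r <= 0) ->
  forall r : R, 0 < r < rho -> g r < 0 /\ f r <= 0.
Proof.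
move=> h g0 w0 n hf r hr.
have [|? _ ? _ //] := radsol_cmp2 h h g0 w0 n g0 w0 n _ hr.
by move=> x hx ? _; split; exact: hf.
Qed.

Lemma radsol_w_homo (R : realType) (rho : R) (g a w P f : R -> R) :
  radsol rho g a w P f -> (forall r : R, 0 < r < rho -> 0 <= f r) ->
  forall s r : R, 0 <= s <= r -> r < rho -> w s <= w r.
Proof.
move=> hs hf s r /andP[s0 sr] rr.
have P0 (x : R) : 0 < x < rho -> 0 <= P x.
  move=> /andP[x0 xr].
  have [||+ _ _ _] := @radsol_ge R rho g a w P f x 0 hs xr _ x.
  - by move=> y /andP[y0 yx]; apply: hf; rewrite y0 /=; lra.
  - by rewrite lexx ltW.
  - by rewrite !mul0r.
have := @le_of_deriv R (cst 0) w (cst 0) (fun r => P r / r ^+ 3) s r sr.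
rewrite /= subrr subr_ge0; apply => //.
- by move=> x /andP[x0 xr]; apply: (rs_w hs); lra.
- exact: cvg_cst.
- move: s0; rewrite le_eqVlt => /predU1P[<-|s0]; first exact: rs_w0 hs.
  by apply: is_derive_cvg_right (rs_w hs (_ : 0 < s < rho)); lra.
- move=> x /andP[x0 xr]; have x00 : 0 < x by lra.
  by rewrite divr_ge0 ?exprn_ge0 ?P0 // ?x00 ?(ltW x00) //=; lra.
Qed.

(** [a r] is the integral of [s ^ 3 * w s], and the nondecreasing [w] has a mean below its last
    value. *)
Lemma radsol_a_le (R : realType) (rho : R) (g a w P f : R -> R) :
  radsol rho g a w P f -> (forall r : R, 0 < r < rho -> 0 <= f r) ->
  forall r : R, 0 <= r < rho -> a r <= w r * r ^+ 4 / 4.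
Proof.
move=> hs hf r /andP[r0 rr].
have [||] // := @radsol_w_le R rho g a w P f r (w r) hs rr _ r.
  move=> x /andP[x0 xr]; apply: radsol_w_homo hs hf _ _ _ rr.
  by rewrite !ltW.
by rewrite r0 lexx.
Qed.

(** A nonnegative mean of the nondecreasing [w] forces [w s >= 0], so [a] increases from [s] on. The
    derivative of [g] thus changes sign at most once, from negative to positive. *)
Lemma radsol_a_ge0 (R : realType) (rho : R) (g a w P f : R -> R) :
  radsol rho g a w P f -> (forall r : R, 0 < r < rho -> 0 <= f r) ->
  forall s r : R, 0 < s <= r -> r < rho -> 0 <= a s -> 0 <= w s /\ a s <= a r.
Proof.
move=> hs hf s r /andP[s0 sr] rr as0.
have srho : 0 <= s < rho by lra.
have s4 : 0 < s ^+ 4 by rewrite exprn_gt0.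
have ws : 0 <= w s by have := radsol_a_le hs hf srho; nra.
split => //.
have := @le_of_deriv_cc R (cst 0) a (cst 0) (fun r => r ^+ 3 * w r) s r sr.
rewrite /= subrr subr_ge0; apply => //.
- by move=> x /andP[x0 xr]; apply: (rs_a hs); lra.
- move=> x /andP[sx xr]; rewrite mulr_ge0 ?exprn_ge0 //; first lra.
  by apply: le_trans ws _; apply: radsol_w_homo hs hf _ _ _ _; lra.
Qed.

(** * Explosion in finite distance and the resulting a priori bound *)

Lemma radsol_growth (R : realType) (rho : R) (g a w P f : R -> R) (r0 r : R) :
  radsol rho g a w P f ->
  (forall r : R, 0 < r < rho -> expR (4 * g r) / 2 <= f r) ->
  0 < r0 <= r -> r < rho -> 0 <= a r0 ->
  g r0 + expR (4 * g r0) * (r - r0) ^+ 4 / 24 / 16 <= g r.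
Proof.
move=> hs hf /andP[r00 r0r] rr a0.
have hf0 (x : R) : 0 < x < rho -> 0 <= f x.
  by move=> /hf; apply: le_trans; rewrite divr_ge0 ?expR_ge0.
set N := g r0; set E := expR (4 * N).
have E0 : 0 < E by exact: expR_gt0.
have pos (x : R) : r0 <= x <= r -> 0 < x < rho by move=> /andP[? ?]; lra.
have pos0 (x : R) : r0 <= x <= r -> 0 < x by move/pos/andP => [].
have ax (x : R) : r0 <= x <= r -> 0 <= a x.
  move=> /andP[? ?]; have h1 : 0 < r0 <= x by lra.
  have h2 : x < rho by lra.
  by have [_] := radsol_a_ge0 hs hf0 h1 h2 a0; apply: le_trans.
have inx (x y : R) : r0 <= x <= r -> r0 <= y <= x -> r0 <= y <= r.
  by move=> /andP[? ?] /andP[? ?]; lra.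
have gx (x : R) : r0 <= x <= r -> N <= g x.
  move=> hx; have /andP[r0x xr] := hx.
  have := @le_of_deriv_cc R (cst 0) g (cst 0) (fun r => a r / r ^+ 3) r0 x r0x.
  rewrite /= subrr subr_ge0; apply => //.
  - by move=> y /(inx _ _ hx) /pos; exact: rs_g hs _.
  - move=> y /(inx _ _ hx) hy; rewrite divr_ge0 ?exprn_ge0 ?ax //.
    by rewrite ltW // pos0.
have Px (x : R) : r0 <= x <= r -> E * (x ^+ 4 - r0 ^+ 4) / 8 <= P x.
  move=> hx; have /andP[r0x xr] := hx.
  have P0 : 0 <= P r0.
    have r0rho : r0 < rho by lra.
    have [||+ _ _ _] := @radsol_ge R rho g a w P f r0 0 hs r0rho _ r0.
    - by move=> y /andP[y0 yx]; apply: hf0; rewrite y0 /=; lra.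
    - by rewrite lexx ltW.
    - by rewrite !mul0r.
  have := @le_of_deriv_cc R (fun x => E * x ^+ 4 / 8) P (fun x => x ^+ 3 * (E / 2))
    (fun r => r ^+ 3 * f r) r0 x r0x.
  suff -> : E * (x ^+ 4 - r0 ^+ 4) / 8 = E * x ^+ 4 / 8 - E * r0 ^+ 4 / 8.
    move=> H; suff : E * x ^+ 4 / 8 - E * r0 ^+ 4 / 8 <= P x - P r0 by lra.
    apply: H.
    - by move=> y _; apply: is_derive_eq; rewrite /GRing.scale /= -!exprVn; field.
    - by move=> y /(inx _ _ hx) /pos; exact: rs_P hs _.
    - move=> y /(inx _ _ hx) hy; apply: ler_wpM2l; first by rewrite exprn_ge0 // ltW // pos0.
      apply: le_trans (hf _ (pos _ hy)); rewrite ler_pM2r ?invr_gt0 // ler_expR ler_pM2l //.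
      exact: gx.
  by ring.
have wx (x : R) : r0 <= x <= r -> E * (x - r0) ^+ 2 / 16 <= w x.
  move=> hx; have /andP[r0x xr] := hx.
  have w0 : 0 <= w r0.
    have h1 : 0 < r0 <= x by lra.
    have h2 : x < rho by lra.
    by have [] := radsol_a_ge0 hs hf0 h1 h2 a0.
  have := @le_of_deriv_cc R (fun x => E * (x - r0) ^+ 2 / 16) w (fun x => E * (x - r0) / 8)
    (fun r => P r / r ^+ 3) r0 x r0x.
  rewrite subrr expr0n /= mulr0 mul0r subr0 => H.
  suff : E * (x - r0) ^+ 2 / 16 <= w x - w r0 by lra.
  apply: H.
  - by move=> y _; apply: is_derive_eq; rewrite /GRing.scale /= -!exprVn; field.
  - by move=> y /(inx _ _ hx) /pos; exact: rs_w hs _.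
  - move=> y /(inx _ _ hx) hy; have y0 := pos0 _ hy.
    rewrite ler_pdivlMr ?exprn_gt0 //; apply: le_trans (Px y hy).
    have /andP[r0y _] := hy.
    (* This is [y ^ 4 - r0 ^ 4 >= y ^ 3 * (y - r0)]. *)
    suff : 0 <= E * r0 * (y ^+ 3 - r0 ^+ 3) / 8 by lra.
    rewrite divr_ge0 // mulr_ge0 // ?subr_ge0 ?mulr_ge0 ?(ltW E0) ?(ltW r00) //.
    by rewrite lerXn2r // nnegrE ltW.
have aax (x : R) : r0 <= x <= r -> E * x ^+ 3 * (x - r0) ^+ 3 / 96 <= a x.
  move=> hx; have /andP[r0x xr] := hx.
  have := @le_of_deriv_cc R (fun x => E * x ^+ 3 * (x - r0) ^+ 3 / 96) a
    (fun x => E * (3 * (x ^+ 2 * (x - r0) ^+ 3 + x ^+ 3 * (x - r0) ^+ 2)) / 96)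
    (fun r => r ^+ 3 * w r) r0 x r0x.
  rewrite subrr expr0n /= mulr0 mul0r subr0 => H.
  suff : E * x ^+ 3 * (x - r0) ^+ 3 / 96 <= a x - a r0 by lra.
  apply: H.
  - by move=> y _; apply: is_derive_eq; rewrite /GRing.scale /=; ring.
  - by move=> y /(inx _ _ hx) /pos; exact: rs_a hs _.
  - move=> y /(inx _ _ hx) hy; have y0 := pos0 _ hy.
    have /andP[r0y _] := hy.
    apply: le_trans (_ : y ^+ 3 * (E * (y - r0) ^+ 2 / 16) <= _); last first.
      by apply: ler_wpM2l; rewrite ?exprn_ge0 ?(ltW y0) // wx.
    suff : 0 <= E * y ^+ 2 * (y - r0) ^+ 2 * r0 / 32 by lra.
    apply: divr_ge0 => //; apply: mulr_ge0 (ltW r00); apply: mulr_ge0 (sqr_ge0 _).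
    exact: mulr_ge0 (ltW E0) (sqr_ge0 _).
have := @le_of_deriv_cc R (fun x => E * (x - r0) ^+ 4 / 24 / 16) g (fun x => E * (4 * (x - r0) ^+ 3) / 24 / 16)
    (fun r => a r / r ^+ 3) r0 r r0r.
rewrite subrr expr0n /= mulr0 !mul0r subr0 => H.
suff : E * (r - r0) ^+ 4 / 24 / 16 <= g r - g r0 by rewrite /N; lra.
have rr0 : r0 <= r <= r by rewrite r0r lexx.
apply: H.
- by move=> y _; apply: is_derive_eq; rewrite /GRing.scale /=; ring.
- by move=> y /pos; exact: rs_g hs _.
- move=> y hy; have y0 := pos0 _ hy.
  rewrite ler_pdivlMr ?exprn_gt0 //; apply: le_trans (aax y hy).
  lra.
Qed.

(** Otherwise [g] would be infinite at [r0 + l]. Along the points [r j], which halve the remaining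
    distance, each step raises [g] by at least 1: halving the step divides the quartic gain by 16,
    and a rise of 1 multiplies [exp (4 * g)] by more than 16. The factor [24 * 16] comes from
    [radsol_growth], the last 16 from the first step [l / 2]. *)
Lemma radsol_apriori (R : realType) (rho : R) (g a w P f : R -> R) (r0 l : R) :
  radsol rho g a w P f ->
  (forall r : R, 0 < r < rho -> expR (4 * g r) / 2 <= f r) ->
  0 < r0 -> 0 < l -> r0 + l < rho -> 0 <= a r0 ->
  expR (4 * g r0) * l ^+ 4 <= 24 * 16 * 16.
Proof.
move=> hs hf r00 l0 rl a0.
have hf0 (x : R) : 0 < x < rho -> 0 <= f x.
  by move=> /hf; apply: le_trans; rewrite divr_ge0 ?expR_ge0.
rewrite leNgt; apply/negP => big.
pose q (j : nat) : R := (2^-1) ^+ j.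
have q01 (j : nat) : 0 < q j <= 1.
  by rewrite /q exprn_gt0 ?invr_gt0 //= exprn_ile1 // ?invr_ge0 // invf_le1 // ler1n.
pose r j := r0 + l * (1 - q j).
have rb (j : nat) : r0 <= r j < r0 + l.
  by rewrite /r; have /andP[? ?] := q01 j; apply/andP; split; nra.
have st (j : nat) : g r0 + j%:R <= g (r j).
  elim: j => [|j IH]; first by rewrite /r /q expr0 subrr mulr0 !addr0.
  have rS : r j.+1 - r j = l * q j / 2 by rewrite /r /q exprS; field.
  have /andP[qj0 qj1] := q01 j.
  have /andP[rj1 rj2] := rb j.
  have /andP[rj3 rj4] := rb j.+1.
  have rjS : r j <= r j.+1 by rewrite -subr_ge0 rS; nra.
  have aj : 0 <= a (r j).
    have h1 : 0 < r0 <= r j by lra.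
    have h2 : r j < rho by lra.
    by have [_] := radsol_a_ge0 hs hf0 h1 h2 a0; apply: le_trans.
  have := radsol_growth hs hf (_ : 0 < r j <= r j.+1) _ aj.
  move=> H; have {H} : g (r j) + expR (4 * g (r j)) * (r j.+1 - r j) ^+ 4 / 24 / 16 <= g (r j.+1).
    by apply: H; lra.
  apply: le_trans; rewrite -natr1 addrA; apply: lerD => //.
  rewrite ler_pdivlMr // mul1r ler_pdivlMr // rS.
  have e1 : expR (4 * g r0) * (2 ^+ j) ^+ 4 <= expR (4 * g (r j)).
    apply: le_trans (_ : expR (4 * (g r0 + j%:R)) <= _); last first.
      by rewrite ler_expR ler_pM2l.
    rewrite mulrDr expRD ler_pM2l ?expR_gt0 // -natrM -[(4 * j)%:R]mulr1 expRM_natl mulnC exprM.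
    rewrite !lerXn2r ?nnegrE ?exprn_ge0 ?expR_ge0 //.
    by apply: le_trans (expR_ge1Dx 1); rewrite -(natrD _ 1 1).
  have e2 : (2 ^+ j) ^+ 4 * (q j) ^+ 4 = 1 :> R.
    by rewrite -exprMn /q -exprMn divff // !expr1n.
  have e3 : 0 < (l * q j / 2) ^+ 4 by rewrite exprn_gt0 // divr_gt0 // mulr_gt0.
  apply: le_trans (_ : expR (4 * g r0) * (2 ^+ j) ^+ 4 * (l * q j / 2) ^+ 4 <= _); last first.
    by rewrite ler_pM2r.
  have -> : expR (4 * g r0) * (2 ^+ j) ^+ 4 * (l * q j / 2) ^+ 4 =
      expR (4 * g r0) * l ^+ 4 * ((2 ^+ j) ^+ 4 * (q j) ^+ 4) / 16 by field.
  by rewrite e2; lra.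
have glast (j : nat) : g r0 + j%:R <= g (r0 + l).
  apply: le_trans (st j) _.
  have /andP[rj1 rj2] := rb j.
  have aj : 0 <= a (r j).
    have h1 : 0 < r0 <= r j by lra.
    have h2 : r j < rho by lra.
    by have [_] := radsol_a_ge0 hs hf0 h1 h2 a0; apply: le_trans.
  have := radsol_growth hs hf (_ : 0 < r j <= r0 + l) rl aj.
  move=> H; apply: le_trans (H _); last by lra.
  rewrite lerDl; apply: divr_ge0 => //; apply: divr_ge0 => //.
  by apply: mulr_ge0; rewrite ?expR_ge0 // exprn_ge0 //; lra.
have := archi_boundP (_ : 0 <= `|g (r0 + l) - g r0|).
move=> /(_ (normr_ge0 _)); have := glast (Num.bound `|g (r0 + l) - g r0|).
have := ler_norm (g (r0 + l) - g r0).
lra.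
Qed.

(** If [a r < 0] then [a] has been nonpositive since [0], so [g] has not risen above [g 0];
    otherwise the explosion bound holds at [r]. *)
Lemma radsol_max (R : realType) (rho : R) (g a w P f : R -> R) (r l : R) :
  radsol rho g a w P f ->
  (forall r : R, 0 < r < rho -> expR (4 * g r) / 2 <= f r) ->
  0 <= r -> 0 < l -> r + l < rho ->
  g r <= g 0 \/ expR (4 * g r) * l ^+ 4 <= 24 * 16 * 16.
Proof.
move=> hs hf; rewrite le_eqVlt => /predU1P[<-|r0] l0 rl; first by left.
have hf0 (x : R) : 0 < x < rho -> 0 <= f x.
  by move=> /hf; apply: le_trans; rewrite divr_ge0 ?expR_ge0.
have [ar|ar] := leP 0 (a r); first by right; exact: radsol_apriori hs hf r0 l0 rl ar.
left; have := @le_of_deriv R g (cst 0) (fun r => a r / r ^+ 3) (cst 0) 0 r (ltW r0).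
rewrite /= subrr subr_le0; apply => //.
- by move=> x /andP[x0 xr]; apply: (rs_g hs); rewrite x0 /=; lra.
- exact: rs_g0 hs.
- exact: cvg_cst.
- move=> x /andP[x0 xr]; rewrite pmulr_lle0 ?invr_gt0 ?exprn_gt0 //.
  rewrite leNgt; apply/negP => ax.
  have h1 : 0 < x <= r by rewrite x0 ltW.
  have h2 : r < rho by lra.
  by have [_] := radsol_a_ge0 hs hf0 h1 h2 (ltW ax); lra.
Qed.

(** * Bubbles, Gaussian barriers and a Gronwall estimate *)

(** Up to dilation and an additive constant, the logarithmic conformal factor of the round sphere in
    stereographic coordinates. Its bilaplacian is [96 / c ^ 2] times [exp (4 * bubble)] and its
    Laplacian at [0] is [8 / c]. *)
Definition bubble (R : realType) (c r : R) : R := ln (c / (c + r ^+ 2)).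

Lemma is_derive_mulX (R : realType) (p q : R -> R) (dp dq r : R) (n : nat) :
  is_derive r 1 p dp -> is_derive r 1 q dq ->
  is_derive r 1 (fun r => p r * q r ^+ n) (dp * q r ^+ n + p r * (n%:R * q r ^+ n.-1 * dq)).
Proof.
move=> hp hq; rewrite [X in is_derive _ _ X _](_ : _ = p * q ^+ n).
  by apply: (is_derive_eq (is_deriveM hp (is_deriveX n hq))); rewrite /GRing.scale /= exprfctE; ring.
by apply/funext => x; rewrite fctE exprfctE.
Qed.

Lemma radsol_bubble (R : realType) (rho c : R) : 0 < c ->
  radsol rho (bubble c) (fun r => - (2 * r ^+ 4) / (c + r ^+ 2))
    (fun r => - (8 * c + 4 * r ^+ 2) / (c + r ^+ 2) ^+ 2)
    (fun r => 8 * r ^+ 4 * (3 * c + r ^+ 2) / (c + r ^+ 2) ^+ 3)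
    (fun r => 96 * c ^+ 2 / (c + r ^+ 2) ^+ 4).
Proof.
move=> c0.
have D0 (r : R) : 0 < c + r ^+ 2 by rewrite ltr_wpDr // sqr_ge0.
have Dn (r : R) : c + r ^+ 2 != 0 by rewrite gt_eqF.
have dq (r : R) : is_derive r 1 (fun r => (c + r ^+ 2)^-1) (- (2 * r) / (c + r ^+ 2) ^+ 2).
  have h : is_derive r 1 (fun r => c + r ^+ 2) (2 * r).
    by apply: is_derive_eq; rewrite /GRing.scale /=; ring.
  by apply: (is_derive_eq (@is_deriveV R (fun r => c + r ^+ 2) r _ 1 (Dn r) h)); rewrite /GRing.scale /=; field.
have dp (n : nat) (p : R -> R) (dp r : R) : is_derive r 1 p dp ->
    is_derive r 1 (fun r => p r / (c + r ^+ 2) ^+ n)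
      (dp / (c + r ^+ 2) ^+ n - p r * n%:R * (2 * r) / (c + r ^+ 2) ^+ n.+1).
  move=> h; have := is_derive_mulX n h (dq r); rewrite [X in is_derive _ _ X _ -> _](_ : _ =
    fun r => p r / (c + r ^+ 2) ^+ n); last by apply/funext => x; rewrite exprVn.
  move=> H; apply: (is_derive_eq H); case: n {H} => [|n].
    by rewrite !expr0; field; exact: Dn.
  by rewrite -!exprVn !exprS /=; field; exact: Dn.
have dg (r : R) : is_derive r 1 (bubble c) (- (2 * r) / (c + r ^+ 2)).
  have qp : 0 < c / (c + r ^+ 2) by rewrite divr_gt0.
  have h : is_derive r 1 (fun r => c / (c + r ^+ 2)) (c * (- (2 * r) / (c + r ^+ 2) ^+ 2)).
    by apply: is_derive_eq; rewrite /GRing.scale /=.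
  have := @is_derive1_comp R (@ln R) (fun r => c / (c + r ^+ 2)) r _ _ (is_derive1_ln qp) h.
  by move=> H; apply: (is_derive_eq H); field; rewrite Dn lt0r_neq0.
have da (r : R) : is_derive r 1 (fun r => - (2 * r ^+ 4) / (c + r ^+ 2))
    (r ^+ 3 * (- (8 * c + 4 * r ^+ 2) / (c + r ^+ 2) ^+ 2)).
  have h : is_derive r 1 (fun r => - (2 * r ^+ 4)) (- (8 * r ^+ 3)).
    by apply: is_derive_eq; rewrite /GRing.scale /=; ring.
  by apply: (is_derive_eq (dp 1%N _ _ r h)); field.
have dw (r : R) : is_derive r 1 (fun r => - (8 * c + 4 * r ^+ 2) / (c + r ^+ 2) ^+ 2)
    (8 * r * (3 * c + r ^+ 2) / (c + r ^+ 2) ^+ 3).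
  have h : is_derive r 1 (fun r => - (8 * c + 4 * r ^+ 2)) (- (8 * r)).
    by apply: is_derive_eq; rewrite /GRing.scale /=; ring.
  by apply: (is_derive_eq (dp 2%N _ _ r h)); field.
have dP (r : R) : is_derive r 1 (fun r => 8 * r ^+ 4 * (3 * c + r ^+ 2) / (c + r ^+ 2) ^+ 3)
    (r ^+ 3 * (96 * c ^+ 2 / (c + r ^+ 2) ^+ 4)).
  have h : is_derive r 1 (fun r => 8 * r ^+ 4 * (3 * c + r ^+ 2)) (96 * c * r ^+ 3 + 48 * r ^+ 5).
    by apply: is_derive_eq; rewrite /GRing.scale /=; ring.
  by apply: (is_derive_eq (dp 3%N _ _ r h)); field.
split.
- move=> r /andP[r0 _]; apply: (is_derive_eq (dg r)); field.
  by rewrite Dn lt0r_neq0.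
- by move=> r _; exact: da.
- move=> r /andP[r0 _]; apply: (is_derive_eq (dw r)); field.
  by rewrite Dn lt0r_neq0.
- by move=> r _; exact: dP.
- exact: is_derive_cvg_right (dg 0).
- exact: is_derive_cvg_right (da 0).
- exact: is_derive_cvg_right (dw 0).
- exact: is_derive_cvg_right (dP 0).
- by rewrite expr0n /= mulr0 oppr0 mul0r.
- by rewrite expr0n /= mulr0 !mul0r.
Qed.

Lemma bubble0 (R : realType) (c : R) : 0 < c -> bubble c 0 = 0.
Proof. by move=> c0; rewrite /bubble expr0n /= addr0 divff ?ln1 // gt_eqF. Qed.

Lemma expR4_bubble (R : realType) (c r : R) : 0 < c ->
  expR (4 * bubble c r) = (c / (c + r ^+ 2)) ^+ 4.
Proof.
move=> c0; rewrite expRM_natl /bubble lnK // posrE divr_gt0 //.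
by rewrite ltr_wpDr // sqr_ge0.
Qed.

(** Barrier for linear growth: for [k >= 0] the bilaplacian of [exp (k * r ^ 2)] is at least
    [96 * k ^ 2] times the function. *)
Lemma radsol_expsq (R : realType) (rho e k : R) :
  radsol rho (fun r => e * expR (k * r ^+ 2))
    (fun r => e * (2 * k * r ^+ 4) * expR (k * r ^+ 2))
    (fun r => e * (8 * k + 4 * k ^+ 2 * r ^+ 2) * expR (k * r ^+ 2))
    (fun r => e * (24 * k ^+ 2 * r ^+ 4 + 8 * k ^+ 3 * r ^+ 6) * expR (k * r ^+ 2))
    (fun r => e * (96 * k ^+ 2 + 96 * k ^+ 3 * r ^+ 2 + 16 * k ^+ 4 * r ^+ 4) * expR (k * r ^+ 2)).
Proof.
have dE (r : R) : is_derive r 1 (fun r => expR (k * r ^+ 2)) (2 * k * r * expR (k * r ^+ 2)).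
  have h : is_derive r 1 (fun r => k * r ^+ 2) (2 * k * r).
    by apply: is_derive_eq; rewrite /GRing.scale /=; ring.
  have := @is_derive1_comp R (@expR R) (fun r => k * r ^+ 2) r _ _ (is_derive_expR _) h.
  by move=> H; apply: (is_derive_eq H); ring.
have dp (p : R -> R) (dp r : R) : is_derive r 1 p dp ->
    is_derive r 1 (fun r => p r * expR (k * r ^+ 2)) ((dp + p r * (2 * k * r)) * expR (k * r ^+ 2)).
  by move=> h; apply: is_derive_eq; rewrite /GRing.scale /=; ring.
have dg (r : R) : is_derive r 1 (fun r => e * expR (k * r ^+ 2)) (e * (2 * k * r) * expR (k * r ^+ 2)).
  by apply: is_derive_eq; rewrite /GRing.scale /=; ring.
have da (r : R) : is_derive r 1 (fun r => e * (2 * k * r ^+ 4) * expR (k * r ^+ 2))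
    (r ^+ 3 * (e * (8 * k + 4 * k ^+ 2 * r ^+ 2) * expR (k * r ^+ 2))).
  have h : is_derive r 1 (fun r => e * (2 * k * r ^+ 4)) (e * (8 * k * r ^+ 3)).
    by apply: is_derive_eq; rewrite /GRing.scale /=; ring.
  by apply: (is_derive_eq (dp _ _ r h)); ring.
have dw (r : R) : is_derive r 1 (fun r => e * (8 * k + 4 * k ^+ 2 * r ^+ 2) * expR (k * r ^+ 2))
    (e * (24 * k ^+ 2 * r + 8 * k ^+ 3 * r ^+ 3) * expR (k * r ^+ 2)).
  have h : is_derive r 1 (fun r => e * (8 * k + 4 * k ^+ 2 * r ^+ 2)) (e * (8 * k ^+ 2 * r)).
    by apply: is_derive_eq; rewrite /GRing.scale /=; ring.
  by apply: (is_derive_eq (dp _ _ r h)); ring.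
have dP (r : R) : is_derive r 1
    (fun r => e * (24 * k ^+ 2 * r ^+ 4 + 8 * k ^+ 3 * r ^+ 6) * expR (k * r ^+ 2))
    (r ^+ 3 * (e * (96 * k ^+ 2 + 96 * k ^+ 3 * r ^+ 2 + 16 * k ^+ 4 * r ^+ 4) * expR (k * r ^+ 2))).
  have h : is_derive r 1 (fun r => e * (24 * k ^+ 2 * r ^+ 4 + 8 * k ^+ 3 * r ^+ 6))
      (e * (96 * k ^+ 2 * r ^+ 3 + 48 * k ^+ 3 * r ^+ 5)).
    by apply: is_derive_eq; rewrite /GRing.scale /=; ring.
  by apply: (is_derive_eq (dp _ _ r h)); ring.
split.
- by move=> r /andP[r0 _]; apply: (is_derive_eq (dg r)); field; rewrite lt0r_neq0.
- by move=> r _; exact: da.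
- by move=> r /andP[r0 _]; apply: (is_derive_eq (dw r)); field; rewrite lt0r_neq0.
- by move=> r _; exact: dP.
- exact: is_derive_cvg_right (dg 0).
- exact: is_derive_cvg_right (da 0).
- exact: is_derive_cvg_right (dw 0).
- exact: is_derive_cvg_right (dP 0).
- by rewrite expr0n /= !mulr0 mul0r.
- by rewrite !expr0n /= !mulr0 addr0 mulr0 mul0r.
Qed.

(** Let [B] be the barrier on the right. Then [g - B] and [- g - B] are strictly negative at [0],
    thanks to the factor 2, and inside the barrier [A * |g| + e <= (A + 1) * B], which is at most
    the bilaplacian of [B]; [radsol_cmp2] applies to the pair. The bound on [f] is assumed only
    inside the barrier, as suits a locally Lipschitz nonlinearity. *)
Lemma radsol_gronwall (R : realType) (rho : R) (g a w P f : R -> R) (A e : R) :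
  radsol rho g a w P f -> 0 <= A -> 0 < e -> `|g 0| <= e -> `|w 0| <= e ->
  (forall r : R, 0 < r < rho -> `|g r| <= 2 * e * expR ((A + 1) * r ^+ 2) ->
     `|f r| <= A * `|g r| + e) ->
  forall r : R, 0 < r < rho -> `|g r| <= 2 * e * expR ((A + 1) * r ^+ 2).
Proof.
move=> hs A0 e0 g0 w0 hf r hr.
have hB := radsol_expsq rho (2 * e) (A + 1).
have h1 := radsol_sub hs hB.
have h2 := radsol_sub (radsol_neg hs) hB.
have /andP[g01 g02] : - e <= g 0 <= e by rewrite -ler_norml.
have /andP[w01 w02] : - e <= w 0 <= e by rewrite -ler_norml.
have ew : e <= 2 * e * (8 * (A + 1)) by nra.
have [|||||||H1 H2 _ _] := radsol_cmp2 h1 h2 _ _ _ _ _ _ _ hr;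
  rewrite ?expr0n /= ?mulr0 ?expR0 ?addr0 ?mulr1; [lra|lra|left; lra|lra|lra|left; lra| |].
  move=> x hx; rewrite !subr_le0 => b1 b2.
  have hb : `|g x| <= 2 * e * expR ((A + 1) * x ^+ 2) by rewrite ler_norml; lra.
  have := hf x hx hb; rewrite ler_norml => /andP[f1 f2].
  set E := expR _ in hb *.
  have E1 : 1 <= E by rewrite -expR0 ler_expR mulr_ge0 ?sqr_ge0 // addr_ge0.
  have : A * `|g x| + e <= 2 * e * (96 * (A + 1) ^+ 2 + 96 * (A + 1) ^+ 3 * x ^+ 2 + 16 * (A + 1) ^+ 4 * x ^+ 4) * E.
    have t1 : A * `|g x| + e <= (A + 1) * (2 * e * E).
      by have := ler_wpM2l A0 hb; nra.
    apply: (le_trans t1).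
    have t2 : A + 1 <= 96 * (A + 1) ^+ 2 by nra.
    have t3 : 0 <= 96 * (A + 1) ^+ 3 * x ^+ 2.
      by apply: mulr_ge0 (sqr_ge0 _); apply: mulr_ge0 => //; apply: exprn_ge0; lra.
    have t4 : 0 <= 16 * (A + 1) ^+ 4 * x ^+ 4.
      by apply: mulr_ge0; [apply: mulr_ge0 => //|]; exact: exprn_even_ge0.
    rewrite [X in _ <= X](_ : _ = (96 * (A + 1) ^+ 2 + 96 * (A + 1) ^+ 3 * x ^+ 2 + 16 * (A + 1) ^+ 4 * x ^+ 4) * (2 * e * E)); last by ring.
    by apply: ler_wpM2r; [nra|lra].
  by lra.
by rewrite ler_norml; lra.
Qed.

(** * The Euclidean norm and the classes C^k on R^4 *)

Notation e_ i := (delta_mx 0 i).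

(** Turns directional derivatives into derivatives at [0] of functions of one variable, to which the
    one-variable chain rule applies. *)
Lemma is_derive_line (R : realType) (f : 'rV[R]_4 -> R) (x v : 'rV[R]_4) (d : R) :
  is_derive (0 : R) 1 (fun h : R => f (h *: v + x)) d <-> is_derive x v f d.
Proof.
set g := fun h : R => _.
have eg : (fun h : R => h^-1 *: ((g \o shift 0) (h *: 1) - g 0)) =
          (fun h : R => h^-1 *: ((f \o shift x) (h *: v) - f x)).
  by apply/funext => h; rewrite /g /= addr0 scale0r add0r /GRing.scale /= mulr1.
by split=> -[h1 h2]; split; move: h1 h2; rewrite /derivable /derive ?eg // -?eg.
Qed.

Lemma enorm_ge0 (R : realType) (x : 'rV[R]_4) : 0 <= enorm x.
Proof. exact: sqrtr_ge0. Qed.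

Lemma enorm_sqr (R : realType) (x : 'rV[R]_4) : enorm x ^+ 2 = \sum_(i < 4) x 0 i ^+ 2.
Proof. by rewrite sqr_sqrtr // sumr_ge0 // => i _; exact: sqr_ge0. Qed.

Lemma enorm0 (R : realType) : enorm (0 : 'rV[R]_4) = 0.
Proof. by rewrite /enorm big1 ?sqrtr0 // => i _; rewrite mxE expr0n. Qed.

Lemma enormZ (R : realType) (k : R) (x : 'rV[R]_4) : enorm (k *: x) = `|k| * enorm x.
Proof.
rewrite /enorm -sqrtr_sqr -sqrtrM ?sqr_ge0 // mulr_sumr.
by congr Num.sqrt; apply: eq_bigr => i _; rewrite mxE exprMn.
Qed.

Lemma enorm_e (R : realType) (i : 'I_4) : enorm (e_ i : 'rV[R]_4) = 1.
Proof.
rewrite /enorm (bigD1 i) //= mxE !eqxx expr1n big1 ?addr0 ?sqrtr1 // => j /negPf ji.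
by rewrite mxE ji andbF expr0n.
Qed.

Lemma enorm_ray (R : realType) (r : R) (i : 'I_4) : 0 <= r -> enorm (r *: (e_ i : 'rV[R]_4)) = r.
Proof. by move=> r0; rewrite enormZ enorm_e mulr1 ger0_norm. Qed.

Lemma coord_le_enorm (R : realType) (x : 'rV[R]_4) (i : 'I_4) : `|x 0 i| <= enorm x.
Proof.
rewrite -sqrtr_sqr ler_wsqrtr // (bigD1 i) //= lerDl sumr_ge0 // => j _.
exact: sqr_ge0.
Qed.

Lemma enorm_eq0 (R : realType) (x : 'rV[R]_4) : enorm x = 0 -> x = 0.
Proof.
move=> x0; apply/rowP => i; rewrite mxE; apply/eqP.
by rewrite -normr_le0 -x0 coord_le_enorm.
Qed.

Lemma enorm_gt0 (R : realType) (x : 'rV[R]_4) : x != 0 -> 0 < enorm x.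
Proof.
by move=> x0; rewrite lt0r enorm_ge0 andbT; apply: contra x0 => /eqP/enorm_eq0 ->.
Qed.

Lemma mx_norm_le_enorm (R : realType) (x : 'rV[R]_4) : `|x| <= enorm x.
Proof.
rewrite [X in X <= _]/Num.norm /= mx_normrE; apply/bigmax_leP; split => [|[i j] _ /=].
  exact: enorm_ge0.
by rewrite (ord1 i) coord_le_enorm.
Qed.

Lemma continuous_enorm (R : realType) : continuous (@enorm R).
Proof.
move=> x; rewrite /enorm; apply: (@continuous_comp _ _ _ _ (@Num.sqrt R)); last exact: sqrt_continuous.
have cs (i : 'I_4) : {for x, continuous (fun y : 'rV[R]_4 => y 0 i ^+ 2)}.
  apply: (@continuous_comp _ _ _ (fun y : 'rV[R]_4 => y 0 i) (fun t : R => t ^+ 2)).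
    exact: coord_continuous.
  exact: exprn_continuous.
rewrite (_ : (fun y => _) = fun y : 'rV[R]_4 => y 0 0 ^+ 2 + y 0 1 ^+ 2 + y 0 2 ^+ 2 + y 0 3 ^+ 2).
  by do 3 (apply: continuousD; last exact: cs); exact: cs.
apply/funext => y; rewrite !big_ord_recr big_ord0 /= add0r.
by congr (_ + _ + _ + _); congr (y _ _ ^+ 2); apply/val_inj.
Qed.

Lemma open_eball (R : realType) (r : R) : open (@eball R r).
Proof.
rewrite (_ : eball r = @enorm R @^-1` [set x | x < r]) //.
by apply: open_comp; [move=> x _; exact: continuous_enorm|exact: open_lt].
Qed.

Lemma is_derive_coord (R : realType) (x : 'rV[R]_4) (i j : 'I_4) :
  is_derive x (e_ i) (fun y : 'rV[R]_4 => y 0 j) (i == j)%:R.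
Proof.
apply/is_derive_line.
rewrite [X in is_derive _ _ X _](_ : _ = fun h : R => h * (i == j)%:R + x 0 j).
  by apply: is_derive_eq; rewrite /GRing.scale /=; ring.
by apply/funext => h; rewrite !mxE eqxx /= eq_sym.
Qed.

Lemma is_derive_enorm (R : realType) (x : 'rV[R]_4) (i : 'I_4) : x != 0 ->
  is_derive x (e_ i) (@enorm R) (x 0 i / enorm x).
Proof.
move=> x0; apply/is_derive_line.
have e0 := enorm_gt0 x0.
pose q (h : R) := enorm x ^+ 2 + 2 * x 0 i * h + h ^+ 2.
rewrite [X in is_derive _ _ X _](_ : _ = Num.sqrt \o q).
  have dq : is_derive (0 : R) 1 q (2 * x 0 i).
    by apply: is_derive_eq; rewrite /GRing.scale /=; ring.
  have q0 : q 0 = enorm x ^+ 2 by rewrite /q mulr0 expr0n /= !addr0.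
  have q00 : 0 < q 0 by rewrite q0 exprn_gt0.
  have H := is_derive1_comp (is_derive1_sqrt q00) dq.
  apply: (is_derive_eq H).
  rewrite q0 sqrtr_sqr ger0_norm ?enorm_ge0 //.
  by field; rewrite lt0r_neq0.
apply/funext => h; rewrite /enorm /=; congr Num.sqrt; rewrite /q enorm_sqr.
rewrite (bigD1 i) //= [in RHS](bigD1 i) //= !mxE !eqxx mulr1.
rewrite (eq_bigr (fun j => x 0 j ^+ 2)); first by ring.
by move=> j /negPf ji; rewrite !mxE ji andbF mulr0 add0r.
Qed.

Lemma is_derive_radial (R : realType) (x : 'rV[R]_4) (i : 'I_4) (h : R -> R) (dh : R) :
  x != 0 -> is_derive (enorm x) 1 h dh ->
  is_derive x (e_ i) (h \o @enorm R) (x 0 i / enorm x * dh).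
Proof.
move=> x0 hh; apply/is_derive_line.
have /is_derive_line hn := is_derive_enorm i x0.
rewrite [X in is_derive _ _ X _](_ : _ = h \o (fun t : R => enorm (t *: e_ i + x))) //.
rewrite mulrC; apply: is_derive1_comp => //.
by rewrite scale0r add0r.
Qed.

Lemma partials_ext (R : realType) (D : set 'rV[R]_4) (f g : 'rV[R]_4 -> R) s :
  open D -> (forall x, D x -> f x = g x) -> forall x, D x -> partials s f x = partials s g x.
Proof.
move=> oD fg; elim: s => [|i s IH] x Dx; first exact: fg.
rewrite /= /partial; apply: near_eq_derive.
by near=> y; apply: IH; near: y; exact: open_nbhs_nbhs.
Unshelve. all: by end_near.
Qed.

Lemma partials_cat (R : realType) (s t : seq 'I_4) (f : 'rV[R]_4 -> R) :
  partials (s ++ t) f = partials s (partials t f).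
Proof. by rewrite /partials foldr_cat. Qed.

Lemma Ck_le (R : realType) (j k : nat) (D : set 'rV[R]_4) (f : 'rV[R]_4 -> R) :
  (j <= k)%N -> Ck k D f -> Ck j D f.
Proof.
move=> jk hf s sj x Dx; have [h1 h2] := hf s (leq_trans sj jk) x Dx.
by split => // sj'; apply: h2; exact: leq_trans sj' jk.
Qed.

Lemma Ck_subset (R : realType) (k : nat) (D E : set 'rV[R]_4) (f : 'rV[R]_4 -> R) :
  D `<=` E -> Ck k E f -> Ck k D f.
Proof. by move=> DE hf s sk x Dx; exact: hf sk x (DE x Dx). Qed.

Lemma Ck_partials (R : realType) (k : nat) (D : set 'rV[R]_4) (f : 'rV[R]_4 -> R) (t : seq 'I_4) :
  Ck (k + size t) D f -> Ck k D (partials t f).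
Proof.
move=> hf s sk x Dx; rewrite -partials_cat.
have [|h1 h2] := hf (s ++ t) _ x Dx; first by rewrite size_cat leq_add2r.
by split => // sk'; apply: h2; rewrite size_cat ltn_add2r.
Qed.

Lemma Ck_is_derive (R : realType) (k : nat) (D : set 'rV[R]_4) (f : 'rV[R]_4 -> R)
    (s : seq 'I_4) (i : 'I_4) (x : 'rV[R]_4) :
  Ck k D f -> (size s < k)%N -> D x ->
  is_derive x (e_ i) (partials s f) (partials (i :: s) f x).
Proof.
by move=> hf sk Dx; apply/derivableP; have [_] := hf s (ltnW sk) x Dx; exact.
Qed.

Lemma Ck_continuous (R : realType) (k : nat) (D : set 'rV[R]_4) (f : 'rV[R]_4 -> R)
    (s : seq 'I_4) (x : 'rV[R]_4) :
  Ck k D f -> (size s <= k)%N -> D x -> {for x, continuous (partials s f)}.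
Proof. by move=> hf sk Dx; have [] := hf s sk x Dx. Qed.

(** Regularity is proved by exhibiting a whole family of candidate derivatives and checking one
    derivation at a time; openness of [D] keeps the induction local, since a derivative at [x] only
    sees values near [x]. *)
Lemma partials_family (R : realType) (k : nat) (D : set 'rV[R]_4) (f : 'rV[R]_4 -> R)
    (F : seq 'I_4 -> 'rV[R]_4 -> R) :
  open D -> (forall x, D x -> F [::] x = f x) ->
  (forall s i x, (size s < k)%N -> D x -> is_derive x (e_ i) (F s) (F (i :: s) x)) ->
  forall s x, (size s <= k)%N -> D x -> partials s f x = F s x.
Proof.
move=> oD F0 Fd; elim=> [|i s IH] x sk Dx; first by rewrite F0.
have h := Fd s i x sk Dx.
rewrite -(derive_val (is_derive := h)) /= /partial; apply: near_eq_derive.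
by near=> y; apply: IH; [exact: ltnW|near: y; exact: open_nbhs_nbhs].
Unshelve. all: by end_near.
Qed.

Lemma Ck_family (R : realType) (k : nat) (D : set 'rV[R]_4) (f : 'rV[R]_4 -> R)
    (F : seq 'I_4 -> 'rV[R]_4 -> R) :
  open D -> (forall x, D x -> F [::] x = f x) ->
  (forall s x, (size s <= k)%N -> D x -> {for x, continuous (F s)}) ->
  (forall s i x, (size s < k)%N -> D x -> is_derive x (e_ i) (F s) (F (i :: s) x)) ->
  (forall s x, (size s <= k)%N -> D x -> partials s f x = F s x) /\ Ck k D f.
Proof.
move=> oD F0 Fc Fd; have E := partials_family oD F0 Fd.
split => // s sk x Dx.
have ne : \forall y \near x, F s y = partials s f y.
  by near=> y; apply/esym/E => //; near: y; exact: open_nbhs_nbhs.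
split.
  rewrite /prop_for /continuous_at E //; apply: cvg_trans (Fc s x sk Dx).
  exact: (@near_eq_cvg _ _ (nbhs x) _ _ _ ne).
move=> sk' i; have h := Fd s i x sk' Dx.
exact: (@ex_derive _ _ _ _ _ _ _ (near_eq_is_derive ne h)).
Unshelve. all: by end_near.
Qed.

Lemma Ck_comb (R : realType) (k : nat) (D : set 'rV[R]_4) (f g : 'rV[R]_4 -> R) (c1 c2 : R) :
  open D -> Ck k D f -> Ck k D g ->
  (forall s x, (size s <= k)%N -> D x ->
    partials s (fun x => c1 * f x + c2 * g x) x = c1 * partials s f x + c2 * partials s g x) /\
  Ck k D (fun x => c1 * f x + c2 * g x).
Proof.
move=> oD hf hg.
apply: (@Ck_family R k D _ (fun s x => c1 * partials s f x + c2 * partials s g x)) => //.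
- move=> s x sk Dx; apply: continuousD; apply: continuousM; [exact: cst_continuous| |exact: cst_continuous|].
    exact: Ck_continuous hf sk Dx.
  exact: Ck_continuous hg sk Dx.
- move=> s i x sk Dx.
  have h1 := Ck_is_derive i hf sk Dx; have h2 := Ck_is_derive i hg sk Dx.
  by apply: is_derive_eq; rewrite /GRing.scale.
Qed.

Lemma Ck_cst (R : realType) (k : nat) (D : set 'rV[R]_4) (c : R) :
  open D -> (forall s x, (size s <= k)%N -> D x ->
    partials s (cst c) x = if s is [::] then c else 0) /\ Ck k D (cst c).
Proof.
move=> oD.
apply: (@Ck_family R k D _ (fun s => cst (if s is [::] then c else 0))) => //.
- by move=> s x _ _; exact: cst_continuous.
Qed.

Lemma Ck_dil (R : realType) (k : nat) (D D' : set 'rV[R]_4) (f : 'rV[R]_4 -> R) (l : R) :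
  open D' -> (forall x, D' x -> D (l *: x)) -> Ck k D f ->
  (forall s x, (size s <= k)%N -> D' x ->
     partials s (fun x => f (l *: x)) x = l ^+ size s * partials s f (l *: x)) /\
  Ck k D' (fun x => f (l *: x)).
Proof.
move=> oD' DD hf.
apply: (@Ck_family R k D' _ (fun s x => l ^+ size s * partials s f (l *: x))) => //.
- by move=> x _; rewrite expr0 mul1r.
- move=> s x sk Dx; apply: continuousM; first exact: cst_continuous.
  apply: (@continuous_comp _ _ _ (fun y : 'rV[R]_4 => l *: y)); first exact: scaler_continuous.
  exact: Ck_continuous hf sk (DD _ Dx).
- move=> s i x sk Dx /=; have /is_derive_line h := Ck_is_derive i hf sk (DD _ Dx).
  apply/is_derive_line.
  set q := fun h : R => partials s f (h *: e_ i + l *: x) in h.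
  have h' : is_derive (l * 0) 1 q (partials (i :: s) f (l *: x)) by rewrite mulr0.
  have dl : is_derive (0 : R) 1 (fun t => l * t) l.
    by apply: is_derive_eq; rewrite /GRing.scale /= mulr1.
  have hc := is_derive1_comp h' dl.
  rewrite [X in is_derive _ _ X _](_ : _ = fun t : R => l ^+ size s * (q \o (fun t => l * t)) t).
    by apply: is_derive_eq; rewrite /GRing.scale /= exprS; ring.
  by apply/funext => t; rewrite /q /= scalerDr scalerA.
Qed.

Lemma laplacianE (R : realType) (f : 'rV[R]_4 -> R) x :
  laplacian f x = - \sum_(i < 4) partials [:: i; i] f x.
Proof. by []. Qed.

Lemma Ck_sum (R : realType) (k : nat) (D : set 'rV[R]_4) (I : Type) (r : seq I)
    (F : I -> 'rV[R]_4 -> R) :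
  open D -> (forall i, Ck k D (F i)) -> Ck k D (fun x => \sum_(i <- r) F i x).
Proof.
move=> oD hF; elim: r => [|i r IH].
  have [_] := Ck_cst k 0 oD; congr (Ck _ _ _).
  by apply/funext => x; rewrite big_nil.
have [_] := Ck_comb 1 1 oD (hF i) IH; congr (Ck _ _ _).
by apply/funext => x; rewrite big_cons !mul1r.
Qed.

Lemma Ck_laplacian (R : realType) (k : nat) (D : set 'rV[R]_4) (f : 'rV[R]_4 -> R) :
  open D -> Ck k.+2 D f -> Ck k D (laplacian f).
Proof.
move=> oD hf.
have h : Ck k D (fun x => \sum_(i < 4) partials [:: i; i] f x).
  apply: (@Ck_sum R k D _ _ (fun i : 'I_4 => partials [:: i; i] f) oD) => i.
  by apply: (@Ck_partials R k D f [:: i; i]); rewrite addn2.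
have [_] := Ck_comb (- 1) 0 oD h h; congr (Ck _ _ _).
by apply/funext => x; rewrite laplacianE mul0r addr0 mulN1r.
Qed.

Lemma laplacian_ext (R : realType) (D : set 'rV[R]_4) (f g : 'rV[R]_4 -> R) :
  open D -> (forall x, D x -> f x = g x) -> forall x, D x -> laplacian f x = laplacian g x.
Proof.
move=> oD fg x Dx; rewrite !laplacianE; apply: congr1; apply: eq_bigr => i _.
exact: partials_ext oD fg _ Dx.
Qed.

Lemma laplacian_comb (R : realType) (D : set 'rV[R]_4) (f g : 'rV[R]_4 -> R) (c1 c2 : R) :
  open D -> Ck 2 D f -> Ck 2 D g -> forall x, D x ->
  laplacian (fun x => c1 * f x + c2 * g x) x = c1 * laplacian f x + c2 * laplacian g x.
Proof.
move=> oD hf hg x Dx; have [h _] := Ck_comb c1 c2 oD hf hg; rewrite !laplacianE.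
rewrite !mulrN -opprD !mulr_sumr -big_split; apply: congr1; apply: eq_bigr => i _.
exact: (h [:: i; i] x isT Dx).
Qed.

Lemma bilaplacian_comb (R : realType) (D : set 'rV[R]_4) (f g : 'rV[R]_4 -> R) (c1 c2 : R) :
  open D -> Ck 4 D f -> Ck 4 D g -> forall x, D x ->
  laplacian (laplacian (fun x => c1 * f x + c2 * g x)) x =
  c1 * laplacian (laplacian f) x + c2 * laplacian (laplacian g) x.
Proof.
move=> oD hf hg x Dx.
have h2f := Ck_laplacian oD hf; have h2g := Ck_laplacian oD hg.
apply: (eq_trans _ (laplacian_comb c1 c2 oD h2f h2g Dx)).
apply: (laplacian_ext oD _ Dx) => y Dy.
have k2f : Ck 2 D f by exact: Ck_le hf.
have k2g : Ck 2 D g by exact: Ck_le hg.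
exact: laplacian_comb c1 c2 oD k2f k2g _ Dy.
Qed.

Lemma laplacian_dil (R : realType) (D D' : set 'rV[R]_4) (f : 'rV[R]_4 -> R) (l : R) :
  open D' -> (forall x, D' x -> D (l *: x)) -> Ck 2 D f -> forall x, D' x ->
  laplacian (fun x => f (l *: x)) x = l ^+ 2 * laplacian f (l *: x).
Proof.
move=> oD DD hf x Dx; have [h _] := Ck_dil oD DD hf; rewrite !laplacianE.
rewrite mulrN mulr_sumr; apply: congr1; apply: eq_bigr => i _.
exact: (h [:: i; i] x isT Dx).
Qed.

Lemma is_derive_ray (R : realType) (f : 'rV[R]_4 -> R) (v : 'rV[R]_4) (r d : R) :
  is_derive (r *: v) v f d -> is_derive r 1 (fun t : R => f (t *: v)) d.
Proof.
move=> /is_derive_line; set q := fun h : R => _ => h.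
have h' : is_derive (r - r) 1 q d by rewrite subrr.
have dl : is_derive r 1 (fun t => t - r) 1.
  by apply: is_derive_eq; rewrite /GRing.scale /= oppr0 addr0.
rewrite [X in is_derive _ _ X _](_ : _ = q \o (fun t => t - r)).
  by apply: (is_derive_eq (@is_derive1_comp R q (fun t => t - r) r _ _ h' dl)); rewrite mulr1.
by apply/funext => t; rewrite /q /= -scalerDl subrK.
Qed.

Lemma near_eball_neq0 (R : realType) (rho : R) (x : 'rV[R]_4) :
  eball rho x -> x != 0 -> \forall y \near x, eball rho y /\ y != 0.
Proof.
move=> xr x0; near=> y; split; near: y; first exact: open_nbhs_nbhs (conj (@open_eball R rho) xr).
have /(cvgr_gt (enorm x)) := @continuous_enorm R x.
move=> /(_ 0 (enorm_gt0 x0)); apply: filterS => y; apply: contraTneq => ->.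
by rewrite enorm0 ltxx.
Unshelve. all: by end_near.
Qed.

Lemma eball_ray (R : realType) (rho : R) (x : 'rV[R]_4) (i : 'I_4) :
  eball rho x -> eball rho (enorm x *: e_ i).
Proof. by rewrite /eball /= enorm_ray ?enorm_ge0. Qed.

(** * Radial functions satisfy the radial system *)

Section radial.
Context {R : realType}.
Variables (rho : R) (u : 'rV[R]_4 -> R).
Hypothesis ur : radial_on (eball rho) u.

Lemma radialE x : eball rho x -> u x = u (enorm x *: e_ 0).
Proof. by move=> xr; apply: ur => //; [exact: eball_ray|rewrite enorm_ray ?enorm_ge0]. Qed.

Lemma is_derive_profile r : Ck 1 (eball rho) u -> 0 <= r < rho ->
  is_derive r 1 (fun t => u (t *: e_ 0)) (partial 0 u (r *: e_ 0)).
Proof.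
move=> hu /andP[r0 rr]; apply: is_derive_ray.
by apply: (Ck_is_derive (s := [::]) 0 hu) => //; rewrite /eball /= enorm_ray.
Qed.

Lemma radial_partial x i : Ck 1 (eball rho) u -> eball rho x -> x != 0 ->
  is_derive x (e_ i) u (x 0 i * (partial 0 u (enorm x *: e_ 0) / enorm x)).
Proof.
move=> hu xr x0.
have ne : \forall y \near x, u (enorm y *: e_ 0) = u y.
  by near=> y; apply/esym/radialE; near: y; exact: open_nbhs_nbhs (conj (@open_eball R rho) xr).
have hx : 0 <= enorm x < rho by rewrite enorm_ge0.
have hd := is_derive_radial i x0 (is_derive_profile hu hx).
apply: (is_derive_eq (near_eq_is_derive ne hd)).
by rewrite mulrAC mulrA.
Unshelve. all: by end_near.
Qed.

Lemma radial_partialE x i : Ck 1 (eball rho) u -> eball rho x -> x != 0 ->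
  partial i u x = x 0 i * (partial 0 u (enorm x *: e_ 0) / enorm x).
Proof. by move=> hu xr x0; exact: (derive_val (is_derive := radial_partial i hu xr x0)). Qed.

Lemma partial_profile r : Ck 2 (eball rho) u -> 0 <= r < rho ->
  is_derive r 1 (fun t => partial 0 u (t *: e_ 0)) (partials [:: 0; 0] u (r *: e_ 0)).
Proof.
move=> hu /andP[r0 rr]; apply: is_derive_ray.
by apply: (Ck_is_derive (s := [:: 0]) 0 hu) => //; rewrite /eball /= enorm_ray.
Qed.

(** In terms of the profile this is [- (u'' + 3 * u' / r)]: the formula [x_i * (u' / r)] for the
    first derivatives is differentiated once more, and the squares of the coordinates add up to
    [r ^ 2]. *)
Lemma laplacian_radialE x : Ck 2 (eball rho) u -> eball rho x -> x != 0 ->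
  laplacian u x = - (partials [:: 0; 0] u (enorm x *: e_ 0) +
                     3 * (partial 0 u (enorm x *: e_ 0) / enorm x)).
Proof.
move=> hu xr x0; have hu1 : Ck 1 (eball rho) u by exact: Ck_le hu.
set r := enorm x; have r0 : 0 < r := enorm_gt0 x0.
set A := partials _ _ _; set B := partial _ _ _.
have hh : is_derive r 1 (fun t => partial 0 u (t *: e_ 0) / t) (A / r - B / r ^+ 2).
  have hp : is_derive r 1 (fun t => partial 0 u (t *: e_ 0)) A.
    by apply: partial_profile => //; rewrite enorm_ge0.
  have hi : is_derive r 1 (fun t : R => t^-1) (- r ^- 2).
    have id1 : is_derive r 1 (fun t : R => t) 1 by exact: is_derive_id.
    apply: (is_derive_eq (@is_deriveV R (fun t : R => t) r _ 1 (lt0r_neq0 r0) id1)).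
    by rewrite /GRing.scale /= mulr1.
  apply: is_derive_eq; rewrite /GRing.scale /= -/B; field.
  exact: lt0r_neq0.
have hi i : partials [:: i; i] u x = B / r + x 0 i ^+ 2 * ((A / r - B / r ^+ 2) / r).
  have ne : \forall y \near x, (y : 'rV[R]_4) 0 i * (partial 0 u (enorm y *: e_ 0) / enorm y) = partial i u y.
    near=> y; apply/esym/radial_partialE => //; near: y.
      exact: open_nbhs_nbhs (conj (@open_eball R rho) xr).
    by apply: filterS (near_eball_neq0 xr x0) => y [].
  have h1 := is_derive_coord x i i; have h2 := is_derive_radial i x0 hh.
  have h3 : is_derive x (e_ i) (fun y : 'rV[R]_4 => y 0 i * (partial 0 u (enorm y *: e_ 0) / enorm y))
     (B / r + x 0 i ^+ 2 * ((A / r - B / r ^+ 2) / r)).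
    apply: (is_derive_eq (is_deriveM h1 h2)); rewrite /GRing.scale /= eqxx -/r -/B mulr1n.
    move: (A / r - _) (B / r) (x 0 i) => ? ? ?; ring.
  exact: (derive_val (is_derive := near_eq_is_derive ne h3)).
rewrite laplacianE; apply: congr1.
apply: (eq_trans (eq_bigr _ (fun i _ => hi i))).
rewrite big_split /= sumr_const card_ord -mulr_suml -enorm_sqr -/r -mulr_natl.
by field; exact: lt0r_neq0.
Unshelve. all: by end_near.
Qed.

Lemma laplacian_radial : Ck 2 (eball rho) u -> radial_on (eball rho) (laplacian u).
Proof.
move=> hu x y xr yr xy.
have [x0|x0] := eqVneq x 0.
  have -> : y = 0 by apply: enorm_eq0; rewrite -xy x0 enorm0.
  by rewrite x0.
have y0 : y != 0 by apply: contra x0 => /eqP y0; apply/eqP/enorm_eq0; rewrite xy y0 enorm0.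
rewrite (laplacian_radialE hu xr x0) (laplacian_radialE hu yr y0).
by rewrite xy.
Qed.

Lemma radial_flux r : Ck 2 (eball rho) u -> 0 < r < rho ->
  is_derive r 1 (fun t => t ^+ 3 * partial 0 u (t *: e_ 0)) (r ^+ 3 * - laplacian u (r *: e_ 0)).
Proof.
move=> hu /andP[r0 rr].
have hr : eball rho (r *: e_ 0) by rewrite /eball /= enorm_ray // ltW.
have hr0 : r *: (e_ 0 : 'rV[R]_4) != 0.
  by apply/eqP => h0; have := enorm_ray (R := R) 0 (ltW r0); rewrite h0 enorm0 => r00; move: r0; rewrite -r00 ltxx.
have hp : is_derive r 1 (fun t => partial 0 u (t *: e_ 0)) (partials [:: 0; 0] u (r *: e_ 0)).
  by apply: partial_profile => //; rewrite (ltW r0).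
have h3 : is_derive r 1 (fun t : R => t ^+ 3) (3 * r ^+ 2).
  by apply: is_derive_eq; rewrite /GRing.scale /=; ring.
apply: (is_derive_eq (is_deriveM h3 hp)).
rewrite (laplacian_radialE hu hr hr0) opprK enorm_ray ?(ltW r0) //.
move: (partials [:: 0; 0] u (r *: e_ 0)) (partial 0 u (r *: e_ 0)) => A B.
by rewrite /GRing.scale /=; field; exact: lt0r_neq0.
Qed.

End radial.

(** With the minus sign convention for the Laplacian, [w] and [P] must carry minus signs; all four
    couplings of the system then have positive coefficients, as the comparison principle
    requires. *)
Lemma radsol_radial (R : realType) (rho : R) (u : 'rV[R]_4 -> R) :
  0 < rho -> radial_on (eball rho) u -> Ck 4 (eball rho) u ->
  radsol rho (fun r => u (r *: e_ 0)) (fun r => r ^+ 3 * partial 0 u (r *: e_ 0))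
    (fun r => - laplacian u (r *: e_ 0)) (fun r => - (r ^+ 3 * partial 0 (laplacian u) (r *: e_ 0)))
    (fun r => laplacian (laplacian u) (r *: e_ 0)).
Proof.
move=> rho0 ur hu.
have oD := @open_eball R rho.
have hu1 : Ck 1 (eball rho) u by exact: Ck_le hu.
have hu2 : Ck 2 (eball rho) u by exact: Ck_le hu.
have hL : Ck 2 (eball rho) (laplacian u) by exact: Ck_laplacian.
have hL1 : Ck 1 (eball rho) (laplacian u) by exact: Ck_le hL.
have Lr : radial_on (eball rho) (laplacian u) by exact: laplacian_radial.
have z0 : 0 <= (0 : R) < rho by rewrite lexx.
have d3 (r : R) : is_derive r 1 (fun t : R => t ^+ 3) (3 * r ^+ 2).
  by apply: is_derive_eq; rewrite /GRing.scale /=; ring.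
have hfl (v : 'rV[R]_4 -> R) : Ck 2 (eball rho) v ->
    is_derive (0 : R) 1 (fun t => t ^+ 3 * partial 0 v (t *: e_ 0)) 0.
  move=> hv; have hp := partial_profile hv z0.
  apply: (is_derive_eq (is_deriveM (d3 0) hp)).
  by rewrite /GRing.scale /= !expr0n /= !mulr0 !mul0r addr0.
split.
- move=> r /andP[r0 rr].
  have hr : 0 <= r < rho by rewrite rr ltW.
  apply: (is_derive_eq (is_derive_profile hu1 hr)).
  by rewrite mulrAC divff ?mul1r // expf_neq0 // lt0r_neq0.
- by move=> r hr; have H := radial_flux ur hu2 hr; apply: (is_derive_eq H).
- move=> r /andP[r0 rr].
  have hr : 0 <= r < rho by rewrite rr ltW.
  apply: (is_derive_eq (is_deriveN (is_derive_profile hL1 hr))).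
  by rewrite mulNr mulrAC divff ?mul1r // expf_neq0 // lt0r_neq0.
- move=> r hr; apply: (is_derive_eq (is_deriveN (radial_flux Lr hL hr))).
  by rewrite mulrN opprK.
- exact: is_derive_cvg_right (is_derive_profile hu1 z0).
- exact: is_derive_cvg_right (hfl _ hu2).
- exact: is_derive_cvg_right (is_deriveN (is_derive_profile hL1 z0)).
- exact: is_derive_cvg_right (is_deriveN (hfl _ hL)).
- by rewrite expr0n /= mul0r.
- by rewrite expr0n /= mul0r oppr0.
Qed.

(** * Bounds on all partial derivatives up to order four *)

Lemma normD_le (R : realType) (a b A B : R) : `|a| <= A -> `|b| <= B -> `|a + b| <= A + B.
Proof. by move=> hA hB; apply: le_trans (ler_normD _ _) (lerD hA hB). Qed.

Lemma normM_le (R : realType) (a b A B : R) : `|a| <= A -> `|b| <= B -> `|a * b| <= A * B.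
Proof. by move=> hA hB; rewrite normrM ler_pM. Qed.

Lemma is_derive_mul (R : realType) (V : normedModType R) (x v : V) (f g : V -> R) (df dg : R) :
  is_derive x v f df -> is_derive x v g dg ->
  is_derive x v (fun y => f y * g y) (f x * dg + g x * df).
Proof. exact: is_deriveM. Qed.

Lemma is_derive_add (R : realType) (V : normedModType R) (x v : V) (f g : V -> R) (df dg : R) :
  is_derive x v f df -> is_derive x v g dg -> is_derive x v (fun y => f y + g y) (df + dg).
Proof. exact: is_deriveD. Qed.

(* The functions h_j are the iterates of (1/r) d/dr on the profile of a radial
   function, so that d_i (h_j(|x|)) = x_i h_(j+1)(|x|). *)
Definition hpart (R : realType) (h0 h1 h2 h3 h4 : R -> R) (s : seq 'I_4) (x : 'rV[R]_4) : R :=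
  let r := enorm x in
  let d (i j : 'I_4) : R := (i == j)%:R in
  match s with
  | [::] => h0 r
  | [:: i] => x 0 i * h1 r
  | [:: j; i] => d j i * h1 r + x 0 i * x 0 j * h2 r
  | [:: k; j; i] => d j i * x 0 k * h2 r + (d k i * x 0 j + x 0 i * d k j) * h2 r
                    + x 0 i * x 0 j * x 0 k * h3 r
  | [:: l; k; j; i] =>
      d j i * (d l k * h2 r + x 0 k * x 0 l * h3 r)
      + ((d k i * d l j + d l i * d k j) * h2 r + (d k i * x 0 j + x 0 i * d k j) * x 0 l * h3 r)
      + ((d l i * x 0 j * x 0 k + x 0 i * d l j * x 0 k + x 0 i * x 0 j * d l k) * h3 r
         + x 0 i * x 0 j * x 0 k * x 0 l * h4 r)
  | _ => 0
  end.

(** A derivation in direction [i] acts on a coordinate as a Kronecker symbol and on a profile as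
    [x_i] times the next profile. The origin is excluded because the norm is not differentiable
    there. *)
Lemma partials_hpart (R : realType) (rho : R) (u : 'rV[R]_4 -> R) (h0 h1 h2 h3 h4 : R -> R) :
  (forall x, eball rho x -> u x = h0 (enorm x)) ->
  (forall r : R, 0 < r < rho -> is_derive r 1 h0 (r * h1 r)) ->
  (forall r : R, 0 < r < rho -> is_derive r 1 h1 (r * h2 r)) ->
  (forall r : R, 0 < r < rho -> is_derive r 1 h2 (r * h3 r)) ->
  (forall r : R, 0 < r < rho -> is_derive r 1 h3 (r * h4 r)) ->
  forall s x, (size s <= 4)%N -> eball rho x -> x != 0 ->
  partials s u x = hpart h0 h1 h2 h3 h4 s x.
Proof.
move=> hu d0 d1 d2 d3 s x s4 xr x0.
pose D := eball rho `&` [set y : 'rV[R]_4 | y != 0].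
have oD : open D.
  rewrite openE => y [yr y0]; exact: (near_eball_neq0 yr y0).
apply: (@partials_family R 4 D u (hpart h0 h1 h2 h3 h4) oD _ _ s x s4 (conj xr x0)).
  by move=> y [yr _]; rewrite /= hu.
move=> {}s i {s4} {xr x0}x s4 [xr x0].
have r0 := enorm_gt0 x0.
have dr (h h' : R -> R) : (forall r : R, 0 < r < rho -> is_derive r 1 h (r * h' r)) ->
    is_derive x (e_ i) (fun y => h (enorm y)) (x 0 i * h' (enorm x)).
  move=> dh; have hr : 0 < enorm x < rho by rewrite r0.
  apply: (is_derive_eq (is_derive_radial i x0 (dh _ hr))).
  by field; rewrite lt0r_neq0.
have D0 := dr _ _ d0; have D1 := dr _ _ d1; have D2 := dr _ _ d2; have D3 := dr _ _ d3.
have dx j := is_derive_coord x i j.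
have dc (c : R) := is_derive_cst c x (e_ i).
case: s s4 => [|a [|b [|c [|//]]]] _ /=.
- exact: D0.
- by apply: (is_derive_eq (is_derive_mul (dx a) D1)); ring.
- have hd := is_derive_add (is_derive_mul (dc (a == b)%:R) D1)
    (is_derive_mul (is_derive_mul (dx b) (dx a)) D2).
  by apply: (is_derive_eq hd) => /=; ring.
- have hd := is_derive_add (is_derive_add (is_derive_mul (is_derive_mul (dc (b == c)%:R) (dx a)) D2)
     (is_derive_mul (is_derive_add (is_derive_mul (dc (a == c)%:R) (dx b))
       (is_derive_mul (dx c) (dc (a == b)%:R))) D2))
    (is_derive_mul (is_derive_mul (is_derive_mul (dx c) (dx b)) (dx a)) D3).
  by apply: (is_derive_eq hd) => /=; ring.
Qed.

Lemma continuous_le_at0 (R : realType) (rho B : R) (F : 'rV[R]_4 -> R) :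
  0 < rho -> {for 0, continuous F} ->
  (forall x, eball rho x -> x != 0 -> `|F x| <= B) -> `|F 0| <= B.
Proof.
move=> rho0 cF hF; rewrite leNgt; apply/negP => hB.
have cN : {for 0, continuous (fun x => `|F x|)} by exact: continuous_comp cF (@norm_continuous _ _ _).
have /(cvgr_gt `|F 0|) /(_ _ hB) /nbhs_ballP[e /= e0 he] := cN.
pose t := Num.min (e / 2) (rho / 2).
have t0 : 0 < t by rewrite lt_min !divr_gt0.
have tr : t < rho by rewrite gt_min; apply/orP; right; lra.
have te : t < e by rewrite gt_min; apply/orP; left; lra.
have nt := enorm_ray (R := R) 0 (ltW t0).
have /he : ball (0 : 'rV[R]_4) e (t *: e_ 0).
  rewrite -ball_normE /= sub0r normrN; apply: le_lt_trans (mx_norm_le_enorm _) _.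
  by rewrite nt.
have h1 : eball rho (t *: (e_ 0 : 'rV[R]_4)) by rewrite /eball /= nt.
have h2 : t *: (e_ 0 : 'rV[R]_4) != 0.
  by apply/eqP => h0; move: nt t0; rewrite h0 enorm0 => <-; rewrite ltxx.
by have := hF _ h1 h2; move=> /le_lt_trans/[apply]; rewrite ltxx.
Qed.

(** [rs_h1] to [rs_h4] are the iterates of [(1 / r) d/dr] on [g], rewritten through the unknowns of
    the system: no derivative of [f] appears, even in the fourth. *)
Definition rs_h1 (R : realType) (a : R -> R) (t : R) : R := a t / t ^+ 4.
Definition rs_h2 (R : realType) (a w : R -> R) (t : R) : R := (w t - 4 * rs_h1 a t) / t ^+ 2.
Definition rs_h3 (R : realType) (a w P : R -> R) (t : R) : R :=
  (P t / t ^+ 4 - 6 * rs_h2 a w t) / t ^+ 2.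
Definition rs_h4 (R : realType) (a w P f : R -> R) (t : R) : R :=
  (f t - 4 * (P t / t ^+ 4) - 8 * t ^+ 2 * rs_h3 a w P t) / t ^+ 4.

Lemma radsol_h (R : realType) (rho : R) (g a w P f : R -> R) : radsol rho g a w P f ->
  [/\ forall r : R, 0 < r < rho -> is_derive r 1 g (r * rs_h1 a r),
     forall r : R, 0 < r < rho -> is_derive r 1 (rs_h1 a) (r * rs_h2 a w r),
     forall r : R, 0 < r < rho -> is_derive r 1 (rs_h2 a w) (r * rs_h3 a w P r) &
     forall r : R, 0 < r < rho -> is_derive r 1 (rs_h3 a w P) (r * rs_h4 a w P f r)].
Proof.
move=> hs; pose h1 := rs_h1 a; pose h2 := rs_h2 a w; pose h3 := rs_h3 a w P.
pose h4 := rs_h4 a w P f.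
have dinv (n : nat) (F : R -> R) (dF r : R) : r != 0 -> is_derive r 1 F dF ->
    is_derive r 1 (fun t => F t / t ^+ n) (dF / r ^+ n - n%:R * F r / r ^+ n.+1).
  move=> r0 hF; have id1 : is_derive r 1 (fun t : R => t) 1 by exact: is_derive_id.
  have hi := @is_deriveV R (fun t : R => t) r _ 1 r0 id1.
  have := is_derive_mulX n hF hi; rewrite [X in is_derive _ _ X _ -> _](_ : _ = fun t => F t / t ^+ n).
    move=> H; apply: (is_derive_eq H); rewrite /GRing.scale /= -!exprVn.
    case: n {H} => [|n]; first by rewrite !expr0; ring.
    by rewrite !exprS /=; field.
  by apply/funext => t; rewrite exprVn.
have D0 (r : R) : 0 < r < rho -> is_derive r 1 g (r * h1 r).
  move=> hr; apply: (is_derive_eq (rs_g hs hr)); rewrite /h1 /rs_h1.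
  by case/andP: hr => r0 _; move: (a r) => ar; field; exact: lt0r_neq0.
have D1 (r : R) : 0 < r < rho -> is_derive r 1 h1 (r * h2 r).
  move=> hr; have r0 : r != 0 by case/andP: hr => r0 _; exact: lt0r_neq0.
  apply: (is_derive_eq (dinv 4%N _ _ _ r0 (rs_a hs hr))); rewrite /h2 /rs_h2 /rs_h1.
  by move: (a r) (w r) => ar wr; field.
have D2 (r : R) : 0 < r < rho -> is_derive r 1 h2 (r * h3 r).
  move=> hr; have r0 : r != 0 by case/andP: hr => r0 _; exact: lt0r_neq0.
  have d1 := D1 _ hr; rewrite -/h1 in d1; have d2 := rs_w hs hr.
  have d3 : is_derive r 1 (fun t => w t - 4 * h1 t) (P r / r ^+ 3 - 4 * (r * h2 r)).
    by apply: is_derive_eq; rewrite /GRing.scale.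
  apply: (is_derive_eq (dinv 2%N _ _ _ r0 d3)); rewrite /h3 /h2 /rs_h3 /rs_h2 -/(h1 r).
  by move: (h1 r) (w r) (P r) => h1r wr Pr; field.
have D3 (r : R) : 0 < r < rho -> is_derive r 1 h3 (r * h4 r).
  move=> hr; have r0 : r != 0 by case/andP: hr => r0 _; exact: lt0r_neq0.
  have d1 := D2 _ hr; have d2 := dinv 4%N _ _ _ r0 (rs_P hs hr).
  have d3 : is_derive r 1 (fun t => P t / t ^+ 4 - 6 * h2 t)
     (r ^+ 3 * f r / r ^+ 4 - 4 * P r / r ^+ 5 - 6 * (r * h3 r)).
    by apply: is_derive_eq; rewrite /GRing.scale.
  apply: (is_derive_eq (dinv 2%N _ _ _ r0 d3)); rewrite /h4 /h3 /rs_h4 /rs_h3 -/(h2 r).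
  by move: (h2 r) (f r) (P r) => h2r fr Pr; field.
by split.
Qed.

(** The integrated bounds give [h1 = w 0 / 4] up to [E * r ^ 2 / 48] and a bounded [h2], while [h3]
    and [h4] are controlled only after multiplication by [r ^ 2] and [r ^ 4]. These powers are
    supplied by the products of coordinates in front of them, each coordinate being at most [r]. *)
Lemma hpart_bound (R : realType) (rho E : R) (g a w P f : R -> R) :
  radsol rho g a w P f -> (forall r : R, 0 < r < rho -> `|f r| <= E) ->
  forall s x, (size s <= 4)%N -> 0 < enorm x < rho ->
  `|hpart g (rs_h1 a) (rs_h2 a w) (rs_h3 a w P) (rs_h4 a w P f) s x| <=
  24 * (1 + rho) ^+ 4 * (`|g 0| + `|w 0| + E).
Proof.
move=> hs hE s x s4 /andP[r0 xr].
have rho0 : 0 < rho by exact: lt_trans xr.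
pose h1 := rs_h1 a; pose h2 := rs_h2 a w; pose h3 := rs_h3 a w P; pose h4 := rs_h4 a w P f.
rewrite -/h1 -/h2 -/h3 -/h4; set r := enorm x in r0 xr *.
have fE (t : R) : 0 < t < r -> `|f t| <= E.
  by move=> /andP[t0 tr]; apply: hE; rewrite t0 (lt_trans tr).
have fE1 (t : R) : 0 < t < r -> f t <= E by move=> /fE; rewrite ler_norml => /andP[].
have fE2 (t : R) : 0 < t < r -> - E <= f t by move=> /fE; rewrite ler_norml => /andP[].
have rr : 0 <= r <= r by rewrite lexx ltW.
have [P1 w1 a1 g1] := radsol_le hs xr fE1 rr.
have [P2 w2 a2 g2] := radsol_ge hs xr fE2 rr.
have E0 : 0 <= E by apply: le_trans (normr_ge0 _) (hE r _); rewrite r0.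
have fr : `|f r| <= E by apply: hE; rewrite r0.
set p := g 0 in g1 g2 *; set q := - w 0.
have qE : w 0 = - q by rewrite /q opprK.
clearbody q.
rewrite qE normrN in P1 P2 w1 w2 a1 a2 g1 g2 *.
have r2 : 0 < r ^+ 2 by exact: exprn_gt0.
have r4 : 0 < r ^+ 4 by exact: exprn_gt0.
have b1' : `|h1 r + q / 4| <= E * r ^+ 2 / 48.
  have -> : h1 r + q / 4 = (a r + q * r ^+ 4 / 4) / r ^+ 4.
    by rewrite /h1 /rs_h1; move: (a r) => ar; field; exact: lt0r_neq0.
  rewrite normrM normfV (gtr0_norm r4) ler_pdivrMr // ler_norml.
  by apply/andP; split; lra.
have bP : `|P r / r ^+ 4| <= E / 4.
  rewrite normrM normfV (gtr0_norm r4) ler_pdivrMr // ler_norml.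
  by apply/andP; split; lra.
have b2 : `|h2 r| <= E * 5 / 24.
  rewrite /h2 /rs_h2 -/(h1 r) normrM normfV (gtr0_norm r2) ler_pdivrMr //.
  move: b1'; rewrite !ler_norml => /andP[? ?].
  by apply/andP; split; lra.
have b3 : r ^+ 2 * `|h3 r| <= E * 3 / 2.
  rewrite /h3 /rs_h3 -/(h2 r) normrM normfV (gtr0_norm r2) mulrCA divff ?mulr1 ?lt0r_neq0 //.
  move: bP b2; rewrite !ler_norml => /andP[? ?] /andP[? ?].
  by apply/andP; split; lra.
have b4 : r ^+ 4 * `|h4 r| <= E * 14.
  rewrite /h4 /rs_h4 -/(h3 r) normrM normfV (gtr0_norm r4) mulrCA divff ?mulr1 ?lt0r_neq0 //.
  have : `|r ^+ 2 * h3 r| <= E * 3 / 2 by rewrite normrM (gtr0_norm r2).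
  move: bP fr; rewrite !ler_norml => /andP[? ?] /andP[? ?] /andP[? ?].
  by apply/andP; split; lra.
have b1 : `|h1 r| <= `|q| / 4 + E * r ^+ 2 / 48.
  move: b1' (ler_norm q) (ler_norm (- q)); rewrite normrN !ler_norml => /andP[? ?] ? ?.
  by apply/andP; split; lra.
have b0 : `|g r| <= `|p| + `|q| * r ^+ 2 / 8 + E * r ^+ 4 / 192.
  have := ler_wpM2r (ltW r2) (ler_norm q); have := ler_wpM2r (ltW r2) (ler_norm (- q)).
  have := ler_norm p; have := ler_norm (- p).
  rewrite !normrN ler_norml => ? ? ? ?.
  by apply/andP; split; lra.
set M := (1 + rho) ^+ 4.
have rM (j : nat) : (j <= 4)%N -> r ^+ j <= M.
  move=> j4; apply: (@le_trans _ _ ((1 + rho) ^+ j)).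
    by rewrite lerXn2r ?nnegrE ?addr_ge0 ?(ltW r0) ?(ltW rho0) //; have : r < rho := xr; lra.
  by rewrite ler_weXn2l // lerDl ltW.
have M0 : 1 <= M by have := rM 0%N isT; rewrite expr0.
have M1 := rM 1%N isT; have M2 := rM 2%N isT; have M3 := rM 3%N isT; have M4 := rM 4%N isT.
rewrite expr1 in M1.
have p0 : 0 <= `|p| by []. have q0 : 0 <= `|q| by [].
have nx j : `|x 0 j| <= r by exact: coord_le_enorm.
have nd i j : `|((i : 'I_4) == j)%:R : R| <= 1 by case: (_ == _); rewrite ?normr1 ?normr0.
have h20 : 0 <= `|h2 r| by []. have h30 : 0 <= `|h3 r| by []. have h40 : 0 <= `|h4 r| by [].
have Mle (A B c : R) : A <= M -> B <= c -> 0 <= c -> 0 <= A -> A * B <= M * c.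
  move=> AM Bc c0 A0; apply: le_trans (ler_wpM2l A0 Bc) _; exact: ler_wpM2r.
have EM : 0 <= M * E by apply: mulr_ge0 => //; lra.
have pM : 0 <= M * `|p| by apply: mulr_ge0 => //; lra.
have qM : 0 <= M * `|q| by apply: mulr_ge0 => //; lra.
have MN : E <= M * E by rewrite ler_peMl.
have pMN : `|p| <= M * `|p| by rewrite ler_peMl.
have qMN : `|q| <= M * `|q| by rewrite ler_peMl.
have qM2 := ler_wpM2r q0 M2. have EM2 := ler_wpM2r E0 M2. have EM4 := ler_wpM2r E0 M4.
rewrite -mulrA; set S := M * _; have SE : S = M * `|p| + M * `|q| + M * E by rewrite /S; ring.
rewrite SE.
case: s s4 => [|i [|j [|k [|l [|//]]]]] _ /=.
- by apply: (le_trans b0); lra.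
- apply: (le_trans (normM_le (nx i) b1)).
  have k1 := ler_wpM2r q0 M1; have k3 := ler_wpM2r E0 M3.
  have -> : r * (`|q| / 4 + E * r ^+ 2 / 48) = r * `|q| / 4 + r ^+ 3 * E / 48 by ring.
  lra.
- apply: (le_trans (normD_le (normM_le (nd i j) b1) (normM_le (normM_le (nx j) (nx i)) (lexx _)))).
  have k2 : r ^+ 2 * `|h2 r| <= M * (E * 5 / 24) by apply: ler_pM => //; exact: ltW.
  lra.
- apply: (le_trans (normD_le (normD_le (normM_le (normM_le (nd j k) (nx i)) b2)
    (normM_le (normD_le (normM_le (nd i k) (nx j)) (normM_le (nx k) (nd i j))) b2))
    (normM_le (normM_le (normM_le (nx k) (nx j)) (nx i)) (lexx _)))).
  have k1 := ler_wpM2r E0 M1.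
  have k3 : r * (r ^+ 2 * `|h3 r|) <= M * (E * 3 / 2).
    by apply: ler_pM => //; rewrite ?(ltW r0) // mulr_ge0 // ltW.
  lra.
- apply: (le_trans (normD_le (normD_le
    (normM_le (nd k l) (normD_le (normM_le (nd i j) b2)
      (normM_le (normM_le (nx j) (nx i)) (lexx _))))
    (normD_le (normM_le (normD_le (normM_le (nd j l) (nd i k)) (normM_le (nd i l) (nd j k))) b2)
      (normM_le (normM_le (normD_le (normM_le (nd j l) (nx k)) (normM_le (nx l) (nd j k))) (nx i))
        (lexx _))))
    (normD_le
      (normM_le (normD_le (normD_le (normM_le (normM_le (nd i l) (nx k)) (nx j))
        (normM_le (normM_le (nx l) (nd i k)) (nx j))) (normM_le (normM_le (nx l) (nx k)) (nd i j)))
        (lexx _))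
      (normM_le (normM_le (normM_le (normM_le (nx l) (nx k)) (nx j)) (nx i)) (lexx _))))).
  lra.
Qed.

(** Plays the role of an elliptic estimate. It is linear in the data at the origin and in the
    bilaplacian, so that applied to differences it turns Cauchy data into Cauchy derivatives. The
    origin itself is reached by continuity of the derivatives. *)
Lemma partials_bound (R : realType) (rho E : R) (d : 'rV[R]_4 -> R) :
  0 < rho -> radial_on (eball rho) d -> Ck 4 (eball rho) d ->
  (forall x, eball rho x -> `|laplacian (laplacian d) x| <= E) ->
  forall s x, (size s <= 4)%N -> eball rho x ->
  `|partials s d x| <= 24 * (1 + rho) ^+ 4 * (`|d 0| + `|laplacian d 0| + E).
Proof.
move=> rho0 dr dC hE s x s4 xr.
suff {x xr} H x : eball rho x -> x != 0 ->
    `|partials s d x| <= 24 * (1 + rho) ^+ 4 * (`|d 0| + `|laplacian d 0| + E).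
  have [x0|] := eqVneq x 0; last exact: H.
  rewrite x0; apply: (continuous_le_at0 rho0 _ H).
  by apply: (Ck_continuous dC s4); rewrite /eball /= enorm0.
move=> xr x0.
have hs := radsol_radial rho0 dr dC.
have [D0 D1 D2 D3] := radsol_h hs.
rewrite (partials_hpart (radialE dr) D0 D1 D2 D3 s4 xr x0).
have hr : 0 < enorm x < rho by rewrite enorm_gt0.
have fE (r : R) : 0 < r < rho -> `|laplacian (laplacian d) (r *: e_ 0)| <= E.
  by move=> /andP[r0 rr]; apply: hE; rewrite /eball /= enorm_ray ?(ltW r0).
have := hpart_bound hs fE s4 hr; rewrite /= scale0r normrN.
exact.
Qed.

(** * Completeness for C^k_loc convergence *)

Lemma Ckloc_cvgP (R : realType) (k : nat) (D : set 'rV[R]_4)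
    (f_ : nat -> 'rV[R]_4 -> R) (g : 'rV[R]_4 -> R) :
  Ckloc_cvg k D f_ g <->
  (forall s K e, (size s <= k)%N -> compact K -> K `<=` D -> 0 < e ->
    \forall n \near \oo, forall x, K x -> `|partials s g x - partials s (f_ n) x| < e).
Proof.
split=> [h s K e sk cK KD e0|h s sk].
  have /fam_cvgP/(_ K (conj cK KD)) := h s sk.
  move=> /(_ [set q | forall y, K y -> `|partials s g y - q y| < e]); apply.
  apply/uniform_nbhs; exists [set xy | `|xy.1 - xy.2| < e]; split => //.
  by rewrite -entourage_ballE; exists e => // -[x y] /=; rewrite -ball_normE.
apply/fam_cvgP => K [cK KD] P /uniform_nbhs[E [entE EP]].
move: entE; rewrite -entourage_ballE => -[e /= e0 eE].
apply: filterS (h s K e sk cK KD e0) => n hn; apply: EP => y Ky; apply: eE => /=.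
by rewrite -ball_normE /=; exact: hn.
Qed.

Lemma is_derive_squeeze (R : realType) (f : R -> R) (d : R) :
  (forall e : R, 0 < e -> exists2 del : R, 0 < del &
    forall h : R, `|h| < del -> `|f h - f 0 - h * d| <= e * `|h|) ->
  is_derive (0 : R) 1 f d.
Proof.
move=> hf.
have H : h^-1 *: ((f \o shift 0) (h *: 1) - f 0) @[h --> 0^'] --> d.
  apply/cvgrPdist_le => e e0; have [del del0 hd] := hf e e0.
  near=> h; rewrite /= addr0 /GRing.scale /= mulr1.
  have h0 : h != 0 by near: h; exact: nbhs_dnbhs_neq.
  have -> : d - h^-1 * (f h - f 0) = - (h^-1 * (f h - f 0 - h * d)) by field.
  rewrite normrN normrM normfV ler_pdivrMl ?normr_gt0 // [leRHS]mulrC.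
  apply: hd; near: h; apply: dnbhs0_lt; exact: del0.
split; first exact: cvgP H.
exact: cvg_lim H.
Unshelve. all: by end_near.
Qed.

Lemma mean_value_le (R : realType) (f df : R -> R) (h d e : R) :
  (forall t : R, `|t| <= `|h| -> is_derive t 1 f (df t)) ->
  (forall t : R, `|t| <= `|h| -> `|df t - d| <= e) ->
  `|f h - f 0 - h * d| <= e * `|h|.
Proof.
move=> hf hd.
have lin (c t : R) : is_derive t 1 (fun t => c * t) c.
  by apply: is_derive_eq; rewrite /GRing.scale /= mulr1.
have [h0|h0] := leP 0 h.
  have tn (t : R) : 0 <= t <= h -> `|t| <= `|h|.
    by move=> /andP[t0 th]; rewrite !ger0_norm.
  have H1 : f h - f 0 <= (d + e) * h - (d + e) * 0.
    apply: (le_of_deriv_cc (dF := df) (dG := fun=> d + e)) => // t /tn ht; first exact: hf.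
    by have := hd t ht; rewrite ler_norml => /andP[? ?]; lra.
  have H2 : (d - e) * h - (d - e) * 0 <= f h - f 0.
    apply: (le_of_deriv_cc (dG := df) (dF := fun=> d - e)) => // t /tn ht; first exact: hf.
    by have := hd t ht; rewrite ler_norml => /andP[? ?]; lra.
  rewrite ler_norml (ger0_norm h0); apply/andP; split; lra.
have tn (t : R) : h <= t <= 0 -> `|t| <= `|h|.
  by move=> /andP[t0 th]; rewrite ler0_norm // ltr0_norm // lerN2.
have H1 : f 0 - f h <= (d + e) * 0 - (d + e) * h.
  apply: (le_of_deriv_cc (dF := df) (dG := fun=> d + e)) => // [|t /tn ht|t /tn ht]; first exact: ltW.
    exact: hf.
  by have := hd t ht; rewrite ler_norml => /andP[? ?]; lra.
have H2 : (d - e) * 0 - (d - e) * h <= f 0 - f h.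
  apply: (le_of_deriv_cc (dG := df) (dF := fun=> d - e)) => // [|t /tn ht|t /tn ht]; first exact: ltW.
    exact: hf.
  by have := hd t ht; rewrite ler_norml => /andP[? ?]; lra.
rewrite ler_norml (ltr0_norm h0); apply/andP; split; lra.
Qed.

Lemma near_line (R : realType) (P : 'rV[R]_4 -> Prop) (x v : 'rV[R]_4) :
  (\forall y \near x, P y) -> exists2 del : R, 0 < del & forall h : R, `|h| < del -> P (h *: v + x).
Proof.
move=> hP.
have c : (fun h : R => h *: v + x) @ (0 : R) --> x.
  rewrite -[X in _ --> X](_ : 0 *: v + x = x); last by rewrite scale0r add0r.
  apply: cvgD; last exact: cvg_cst.
  by apply: cvgZl; exact: cvg_id.
have /nbhs_ballP[e /= e0 he] := c _ hP.
exists e => // h he'; apply: he; rewrite -ball_normE /= sub0r normrN.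
exact: he'.
Qed.

Lemma continuous_atP (R : realType) (f : 'rV[R]_4 -> R) (x : 'rV[R]_4) :
  {for x, continuous f} <->
  (forall e : R, 0 < e -> \forall y \near x, `|f x - f y| <= e).
Proof. exact: (@cvgrPdist_le _ _ _ (nbhs x) _ f (f x)). Qed.

(** Locally uniform limits of the derivatives are the derivatives of the limit. [J] is a set of
    radii of exhausting balls, which covers the unit ball and the whole space at once. *)
Lemma Ckloc_limit (R : realType) (k : nat) (D : set 'rV[R]_4) (J : set R)
    (v : nat -> 'rV[R]_4 -> R) :
  D = \bigcup_(r in J) eball r ->
  (forall K, compact K -> K `<=` D -> exists2 r, J r & K `<=` eball r) ->
  (forall r, J r -> \forall n \near \oo, Ck k (eball r) (v n)) ->
  (forall (r e : R), J r -> 0 < e -> exists N : nat, forall m n, (N <= m)%N -> (N <= n)%N ->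
     forall s x, (size s <= k)%N -> eball r x ->
     `|partials s (v m) x - partials s (v n) x| <= e) ->
  exists g, [/\ Ck k D g, Ckloc_cvg k D v g &
    forall (r e : R), J r -> 0 < e -> exists N : nat, forall n, (N <= n)%N ->
     forall s x, (size s <= k)%N -> eball r x ->
     `|partials s (v n) x - partials s g x| <= e].
Proof.
move=> DJ KJ hC hcau.
have oD : open D by rewrite DJ; apply: bigcup_open => r _; exact: open_eball.
pose F s x := lim ((fun n => partials s (v n) x) @ \oo).
have hcvg r s x : J r -> (size s <= k)%N -> eball r x ->
    partials s (v n) x @[n --> \oo] --> F s x.
  move=> Jr sk xr; apply/cauchy_cvgP/cauchy_ballP => e e0.
  have [N hN] := hcau r (e / 2) Jr (divr_gt0 e0 (ltr0Sn _ 1)).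
  pose Q := [set y | exists2 m : nat, (N <= m)%N & y = partials s (v m) x].
  exists (Q, Q) => [|[_ _] /= [[m Nm ->] [n Nn ->]]].
    by split; exists N => // n /= Nn; exists n.
  rewrite -ball_normE /=; apply: le_lt_trans (hN m n Nm Nn s x sk xr) _.
  by rewrite ltr_pdivrMr // ltr_pMr // ltr1n.
have hunif (r e : R) : J r -> 0 < e -> exists N : nat, forall n, (N <= n)%N ->
     forall s x, (size s <= k)%N -> eball r x -> `|partials s (v n) x - F s x| <= e.
  move=> Jr e0; have [N hN] := hcau r e Jr e0; exists N => n Nn s x sk xr.
  have c : `|partials s (v n) x - partials s (v m) x| @[m --> \oo] -->
      `|partials s (v n) x - F s x|.
    by apply: cvg_norm; apply: cvgB; [exact: cvg_cst|exact: hcvg sk xr].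
  apply: (cvgr_to_le c).
  by exists N => // m /= Nm; exact: hN.
have hFc s x : (size s <= k)%N -> D x -> {for x, continuous (F s)}.
  move=> sk; rewrite {1}DJ => -[r Jr xr]; apply/continuous_atP => e e0.
  have e3 : 0 < e / 3 by exact: divr_gt0.
  have [N hN] := hunif r (e / 3) Jr e3.
  have [n Nn hn] : exists2 n, (N <= n)%N & Ck k (eball r) (v n).
    have [N' _ hN'] := hC r Jr; exists (maxn N N'); first exact: leq_maxl.
    by apply: hN'; exact: leq_maxr.
  have /continuous_atP/(_ _ e3) cn := Ck_continuous hn sk xr.
  near=> y.
  have yr : eball r y by near: y; exact: open_nbhs_nbhs (conj (@open_eball R r) xr).
  have h1 := hN n Nn s x sk xr; have h2 := hN n Nn s y sk yr.
  have h3 : `|partials s (v n) x - partials s (v n) y| <= e / 3 by near: y.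
  move: h1 h2 h3; move: (partials s (v n) x) (partials s (v n) y) (F s x) (F s y).
  move=> A B C G; rewrite !ler_norml => /andP[? ?] /andP[? ?] /andP[? ?].
  by apply/andP; split; lra.
have [hE hCg] : (forall s x, (size s <= k)%N -> D x -> partials s (F [::]) x = F s x) /\
    Ck k D (F [::]).
  apply: Ck_family => // s i x sk; rewrite {1}DJ => -[r Jr xr].
  apply/is_derive_line; apply: is_derive_squeeze => e e0.
  have Dx : D x by rewrite DJ; exists r.
  have e2 : 0 < e / 4 by exact: divr_gt0.
  have /continuous_atP/(_ _ e2) cF := hFc (i :: s) x sk Dx.
  have ne : \forall y \near x, eball r y /\ `|F (i :: s) x - F (i :: s) y| <= e / 4.
    near=> y; split; last by near: y.
    by near: y; exact: open_nbhs_nbhs (conj (@open_eball R r) xr).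
  have [del del0 hdel] := near_line (e_ i) ne; exists del => // h hh.
  have [->|h0] := eqVneq h 0.
    by rewrite subrr mul0r subrr normr0 mulr0.
  have h00 : 0 < `|h| by rewrite normr_gt0.
  have e4 : 0 < e / 4 * `|h| by exact: mulr_gt0.
  (* The index [n] is chosen after [h]: replacing [F s] by [partials s (v n)] at the two ends of the
     segment then costs a small multiple of [|h|], while the mean value inequality for [v n] costs
     [e / 2 * |h|]. *)
  have [N1 hN1] := hunif r (e / 4) Jr e2; have [N2 hN2] := hunif r _ Jr e4.
  have [N3 _ hN3] := hC r Jr.
  pose n := maxn N1 (maxn N2 N3).
  have n1 : (N1 <= n)%N by exact: leq_maxl.
  have n2 : (N2 <= n)%N by rewrite /n maxnCA leq_maxl.
  have n3 : (N3 <= n)%N by rewrite /n maxnA leq_maxr.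
  have hn := hN3 _ n3.
  have tx (t : R) : `|t| <= `|h| -> eball r (t *: e_ i + x) by move=> /le_lt_trans/(_ hh)/hdel[].
  have MV : `|partials s (v n) (h *: e_ i + x) - partials s (v n) (0 *: e_ i + x) - h * F (i :: s) x|
      <= (e / 2) * `|h|.
    apply: (mean_value_le (f := fun t : R => partials s (v n) (t *: e_ i + x))
       (df := fun t => partials (i :: s) (v n) (t *: e_ i + x))) => t ht.
      have /is_derive_line hd := Ck_is_derive i hn sk (tx t ht).
      set q := fun y : R => _ in hd.
      have hd' : is_derive (t - t) 1 q (partials (i :: s) (v n) (t *: e_ i + x)) by rewrite subrr.
      have dl : is_derive t 1 (fun y => y - t) 1.
        by apply: is_derive_eq; rewrite /GRing.scale /= oppr0 addr0.
      rewrite [X in is_derive _ _ X _](_ : _ = q \o (fun y => y - t)).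
        apply: (is_derive_eq (@is_derive1_comp R q (fun y => y - t) t _ _ hd' dl)).
        by rewrite mulr1.
      by apply/funext => y; rewrite /q /= addrA -scalerDl subrK.
    have [_ h1] := hdel t (le_lt_trans ht hh).
    have h2 := hN1 n n1 (i :: s) _ sk (tx t ht).
    move: h1 h2; move: (partials (i :: s) (v n) _) (F _ _) (F _ _) => A B C.
    rewrite !ler_norml => /andP[? ?] /andP[? ?].
    by apply/andP; split; lra.
  have x1 := hN2 n n2 s _ (ltnW sk) (tx h (lexx _)).
  have x2 : `|partials s (v n) (0 *: e_ i + x) - F s (0 *: e_ i + x)| <= e / 4 * `|h|.
    by apply: hN2 => //; [exact: ltnW|rewrite scale0r add0r].
  move: MV x1 x2.
  move: (partials s (v n) (h *: e_ i + x)) (partials s (v n) (0 *: e_ i + x)) => A B.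
  move: (F (i :: s) x) (F s (h *: e_ i + x)) (F s (0 *: e_ i + x)) => C G H.
  rewrite !ler_norml => /andP[? ?] /andP[? ?] /andP[? ?].
  by apply/andP; split; lra.
exists (F [::]); split => //.
  apply/Ckloc_cvgP => s K e sk cK KD e0.
  have [r Jr Kr] := KJ K cK KD.
  have e2 : 0 < e / 2 by exact: divr_gt0.
  have [N hN] := hunif r (e / 2) Jr e2.
  exists N => // n /= Nn x Kx; have Dx := KD x Kx.
  rewrite hE // distrC; apply: le_lt_trans (hN n Nn s x sk (Kr x Kx)) _.
  by rewrite ltr_pdivrMr // ltr_pMr // ltr1n.
move=> r e Jr e0; have [N hN] := hunif r e Jr e0.
exists N => n Nn s x sk xr; rewrite hE //; first exact: hN.
by rewrite DJ; exists r.
Unshelve. all: by end_near.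
Qed.

(** * Volume of the four-dimensional ball *)

Lemma is_derive_compf (R : realType) (f g : R -> R) (x a b : R) :
  is_derive (g x) 1 f a -> is_derive x 1 g b -> is_derive x 1 (fun t => f (g t)) (a * b).
Proof. exact: is_derive1_comp. Qed.

Definition chord (R : realType) (rho t : R) : R := Num.sqrt (rho ^+ 2 - t ^+ 2).

(* Primitive of [2 * chord rho]; the half-angle form of [asin (t / rho)] is
   continuous up to the endpoints. *)
Definition half_disk (R : realType) (rho t : R) : R :=
  t * chord rho t + rho ^+ 2 * (2 * atan (t / (rho + chord rho t))).

Section chord.
Context {R : realType}.
Variable rho : R.
Hypothesis rho0 : 0 < rho.
Local Notation q := (chord rho).
Local Notation ha := (half_disk rho).

Lemma chord_ge0 (t : R) : 0 <= q t. Proof. exact: sqrtr_ge0. Qed.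

Lemma rho_chord_neq0 (t : R) : rho + q t != 0.
Proof. by rewrite gt_eqF // ltr_wpDr // chord_ge0. Qed.

Lemma continuous_chord : continuous q.
Proof.
move=> t; apply: (@continuous_comp _ _ _ (fun t : R => rho ^+ 2 - t ^+ 2) (@Num.sqrt R)); last exact: sqrt_continuous.
by apply: continuousB; [exact: cst_continuous|exact: exprn_continuous].
Qed.

Lemma chord_end : (q rho = 0) * (q (- rho) = 0).
Proof. by rewrite /chord sqrrN subrr sqrtr0. Qed.

Lemma chord_pos (t : R) : t \in `]- rho, rho[ -> 0 < q t.
Proof.
rewrite in_itv /= => /andP[t1 t2]; rewrite sqrtr_gt0.
have -> : rho ^+ 2 - t ^+ 2 = (rho - t) * (rho + t) by ring.
by rewrite mulr_gt0 //; lra.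
Qed.

Lemma chord_sqr (t : R) : t \in `]- rho, rho[ -> q t ^+ 2 = rho ^+ 2 - t ^+ 2.
Proof. by move=> /chord_pos; rewrite sqrtr_gt0 => /ltW; exact: sqr_sqrtr. Qed.

Lemma is_derive_chord (t : R) : t \in `]- rho, rho[ -> is_derive t 1 q (- t / q t).
Proof.
move=> ht; have q0 := chord_pos ht.
have h1 : is_derive t 1 (fun t => rho ^+ 2 - t ^+ 2) (- (2 * t)).
  by apply: is_derive_eq; rewrite /GRing.scale /=; ring.
have h2 : 0 < rho ^+ 2 - t ^+ 2 by rewrite -sqrtr_gt0.
apply: (is_derive_eq (@is_derive_compf R (@Num.sqrt R) (fun t => rho ^+ 2 - t ^+ 2) t _ _ (is_derive1_sqrt h2) h1)).
by rewrite -/(chord rho t); field; exact: lt0r_neq0.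
Qed.

Lemma continuous_half_disk : continuous ha.
Proof.
move=> t.
have c1 : {for t, continuous (fun t : R => t * q t)}.
  by apply: continuousM; [exact: cvg_id|exact: continuous_chord].
have c2 : {for t, continuous (fun t : R => (rho + q t)^-1)}.
  apply: continuousV; first exact: rho_chord_neq0.
  by apply: continuousD; [exact: cst_continuous|exact: continuous_chord].
have c3 : {for t, continuous (fun t : R => t / (rho + q t))}.
  by apply: continuousM; [exact: cvg_id|exact: c2].
have c4 : {for t, continuous (fun t : R => atan (t / (rho + q t)))}.
  by apply: continuous_comp; [exact: c3|exact: continuous_atan].
have c5 : {for t, continuous (fun t : R => rho ^+ 2 * (2 * atan (t / (rho + q t))))}.
  by apply: continuousM; [exact: cst_continuous|apply: continuousM; [exact: cst_continuous|exact: c4]].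
exact: continuousD c1 c5.
Qed.

Lemma is_derive_half_disk (t : R) : t \in `]- rho, rho[ -> is_derive t 1 ha (2 * q t).
Proof.
move=> ht; have q0 := chord_pos ht; have dq := is_derive_chord ht; have q2 := chord_sqr ht.
have qn : q t != 0 by rewrite gt_eqF.
have d1 : is_derive t 1 (fun t => rho + q t) (- t / q t).
  by apply: (is_derive_eq (is_derive_add (is_derive_cst rho t 1) dq)); rewrite add0r.
have d2 : is_derive t 1 (fun t => (rho + q t)^-1) (t / q t / (rho + q t) ^+ 2).
  apply: (is_derive_eq (@is_deriveV R (fun t => rho + q t) t _ 1 (rho_chord_neq0 t) d1)).
  by rewrite /GRing.scale /=; field; rewrite rho_chord_neq0 qn.
have d3 : is_derive t 1 (fun t => t / (rho + q t)) (rho / (q t * (rho + q t))).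
  have id1 : is_derive t 1 (fun t : R => t) 1 by exact: is_derive_id.
  apply: (is_derive_eq (is_derive_mul id1 d2)).
  have -> : t * (t / q t / (rho + q t) ^+ 2) = t ^+ 2 / (q t * (rho + q t) ^+ 2).
    by field; rewrite rho_chord_neq0 qn.
  have -> : t ^+ 2 = rho ^+ 2 - q t ^+ 2 by rewrite q2; ring.
  by field; rewrite rho_chord_neq0 qn.
have d4 := @is_derive_compf R (@atan R) (fun t => t / (rho + q t)) t _ _ (is_derive1_atan _) d3.
have d5 : is_derive t 1 (fun t => 2 * atan (t / (rho + q t))) (q t)^-1.
  apply: (is_derive_eq (is_derive_mul (is_derive_cst (2 : R) t 1) d4)).
  rewrite mulr0 addr0 /=.
  have -> : 1 + (t / (rho + q t)) ^+ 2 = 2 * rho / (rho + q t).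
    rewrite exprMn exprVn.
    have -> : t ^+ 2 = rho ^+ 2 - q t ^+ 2 by rewrite q2; ring.
    by field; exact: rho_chord_neq0.
  by field; rewrite rho_chord_neq0 qn lt0r_neq0.
have id1 : is_derive t 1 (fun t : R => t) 1 by exact: is_derive_id.
have := is_derive_add (is_derive_mul id1 dq) (is_derive_mul (is_derive_cst (rho ^+ 2) t 1) d5).
move=> H; apply: (is_derive_eq H).
have -> : rho ^+ 2 = q t ^+ 2 + t ^+ 2 by rewrite q2; ring.
by rewrite /cst /=; move: (atan _) => z; field.
Qed.

(** [Num.sqrt] is [0] on negative numbers and [n > 0], so the integrand vanishes off the segment and
    the integral over the line is given by a primitive on it. *)
Lemma chord_integral (c : R) (n : nat) (F : R -> R) : (0 < n)%N ->
  continuous F -> (forall t, t \in `]- rho, rho[ -> is_derive t 1 F (c * q t ^+ n)) ->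
  (\int[lebesgue_measure]_t (c * q t ^+ n)%:E = (F rho - F (- rho))%:E)%E.
Proof.
move=> n0 cF dF; rewrite EFinB.
have rr : - rho < rho by rewrite gtrN.
rewrite -(continuous_FTC2 rr (f := fun t => c * q t ^+ n)).
- rewrite [RHS]integral_mkcond; apply: eq_integral => t _.
  rewrite patchE; case: ifPn => // /negP nt.
  suff -> : q t = 0 by rewrite expr0n /= eqn0Ngt n0 mulr0.
  apply/eqP; rewrite sqrtr_eq0 leNgt; apply/negP => h; apply: nt.
  rewrite inE /= in_itv /= -ler_norml -(ler_pXn2r (ltn0Sn 1)) ?nnegrE ?(ltW rho0) //.
  by rewrite real_normK ?num_real //; lra.
- apply: continuous_subspaceT => t.
  have c1 : {for t, continuous (fun t : R => q t ^+ n)}.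
    apply: (@continuous_comp _ _ _ q (fun x : R => x ^+ n)); first exact: continuous_chord.
    exact: exprn_continuous.
  have c2 : {for t, continuous (fun _ : R => c)} by exact: cst_continuous.
  exact: continuousM c2 c1.
- split.
  + by move=> t ht; have := dF t ht => hd; exact: ex_derive.
  + by apply: cvg_at_right_filter; exact: cF.
  + by apply: cvg_at_left_filter; exact: cF.
- by move=> t ht; rewrite derive1E; have := dF t ht => hd; exact: derive_val.
Qed.

End chord.

Lemma half_disk_ends (R : realType) (rho : R) : 0 < rho ->
  half_disk rho rho = rho ^+ 2 * pi / 2 /\ half_disk rho (- rho) = - (rho ^+ 2 * pi / 2).
Proof.
move=> rho0; have [q1 q2] := chord_end rho.
by rewrite /half_disk q1 q2 !mulr0 !add0r !addr0 mulNr divff ?lt0r_neq0 // atanN atan1;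
  split; field.
Qed.

(** Each integrand is the volume of a slice one dimension lower, from dimension two to four. The
    parameter is a squared radius [s], so that empty slices, where [s - t ^ 2 <= 0], are covered by
    the same formula. *)
Lemma chord_integrals (R : realType) (s : R) :
  [/\ (\int[lebesgue_measure]_t (2 * Num.sqrt (s - t ^+ 2))%:E = (pi * Num.sqrt s ^+ 2)%:E)%E,
     (\int[lebesgue_measure]_t (pi * Num.sqrt (s - t ^+ 2) ^+ 2)%:E =
       (4 * pi / 3 * Num.sqrt s ^+ 3)%:E)%E &
     (\int[lebesgue_measure]_t (4 * pi / 3 * Num.sqrt (s - t ^+ 2) ^+ 3)%:E =
       (pi ^+ 2 / 2 * Num.sqrt s ^+ 4)%:E)%E].
Proof.
have [s0|s0] := leP s 0.
  have q0 (t : R) : Num.sqrt (s - t ^+ 2) = 0.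
    by apply/eqP; rewrite sqrtr_eq0; have := sqr_ge0 t; lra.
  have -> : Num.sqrt s = 0 by apply/eqP; rewrite sqrtr_eq0.
  by split; under eq_integral do rewrite q0 ?expr0n /= mulr0; rewrite integral0 expr0n /= mulr0.
set rho := Num.sqrt s; have rho0 : 0 < rho by rewrite sqrtr_gt0.
have -> : s = rho ^+ 2 by rewrite sqr_sqrtr // ltW.
have [e1 e2] := half_disk_ends rho0.
have dpoly (t : R) : is_derive t 1 (fun t => pi * (rho ^+ 2 * t - t ^+ 3 / 3)) (pi * (rho ^+ 2 - t ^+ 2)).
  by apply: is_derive_eq; rewrite /GRing.scale /=; field.
split.
- have := @chord_integral R rho rho0 2 1 (half_disk rho) isT (continuous_half_disk rho0).
  rewrite e1 e2 => H; rewrite (_ : pi * rho ^+ 2 = rho ^+ 2 * pi / 2 - - (rho ^+ 2 * pi / 2)); last by field.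
  by apply: H => t ht; rewrite expr1; exact: is_derive_half_disk.
- have cF : continuous (fun t : R => pi * (rho ^+ 2 * t - t ^+ 3 / 3)).
    by move=> t; exact: is_derive_cvg (dpoly t).
  have := @chord_integral R rho rho0 pi 2 _ isT cF.
  rewrite (_ : _ - _ = 4 * pi / 3 * rho ^+ 3); last by field.
  apply => t ht; apply: (is_derive_eq (dpoly t)).
  by rewrite (chord_sqr ht).
(* Integration by parts reduces the cube of the chord to the chord: the derivative of the second
   factor is [q ^ 3 / 4 + 3 / 4 * (rho ^ 2 - t ^ 2) * q = q ^ 3], with [q = chord rho t]. *)
- pose F (t : R) := 4 * pi / 3 * (t * chord rho t ^+ 3 / 4 + 3 * rho ^+ 2 / 8 * half_disk rho t).
  have cF : continuous F.
    move=> t.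
    have c1 : {for t, continuous (fun t : R => chord rho t ^+ 3)}.
      apply: (@continuous_comp _ _ _ (chord rho) (fun x : R => x ^+ 3)); first exact: continuous_chord.
      exact: exprn_continuous.
    have c2 : {for t, continuous (fun t : R => t * chord rho t ^+ 3)}.
      by apply: continuousM; [exact: cvg_id|exact: c1].
    have c3 : {for t, continuous (fun t : R => t * chord rho t ^+ 3 / 4)}.
      by apply: continuousM; [exact: c2|exact: cst_continuous].
    have c4 : {for t, continuous (fun t : R => 3 * rho ^+ 2 / 8 * half_disk rho t)}.
      by apply: continuousM; [exact: cst_continuous|exact: continuous_half_disk].
    have c5 := continuousD c3 c4.
    have c6 : {for t, continuous (fun _ : R => 4 * pi / 3 : R)} by exact: cst_continuous.
    exact: continuousM c6 c5.
  have := @chord_integral R rho rho0 (4 * pi / 3) 3 F isT cF.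
  rewrite (_ : _ - _ = pi ^+ 2 / 2 * rho ^+ 4); last first.
    by rewrite /F e1 e2; have [-> ->] := chord_end rho; rewrite expr0n /= !mulr0 !mul0r !add0r; field.
  apply => t ht; have dq := is_derive_chord ht; have q2 := chord_sqr ht.
  have qn : chord rho t != 0 by rewrite gt_eqF // chord_pos.
  have id1 : is_derive t 1 (fun t : R => t) 1 by exact: is_derive_id.
  have d1 := is_derive_mulX 3 id1 dq.
  have d2 := is_derive_add (is_derive_mul (is_derive_cst (4^-1 : R) t 1) d1)
     (is_derive_mul (is_derive_cst (3 * rho ^+ 2 / 8) t 1) (is_derive_half_disk rho0 ht)).
  have d3 := is_derive_mul (is_derive_cst (4 * pi / 3) t 1) d2.
  rewrite [X in is_derive _ _ X _](_ : _ = fun t => 4 * pi / 3 * (4^-1 * (t * chord rho t ^+ 3) + 3 * rho ^+ 2 / 8 * half_disk rho t)).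
    apply: (is_derive_eq d3); rewrite /cst /= !mulr0 !addr0.
    have -> : rho ^+ 2 = chord rho t ^+ 2 + t ^+ 2 by rewrite q2; ring.
    by field.
  by apply/funext => y; rewrite /F; ring.
Qed.

Lemma lebesgue_measure_sqr_lt (R : realType) (s : R) :
  @lebesgue_measure R [set t | t ^+ 2 < s] = (2 * Num.sqrt s)%:E.
Proof.
have [s0|s0] := leP s 0.
  have -> : Num.sqrt s = 0 by apply/eqP; rewrite sqrtr_eq0.
  rewrite mulr0 (_ : [set t | _] = set0) ?measure0 //.
  by apply/seteqP; split => // t /=; have := sqr_ge0 t; lra.
rewrite (_ : [set t | _] = [set` `](- Num.sqrt s), (Num.sqrt s)[ ]).
  have h : - Num.sqrt s < Num.sqrt s by rewrite gtrN // sqrtr_gt0.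
  by rewrite lebesgue_measure_itv /= lte_fin h -EFinB; congr EFin; ring.
apply/seteqP; split => t /=; rewrite in_itv /= -ltr_norml.
  by move=> ts; rewrite -sqrtr_sqr ltr_sqrt.
by rewrite -sqrtr_sqr ltr_sqrt.
Qed.

Section ball_volume.
Context {R : realType}.
Local Notation T := (measurableTypeR R).
Local Notation mu := (@lebesgue_measure R).

(* The library has no canonical sigma-finite structure on products of
   sigma-finite measures. *)
Definition lebesgue2 : {sigma_finite_measure set (T * T)%type -> \bar R} :=
  HB.pack_for (SigmaFiniteMeasure.type (T * T)%type R) (product_measure1 mu mu)
   (lebesgue_integral_fubini.measure_function_Measure_isSigmaFinite__to__measure_function_isSFinite mu mu)
   (lebesgue_integral_fubini.measure_function_Measure_isSigmaFinite__to__measure_function_isSigmaFinite mu mu).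

Definition lebesgue3 : {sigma_finite_measure set (T * T * T)%type -> \bar R} :=
  HB.pack_for (SigmaFiniteMeasure.type (T * T * T)%type R) (product_measure1 lebesgue2 mu)
   (lebesgue_integral_fubini.measure_function_Measure_isSigmaFinite__to__measure_function_isSFinite lebesgue2 mu)
   (lebesgue_integral_fubini.measure_function_Measure_isSigmaFinite__to__measure_function_isSigmaFinite lebesgue2 mu).

Let S2 (s : R) : set (T * T) := [set p | p.1 ^+ 2 + p.2 ^+ 2 < s].
Let S3 (s : R) : set (T * T * T) := [set p | p.1.1 ^+ 2 + p.1.2 ^+ 2 + p.2 ^+ 2 < s].
Let S4 (s : R) : set (T * T * T * T) :=
  [set p | p.1.1.1 ^+ 2 + p.1.1.2 ^+ 2 + p.1.2 ^+ 2 + p.2 ^+ 2 < s].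

Let measurable_lt d (X : measurableType d) (f : X -> T) (s : R) :
  measurable_fun setT f -> measurable [set x | f x < s].
Proof.
move=> mf; rewrite [X in measurable X](_ : _ = setT `&` f @^-1` [set` `]-oo, s[ ]).
  by apply: mf => //; exact: measurable_itv.
by apply/seteqP; split => x /=; rewrite in_itv //= => -[].
Qed.

Let mS2 s : measurable (S2 s).
Proof.
apply: measurable_lt; apply: measurable_funD; apply: measurable_funX.
  exact: measurable_fst.
exact: measurable_snd.
Qed.

Let mS3 s : measurable (S3 s).
Proof.
apply: measurable_lt; apply: measurable_funD; last by apply: measurable_funX; exact: measurable_snd.
apply: measurable_funD; apply: measurable_funX.
  by apply: measurableT_comp; exact: measurable_fst.
by apply: measurableT_comp; [exact: measurable_snd|exact: measurable_fst].
Qed.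

Let mS4 s : measurable (S4 s).
Proof.
apply: measurable_lt; apply: measurable_funD; last by apply: measurable_funX; exact: measurable_snd.
apply: measurable_funD; last first.
  by apply: measurable_funX; apply: measurableT_comp; [exact: measurable_snd|exact: measurable_fst].
apply: measurable_funD; apply: measurable_funX.
  apply: (@measurableT_comp _ _ _ _ _ _ (fun p : T * T => p.1) _ (fun p : T * T * T * T => p.1.1)).
    exact: measurable_fst.
  by apply: measurableT_comp; exact: measurable_fst.
apply: (@measurableT_comp _ _ _ _ _ _ (fun p : T * T => p.2) _ (fun p : T * T * T * T => p.1.1)).
  exact: measurable_snd.
by apply: measurableT_comp; exact: measurable_fst.
Qed.

(** Slices by the last coordinate: the product measure integrates sections over the first factor,
    and uniqueness of product measures gives the other order. *)
Let prod21 d1 d2 (X : measurableType d1) (Y : measurableType d2)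
    (m1 : {sigma_finite_measure set X -> \bar R}) (m2 : {sigma_finite_measure set Y -> \bar R}) A :
  measurable A -> ((m1 \x m2) A = \int[m2]_y m1 (ysection A y))%E.
Proof.
move=> mA; rewrite (@product_measure_unique _ _ _ _ _ m1 m2 (m1 \x^ m2)%E) // => B C mB mC.
exact: product_measure2E.
Qed.

Let vol2 s : (mu \x mu)%E (S2 s) = (pi * Num.sqrt s ^+ 2)%:E.
Proof.
have [<- _ _] := chord_integrals s; rewrite prod21 //.
apply: eq_integral => y _; rewrite -lebesgue_measure_sqr_lt; congr (mu _).
apply/seteqP; split => x; rewrite /ysection /S2 /= inE /= => ?; lra.
Qed.

Let vol3 s : (mu \x mu \x mu)%E (S3 s) = (4 * pi / 3 * Num.sqrt s ^+ 3)%:E.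
Proof.
have [_ <- _] := chord_integrals s.
apply: (eq_trans (@prod21 _ _ _ _ lebesgue2 mu _ (mS3 s))).
apply: eq_integral => y _; rewrite -vol2; congr (product_measure1 mu mu _).
apply/seteqP; split => x; rewrite /ysection /S3 /S2 /= inE /= => ?; lra.
Qed.

Let vol4 s : (mu \x mu \x mu \x mu)%E (S4 s) = (pi ^+ 2 / 2 * Num.sqrt s ^+ 4)%:E.
Proof.
have [_ _ <-] := chord_integrals s.
apply: (eq_trans (@prod21 _ _ _ _ lebesgue3 mu _ (mS4 s))).
apply: eq_integral => y _; rewrite -vol3; congr (product_measure1 (product_measure1 mu mu) mu _).
apply/seteqP; split => x; rewrite /ysection /S4 /S3 /= inE /= => ?; lra.
Qed.

Lemma lebesgue4_eball (r : R) : 0 <= r -> lebesgue4 (eball r) = (pi ^+ 2 / 2 * r ^+ 4)%:E.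
Proof.
move=> r0; rewrite /lebesgue4 /pushforward (_ : _ @^-1` _ = S4 (r ^+ 2)).
  by rewrite vol4 sqrtr_sqr ger0_norm.
have e p : enorm (row4 p) < r = (p.1.1.1 ^+ 2 + p.1.1.2 ^+ 2 + p.1.2 ^+ 2 + p.2 ^+ 2 < r ^+ 2) :> Prop.
  by rewrite -(ltr_pXn2r (ltn0Sn 1)) ?nnegrE ?enorm_ge0 // enorm_sqr !big_ord_recr big_ord0 /= !mxE add0r.
by apply/seteqP; split => p; rewrite /S4 /eball /= e.
Qed.

End ball_volume.

(** * Integrals of radial functions over balls *)

Lemma measurable_coord (R : realType) (i : 'I_4) :
  measurable_fun [set: 'rV[R]_4] (@rV_coord R 4 i).
Proof.
move=> _ B mB; rewrite setTI; apply: sub_sigma_algebra.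
rewrite -bigcup_mkord_ord; exists i => //=; exists B => //.
by rewrite setTI inord_val.
Qed.

(** The sigma-algebra is generated by the coordinates; an open set is the countable union of the
    rational boxes that it contains, enumerated by [unpickle]. *)
Lemma measurable_open (R : realType) (A : set 'rV[R]_4) : open A -> measurable A.
Proof.
move=> oA.
pose box (b : {ffun 'I_4 -> rat * rat}) : set 'rV[R]_4 :=
  \bigcap_(i in [set: 'I_4]) (rV_coord i @^-1` [set` `]ratr (b i).1, ratr (b i).2[ ]).
have mbox b : measurable (box b).
  rewrite /box; apply: fin_bigcap_measurable => [|i _]; first exact: finite_finset.
  by rewrite -[X in measurable X]setTI; apply: measurable_coord => //; exact: measurable_itv.
pose F (n : nat) : set 'rV[R]_4 :=
  if unpickle n is Some b then if `[< box b `<=` A >] then box b else set0 else set0.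
rewrite (_ : A = \bigcup_n F n).
  apply: bigcupT_measurable => n; rewrite /F; case: unpickle => [b|//].
  by case: ifP.
apply/seteqP; split => [x Ax|x [n _]]; last first.
  by rewrite /F; case: unpickle => [b|//]; case: asboolP => // bA /bA.
have /nbhs_ballP[e /= e0 he] := open_nbhs_nbhs (conj oA Ax).
have lo (i : 'I_4) : exists q : rat, ratr q \in `]x 0 i - e, x 0 i[.
  by apply: rat_in_itvoo; rewrite ltrBlDr ltrDl.
have hi (i : 'I_4) : exists q : rat, ratr q \in `]x 0 i, x 0 i + e[.
  by apply: rat_in_itvoo; rewrite ltrDl.
have [l hl] := choice lo; have [h hh] := choice hi.
pose b := [ffun i => (l i, h i)].
have bA : box b `<=` A.
  move=> y yb; apply: he; rewrite -ball_normE /= [X in X < _]/Num.norm /= mx_normrE.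
  apply/bigmax_ltP; split => // -[i j] _ /=; rewrite (ord1 i) !mxE.
  have := yb j I; rewrite /rV_coord /= ffunE /= in_itv /= => /andP[y1 y2].
  have := hl j; have := hh j; rewrite !in_itv /= => /andP[? ?] /andP[? ?].
  by rewrite ltr_norml; apply/andP; split; lra.
exists (pickle b) => //; rewrite /F pickleK; case: asboolP => // _ i _.
have := hl i; have := hh i; rewrite /rV_coord /= ffunE /= !in_itv /= => /andP[-> _] /andP[_ ->].
by [].
Qed.

Lemma measurable_eball (R : realType) (r : R) : measurable (@eball R r).
Proof. by apply: measurable_open; exact: open_eball. Qed.

Lemma continuous_on_measurable (R : realType) (D : set 'rV[R]_4) (f : 'rV[R]_4 -> R) :
  open D -> (forall x, D x -> {for x, continuous f}) -> measurable_fun D f.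
Proof.
move=> oD cf; apply: (measurability (@RGenOInfty.G R)); first exact: RGenOInfty.measurableE.
move=> _ [_ [a ->] <-]; apply: measurable_open.
rewrite openE => x [Dx]; rewrite /= in_itv /= andbT => fx.
have /(cvgr_gt (f x)) := cf x Dx; move=> /(_ _ fx) hx.
near=> y; split; first by near: y; exact: open_nbhs_nbhs.
by rewrite /= in_itv /= andbT; near: y.
Unshelve. all: by end_near.
Qed.

Lemma subset_eball (R : realType) (s t : R) : s <= t -> eball s `<=` @eball R t.
Proof. by move=> st x; rewrite /eball /= => /lt_le_trans; apply. Qed.

Lemma is_derive_shift (R : realType) (f : R -> R) (r d : R) :
  is_derive (0 : R) 1 (fun h => f (h + r)) d -> is_derive r 1 f d.
Proof.
move=> hf.
have h' : is_derive (r - r) 1 (fun h => f (h + r)) d by rewrite subrr.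
have dl : is_derive r 1 (fun t => t - r) 1.
  by apply: is_derive_eq; rewrite /GRing.scale /= oppr0 addr0.
rewrite [X in is_derive _ _ X _](_ : _ = (fun h => f (h + r)) \o (fun t => t - r)).
  by apply: (is_derive_eq (@is_derive1_comp R _ (fun t => t - r) r _ _ h' dl)); rewrite mulr1.
by apply/funext => t /=; rewrite subrK.
Qed.

Section radial_integral.
Context {R : realType}.
Variables (rho : R) (f : 'rV[R]_4 -> R).
Hypotheses (rho0 : 0 < rho) (fr : radial_on (eball rho) f)
  (fc : forall x, eball rho x -> {for x, continuous f})
  (f0 : forall x, eball rho x -> 0 <= f x).

Let p (t : R) := f (t *: e_ 0).
Let Q (t : R) : R := pi ^+ 2 / 2 * t ^+ 4.
Let G (t : R) : R := fine (\int[lebesgue4]_(x in eball t) (f x)%:E)%E.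

Lemma continuous_profile (t : R) : 0 <= t < rho -> {for t, continuous p}.
Proof.
move=> /andP[t0 tr].
apply: (@continuous_comp _ _ _ (fun t : R => t *: (e_ 0 : 'rV[R]_4)) f).
  by apply: cvgZl; exact: cvg_id.
by apply: fc; rewrite /eball /= enorm_ray.
Qed.

Let pE x : eball rho x -> f x = p (enorm x).
Proof. exact: radialE. Qed.

Let mf t : t <= rho -> measurable_fun (eball t) (fun x => (f x)%:E).
Proof.
move=> tr; apply/measurable_EFinP; apply: continuous_on_measurable; first exact: open_eball.
by move=> x xt; apply: fc; exact: subset_eball xt.
Qed.

Let shell (s t : R) : 0 <= s <= t ->
  measurable (eball t `\` @eball R s) /\
  lebesgue4 (eball t `\` @eball R s) = (Q t - Q s)%:E.
Proof.
move=> /andP[s0 st].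
have mD : measurable (eball t `\` @eball R s).
  by apply: measurableD; exact: measurable_eball.
split => //.
have := @measureU _ _ _ (@lebesgue4 R) (eball s) (eball t `\` eball s) (measurable_eball s) mD.
rewrite setDUK; last exact: subset_eball.
have -> : eball s `&` (eball t `\` @eball R s) = set0 by rewrite setDE setICA setICr setI0.
move=> /(_ erefl) H.
have {}H : (lebesgue4 (eball t) = lebesgue4 (eball s) + lebesgue4 (eball t `\` @eball R s))%E := H.
rewrite lebesgue4_eball ?(le_trans s0 st) // lebesgue4_eball // -/(Q s) -/(Q t) in H.
by rewrite EFinB H addeAC subee // add0e.
Qed.

Let int_split (s t : R) : 0 <= s <= t -> t <= rho ->
  (\int[lebesgue4]_(x in eball t) (f x)%:E =
   \int[lebesgue4]_(x in eball s) (f x)%:E +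
   \int[lebesgue4]_(x in eball t `\` eball s) (f x)%:E)%E.
Proof.
move=> hst tr; have [mD _] := shell hst; have /andP[s0 st] := hst.
rewrite -ge0_integral_setU //.
- by rewrite setDUK //; exact: subset_eball.
- exact: measurable_eball.
- by rewrite setDUK //; [exact: mf|exact: subset_eball].
- move=> x; rewrite setDUK; last exact: subset_eball.
  by move=> xt; rewrite lee_fin; apply: f0; exact: subset_eball xt.
- by apply/eqP; rewrite setDE setICA setICr setI0.
Qed.

Let int_bounds (s t m M : R) : 0 <= s <= t -> t < rho ->
  (forall y : R, s <= y <= t -> m <= p y <= M) -> 0 <= m ->
  ((m * (Q t - Q s))%:E <= \int[lebesgue4]_(x in eball t `\` eball s) (f x)%:E <=
   (M * (Q t - Q s))%:E)%E.
Proof.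
move=> hst tr hp m0; have [mD vD] := shell hst; have /andP[s0 st] := hst.
have mfD : measurable_fun (eball t `\` eball s) (fun x => (f x)%:E).
  by apply: (@measurable_funS _ _ _ _ (eball t)); [exact: measurable_eball|exact: subDsetl|exact: mf (ltW tr)].
have hx x : (eball t `\` eball s) x -> m <= f x <= M /\ 0 <= f x.
  move=> [xt]; rewrite /eball /= => /negP; rewrite -leNgt => sx.
  have xr : eball rho x by exact: (subset_eball (ltW tr)) xt.
  by split; [rewrite pE //; apply: hp; rewrite sx ltW|exact: f0].
have M0 : 0 <= M.
  have tt : s <= t <= t by rewrite st lexx.
  by have /andP[a b] := hp t tt; exact: le_trans (le_trans m0 a) b.
rewrite !EFinM -!vD -!integral_cst //; apply/andP; split.
- by apply: ge0_le_integral => // x /hx[/andP[? ?] ?]; rewrite lee_fin.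
- by apply: ge0_le_integral => // x /hx[/andP[? ?] ?]; rewrite lee_fin.
Qed.

(** Polar coordinates without a change of variables. On a shell where the profile lies between [m]
    and [M], the increments of the integral [G] and of [2 * pi ^ 2 * P] both lie between [m] and [M]
    times the volume of the shell; since the profile is continuous, their difference has zero
    derivative. *)
Lemma radial_integral (P : R -> R) :
  (forall r : R, 0 < r < rho -> is_derive r 1 P (r ^+ 3 * p r)) ->
  P x @[x --> 0^'+] --> P 0 -> P 0 = 0 ->
  forall r : R, 0 <= r < rho ->
  (\int[lebesgue4]_(x in eball r) (f x)%:E = (2 * pi ^+ 2 * P r)%:E)%E.
Proof.
move=> dP cP P0 r /andP[r0 rrho].
have b0' : exists b, r < b /\ b < rho by exists ((r + rho) / 2); lra.
have [b [rb brho]] := b0'.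
have b0 : 0 < b by lra.
have cp : {within `[0, b], continuous p}.
  apply: continuous_in_subspaceT => t; rewrite inE /= in_itv /= => /andP[t0 tb].
  by apply: continuous_profile; rewrite t0 /=; lra.
(* The bound [K] on a closed interval that ends beyond [r] but before [rho] makes every integral
   below finite, whatever [f] does near radius [rho]. *)
have [c _ hc] := EVT_max (ltW b0) cp.
set K := p c in hc.
have p0 (t : R) : 0 <= t <= b -> 0 <= p t.
  by move=> /andP[t0 tb]; apply: f0; rewrite /eball /= enorm_ray //; lra.
have pK (t : R) : 0 <= t <= b -> p t <= K by move=> ht; apply: hc; rewrite in_itv.
have K0 : 0 <= K by have h0 : 0 <= (0 : R) <= b by [rewrite lexx ltW]; exact: le_trans (p0 _ h0) (pK _ h0).
have e0 : @eball R 0 = set0.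
  by apply/seteqP; split => // x; rewrite /eball /= ltNge enorm_ge0.
have I0 : (\int[lebesgue4]_(x in eball 0%R) (f x)%:E = 0)%E by rewrite e0 integral_set0.
have Q0 : Q 0 = 0 by rewrite /Q expr0n /= mulr0.
have Qhom (s t : R) : 0 <= s <= t -> 0 <= Q t - Q s.
  move=> /andP[s0 st]; rewrite subr_ge0 /Q ler_wpM2l ?divr_ge0 ?sqr_ge0 //.
  by rewrite lerXn2r // nnegrE // (le_trans s0).
have GE (t : R) : 0 <= t <= b -> ((G t)%:E = \int[lebesgue4]_(x in eball t) (f x)%:E)%E.
  move=> /andP[t0 tb]; rewrite /G fineK //.
  have h0t : 0 <= (0 : R) <= t by rewrite lexx.
  have trho : t < rho by lra.
  rewrite (int_split h0t (ltW trho)) I0 add0e.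
  have hb (y : R) : 0 <= y <= t -> 0 <= p y <= K.
    by move=> /andP[y0 yt]; rewrite p0 ?pK // y0 /=; lra.
  have /andP[B1 B2] := int_bounds h0t trho hb (lexx _).
  rewrite ge0_fin_numE; first by apply: le_lt_trans B2 _; rewrite ltry.
  by apply: le_trans B1; rewrite mul0r.
have GB (s t m M : R) : 0 <= s <= t -> t <= b -> (forall y : R, s <= y <= t -> m <= p y <= M) ->
    0 <= m -> m * (Q t - Q s) <= G t - G s <= M * (Q t - Q s).
  move=> hst tb hp m0; have /andP[s0 st] := hst.
  have trho : t < rho by lra.
  have := int_bounds hst trho hp m0; have := int_split hst (ltW trho).
  have ht : 0 <= t <= b by lra.
  have hs : 0 <= s <= b by lra.
  rewrite -(GE t ht) -(GE s hs).
  case: (\int[lebesgue4]_(x in _ `\` _) _)%E => [z| |] //=.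
  by rewrite -EFinD => -[->]; rewrite !lee_fin addrAC subrr add0r.
have dQ (t : R) : is_derive t 1 Q (2 * pi ^+ 2 * t ^+ 3).
  by apply: is_derive_eq; rewrite /GRing.scale /=; field.
have dP2 (t : R) : 0 < t < rho -> is_derive t 1 (fun t => 2 * pi ^+ 2 * P t) (2 * pi ^+ 2 * (t ^+ 3 * p t)).
  by move=> ht; have h1 := dP _ ht; apply: is_derive_eq; rewrite /GRing.scale.
have PB (s t m M : R) : 0 < s <= t -> t <= b -> (forall y : R, s <= y <= t -> m <= p y <= M) ->
    m * (Q t - Q s) <= 2 * pi ^+ 2 * P t - 2 * pi ^+ 2 * P s <= M * (Q t - Q s).
  move=> /andP[s0 st] tb hp.
  have dmQ (k y : R) : is_derive y 1 (fun y => k * Q y) (k * (2 * pi ^+ 2 * y ^+ 3)).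
    by have h1 := dQ y; apply: is_derive_eq; rewrite /GRing.scale.
  have pos (y : R) : s <= y <= t -> 0 <= 2 * pi ^+ 2 * y ^+ 3.
    move=> /andP[sy _]; apply: mulr_ge0; last by apply: exprn_ge0; lra.
    by apply: mulr_ge0 => //; exact: sqr_ge0.
  have dP3 (y : R) : s <= y <= t ->
      is_derive y 1 (fun y => 2 * pi ^+ 2 * P y) (2 * pi ^+ 2 * (y ^+ 3 * p y)).
    by move=> hy; apply: dP2; lra.
  have le1 (y : R) : s <= y <= t -> m * (2 * pi ^+ 2 * y ^+ 3) <= 2 * pi ^+ 2 * (y ^+ 3 * p y).
    by move=> hy; have /andP[h1 _] := hp y hy; have := ler_wpM2l (pos y hy) h1; lra.
  have le2 (y : R) : s <= y <= t -> 2 * pi ^+ 2 * (y ^+ 3 * p y) <= M * (2 * pi ^+ 2 * y ^+ 3).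
    by move=> hy; have /andP[_ h1] := hp y hy; have := ler_wpM2l (pos y hy) h1; lra.
  rewrite !mulrBr; apply/andP; split.
    exact: (@le_of_deriv_cc R (fun y => m * Q y) (fun y => 2 * pi ^+ 2 * P y) _ _ s t st
      (fun y _ => dmQ m y) dP3 le1).
  exact: (@le_of_deriv_cc R (fun y => 2 * pi ^+ 2 * P y) (fun y => M * Q y) _ _ s t st
    dP3 (fun y _ => dmQ M y) le2).
pose D (t : R) := G t - 2 * pi ^+ 2 * P t.
set L := 2 * pi ^+ 2 * b ^+ 3.
have L0 : 0 <= L.
  by rewrite mulr_ge0 ?exprn_ge0 ?(ltW b0) // mulr_ge0 // sqr_ge0.
have QL (s t : R) : 0 <= s <= t -> t <= b -> Q t - Q s <= L * (t - s).
  move=> /andP[s0 st] tb; rewrite mulrBr.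
  apply: (le_of_deriv_cc (F := Q) (G := fun y => L * y)
      (dF := fun y => 2 * pi ^+ 2 * y ^+ 3) (dG := fun=> L)) => // y hy.
    by apply: is_derive_eq; rewrite /GRing.scale /= mulr1.
  apply: ler_wpM2l; first by apply: mulr_ge0 => //; exact: sqr_ge0.
  by have /andP[? ?] := hy; rewrite lerXn2r // ?nnegrE; lra.
have DB (s t z eta : R) : 0 < s <= t -> t <= b -> 0 <= eta ->
    (forall y : R, s <= y <= t -> `|p y - z| <= eta) -> `|D t - D s| <= 2 * eta * L * (t - s).
  move=> hst tb eta0 hp.
  have hst' : 0 <= s <= t by have /andP[? ?] := hst; lra.
  have hp2 (y : R) : s <= y <= t -> z - eta <= p y <= z + eta.
    by move=> /hp; rewrite ler_norml => /andP[? ?]; lra.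
  (* The truncation at [0] is there because [GB] takes a nonnegative lower bound. *)
  have hp1 (y : R) : s <= y <= t -> Num.max 0 (z - eta) <= p y <= z + eta.
    move=> hy; have /andP[h1 h2] := hp2 y hy; rewrite h2 andbT ge_max h1 andbT.
    by apply: p0; have /andP[? ?] := hy; have /andP[? ?] := hst'; lra.
  have m0 : 0 <= Num.max 0 (z - eta) by rewrite le_max lexx.
  have /andP[G1 G2] := GB _ _ _ _ hst' tb hp1 m0.
  have /andP[P1 P2] := PB _ _ _ _ hst tb hp2.
  have q0 := Qhom _ _ hst'; have qL := QL _ _ hst' tb.
  have m1 : (z - eta) * (Q t - Q s) <= Num.max 0 (z - eta) * (Q t - Q s).
    by apply: ler_wpM2r => //; rewrite le_max lexx orbT.
  have e1 := ler_wpM2l eta0 qL.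
  rewrite /D ler_norml; apply/andP; split; lra.
have dD (t : R) : 0 < t < b -> is_derive t 1 D 0.
  move=> /andP[t0 tb]; apply: is_derive_shift; apply: is_derive_squeeze => e e0'.
  pose eta := e / (2 * (L + 1)).
  have L1 : 0 < L + 1 by lra.
  have eta0 : 0 < eta by rewrite divr_gt0 // mulr_gt0.
  have ht : 0 <= t < rho by rewrite (ltW t0) /=; lra.
  have /(@cvgrPdist_le _ _ _ (nbhs t))/(_ _ eta0) := continuous_profile ht.
  move=> /nbhs_ballP[del /= del0 hdel].
  exists (Num.min del (Num.min t (b - t))).
    by rewrite !lt_min del0 t0 /=; lra.
  move=> h; rewrite !lt_min => /and3P[hd h1 h2].
  rewrite mulr0 subr0 add0r.
  move: (h1) (h2) (hd); rewrite !ltr_norml => /andP[? ?] /andP[? ?] /andP[? ?].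
  have hp (y : R) : `|y - t| <= `|h| -> `|p y - p t| <= eta.
    move=> hy; rewrite distrC; apply: hdel; rewrite -ball_normE /= distrC.
    exact: le_lt_trans hy hd.
  have fin : 2 * eta * L * `|h| <= e * `|h|.
    rewrite ler_wpM2r //.
    have -> : 2 * eta * L = e * (L / (L + 1)) by rewrite /eta; field; exact: lt0r_neq0.
    by rewrite ger_pMr // ler_pdivrMr // mul1r lerDl.
  apply: le_trans fin.
  have [hh|hh] := leP 0 h.
    have -> : `|h| = (h + t) - t by rewrite ger0_norm //; ring.
    apply: (DB _ _ (p t)) => //; [lra|lra|exact: ltW|].
    by move=> y hy; apply: hp; rewrite (ger0_norm hh) ger0_norm; lra.
  have -> : `|h| = t - (h + t) by rewrite ltr0_norm //; ring.
  rewrite distrC; apply: (DB _ _ (p t)) => //; [lra|lra|exact: ltW|].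
  by move=> y hy; apply: hp; rewrite (ltr0_norm hh) ler0_norm; lra.
have G0 : G 0 = 0 by rewrite /G I0.
have D0 : D 0 = 0 by rewrite /D G0 P0 mulr0 subr0.
have cG : G x @[x --> 0^'+] --> G 0.
  rewrite G0; apply: (@squeeze_cvgr _ _ _ _ (fun=> 0) (fun x => K * Q x)).
  - near=> x.
    have x0 : 0 < x by near: x; exact: nbhs_right_gt.
    have xb : x < b by near: x; exact: nbhs_right_lt.
    have h0x : 0 <= (0 : R) <= x by rewrite lexx ltW.
    have hb (y : R) : 0 <= y <= x -> 0 <= p y <= K.
      by move=> /andP[y0 yt]; rewrite p0 ?pK // y0 /=; lra.
    have := GB _ _ _ _ h0x (ltW xb) hb (lexx _).
    by rewrite G0 Q0 !subr0 mul0r.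
  - exact: cvg_cst.
  - rewrite -[X in _ --> X](_ : K * Q 0 = 0); last by rewrite Q0 mulr0.
    by apply: cvgMr; exact: is_derive_cvg_right (dQ 0).
have cD : D x @[x --> 0^'+] --> D 0.
  by apply: cvgB => //; apply: cvgMr.
have dcst (x : R) : is_derive x 1 (fun=> 0 : R) 0 by exact: is_derive_cst.
have in_b (x : R) : 0 < x <= r -> 0 < x < b by move=> /andP[-> ?] /=; lra.
have H1 : D r - D 0 <= 0 - 0.
  apply: (@le_of_deriv R D (fun=> 0) (fun=> 0) (fun=> 0)) => //.
  - by move=> x /in_b; exact: dD.
  - exact: cvg_cst.
have H2 : 0 - 0 <= D r - D 0.
  apply: (@le_of_deriv R (fun=> 0) D (fun=> 0) (fun=> 0)) => //.
  - by move=> x /in_b; exact: dD.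
  - exact: cvg_cst.
rewrite -GE; last by rewrite r0 ltW.
congr EFin; move: H1 H2; rewrite D0 /D => H1 H2; lra.
Unshelve. all: by end_near.
Qed.

End radial_integral.

(** * Comparison with bubbles and stability of solutions *)

Lemma radsol_restrict (R : realType) (rho rho' : R) (g a w P f : R -> R) :
  rho' <= rho -> radsol rho g a w P f -> radsol rho' g a w P f.
Proof.
move=> rr [hg ha hw hP cg ca cw cP a0 P0]; split => //.
- by move=> r /andP[r0 rr']; apply: hg; rewrite r0; lra.
- by move=> r /andP[r0 rr']; apply: ha; rewrite r0; lra.
- by move=> r /andP[r0 rr']; apply: hw; rewrite r0; lra.
- by move=> r /andP[r0 rr']; apply: hP; rewrite r0; lra.
Qed.

Lemma radsol_P_homo (R : realType) (rho : R) (g a w P f : R -> R) :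
  radsol rho g a w P f -> (forall r : R, 0 < r < rho -> 0 <= f r) ->
  forall s r : R, 0 <= s <= r -> r < rho -> P s <= P r.
Proof.
move=> hs hf s r /andP[s0 sr] rr; rewrite -subr_ge0.
have -> : 0 = (fun=> 0 : R) r - (fun=> 0 : R) s by rewrite subr0.
apply: (@le_of_deriv R (fun=> 0) P (fun=> 0) (fun x => x ^+ 3 * f x)) => //.
- by move=> x /andP[sx xr]; apply: (rs_P hs); lra.
- exact: cvg_cst.
- move: s0; rewrite le_eqVlt => /predU1P[<-|s0]; first exact: rs_P0 hs.
  by apply: is_derive_cvg_right (rs_P hs (_ : 0 < s < rho)); lra.
- move=> x /andP[sx xr]; apply: mulr_ge0; first by apply: exprn_ge0; lra.
  by apply: hf; lra.
Qed.

Lemma radsol_P_sub (R : realType) (rho : R) (g1 a1 w1 P1 f1 g2 a2 w2 P2 f2 : R -> R) :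
  radsol rho g1 a1 w1 P1 f1 -> radsol rho g2 a2 w2 P2 f2 ->
  (forall r : R, 0 < r < rho -> f1 r <= f2 r) ->
  forall s r : R, 0 <= s <= r -> r < rho -> P1 r - P1 s <= P2 r - P2 s.
Proof.
move=> h1 h2 hf s r hsr rr.
have hf' (t : R) : 0 < t < rho -> 0 <= f2 t - f1 t by move=> /hf; rewrite subr_ge0.
have := radsol_P_homo (radsol_sub h2 h1) hf' hsr rr; lra.
Qed.

(** [bubble c] solves the equation with the larger weight [96 / c ^ 2], and the nonlinearity
    increases with [g], so the comparison principle puts [g] below it. Integrating once more the
    resulting order between the densities turns the gap [w 0 + 8 / c] between the data into a
    quadratic gap. *)
Lemma sol_upper (R : realType) (rho c : R) (W g a w P : R -> R) :
  0 < c -> radsol rho g a w P (fun r => W r * expR (4 * g r)) ->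
  (forall r : R, 0 < r < rho -> 0 <= W r <= 96 / c ^+ 2) -> g 0 = 0 -> w 0 < - (8 / c) ->
  forall r : R, 0 < r < rho ->
  g r <= bubble c r + (w 0 + 8 / c) * r ^+ 2 / 8 /\
  W r * expR (4 * g r) <= 96 * c ^+ 2 / (c + r ^+ 2) ^+ 4.
Proof.
move=> c0 hs hW g0 w0.
have hb := radsol_bubble rho c0; have hz := radsol_sub hs hb.
have z0 : g 0 - bubble c 0 = 0 by rewrite g0 bubble0 // subrr.
have zw : w 0 - - (8 * c + 4 * 0 ^+ 2) / (c + 0 ^+ 2) ^+ 2 = w 0 + 8 / c.
  by rewrite expr0n /= mulr0 !addr0; field; exact: lt0r_neq0.
have fb (r : R) : 96 * c ^+ 2 / (c + r ^+ 2) ^+ 4 = 96 / c ^+ 2 * expR (4 * bubble c r).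
  have cn : c != 0 by rewrite gt_eqF.
  have Dn : c + r ^+ 2 != 0 by rewrite gt_eqF // ltr_wpDr // sqr_ge0.
  by rewrite expR4_bubble //; field; rewrite cn Dn.
have key : forall r : R, 0 < r < rho -> g r - bubble c r < 0 /\
    W r * expR (4 * g r) - 96 * c ^+ 2 / (c + r ^+ 2) ^+ 4 <= 0.
  apply: (radsol_cmp hz).
  - by rewrite z0.
  - by rewrite zw; lra.
  - by right; rewrite zw; lra.
  - move=> r hr; rewrite !subr_le0 fb => gb.
    have /andP[W0 W1] := hW r hr.
    by apply: ler_pM; rewrite ?expR_ge0 // ler_expR ler_pM2l.
move=> r hr; have [_ h2] := key r hr; split; last by rewrite -subr_le0.
have rr : r < rho by case/andP: hr.
have hf (t : R) : 0 < t < r -> W t * expR (4 * g t) - 96 * c ^+ 2 / (c + t ^+ 2) ^+ 4 <= 0.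
  by move=> /andP[t0 tr]; have [] := key t _ => //; rewrite t0 (lt_trans tr).
have rr' : 0 <= r <= r by rewrite lexx andbT ltW //; case/andP: hr.
have [_ _ _] := radsol_le hz rr hf rr'.
by rewrite z0 zw; lra.
Qed.

(** The mirror image, with [bubble c] below. The bound on [a] is kept as well: it detects where [g]
    increases. *)
Lemma sol_lower (R : realType) (rho c : R) (W g a w P : R -> R) :
  0 < c -> radsol rho g a w P (fun r => W r * expR (4 * g r)) ->
  (forall r : R, 0 < r < rho -> 96 / c ^+ 2 <= W r) -> g 0 = 0 -> - (8 / c) < w 0 ->
  forall r : R, 0 < r < rho ->
  bubble c r + (w 0 + 8 / c) * r ^+ 2 / 8 <= g r /\
  - (2 * r ^+ 4) / (c + r ^+ 2) + (w 0 + 8 / c) * r ^+ 4 / 4 <= a r.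
Proof.
move=> c0 hs hW g0 w0.
have hb := radsol_bubble rho c0; have hz := radsol_sub hb hs.
have z0 : bubble c 0 - g 0 = 0 by rewrite g0 bubble0 // subrr.
have zw : - (8 * c + 4 * 0 ^+ 2) / (c + 0 ^+ 2) ^+ 2 - w 0 = - (w 0 + 8 / c).
  by rewrite expr0n /= mulr0 !addr0; field; exact: lt0r_neq0.
have fb (r : R) : 96 * c ^+ 2 / (c + r ^+ 2) ^+ 4 = 96 / c ^+ 2 * expR (4 * bubble c r).
  have cn : c != 0 by rewrite gt_eqF.
  have Dn : c + r ^+ 2 != 0 by rewrite gt_eqF // ltr_wpDr // sqr_ge0.
  by rewrite expR4_bubble //; field; rewrite cn Dn.
have key : forall r : R, 0 < r < rho -> bubble c r - g r < 0 /\
    96 * c ^+ 2 / (c + r ^+ 2) ^+ 4 - W r * expR (4 * g r) <= 0.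
  apply: (radsol_cmp hz).
  - by rewrite z0.
  - by rewrite zw; lra.
  - by right; rewrite zw; lra.
  - move=> r hr; rewrite !subr_le0 fb => gb.
    have W0 : 0 <= 96 / c ^+ 2 by rewrite divr_ge0 // sqr_ge0.
    by apply: ler_pM; rewrite ?expR_ge0 ?hW // ler_expR ler_pM2l.
move=> r hr.
have rr : r < rho by case/andP: hr.
have hf (t : R) : 0 < t < r -> 96 * c ^+ 2 / (c + t ^+ 2) ^+ 4 - W t * expR (4 * g t) <= 0.
  by move=> /andP[t0 tr]; have [] := key t _ => //; rewrite t0 (lt_trans tr).
have rr' : 0 <= r <= r by rewrite lexx andbT ltW //; case/andP: hr.
have [_ _ + +] := radsol_le hz rr hf rr'.
by rewrite z0 zw => h1 h2; split; lra.
Qed.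

Lemma expR_lip (R : realType) (A x y : R) : x <= A -> y <= A ->
  `|expR x - expR y| <= expR A * `|x - y|.
Proof.
wlog xy : x y / x <= y.
  move=> H xA yA; have [xy|yx] := leP x y; first exact: H.
  by rewrite distrC (distrC x); apply: H => //; exact: ltW.
move=> xA yA; rewrite distrC (distrC x) !ger0_norm ?subr_ge0 ?ler_expR //.
have := @le_of_deriv_cc R (@expR R) (fun t => expR A * t) (@expR R) (fun=> expR A) x y xy.
rewrite -mulrBr; apply.
- by move=> t _; apply: is_derive_eq; rewrite /GRing.scale /= mulr1.
- by move=> t /andP[_ ty]; rewrite ler_expR (le_trans ty).
Qed.

(** The densities differ by [(W1 - W2) * exp (4 * g1)], which is at most [e'], plus
    [W2 * (exp (4 * g1) - exp (4 * g2))], which is Lipschitz with constant [2 * 4 * exp (4 * A) = K]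
    on values below [A]. *)
Lemma sol_gronwall (R : realType) (rho A e e' : R) (W1 g1 a1 w1 P1 W2 g2 a2 w2 P2 : R -> R) :
  let K := 8 * expR (4 * A) in
  radsol rho g1 a1 w1 P1 (fun r => W1 r * expR (4 * g1 r)) ->
  radsol rho g2 a2 w2 P2 (fun r => W2 r * expR (4 * g2 r)) ->
  0 < e <= 1 -> 2 * e * expR (4 * A) <= e' ->
  (forall r : R, 0 < r < rho -> `|W1 r - 1| <= e /\ `|W2 r - 1| <= e) ->
  `|g1 0 - g2 0| <= e' -> `|w1 0 - w2 0| <= e' ->
  (forall r : R, 0 < r < rho -> g2 r <= A) ->
  (forall r : R, 0 < r < rho -> `|g1 r - g2 r| <= 2 * e' * expR ((K + 1) * r ^+ 2) -> g1 r <= A) ->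
  forall r : R, 0 < r < rho ->
  `|g1 r - g2 r| <= 2 * e' * expR ((K + 1) * r ^+ 2) /\
  `|W1 r * expR (4 * g1 r) - W2 r * expR (4 * g2 r)| <= K * `|g1 r - g2 r| + e'.
Proof.
move=> K h1 h2 /andP[e0 e1] ee' hW hg0 hw0 A2 A1.
have E0 : 0 < expR (4 * A) by exact: expR_gt0.
have K0 : 0 <= K by rewrite /K; lra.
have e'0 : 0 < e' by apply: lt_le_trans ee'; rewrite !mulr_gt0.
have fle (r : R) : 0 < r < rho -> `|g1 r - g2 r| <= 2 * e' * expR ((K + 1) * r ^+ 2) ->
    `|W1 r * expR (4 * g1 r) - W2 r * expR (4 * g2 r)| <= K * `|g1 r - g2 r| + e'.
  move=> hr hB; have a1' := A1 r hr hB; have a2' := A2 r hr.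
  have [w1' w2'] := hW r hr.
  have -> : W1 r * expR (4 * g1 r) - W2 r * expR (4 * g2 r) =
     (W1 r - W2 r) * expR (4 * g1 r) + W2 r * (expR (4 * g1 r) - expR (4 * g2 r)) by ring.
  have t1 : `|(W1 r - W2 r) * expR (4 * g1 r)| <= 2 * e * expR (4 * A).
    rewrite normrM; apply: ler_pM => //.
      by move: w1' w2'; rewrite !ler_norml => /andP[? ?] /andP[? ?]; apply/andP; split; lra.
    by rewrite ger0_norm ?expR_ge0 // ler_expR ler_pM2l.
  have t2 : `|W2 r * (expR (4 * g1 r) - expR (4 * g2 r))| <= 2 * (expR (4 * A) * (4 * `|g1 r - g2 r|)).
    rewrite normrM; apply: ler_pM => //.
      by move: w2'; rewrite !ler_norml => /andP[? ?]; apply/andP; split; lra.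
    have -> : 4 * `|g1 r - g2 r| = `|4 * g1 r - 4 * g2 r|.
      by rewrite -mulrBr normrM ger0_norm.
    by apply: expR_lip; rewrite ler_pM2l.
  apply: le_trans (ler_normD _ _) _; rewrite /K; lra.
have G := radsol_gronwall (radsol_sub h1 h2) K0 e'0 hg0 hw0 fle.
by move=> r hr; have := G r hr; split => //; exact: fle.
Qed.

(** * Decay of the tail in the critical case *)

(* [w + 3 / r ^+ 2] is nondecreasing once [P >= 6]; hence, for a suitable constant [k],
   [g + 3 / 2 * ln r - k / (2 * r ^+ 2)] is a convex function of [r ^+ 2] with derivative [N / 2]. *)
Lemma tail_convex (R : realType) (R0 rho0 rho : R) (g a w P f : R -> R) :
  radsol rho0 g a w P f -> (forall r : R, 0 < r < rho0 -> 0 <= f r) ->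
  0 < R0 -> rho < rho0 -> 6 <= P R0 ->
  let k := w R0 * R0 ^+ 4 / 4 - a R0 - 3 / 4 * R0 ^+ 2 in
  let N x := (a x + 3 / 2 * x ^+ 2 + k) * (x ^-1) ^+ 4 in
  let y x := g x + 3 / 2 * ln x - k / 2 * (x ^-1) ^+ 2 in
  forall s t : R, R0 <= s -> s <= t -> t <= rho ->
  [/\ N s <= N t, y t - y s <= N t / 2 * (t ^+ 2 - s ^+ 2) &
      N s / 2 * (t ^+ 2 - s ^+ 2) <= y t - y s].
Proof.
move=> hs f0 R00 rr0 P6 k N y.
have pos (x : R) : R0 <= x -> 0 < x by exact: lt_le_trans.
have nz (x : R) : R0 <= x -> x != 0 by move=> Rx; rewrite gt_eqF // pos.
have ins (x : R) : R0 <= x <= rho -> 0 < x < rho0.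
  by move=> /andP[Rx xr]; rewrite (pos _ Rx) (le_lt_trans xr).
pose W x := w x + 3 * (x ^-1) ^+ 2.
have dW (x : R) : R0 <= x <= rho -> is_derive x 1 W ((P x - 6) / x ^+ 3).
  move=> hx; have hw := rs_w hs (ins x hx); have xn : x != 0 by apply: nz; case/andP: hx.
  have hi := @is_deriveV R (fun x => x) x 1 1 xn (is_derive_id _ _).
  by rewrite /W; apply: is_derive_eq; rewrite /GRing.scale /=; field.
have W_homo (s t : R) : R0 <= s -> s <= t -> t <= rho -> W s <= W t.
  move=> Rs st tr; rewrite -subr_ge0.
  have -> : 0 = (fun=> 0 : R) t - (fun=> 0 : R) s by rewrite subr0.
  apply: (@le_of_deriv_cc R (fun=> 0) W (fun=> 0) (fun x => (P x - 6) / x ^+ 3)) => //.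
  - by move=> x /andP[sx xt]; apply: dW; lra.
  - move=> x /andP[sx xt]; apply: mulr_ge0; last by rewrite invr_ge0 exprn_ge0 //; lra.
    rewrite subr_ge0; apply: (le_trans P6); apply: (radsol_P_homo hs f0); lra.
pose b x := a x + 3 / 2 * x ^+ 2 + k.
have db (x : R) : R0 <= x <= rho -> is_derive x 1 b (x ^+ 3 * W x).
  move=> hx; have ha := rs_a hs (ins x hx); have xn : x != 0 by apply: nz; case/andP: hx.
  by rewrite /b; apply: is_derive_eq; rewrite /GRing.scale /= /W; field.
(* The constant [k] is the one for which [b R0 = W R0 * R0 ^ 4 / 4]. Then [b] is the integral of
   [x ^ 3 * W] from [0], with [W] extended by the constant [W R0] below [R0], and a mean of this
   nondecreasing function is at most its last value. *)
have bW (x : R) : R0 <= x <= rho -> 4 * b x <= x ^+ 4 * W x.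
  move=> /andP[Rx xr].
  have := @le_of_deriv_cc R b (fun t => W x * t ^+ 4 / 4) (fun t => t ^+ 3 * W t)
    (fun t => t ^+ 3 * W x) R0 x Rx.
  have -> : b R0 = W R0 * R0 ^+ 4 / 4 by rewrite /b /k /W; field; exact: nz.
  have : W R0 * R0 ^+ 4 <= W x * R0 ^+ 4.
    by apply: ler_wpM2r; [apply: exprn_ge0; exact: ltW|exact: W_homo].
  move=> h0 h; suff : b x - W R0 * R0 ^+ 4 / 4 <= W x * x ^+ 4 / 4 - W x * R0 ^+ 4 / 4 by lra.
  apply: h.
  - by move=> t /andP[? ?]; apply: db; lra.
  - by move=> t _; apply: is_derive_eq; rewrite /GRing.scale /=; field.
  - move=> t /andP[? ?]; apply: ler_wpM2l; first by rewrite exprn_ge0 //; lra.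
    by apply: W_homo.
have dN (x : R) : R0 <= x <= rho -> is_derive x 1 N ((x ^+ 4 * W x - 4 * b x) / x ^+ 5).
  move=> hx; have hb := db x hx; have xn : x != 0 by apply: nz; case/andP: hx.
  have hi := @is_deriveV R (fun x => x) x 1 1 xn (is_derive_id _ _).
  by apply: (is_derive_eq (is_derive_mulX 4 hb hi)); rewrite /GRing.scale /=; field.
have N_homo (s t : R) : R0 <= s -> s <= t -> t <= rho -> N s <= N t.
  move=> Rs st tr; rewrite -subr_ge0.
  have -> : 0 = (fun=> 0 : R) t - (fun=> 0 : R) s by rewrite subr0.
  apply: (@le_of_deriv_cc R (fun=> 0) N (fun=> 0) (fun x => (x ^+ 4 * W x - 4 * b x) / x ^+ 5)) => //.
  - by move=> x /andP[sx xt]; apply: dN; lra.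
  - move=> x /andP[sx xt]; apply: mulr_ge0; last by rewrite invr_ge0 exprn_ge0 //; lra.
    by rewrite subr_ge0; apply: bW; lra.
have dy (x : R) : R0 <= x <= rho -> is_derive x 1 y (x * N x).
  move=> hx; have hg := rs_g hs (ins x hx); have xn : x != 0 by apply: nz; case/andP: hx.
  have hl := is_derive1_ln (pos x (proj1 (andP hx))).
  have hi := @is_deriveV R (fun x => x) x 1 1 xn (is_derive_id _ _).
  by rewrite /y; apply: is_derive_eq; rewrite /GRing.scale /= /N /b; field.
have up (s t : R) : R0 <= s -> s <= t -> t <= rho -> y t - y s <= N t / 2 * (t ^+ 2 - s ^+ 2).
  move=> Rs st tr; rewrite mulrBr.
  apply: (@le_of_deriv_cc R y (fun x => N t / 2 * x ^+ 2) (fun x => x * N x) (fun x => x * N t)) => //.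
  - by move=> x /andP[sx xt]; apply: dy; lra.
  - by move=> x _; apply: is_derive_eq; rewrite /GRing.scale /=; field.
  - by move=> x /andP[sx xt]; apply: ler_wpM2l; [lra|apply: N_homo => //; lra].
have dn (s t : R) : R0 <= s -> s <= t -> t <= rho -> N s / 2 * (t ^+ 2 - s ^+ 2) <= y t - y s.
  move=> Rs st tr; rewrite mulrBr.
  apply: (@le_of_deriv_cc R (fun x => N s / 2 * x ^+ 2) y (fun x => x * N s) (fun x => x * N x)) => //.
  - by move=> x _; apply: is_derive_eq; rewrite /GRing.scale /=; field.
  - by move=> x /andP[sx xt]; apply: dy; lra.
  - by move=> x /andP[sx xt]; apply: ler_wpM2l; [lra|apply: N_homo => //; lra].
move=> s t Rs st tr; split; [exact: N_homo|exact: up|exact: dn].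
Qed.

(** The numerical core of [tail_bound]: [y] is convex in the squared radius, with slope [n / 2] at
    [r2], and the information at the outer end bounds either the slope or the value. A bounded value
    is interpolated along the chord, which produces the weight [th = r2 / rho2]. *)
Lemma tail_combine (R : realType) (y0 c1 C1 M th R2 r2 rho2 n m y yR yrho : R) :
  0 <= y0 -> 0 <= c1 -> 0 <= M -> 0 <= th <= 1 -> th * rho2 = r2 -> 0 <= R2 <= r2 ->
  yR <= y0 -> n <= m -> n / 2 * (rho2 - r2) <= yrho - y -> y - yR <= n / 2 * (r2 - R2) ->
  m * rho2 <= 3 / 2 + c1 \/ yrho <= C1 + M / 2 + c1 / 2 ->
  y <= y0 + `|C1| + 3 / 2 * c1 + 1 + M / 2 * th.
Proof.
move=> y00 c10 M0 /andP[th0 th1] thE /andP[R20 R2r] yR0 nm h2 hu hor.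
have thM : 0 <= M / 2 * th by apply: mulr_ge0 => //; lra.
have C10 := normr_ge0 C1; have C11 := ler_norm C1.
have [n0|n0] := leP n 0.
  have : n / 2 * (r2 - R2) <= 0 by apply: mulr_le0_ge0; lra.
  lra.
have nR : 0 <= n * R2 by apply: mulr_ge0 => //; exact: ltW.
have hu' : y <= y0 + n / 2 * r2 by lra.
case: hor => [hm|yr].
  have h3 : n * r2 <= m * (th * rho2) by rewrite thE; apply: ler_wpM2r => //; lra.
  have h4 : th * (m * rho2) <= th * (3 / 2 + c1) by exact: ler_wpM2l.
  have h5 : th * (3 / 2 + c1) <= 3 / 2 + c1 by rewrite ler_piMl //; lra.
  lra.
have th1' : 0 <= 1 - th by lra.
have k1 := ler_wpM2l th1' hu'.
have k2 : th * y <= th * (C1 + M / 2 + c1 / 2 - n / 2 * (rho2 - r2)).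
  by apply: ler_wpM2l => //; lra.
have k3 : th * (n / 2 * (rho2 - r2)) = n / 2 * (1 - th) * r2 by rewrite -thE; ring.
have k4 : 0 <= th * y0 by exact: mulr_ge0.
have k5 : th * C1 <= `|C1|.
  by apply: le_trans (ler_wpM2l th0 C11) _; rewrite ler_piMl.
have k6 : th * c1 <= c1 by rewrite ler_piMl.
lra.
Qed.

(** If [g rho <= C1 - M], adding [3 / 2 * ln rho] leaves a quantity of size [M / 2]; convexity in
    [r ^ 2] brings it inwards with the weight [r ^ 2 / rho ^ 2]. If [a rho <= 0], the slope at [rho]
    is of order [1 / rho ^ 2] and costs a constant only. [C'] depends neither on [M] nor on the
    solution. *)
Lemma tail_bound (R : realType) (R0 C C1 : R) : 1 <= R0 -> exists C' : R,
  forall (M rho0 rho : R) (g a w P f : R -> R), radsol rho0 g a w P f ->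
  (forall r : R, 0 < r < rho0 -> 0 <= f r) -> R0 <= rho < rho0 -> 6 <= P R0 ->
  `|g R0| <= C -> `|w R0| <= C -> `|a R0| <= C -> ln rho <= M ->
  a rho <= 0 \/ g rho <= C1 - M ->
  forall r : R, R0 <= r <= rho -> g r <= C' - 3 / 2 * ln r + M / 2 * (r ^+ 2 / rho ^+ 2).
Proof.
move=> R1.
pose c1 := (C + 3) * R0 ^+ 4 / 4 + C + 3 / 2 * R0 ^+ 2.
pose y0 := C + 3 / 2 * ln R0 + c1 / 2.
exists (y0 + `|C1| + 2 * c1 + 1).
move=> M rho0 rho g a w P f hs f0 /andP[R0rho rr0] P6 gC wC aC rhoM hrho r /andP[R0r rrho].
have R00 : 0 < R0 by lra.
have C0 : 0 <= C by exact: le_trans gC.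
have lnR : 0 <= ln R0 by rewrite ln_ge0.
have R04 : 0 <= R0 ^+ 4 by apply: exprn_ge0; exact: ltW.
have R02 : 0 <= R0 ^+ 2 by exact: sqr_ge0.
have R24 : R0 ^+ 2 <= R0 ^+ 4 by rewrite ler_weXn2l.
have CR : 0 <= C * R0 ^+ 4 by exact: mulr_ge0.
have c10 : 0 <= c1 by rewrite /c1; lra.
have y00 : 0 <= y0 by rewrite /y0; lra.
have rho0_gt0 : 0 < rho by exact: lt_le_trans R0rho.
have r0 : 0 < r by exact: lt_le_trans R0r.
have M0 : 0 <= M by apply: le_trans rhoM; rewrite ln_ge0 // (le_trans R1).
have H := tail_convex hs f0 R00 rr0 P6.
pose k := w R0 * R0 ^+ 4 / 4 - a R0 - 3 / 4 * R0 ^+ 2.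
pose N x := (a x + 3 / 2 * x ^+ 2 + k) * (x ^-1) ^+ 4.
pose y x := g x + 3 / 2 * ln x - k / 2 * (x ^-1) ^+ 2.
have [_ yrR _] : [/\ N R0 <= N r, y r - y R0 <= N r / 2 * (r ^+ 2 - R0 ^+ 2) &
    N R0 / 2 * (r ^+ 2 - R0 ^+ 2) <= y r - y R0] := H R0 r (lexx _) R0r rrho.
have [Nr _ yr] : [/\ N r <= N rho, y rho - y r <= N rho / 2 * (rho ^+ 2 - r ^+ 2) &
    N r / 2 * (rho ^+ 2 - r ^+ 2) <= y rho - y r] := H r rho R0r rrho (lexx _).
have kc1 : `|k| <= c1.
  have hw : `|w R0 * R0 ^+ 4| <= C * R0 ^+ 4.
    by rewrite normrM (ger0_norm R04) ler_wpM2r.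
  move: aC hw; rewrite /k /c1 !ler_norml; move: (w R0 * _) => z.
  by move=> /andP[? ?] /andP[? ?]; apply/andP; split; lra.
have iv (x : R) : R0 <= x -> - (c1 / 2) <= k / 2 * (x ^-1) ^+ 2 <= c1 / 2.
  move=> Rx; have x1 : 1 <= x by exact: le_trans Rx.
  have xV : 0 <= (x ^-1) ^+ 2 <= 1.
    have x0 : 0 < x by exact: lt_le_trans x1.
    by rewrite sqr_ge0 expr_le1 ?invr_ge0 ?invf_le1 // ltW.
  rewrite -ler_norml normrM -[leRHS]mulr1; apply: ler_pM => //.
    by rewrite normrM (@ger0_norm _ 2^-1) // ler_wpM2r.
  by have /andP[z0 z1] := xV; rewrite ger0_norm.
have yR0 : y R0 <= y0.
  have /andP[h1 h2] := iv R0 (lexx _); move: gC; rewrite /y /y0 ler_norml => /andP[_ h3].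
  by move: h1 h3; move: (k / 2 * _) => z; lra.
have rho2 : 0 < rho ^+ 2 by exact: exprn_gt0.
have rrho2 : r ^+ 2 <= rho ^+ 2 by rewrite lerXn2r // ?nnegrE ltW.
have R0r2 : R0 ^+ 2 <= r ^+ 2 by rewrite lerXn2r // ?nnegrE ltW.
have th01 : 0 <= r ^+ 2 / rho ^+ 2 <= 1.
  by rewrite divr_ge0 ?sqr_ge0 //= ler_pdivrMr // mul1r.
have thE : r ^+ 2 / rho ^+ 2 * rho ^+ 2 = r ^+ 2 by rewrite divfK // gt_eqF.
have hor : N rho * rho ^+ 2 <= 3 / 2 + c1 \/ y rho <= C1 + M / 2 + c1 / 2.
  case: hrho => hrho; [left|right].
    have -> : N rho * rho ^+ 2 = (a rho + 3 / 2 * rho ^+ 2 + k) / rho ^+ 2.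
      by rewrite /N; field; rewrite gt_eqF.
    rewrite ler_pdivrMr // (mulrDl (3 / 2) c1); have : c1 <= c1 * rho ^+ 2.
      by rewrite ler_peMr // exprn_ege1 // (le_trans R1).
    move=> c1r; apply: lerD; first by rewrite gerDr.
    exact: le_trans (ler_normlW kc1) c1r.
  by have /andP[h1 h2] := iv rho R0rho; rewrite /y; move: h1; move: (k / 2 * _) => z; lra.
have R0r2' : 0 <= R0 ^+ 2 <= r ^+ 2 by rewrite R02.
have := tail_combine y00 c10 M0 th01 thE R0r2' yR0 Nr yr yrR hor.
have /andP[_] := iv r R0r; rewrite /y; move: (k / 2 * _) (M / 2 * _) => z1 z2; lra.
Qed.

(** Absorbs the interpolation error, with [t = (r / rho) ^ 2] and [l = ln r]. As [t > 1 / M], [l] is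
    at least [M - ln M / 2] up to constants, so [(1 + q) * l] exceeds [2 * M * t <= 2 * q * M] by
    about [(1 - q) * M], and this absorbs the logarithm of [M]. *)
Lemma tail_exponent (R : realType) (M d q t l : R) : 0 < M -> 0 < d < 1 -> 0 < q < 1 ->
  0 <= l -> t <= q -> 1 < M * t -> 2 * l = ln t + 2 * (M + ln d) ->
  - 2 * l + 2 * M * t <= - 2 * ln d - ln ((1 - q) / 2) - (1 - q) * l.
Proof.
move=> M0 /andP[d0 d1] /andP[q0 q1] l0 tq Mt hl.
have t0 : 0 < t by rewrite -(pmulr_rgt0 _ M0); lra.
have lnd : ln d <= 0 by rewrite ln_le0 // ltW.
have e0 : 0 < (1 - q) / 2 by lra.
have lne : ln ((1 - q) / 2) <= 0 by rewrite ln_le0 //; lra.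
have lM : - ln M <= ln t.
  by rewrite -lnV ?posrE // ler_ln ?posrE ?invr_gt0 // -div1r ler_pdivrMr //; lra.
have eM : ln ((1 - q) / 2) + ln M <= (1 - q) / 2 * M - 1.
  rewrite -lnM ?posrE //.
  have -> : (1 - q) / 2 * M = 1 + ((1 - q) / 2 * M - 1) by ring.
  have eM0 : 0 < (1 - q) / 2 * M by exact: mulr_gt0.
  by apply: le_trans (le_ln1Dx _) _; lra.
have MT : M * t <= M * q by rewrite ler_pM2l.
have h1 : M * (1 + q) - (1 + q) / 2 * ((1 - q) / 2 * M - 1 - ln ((1 - q) / 2))
   + (1 + q) * ln d <= (1 + q) * l.
  have : 2 * l >= - ((1 - q) / 2 * M - 1 - ln ((1 - q) / 2)) + 2 * (M + ln d) by lra.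
  move=> H; have q1' : 0 <= (1 + q) / 2 by lra.
  have := ler_wpM2l q1' H; move: (ln _) (ln _) => x y h.
  have -> : (1 + q) * l = (1 + q) / 2 * (2 * l) by field.
  by apply: le_trans h; rewrite le_eqVlt; apply/orP; left; apply/eqP; field.
have h2 : 2 * ln d <= (1 + q) * ln d.
  by rewrite -subr_ge0 -mulrBl; apply: mulr_le0; lra.
have h3 : ln ((1 - q) / 2) <= (1 + q) / 2 * ln ((1 - q) / 2).
  by rewrite -subr_ge0 -{2}[ln _]mul1r -mulrBl; apply: mulr_le0; lra.
have h4 : 0 <= M * (1 - q) * (1 - (1 + q) / 4) by apply: mulr_ge0; [apply: mulr_ge0|]; lra.
lra.
Qed.

(** The assumption bounds the density [t ^ 3 * f t] by [2 * exp C * t ^ (- 1 - b)], which has a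
    decaying primitive. *)
Lemma tail_integral (R : realType) (rho s r C b : R) (g a w P f : R -> R) :
  radsol rho g a w P f -> (forall t : R, s <= t <= r -> f t <= 2 * expR (4 * g t)) ->
  0 < s <= r -> r < rho -> 0 < b ->
  (forall t : R, s <= t <= r -> 4 * g t <= C - b * ln t - 4 * ln t) ->
  P r - P s <= 2 * expR C / b * expR (- b * ln s).
Proof.
move=> hs hf /andP[s0 sr] rrho b0 key.
have E0 : 0 < expR C by exact: expR_gt0.
move: E0 key; rewrite -{2}[C]expRK; move: (expR C) => E E0 key.
pose G t := - (2 * E / b) * expR (- b * ln t).
have hG (t : R) : s <= t <= r -> is_derive t 1 G (2 * E * expR (- b * ln t) / t).
  move=> /andP[st tr]; have t0 : 0 < t by lra.
  have hl : is_derive t 1 (fun t => - b * ln t) (- b / t).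
    have hl := is_derive1_ln t0.
    by apply: is_derive_eq; rewrite /GRing.scale /=.
  have he := @is_derive1_comp R (@expR R) (fun t => - b * ln t) t _ _ (is_derive_expR _) hl.
  have H := is_derive_mul (is_derive_cst (- (2 * E / b)) t 1) he.
  by apply: (is_derive_eq H); rewrite /=; field; rewrite !gt_eqF.
have hPt (t : R) : s <= t <= r -> is_derive t 1 P (t ^+ 3 * f t).
  by move=> /andP[st tr]; apply: (rs_P hs); lra.
have le (t : R) : s <= t <= r -> t ^+ 3 * f t <= 2 * E * expR (- b * ln t) / t.
  move=> ht; have /andP[st tr] := ht; have t0 : 0 < t by lra.
  rewrite ler_pdivlMr // [X in X <= _](_ : _ = t ^+ 4 * f t); last by ring.
  apply: (@le_trans _ _ (t ^+ 4 * (2 * expR (4 * g t)))).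
    by apply: ler_wpM2l; [rewrite exprn_ge0 // ltW|exact: hf].
  have -> : t ^+ 4 = expR (4 * ln t) by rewrite expRM_natl lnK ?posrE.
  have -> : E = expR (ln E) by rewrite lnK ?posrE.
  rewrite mulrCA -mulrA ler_pM2l // -!expRD ler_expR.
  by have := key t ht; lra.
have := le_of_deriv_cc sr hPt hG le; rewrite /G.
have : 0 <= 2 * E / b * expR (- b * ln r).
  by apply: mulr_ge0 (expR_ge0 _); apply: divr_ge0; lra.
lra.
Qed.

(** By [tail_bound], [4 * g] is at most [- 6 * ln t] plus the error in [M]. Integrability needs the
    exponent 4; of the excess 2, the error uses up [1 + q] and the rate [b = 1 - q] remains. Staying
    at a smaller fraction [del < d] of the outer radius is what makes [q = (del / d) ^ 2 < 1]. *)
Lemma tail_mass (R : realType) (R0 C C1 d del : R) :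
  1 <= R0 -> 0 < del < d -> d < 1 -> exists K b : R, 0 < b /\
  forall (M rho0 : R) (g a w P f : R -> R), radsol rho0 g a w P f ->
  (forall r : R, 0 < r < rho0 -> 0 <= f r <= 2 * expR (4 * g r)) ->
  R0 <= d * expR M < rho0 -> 6 <= P R0 ->
  `|g R0| <= C -> `|w R0| <= C -> `|a R0| <= C ->
  a (d * expR M) <= 0 \/ g (d * expR M) <= C1 - M ->
  forall s r : R, R0 <= s <= r -> r <= del * expR M -> P r - P s <= K * expR (- b * ln s).
Proof.
move=> R1 /andP[del0 dd] d1.
have [C' HC] := tail_bound C C1 R1.
have d0 : 0 < d by lra.
pose q := (del / d) ^+ 2.
have q0 : 0 < q by rewrite exprn_gt0 // divr_gt0.
have q1 : q < 1 by rewrite expr_lt1 // ?ltr_pdivrMr ?mul1r // divr_ge0 // ltW.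
pose C2 := 4 * C' + 2 - 2 * ln d - ln ((1 - q) / 2).
exists (2 * expR C2 / (1 - q)), (1 - q); split; first by lra.
move=> M rho0 g a w P f hs hf hd P6 gC wC aC hrho s r /andP[R0s sr] rdel.
set rho := d * expR M in hd hrho.
have rho_gt0 : 0 < rho by rewrite mulr_gt0 ?expR_gt0.
have lnrho : ln rho = M + ln d by rewrite lnM ?posrE ?expR_gt0 // expRK addrC.
have lnd : ln d <= 0 by rewrite ln_le0 // ltW.
have lnrho0 : 0 <= ln rho by rewrite ln_ge0; case/andP: hd; lra.
have M0 : 0 <= M by lra.
have f0 (x : R) : 0 < x < rho0 -> 0 <= f x by move=> /hf /andP[].
have dE : del * expR M = del / d * rho by rewrite /rho mulrA divfK // gt_eqF.
have delrho : del * expR M <= rho.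
  by rewrite /rho ler_pM2r ?expR_gt0 // ltW.
have key (t : R) : s <= t <= r -> 4 * g t <= C2 - (1 - q) * ln t - 4 * ln t.
  move=> /andP[st tr].
  have t0 : 0 < t by lra.
  have lnt : 0 <= ln t by rewrite ln_ge0; lra.
  have := HC M rho0 rho g a w P f hs f0 hd P6 gC wC aC _ hrho t.
  rewrite lnrho => /(_ ltac:(lra)) /(_ ltac:(lra)).
  set th := t ^+ 2 / rho ^+ 2 => hg.
  have thq : th <= q.
    rewrite ler_pdivrMr ?exprn_gt0 // -exprMn -dE lerXn2r // ?nnegrE; try lra.
  have lth : 2 * ln t = ln th + 2 * (M + ln d).
    rewrite ln_div ?posrE ?exprn_gt0 // !lnXn // lnrho; lra.
  have th0 : 0 < th by rewrite divr_gt0 ?exprn_gt0.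
  have lne : ln ((1 - q) / 2) <= 0 by rewrite ln_le0 //; lra.
  have qlt : 0 <= q * ln t by rewrite mulr_ge0 // ltW.
  (* For [M * th <= 1] the error is a constant; otherwise [t] is close to the outer radius on a
     logarithmic scale. *)
  have [Mt|Mt] := leP (M * th) 1; first by rewrite /C2; lra.
  have M1 : 0 < M.
    by rewrite lt0r M0 andbT; apply: contraTneq Mt => ->; rewrite mul0r -leNgt ler01.
  have dd' : 0 < d < 1 by rewrite d0.
  have qq' : 0 < q < 1 by rewrite q0.
  have := tail_exponent M1 dd' qq' lnt thq Mt lth; rewrite /C2; lra.
apply: (tail_integral hs _ _ _ _ key) => //; try lra.
move=> t ht; have /andP[_ //] : 0 <= f t <= 2 * expR (4 * g t).
by apply: hf; move: ht => /andP[? ?]; lra.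
Qed.

(** * Subsequences *)

Lemma subsequence_ge (s : nat -> nat) : subsequence s -> forall n, (n <= s n)%N.
Proof.
move=> hs; elim=> [//|n IH]; exact: leq_ltn_trans IH (hs _ _ (ltnSn n)).
Qed.

Lemma subsequence_cvg (s : nat -> nat) : subsequence s -> s n @[n --> \oo] --> \oo.
Proof.
move=> hs A [N _ hN]; exists N => // n /= Nn; apply: hN => /=.
exact: leq_trans Nn (subsequence_ge hs n).
Qed.

Lemma subsequence_comp (s t : nat -> nat) :
  subsequence s -> subsequence t -> subsequence (s \o t).
Proof. by move=> hs ht i j /ht/hs. Qed.

Lemma subsequence_exists (Q : nat -> nat -> Prop) :
  (forall k N : nat, exists n : nat, (N <= n)%N /\ Q k n) ->
  exists s : nat -> nat, subsequence s /\ forall k, Q k (s k).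
Proof.
move=> h; have /boolp.choice[F hF] : forall kN : nat * nat,
    exists n : nat, (kN.2 <= n)%N /\ Q kN.1 n by move=> [k N]; exact: h.
pose s := fix s k := if k is k'.+1 then F (k, (s k').+1) else F (0%N, 0%N).
exists s; split=> [|[|k]]; last 2 first.
- by have [] := hF (0%N, 0%N).
- by have [] := hF (k.+1, (s k).+1).
move=> i j; elim: j => // j IH; rewrite ltnS leq_eqVlt => /predU1P[->|/IH ij];
  have [/= hj _] := hF (j.+1, (s j).+1); first exact: hj.
exact: ltn_trans ij hj.
Qed.

(** Generates the cases of the theorem: it is applied to the values at 0, to the size of the data at
    0, and to the rescaled Laplacian at 0. *)
Lemma subsequence_dichotomy (R : realType) (x : nat -> R) :
  (exists (s : nat -> nat) (C : R), subsequence s /\ forall k, x (s k) <= C) \/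
  x n @[n --> \oo] --> +oo.
Proof.
have [h|h] := pselect (exists C : R, forall N, exists n, (N <= n)%N /\ x n <= C).
  left; have [C hC] := h.
  have [s [hs hsC]] := @subsequence_exists (fun _ n => x n <= C) (fun _ => hC).
  by exists s, C.
right; apply/cvgryPge => A.
have [N hN] : exists N, forall n, (N <= n)%N -> A <= x n.
  apply: contrapT => hA; apply: h; exists A => N.
  apply: contrapT => hN; apply: hA; exists N => n Nn.
  by rewrite leNgt; apply/negP => xA; apply: hN; exists n; split => //; exact: ltW.
by exists N.
Qed.

Lemma bounded_subsequence (R : realType) (x : nat -> R) (A B : R) :
  (forall n, A <= x n <= B) ->
  exists (s : nat -> nat) (l : R), subsequence s /\ x (s k) @[k --> \oo] --> l.
Proof.
move=> hx.
have [l [_ hl]] : `[A, B] `&` cluster (x @ \oo) !=set0.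
  have := @segment_compact R A B (x n @[n --> \oo]) _; apply.
  by exists 0%N => // n _ /=; rewrite in_itv /= hx.
have [|s [hs hsl]] := @subsequence_exists (fun k n => `|l - x n| < k.+1%:R^-1).
  move=> k N.
  have e0 : 0 < k.+1%:R^-1 :> R by rewrite invr_gt0 ltr0n.
  have [] := hl [set y | exists2 n, (N <= n)%N & y = x n] (ball l k.+1%:R^-1).
  - by exists N => // n /= Nn; exists n.
  - exact: nbhsx_ballx.
  - by move=> y [[n Nn ->]]; rewrite -ball_normE /= => ?; exists n.
exists s, l; split => //; apply/cvgrPdist_lt => e e0.
have [N _ hN] := near_infty_natSinv_lt (PosNum e0).
by exists N => // n Nn; apply: lt_trans (hsl n) (hN n Nn).
Qed.

Lemma Ckloc_cvg_subsequence (R : realType) (k : nat) (D : set 'rV[R]_4)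
    (f : nat -> 'rV[R]_4 -> R) (g : 'rV[R]_4 -> R) (s : nat -> nat) :
  subsequence s -> Ckloc_cvg k D f g -> Ckloc_cvg k D (f \o s) g.
Proof.
move=> hs /Ckloc_cvgP hf; apply/Ckloc_cvgP => t K e tk cK KD e0.
have [N _ hN] := hf t K e tk cK KD e0.
by exists N => // n /= Nn; apply: hN => /=; exact: leq_trans Nn (subsequence_ge hs n).
Qed.

Lemma Ckloc_cvg_le (R : realType) (j k : nat) (D : set 'rV[R]_4)
    (f : nat -> 'rV[R]_4 -> R) (g : 'rV[R]_4 -> R) :
  (j <= k)%N -> Ckloc_cvg k D f g -> Ckloc_cvg j D f g.
Proof. by move=> jk hf s sj; apply: hf; exact: leq_trans jk. Qed.

(** * Scaling, stability of families of solutions, mass of bubbles *)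

Lemma radsol_eqf (R : realType) (rho : R) (g a w P f f' : R -> R) :
  radsol rho g a w P f -> (forall r : R, 0 < r < rho -> f r = f' r) -> radsol rho g a w P f'.
Proof.
move=> [hg ha hw hP cg ca cw cP a0 P0] ff'; split => //.
by move=> r hr; rewrite -ff' //; exact: hP.
Qed.

(** The flux [P], hence the mass, is invariant, while [f] is multiplied by [l ^ 4]; the choice
    [c = ln l] compensates this factor in [exp (4 * g)]. *)
Lemma radsol_scale (R : realType) (rho l c : R) (g a w P f : R -> R) : 0 < l ->
  radsol rho g a w P f ->
  radsol (rho / l) (fun r => g (l * r) + c) (fun r => l ^- 2 * a (l * r))
    (fun r => l ^+ 2 * w (l * r)) (fun r => P (l * r)) (fun r => l ^+ 4 * f (l * r)).
Proof.
move=> l0 [hg ha hw hP cg ca cw cP a0 P0].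
have ln : l != 0 by rewrite gt_eqF.
have ins (r : R) : 0 < r < rho / l -> 0 < l * r < rho.
  by move=> /andP[r0]; rewrite ltr_pdivlMr // mulrC => ->; rewrite mulr_gt0.
have dl (r : R) : is_derive r 1 (fun r => l * r) l.
  by apply: is_derive_eq; rewrite /GRing.scale /= mulr1.
have cmp (F : R -> R) (d r : R) : is_derive (l * r) 1 F d -> is_derive r 1 (fun r => F (l * r)) (l * d).
  move=> h; have H := @is_derive1_comp R F (fun r => l * r) r _ _ h (dl r).
  by apply: (is_derive_eq H); rewrite mulrC.
have cvg (F : R -> R) : F x @[x --> 0^'+] --> F 0 -> F (l * x) @[x --> 0^'+] --> F (l * 0).
  rewrite mulr0 => h; apply: cvg_comp h => A [e /= e0 eA].
  exists (e / l); first by rewrite /= divr_gt0.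
  move=> x /=; rewrite sub0r normrN => xe x0; apply: eA => /=; last exact: mulr_gt0.
  by rewrite sub0r normrN normrM (gtr0_norm l0) mulrC -ltr_pdivlMr.
split.
- move=> r hr; have [r0 _] := andP hr; have := cmp _ _ _ (hg _ (ins r hr)) => h.
  by apply: is_derive_eq; rewrite ?addr0; field; rewrite ln gt_eqF.
- move=> r hr; have := cmp _ _ _ (ha _ (ins r hr)) => h.
  by apply: is_derive_eq; rewrite /GRing.scale /=; field.
- move=> r hr; have [r0 _] := andP hr; have := cmp _ _ _ (hw _ (ins r hr)) => h.
  by apply: is_derive_eq; rewrite /GRing.scale /=; field; rewrite ln gt_eqF.
- move=> r hr; have := cmp _ _ _ (hP _ (ins r hr)) => h.
  by apply: is_derive_eq; rewrite /GRing.scale /=; ring.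
- by apply: cvgD; [exact: cvg|exact: cvg_cst].
- by apply: cvgMr; exact: cvg.
- by apply: cvgMr; exact: cvg.
- exact: cvg.
- by rewrite mulr0 a0 mulr0.
- by rewrite mulr0.
Qed.

(** Compares the index [m] of one family with the index [n] of another having the same limits of
    data. Two equal families give a Cauchy property; a constant second family gives convergence to
    an explicit solution. *)
Lemma radsol_close (R : realType) (rho A p q : R) (W1 g1 a1 w1 P1 W2 g2 a2 w2 P2 : nat -> R -> R) :
  0 <= rho ->
  (\forall n \near \oo, radsol rho (g1 n) (a1 n) (w1 n) (P1 n) (fun r => W1 n r * expR (4 * g1 n r))) ->
  (\forall n \near \oo, radsol rho (g2 n) (a2 n) (w2 n) (P2 n) (fun r => W2 n r * expR (4 * g2 n r))) ->
  (forall e : R, 0 < e -> \forall n \near \oo, forall r : R, 0 < r < rho ->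
     `|W1 n r - 1| <= e /\ `|W2 n r - 1| <= e) ->
  g1 n 0 @[n --> \oo] --> p -> g2 n 0 @[n --> \oo] --> p ->
  w1 n 0 @[n --> \oo] --> q -> w2 n 0 @[n --> \oo] --> q ->
  (\forall n \near \oo, forall r : R, 0 < r < rho -> g1 n r <= A /\ g2 n r <= A) ->
  forall e : R, 0 < e -> exists N : nat, forall m n : nat, (N <= m)%N -> (N <= n)%N ->
    [/\ `|g1 m 0 - g2 n 0| <= e, `|w1 m 0 - w2 n 0| <= e &
       forall r : R, 0 < r < rho -> `|g1 m r - g2 n r| <= e /\
       `|W1 m r * expR (4 * g1 m r) - W2 n r * expR (4 * g2 n r)| <= e].
Proof.
move=> rho0 hs1 hs2 hW hg1 hg2 hw1 hw2 hA e e0.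
pose K := 8 * expR (4 * A); pose E := expR ((K + 1) * rho ^+ 2).
have A0 : 0 < expR (4 * A) by exact: expR_gt0.
have K0 : 0 <= K by rewrite /K; lra.
have E0 : 0 < E by exact: expR_gt0.
have KE : 0 <= K * E by exact/mulr_ge0/ltW.
pose D := 2 * (K * E) + 2 * E + 1.
have D0 : 0 < D by rewrite /D; lra.
pose e' := e / D.
have e'0 : 0 < e' by exact: divr_gt0.
have e'D : e' * D = e by rewrite /e' divfK // gt_eqF.
have e'K : 0 <= e' * (K * E) by apply: mulr_ge0 => //; exact: ltW.
have e'E : 0 <= e' * E by apply: mulr_ge0; exact: ltW.
rewrite /D in e'D.
have e'le : e' <= e by lra.
pose e1 := Num.min 1 (e' / (2 * expR (4 * A))).
have e10 : 0 < e1 <= 1.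
  by rewrite /e1 ge_min lexx /= andbT lt_min ltr01 divr_gt0 // mulr_gt0.
have e1e' : 2 * e1 * expR (4 * A) <= e'.
  have : e1 <= e' / (2 * expR (4 * A)) by rewrite /e1 ge_min lexx orbT.
  by rewrite ler_pdivlMr ?mulr_gt0 // => h; lra.
have e2 : 0 < e' / 2 by lra.
have [e1p _] := andP e10.
have close (x : nat -> R) (l : R) : x n @[n --> \oo] --> l ->
    \forall n \near \oo, `|l - x n| <= e' / 2.
  by move/cvgrPdist_le; apply.
have [N _ hN] : \forall n \near \oo,
    [/\ radsol rho (g1 n) (a1 n) (w1 n) (P1 n) (fun r => W1 n r * expR (4 * g1 n r)) /\
      radsol rho (g2 n) (a2 n) (w2 n) (P2 n) (fun r => W2 n r * expR (4 * g2 n r)),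
     forall r : R, 0 < r < rho -> `|W1 n r - 1| <= e1 /\ `|W2 n r - 1| <= e1,
     `|p - g1 n 0| <= e' / 2 /\ `|p - g2 n 0| <= e' / 2,
     `|q - w1 n 0| <= e' / 2 /\ `|q - w2 n 0| <= e' / 2 &
     forall r : R, 0 < r < rho -> g1 n r <= A /\ g2 n r <= A].
  near=> n; split; [split| |split|split|]; near: n;
    [exact: hs1|exact: hs2|exact: hW|exact: close|exact: close|exact: close|exact: close|exact: hA].
exists N => m n /hN[/= [s1 _] W1' [p1 _] [q1 _] A1] /hN[/= [_ s2] W2' [_ p2] [_ q2] A2].
have dist (z x y : R) : `|z - x| <= e' / 2 -> `|z - y| <= e' / 2 -> `|x - y| <= e'.
  by rewrite !ler_norml => /andP[? ?] /andP[? ?]; apply/andP; split; lra.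
have g12 := dist _ _ _ p1 p2; have w12 := dist _ _ _ q1 q2.
split; [exact: le_trans e'le|exact: le_trans e'le|] => r hr.
have W12 (t : R) : 0 < t < rho -> `|W1 m t - 1| <= e1 /\ `|W2 n t - 1| <= e1.
  by move=> ht; split; [have [] := W1' t ht|have [] := W2' t ht].
have A1' (t : R) : 0 < t < rho ->
  `|g1 m t - g2 n t| <= 2 * e' * expR ((8 * expR (4 * A) + 1) * t ^+ 2) -> g1 m t <= A.
  by move=> ht _; have [] := A1 t ht.
have A2' (t : R) : 0 < t < rho -> g2 n t <= A by move=> ht; have [] := A2 t ht.
have [h1 h2] := sol_gronwall s1 s2 e10 e1e' W12 g12 w12 A2' A1' hr.
have rE : expR ((K + 1) * r ^+ 2) <= E.
  rewrite ler_expR; apply: ler_wpM2l; first by lra.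
  by case/andP: hr => r0 rr; rewrite lerXn2r // ?nnegrE; lra.
have h3 : `|g1 m r - g2 n r| <= 2 * e' * E.
  by apply: le_trans h1 _; apply: ler_wpM2l rE; lra.
split; first by lra.
apply: le_trans h2 _; rewrite -/K.
have := ler_wpM2l K0 h3; lra.
Unshelve. all: by end_near.
Qed.

Lemma radsol_cauchy (R : realType) (rho A p q : R) (W g a w P : nat -> R -> R) :
  0 <= rho ->
  (\forall n \near \oo, radsol rho (g n) (a n) (w n) (P n) (fun r => W n r * expR (4 * g n r))) ->
  (forall e : R, 0 < e -> \forall n \near \oo, forall r : R, 0 < r < rho -> `|W n r - 1| <= e) ->
  g n 0 @[n --> \oo] --> p -> w n 0 @[n --> \oo] --> q ->
  (\forall n \near \oo, forall r : R, 0 < r < rho -> g n r <= A) ->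
  forall e : R, 0 < e -> exists N : nat, forall m n : nat, (N <= m)%N -> (N <= n)%N ->
    [/\ `|g m 0 - g n 0| <= e, `|w m 0 - w n 0| <= e &
       forall r : R, 0 < r < rho ->
       `|W m r * expR (4 * g m r) - W n r * expR (4 * g n r)| <= e].
Proof.
move=> rho0 hs hW hg hw hA e e0.
have [N hN] := radsol_close rho0 hs hs (fun e e0 => filterS (fun n h r hr => conj (h r hr) (h r hr)) (hW e e0))
  hg hg hw hw (filterS (fun n h r hr => conj (h r hr) (h r hr)) hA) e0.
exists N => m n Nm Nn; have [h1 h2 h3] := hN m n Nm Nn.
by split => // r /h3[].
Qed.

(** The component [P] in [radsol_bubble]; its limit [8] corresponds to the mass [16 * pi ^ 2]. *)
Definition bubble_mass (R : realType) (c r : R) : R :=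
  8 * r ^+ 4 * (3 * c + r ^+ 2) / (c + r ^+ 2) ^+ 3.

Lemma bubble_mass_ge0 (R : realType) (c r : R) : 0 < c -> 0 <= bubble_mass c r.
Proof.
move=> c0; have r2 := sqr_ge0 r.
apply: divr_ge0; last by apply: exprn_ge0; lra.
by apply: mulr_ge0; [apply: mulr_ge0 => //; exact: exprn_even_ge0|lra].
Qed.

Lemma bubble_mass_compl (R : realType) (c r : R) : 0 < c ->
  8 - bubble_mass c r = 8 * c ^+ 2 * (c + 3 * r ^+ 2) / (c + r ^+ 2) ^+ 3.
Proof.
move=> c0; rewrite /bubble_mass; field.
by rewrite gt_eqF // ltr_wpDr // sqr_ge0.
Qed.

Lemma bubble_mass_le (R : realType) (c r : R) : 0 < c -> bubble_mass c r <= 8.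
Proof.
move=> c0; rewrite -subr_ge0 bubble_mass_compl //; have r2 := sqr_ge0 r.
apply: divr_ge0; last by apply: exprn_ge0; lra.
by apply: mulr_ge0; [apply: mulr_ge0 => //; exact: sqr_ge0|lra].
Qed.

Lemma bubble_mass_tail (R : realType) (c r : R) : 0 < c -> 0 < r ->
  8 - bubble_mass c r <= 24 * c ^+ 2 / r ^+ 2 ^+ 2.
Proof.
move=> c0 r0; rewrite bubble_mass_compl //.
have : 0 < r ^+ 2 by exact: exprn_gt0.
move: (r ^+ 2) => s s0; have s20 : 0 < s ^+ 2 by exact: exprn_gt0.
have c2 : 0 < c ^+ 2 by exact: exprn_gt0.
have D0 : 0 < (c + s) ^+ 3 by rewrite exprn_gt0 // addr_gt0.
rewrite ler_pdivlMr // mulrAC ler_pdivrMr // -subr_ge0.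
have -> : 24 * c ^+ 2 * (c + s) ^+ 3 - 8 * c ^+ 2 * (c + 3 * s) * s ^+ 2 =
   c ^+ 2 * (24 * (c * c * c) + 72 * (c * c) * s + 64 * c * s ^+ 2) by ring.
apply: mulr_ge0; first exact: ltW.
have cc : 0 < c * c by exact: mulr_gt0.
have := mulr_gt0 cc c0; have := mulr_gt0 cc s0; have := mulr_gt0 c0 s20; lra.
Qed.

Lemma bubble_mass_small (R : realType) (c r : R) : 0 < c ->
  bubble_mass c r <= 24 * r ^+ 4 / c ^+ 2.
Proof.
move=> c0; rewrite /bubble_mass.
have -> : r ^+ 4 = (r ^+ 2) ^+ 2 by rewrite -exprM.
have : 0 <= r ^+ 2 by exact: sqr_ge0.
move: (r ^+ 2) => s s0; have s20 : 0 <= s ^+ 2 by exact: sqr_ge0.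
have c2 : 0 < c ^+ 2 by exact: exprn_gt0.
have D0 : 0 < (c + s) ^+ 3 by rewrite exprn_gt0 // ltr_wpDr.
rewrite ler_pdivlMr // mulrAC ler_pdivrMr // -subr_ge0.
have -> : 24 * s ^+ 2 * (c + s) ^+ 3 - 8 * s ^+ 2 * (3 * c + s) * c ^+ 2 =
   s ^+ 2 * (64 * (c * c) * s + 72 * c * s ^+ 2 + 24 * (s ^+ 2 * s)) by ring.
apply: mulr_ge0 => //.
have cc : 0 < c * c by exact: mulr_gt0.
have := mulr_ge0 (ltW cc) s0; have := mulr_ge0 (ltW c0) s20; have := mulr_ge0 s20 s0; lra.
Qed.

(** Inside radius [s] the density is below that of the bubble; outside, the quadratic gap of
    [sol_upper] brings the additional factor [exp ((w 0 + 8 / c) * s ^ 2 / 2) < 1]. This yields a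
    limit strictly below [8], and no mass when [w 0] tends to minus infinity. *)
Lemma upper_mass (R : realType) (rho c : R) (W g a w P : R -> R) :
  0 < c -> radsol rho g a w P (fun r => W r * expR (4 * g r)) ->
  (forall r : R, 0 < r < rho -> 0 <= W r <= 96 / c ^+ 2) -> g 0 = 0 -> w 0 < - (8 / c) ->
  forall s r : R, 0 < s <= r -> r < rho ->
  P r <= bubble_mass c s + expR ((w 0 + 8 / c) * s ^+ 2 / 2) * (bubble_mass c r - bubble_mass c s).
Proof.
move=> c0 hs hW g0 w0 s r /andP[s0 sr] rr.
have hb := radsol_bubble rho c0.
have key := sol_upper c0 hs hW g0 w0.
have Ps : P s <= bubble_mass c s.
  have := radsol_P_sub hs hb (fun t ht => (key t ht).2) (s := 0) (r := s).
  rewrite (rs_P00 hs) (rs_P00 hb) !subr0; apply; rewrite ?lexx ?ltW //.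
  exact: le_lt_trans rr.
set th := expR _.
suff : P r - P s <= th * bubble_mass c r - th * bubble_mass c s by lra.
have ins (t : R) : s <= t <= r -> 0 < t < rho by move=> /andP[? ?]; lra.
apply: (@le_of_deriv_cc R P (fun t => th * bubble_mass c t) _ (fun t => th * (t ^+ 3 * (96 * c ^+ 2 / (c + t ^+ 2) ^+ 4))) s r sr).
- by move=> t ht; exact: (rs_P hs (ins t ht)).
- by move=> t ht; have h := rs_P hb (ins t ht); apply: is_derive_eq.
move=> t ht; have /andP[st tr] := ht; rewrite [leRHS]mulrCA.
apply: ler_wpM2l; first by rewrite exprn_ge0 //; lra.
have /andP[W0 W1] := hW t (ins t ht).
have [h1 _] := key t (ins t ht).
apply: (@le_trans _ _ (96 / c ^+ 2 * (th * expR (4 * bubble c t)))); last first.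
  rewrite le_eqVlt; apply/orP; left; apply/eqP; rewrite expR4_bubble //.
  have cn : c != 0 by rewrite gt_eqF.
  have Dn : c + t ^+ 2 != 0 by rewrite gt_eqF // ltr_wpDr // sqr_ge0.
  by field; rewrite cn Dn.
apply: ler_pM W0 (expR_ge0 _) W1 _.
rewrite /th -expRD ler_expR.
have st2 : s ^+ 2 <= t ^+ 2 by rewrite lerXn2r // ?nnegrE; lra.
have eta : w 0 + 8 / c <= 0 by lra.
have := ler_wnM2l eta st2; lra.
Qed.

Lemma cauchy_seq_cvg (R : realType) (x : nat -> R) :
  (forall e : R, 0 < e -> exists N : nat, forall m n : nat, (N <= m)%N -> (N <= n)%N ->
     `|x m - x n| <= e) -> exists l : R, x n @[n --> \oo] --> l.
Proof.
move=> hx; suff H : x n @[n --> \oo] --> lim (x n @[n --> \oo]) by eexists; exact: H.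
apply/cauchy_cvgP/cauchy_ballP => e e0.
have [N hN] := hx (e / 2) (divr_gt0 e0 (ltr0Sn _ 1)).
pose Q := [set y | exists2 m : nat, (N <= m)%N & y = x m].
exists (Q, Q) => [|[_ _] /= [[m Nm ->] [n Nn ->]]].
  by split; exists N => // n /= Nn; exists n.
rewrite -ball_normE /=; apply: le_lt_trans (hN m n Nm Nn) _.
by rewrite ltr_pdivrMr // ltr_pMr // ltr1n.
Qed.

Lemma near_le_expR (R : realType) (M : nat -> R) (del r : R) :
  M n @[n --> \oo] --> +oo -> 0 < del -> \forall n \near \oo, r < del * expR (M n).
Proof.
move=> hM d0; move/cvgryPge : hM => /(_ (r / del)) hM.
near=> n; rewrite mulrC -ltr_pdivrMr //.
have h : r / del <= M n by near: n; exact: hM.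
by apply: lt_le_trans (expR_ge1Dx _); rewrite ltr_pwDl.
Unshelve. all: by end_near.
Qed.

(** Interchange of limits: up to a uniformly small tail, [P n (del * expR (M n))] is [P n r] for a
    fixed large [r], hence close to [Phi r]. Its limit is therefore that of [Phi], the same for
    every [del]. *)
Lemma mass_limit (R : realType) (M : nat -> R) (P : nat -> R -> R) (Phi : R -> R) :
  M n @[n --> \oo] --> +oo ->
  (forall r : R, 0 < r -> P n r @[n --> \oo] --> Phi r) ->
  (forall del e : R, 0 < del < 1 -> 0 < e -> exists2 R0 : R, 0 < R0 &
     \forall n \near \oo, forall s r : R, R0 <= s <= r -> r <= del * expR (M n) ->
     `|P n r - P n s| <= e) ->
  exists A : R, Phi r @[r --> +oo] --> A /\
    forall del : R, 0 < del < 1 -> P n (del * expR (M n)) @[n --> \oo] --> A.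
Proof.
move=> hM hPhi htail.
have near1 (del e : R) : 0 < del < 1 -> 0 < e -> exists2 R0 : R, 0 < R0 & forall r, R0 <= r ->
    \forall n \near \oo, `|P n (del * expR (M n)) - Phi r| <= e.
  move=> hd e0; have e2 : 0 < e / 2 by exact: divr_gt0.
  have [R0 R00 hR] := htail del (e / 2) hd e2.
  have [d0 _] := andP hd; exists R0 => // r R0r; near=> n.
  have h1 : `|Phi r - P n r| <= e / 2.
    near: n; have /hPhi/cvgrPdist_le : 0 < r by exact: lt_le_trans R0r.
    by apply.
  have h2 : r < del * expR (M n) by near: n; exact: near_le_expR.
  have h3 : `|P n (del * expR (M n)) - P n r| <= e / 2.
    have h4 : forall s r : R, R0 <= s <= r -> r <= del * expR (M n) -> `|P n r - P n s| <= e / 2.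
      by near: n; exact: hR.
    by apply: h4; rewrite ?lexx // R0r ltW.
  move: h1 h3; rewrite !ler_norml => /andP[? ?] /andP[? ?]; apply/andP; split; lra.
have cvg (del : R) : 0 < del < 1 -> exists A : R,
    P n (del * expR (M n)) @[n --> \oo] --> A.
  move=> hd; apply: cauchy_seq_cvg => e e0; have e2 : 0 < e / 2 by exact: divr_gt0.
  have [R0 R00 /(_ _ (lexx _))[N _ hN]] := near1 del _ hd e2.
  exists N => m n /hN /= hm /hN /= hn.
  move: hm hn; rewrite !ler_norml => /andP[? ?] /andP[? ?]; apply/andP; split; lra.
have lim (del A : R) : 0 < del < 1 -> P n (del * expR (M n)) @[n --> \oo] --> A ->
    Phi r @[r --> +oo] --> A.
  move=> hd hA; apply/cvgrPdist_le => e e0; have e2 : 0 < e / 2 by exact: divr_gt0.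
  have [R0 R00 hR] := near1 del _ hd e2.
  near=> r; have R0r : R0 <= r by near: r; apply: nbhs_pinfty_ge; rewrite num_real.
  have /cvgrPdist_le/(_ _ e2) hA2 := hA.
  near \oo => n.
  have h1 : `|P n (del * expR (M n)) - Phi r| <= e / 2 by near: n; exact: hR.
  have h2 : `|A - P n (del * expR (M n))| <= e / 2 by near: n.
  move: h1 h2; rewrite !ler_norml => /andP[? ?] /andP[? ?]; apply/andP; split; lra.
have h2 : 0 < (2^-1 : R) < 1 by apply/andP; split; lra.
have [A hA] := cvg _ h2; have hPA := lim _ _ h2 hA.
exists A; split => // del hd; have [B hB] := cvg _ hd.
by rewrite (cvg_unique _ hPA (lim _ _ hd hB)).
Unshelve. all: by end_near.
Qed.

Lemma radsol_P_dist (R : realType) (rho e : R) (g1 a1 w1 P1 f1 g2 a2 w2 P2 f2 : R -> R) :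
  radsol rho g1 a1 w1 P1 f1 -> radsol rho g2 a2 w2 P2 f2 ->
  (forall r : R, 0 < r < rho -> `|f1 r - f2 r| <= e) ->
  forall r : R, 0 <= r < rho -> `|P1 r - P2 r| <= e * r ^+ 4 / 4.
Proof.
move=> h1 h2 hf r /andP[r0 rr]; have hz := radsol_sub h1 h2.
have ins (t : R) : 0 < t < r -> 0 < t < rho by move=> /andP[-> tr]; exact: lt_trans rr.
have r0r : 0 <= r <= r by rewrite r0 lexx.
have [u1 _ _ _] := radsol_le hz rr (fun t ht => ler_normlW (hf t (ins t ht))) r0r.
have lo (t : R) : 0 < t < r -> - e <= f1 t - f2 t.
  by move=> /ins/hf; rewrite ler_norml => /andP[].
have [u2 _ _ _] := radsol_ge hz rr lo r0r.
by rewrite ler_norml u1 andbT; lra.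
Qed.

Lemma dist_le_norm (R : realType) (x y e : R) : 0 <= x -> `|- x - y| <= e -> `|y| <= x + e.
Proof. by move=> x0; rewrite !ler_norml => /andP[? ?]; apply/andP; split; lra. Qed.

Lemma radsol_bounded (R : realType) (rho r k : R) (g a w P f : R -> R) :
  radsol rho g a w P f -> 1 <= r -> r < rho ->
  (forall t : R, 0 < t < r -> 0 <= f t <= 2) -> g 0 = 0 -> `|w 0| <= k ->
  [/\ `|g r| <= (k + 1) * r ^+ 6, `|w r| <= (k + 1) * r ^+ 6 & `|a r| <= (k + 1) * r ^+ 6].
Proof.
move=> hs r1 rr hf g0 wk.
have fl (t : R) : 0 < t < r -> 0 <= f t by move=> /hf /andP[].
have fu (t : R) : 0 < t < r -> f t <= 2 by move=> /hf /andP[].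
have r0 : 0 <= r by lra.
have r0r : 0 <= r <= r by rewrite r0 lexx.
have [_ hw1 ha1 hg1] := radsol_ge hs rr fl r0r.
have [_ hw2 ha2 hg2] := radsol_le hs rr fu r0r.
have X1 : 1 <= r ^+ 6 by exact: exprn_ege1.
have r2X : r ^+ 2 <= r ^+ 6 by rewrite ler_weXn2l.
have r4X : r ^+ 4 <= r ^+ 6 by rewrite ler_weXn2l.
have r20 : 0 <= r ^+ 2 by exact: exprn_ge0.
have r40 : 0 <= r ^+ 4 by exact: exprn_ge0.
move: X1 r2X r4X r20 r40 hw1 hw2 ha1 ha2 hg1 hg2; rewrite g0.
move: (r ^+ 6) (r ^+ 4) (r ^+ 2) (g r) (w r) (a r) (w 0) wk => X Y Z G W A w0 wk.
move=> X1 ZX YX Z0 Y0 hw1 hw2 ha1 ha2 hg1 hg2.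
have k0 : 0 <= k by exact: le_trans wk.
have wX (y : R) : 0 <= y <= X -> - (k * X) <= w0 * y <= k * X.
  by move=> /andP[y0 yX]; rewrite -ler_norml normrM; apply: ler_pM => //; rewrite ger0_norm.
have := wX 1; rewrite ler01 X1 mulr1 => /(_ isT) /andP[? ?].
have := wX Y; rewrite Y0 YX => /(_ isT) /andP[? ?].
have := wX Z; rewrite Z0 ZX => /(_ isT) /andP[? ?].
have kX0 : 0 <= k * X by apply: mulr_ge0 => //; lra.
by split; rewrite ler_norml; apply/andP; split; lra.
Qed.

Lemma expR_mul_le (R : realType) (x y k A : R) : 0 < k -> 0 < A ->
  expR (4 * x) * (k * expR y) ^+ 4 <= A -> x <= ln (A / k ^+ 4) / 4 - y.
Proof.
move=> k0 A0; rewrite exprMn mulrCA mulrC -expRM_natl -expRD -ler_pdivlMr ?exprn_gt0 //.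
have B0 : 0 < A / k ^+ 4 by apply: divr_gt0 => //; exact: exprn_gt0.
rewrite -{1}(lnK B0) ler_expR; lra.
Qed.

(** At half of the outer radius [k * r ^ 2] is of order [exp (2 * M)], which beats both [M] and the
    logarithm of the bubble; [a] is nonnegative there because [r ^ 2 >= 16 / e] gives
    [k * (c + r ^ 2) >= 8]. *)
Lemma lower_large (R : realType) (c e C : R) : 0 < c -> 0 < e -> exists A : R,
  forall M k : R, A <= M -> e / 2 <= k -> let r := 2^-1 * expR M in
  0 <= - (2 * r ^+ 4) / (c + r ^+ 2) + k * r ^+ 4 / 4 /\
  C - M < bubble c r + k * r ^+ 2 / 8.
Proof.
move=> c0 e0; pose L := ln (c / (c + 1)).
exists (16 / e + 4 + 64 * (`|C| + `|L| + 2) / e) => M k AM ek r.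
have p1 : 0 <= 16 / e by apply: divr_ge0 => //; exact: ltW.
have p2 : 0 <= 64 * (`|C| + `|L| + 2) / e.
  by apply: divr_ge0; [apply: mulr_ge0 => //; rewrite !addr_ge0|exact: ltW].
have M8 : 16 / e <= M by lra.
have M4 : 4 <= M by lra.
have MC : 64 * (`|C| + `|L| + 2) / e <= M by lra.
have {AM p2} M0 : 0 <= M by lra.
have EM : 1 + M <= expR M by exact: expR_ge1Dx.
have r0 : 0 < r by rewrite /r; apply: mulr_gt0 => //; exact: expR_gt0.
have rM : M / 2 <= r by rewrite /r; lra.
have r20 : 0 < r ^+ 2 by exact: exprn_gt0.
have r2M : M ^+ 2 / 4 <= r ^+ 2.
  have -> : M ^+ 2 / 4 = (M / 2) ^+ 2 by field.
  by rewrite !expr2; apply: ler_pM => //; lra.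
have r2e : 16 / e <= r ^+ 2 by have := ler_pM p1 (ler0n _ 4) M8 M4; lra.
have rE : r ^+ 2 <= expR (2 * M).
  have rE : r <= expR M by rewrite /r; lra.
  by rewrite expRM_natl !expr2; apply: ler_pM => //; exact: ltW.
have r4 : r ^+ 4 = r ^+ 2 * r ^+ 2 by ring.
have hb : L - 2 * M <= bubble c r.
  have -> : 2 * M = ln (expR (2 * M)) by rewrite expRK.
  have E0 : 0 < expR (2 * M) by exact: expR_gt0.
  have E1 : 1 <= expR (2 * M) by rewrite -expR0 ler_expR mulr_ge0.
  move: (expR _) rE E0 E1 => E rE E0 E1.
  have c1 : 0 < c + 1 by lra.
  have D0 : 0 < c + r ^+ 2 by lra.
  rewrite /L -ln_div ?posrE ?divr_gt0 // /bubble ler_ln ?posrE ?divr_gt0 //.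
  rewrite -mulrA ler_pM2l // -invfM lef_pV2 ?posrE ?mulr_gt0 //.
  have := ler_wpM2l (ltW c0) E1; lra.
move: hb rE; move: (bubble c r) => B hb rE.
have {}ek0 : 0 < k by lra.
move: r20 r2M r2e r4; move: (r ^+ 2) (r ^+ 4) => s _ s0 sM se ->.
split.
  have D0 : 0 < c + s by lra.
  have -> : - (2 * (s * s)) / (c + s) + k * (s * s) / 4 = s * s * (k * (c + s) / 4 - 2) / (c + s).
    by field; rewrite gt_eqF.
  apply: divr_ge0; last exact: ltW.
  apply: mulr_ge0; first by apply: mulr_ge0; exact: ltW.
  have h3 : 16 <= s * e by move: se; rewrite ler_pdivrMr.
  have h4 := ler_wpM2r (ltW s0) ek; have h5 := mulr_gt0 ek0 c0; lra.
have h6 := ler_wpM2r (ltW s0) ek.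
have h7 : M * (64 * (`|C| + `|L| + 2)) <= M * M * e.
  by move: MC; rewrite ler_pdivrMr // => MC; rewrite -mulrA; exact: ler_wpM2l.
have h8 := ler_wpM2l (ltW e0) sM.
have h9 : `|C| <= M * `|C| by rewrite ler_peMl //; lra.
have h10 : `|L| <= M * `|L| by rewrite ler_peMl //; lra.
have h11 := ler_norm C; have h12 : - L <= `|L| by rewrite -normrN ler_norm.
lra.
Qed.

(** * Families of rescaled profiles on balls of radius [expR (M n)] *)

Section blowup.
Context {R : realType}.
Variables (M : nat -> R) (W g a w P : nat -> R -> R).
Hypotheses (hM : M n @[n --> \oo] --> +oo)
  (hs : forall n, radsol (expR (M n)) (g n) (a n) (w n) (P n)
     (fun r => W n r * expR (4 * g n r)))
  (g0 : forall n, g n 0 = 0)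
  (hW : forall del e : R, 0 < del < 1 -> 0 < e ->
     \forall n \near \oo, forall r : R, 0 < r < del * expR (M n) -> `|W n r - 1| <= e).

Let hsd (del : R) (n : nat) : del <= 1 -> radsol (del * expR (M n)) (g n) (a n) (w n) (P n)
  (fun r => W n r * expR (4 * g n r)).
Proof. by move=> d1; apply: radsol_restrict (hs n); rewrite ler_piMl ?expR_ge0. Qed.

Let nearM (A : R) : \forall n \near \oo, A <= M n.
Proof. by move/cvgryPge : hM; apply. Qed.

Let W_bounds (del e : R) : 0 < del < 1 -> 0 < e ->
  \forall n \near \oo, forall r : R, 0 < r < del * expR (M n) -> 1 - e <= W n r <= 1 + e.
Proof.
move=> hd e0; apply: filterS (hW hd e0) => n h r /h.
by rewrite ler_norml => /andP[? ?]; apply/andP; split; lra.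
Qed.

Let f_ge (del : R) : 0 < del < 1 -> \forall n \near \oo,
  forall r : R, 0 < r < del * expR (M n) -> expR (4 * g n r) / 2 <= W n r * expR (4 * g n r).
Proof.
move=> hd; have e0 : (0 : R) < 2^-1 by lra.
apply: filterS (W_bounds hd e0) => n h r /h /andP[h1 _].
by rewrite mulrC ler_wpM2r ?expR_ge0 //; lra.
Qed.

Let f_ge0 (del : R) : 0 < del < 1 -> \forall n \near \oo,
  forall r : R, 0 < r < del * expR (M n) ->
  0 <= W n r * expR (4 * g n r) <= 2 * expR (4 * g n r).
Proof.
move=> hd; apply: filterS (W_bounds hd (ltr01)) => n h r /h /andP[h1 h2].
by rewrite mulr_ge0 ?expR_ge0 ?ler_wpM2r ?expR_ge0 //=; lra.
Qed.

(** A fraction [k] of the outer radius is left beyond [del * expR (M n)], so the explosion bound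
    reads [exp (4 * g) * exp (4 * M) <= constant]. *)
Lemma blowup_apriori (del : R) : 0 < del < 1 -> exists C : R, \forall n \near \oo,
  0 <= a n (del * expR (M n)) -> g n (del * expR (M n)) <= C - M n.
Proof.
move=> /andP[d0 d1]; pose k := (1 - del) / 2.
have k0 : 0 < k by rewrite /k; lra.
(* A fraction strictly between [del + k = (1 + del) / 2] and [1]. *)
have hd : 0 < (3 + del) / 4 < 1 by apply/andP; split; lra.
exists (ln (24 * 16 * 16 / k ^+ 4) / 4).
apply: filterS (f_ge hd) => n hf a0; have E0 : 0 < expR (M n) by exact: expR_gt0.
have := radsol_apriori (hsd n (ltW (andP hd).2)) hf (mulr_gt0 d0 E0) (mulr_gt0 k0 E0) _ a0.
rewrite -mulrDl ltr_pM2r // => /(_ ltac:(rewrite /k; lra)).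
by apply: expR_mul_le.
Qed.

(** Away from the outer boundary a value above [g n 0 = 0] would obey the explosion bound
    [g <= constant - M n], which is nonpositive for large [n]. *)
Lemma blowup_le0 (del : R) : 0 < del < 1 -> \forall n \near \oo,
  forall r : R, 0 <= r <= del * expR (M n) -> g n r <= 0.
Proof.
move=> /andP[d0 d1]; pose k := (1 - del) / 2.
have k0 : 0 < k by rewrite /k; lra.
have hd : 0 < (3 + del) / 4 < 1 by apply/andP; split; lra.
near=> n => r /andP[r0 rd]; have E0 : 0 < expR (M n) by exact: expR_gt0.
have hf : forall r : R, 0 < r < (3 + del) / 4 * expR (M n) ->
   expR (4 * g n r) / 2 <= W n r * expR (4 * g n r) by near: n; exact: f_ge.
have := radsol_max (hsd n (ltW (andP hd).2)) hf r0 (mulr_gt0 k0 E0) _.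
case => [||]; [|by rewrite g0|].
  apply: (@le_lt_trans _ _ ((del + k) * expR (M n))); first by rewrite mulrDl lerD2r.
  by rewrite ltr_pM2r //; rewrite /k; lra.
have A0 : 0 < 24 * 16 * 16 :> R by rewrite !mulr_gt0.
move=> /(expR_mul_le k0 A0).
have : ln (24 * 16 * 16 / k ^+ 4) <= M n by near: n; exact: nearM.
have : 0 <= M n by near: n; exact: nearM.
lra.
Unshelve. all: by end_near.
Qed.

Let sq : R := Num.sqrt 96.
Let sq0 : 0 < sq. Proof. by rewrite sqrtr_gt0. Qed.
Let sq2 : sq ^+ 2 = 96. Proof. by rewrite sqr_sqrtr. Qed.

(** Otherwise a bubble with [c] slightly above [sqrt 96], whose weight is below 1, lies under [g n]
    by a quadratic amount. At half of the outer radius [g n] is then increasing and large, against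
    [blowup_apriori]. *)
Lemma blowup_laplacian (e : R) : 0 < e -> \forall n \near \oo, w n 0 <= - (8 / sq) + e.
Proof.
move=> e0; have bs0 : 0 < 8 / sq by exact: divr_gt0.
have q34 : 2^-1 < 3 / 4 :> R by lra.
pose e1 := Num.min e (8 / sq).
have e10 : 0 < e1 by rewrite lt_min e0.
have e1e : e1 <= e by rewrite ge_min lexx.
have e1b : e1 <= 8 / sq by rewrite ge_min lexx orbT.
(* Half of [e1] makes the weight [96 / c ^ 2] smaller than 1, the other half is the gap between the
   data; [e1 <= 8 / sq] keeps [c] positive. *)
pose c := 8 / (8 / sq - e1 / 2).
have D0 : 0 < 8 / sq - e1 / 2 by lra.
have c0 : 0 < c by exact: divr_gt0.
have ec : 8 / c = 8 / sq - e1 / 2 by rewrite /c invf_div mulrC divfK.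
have csq : sq < c.
  by rewrite /c ltr_pdivlMr // mulrBr mulrC divfK ?gt_eqF // gtrBl mulr_gt0 // divr_gt0.
have c96 : 96 / c ^+ 2 < 1.
  have h : sq ^+ 2 < c ^+ 2 by rewrite !expr2; apply: ltr_pM => //; exact: ltW.
  by rewrite ltr_pdivrMr ?exprn_gt0 // mul1r -sq2.
have hd : 0 < (2^-1 : R) < 1 by apply/andP; split; lra.
have hd' : 0 < (3 / 4 : R) < 1 by apply/andP; split; lra.
have [C hC] := blowup_apriori hd.
have [A hA] := lower_large C c0 e10.
have ec0 : 0 < 1 - 96 / c ^+ 2 by lra.
near=> n; rewrite leNgt; apply/negP => wn.
have wc : e1 / 2 <= w n 0 + 8 / c by rewrite ec; lra.
have Wn : forall r : R, 0 < r < 3 / 4 * expR (M n) -> 96 / c ^+ 2 <= W n r.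
  near: n; apply: filterS (W_bounds hd' ec0) => n h r /h /andP[+ _]; lra.
have w8 : - (8 / c) < w n 0 by lra.
have E0 : 0 < expR (M n) by exact: expR_gt0.
have hr0 : 0 < 2^-1 * expR (M n) < 3 / 4 * expR (M n) by rewrite mulr_gt0 //= ltr_pM2r.
have [h1 h2] := sol_lower c0 (hsd n (ltW (andP hd').2)) Wn (g0 n) w8 hr0.
have AM : A <= M n by near: n; exact: nearM.
have [h3 h4] := hA _ _ AM wc.
have a0 := le_trans h3 h2.
have hg : g n (2^-1 * expR (M n)) <= C - M n by move: a0; near: n; exact: hC.
by have := lt_le_trans h4 (le_trans h1 hg); rewrite ltxx.
Unshelve. all: by end_near.
Qed.

Let near_ball (del r : R) : 0 < del -> \forall n \near \oo, r < del * expR (M n).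
Proof. exact: near_le_expR. Qed.

Lemma blowup_cauchy (q r : R) : w n 0 @[n --> \oo] --> q -> 0 < r ->
  forall e : R, 0 < e -> exists N : nat, forall m n : nat, (N <= m)%N -> (N <= n)%N ->
    [/\ `|g m 0 - g n 0| <= e, `|w m 0 - w n 0| <= e &
       forall t : R, 0 < t < r ->
       `|W m t * expR (4 * g m t) - W n t * expR (4 * g n t)| <= e].
Proof.
move=> hw r0; have hd : 0 < (2^-1 : R) < 1 by apply/andP; split; lra.
have [d0 _] := andP hd.
apply: (@radsol_cauchy R r 0 0 q W g a w P (ltW r0)) => //.
- near=> n; apply: radsol_restrict (hs n).
  apply: (@le_trans _ _ (2^-1 * expR (M n))); last by rewrite ler_piMl ?expR_ge0 //; lra.
  by apply: ltW; near: n; exact: near_ball.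
- move=> e e0; near=> n => t /andP[t0 tr].
  have h : forall t : R, 0 < t < 2^-1 * expR (M n) -> `|W n t - 1| <= e by near: n; exact: hW.
  apply: h; rewrite t0 (lt_trans tr) //; near: n; exact: near_ball.
- by under eq_fun do rewrite g0; exact: cvg_cst.
- near=> n => t /andP[t0 tr].
  have h : forall t : R, 0 <= t <= 2^-1 * expR (M n) -> g n t <= 0 by near: n; exact: blowup_le0.
  apply: h; rewrite ltW //= ltW // (lt_trans tr) //; near: n; exact: near_ball.
Unshelve. all: by end_near.
Qed.

Lemma blowup_Phi (q : R) : w n 0 @[n --> \oo] --> q ->
  exists Phi : R -> R, forall r : R, 0 < r -> P n r @[n --> \oo] --> Phi r.
Proof.
move=> hw.
have H (r : R) : 0 < r -> exists l : R, P n r @[n --> \oo] --> l.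
  move=> r0; apply: cauchy_seq_cvg => e e0.
  have r1 : 0 < r + 1 by lra.
  have e1 : 0 < 4 * e / r ^+ 4 by apply: divr_gt0; [lra|exact: exprn_gt0].
  have [N hN] := blowup_cauchy hw r1 e1.
  have [N' _ hN'] := near_ball (r + 1) ltr01.
  exists (maxn N N') => m n; rewrite !geq_max => /andP[Nm N'm] /andP[Nn N'n].
  have [_ _ hf] := hN m n Nm Nn.
  have sm : radsol (r + 1) (g m) (a m) (w m) (P m) (fun r => W m r * expR (4 * g m r)).
    by apply: radsol_restrict (hs m); have := hN' m N'm; rewrite /= mul1r; exact: ltW.
  have sn : radsol (r + 1) (g n) (a n) (w n) (P n) (fun r => W n r * expR (4 * g n r)).
    by apply: radsol_restrict (hs n); have := hN' n N'n; rewrite /= mul1r; exact: ltW.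
  have rr : 0 <= r < r + 1 by apply/andP; split; lra.
  have := radsol_P_dist sm sn hf rr.
  by have -> : 4 * e / r ^+ 4 * r ^+ 4 / 4 = e by field; rewrite gt_eqF.
have /boolp.choice[Phi hPhi] : forall r : R, exists l : R, 0 < r -> P n r @[n --> \oo] --> l.
  move=> r; have [/H[l hl]|r0] := ltP 0 r; first by exists l.
  by exists 0.
by exists Phi.
Qed.

Let P_mono (del : R) : 0 < del < 1 -> \forall n \near \oo, forall s r : R,
  0 <= s <= r -> r < del * expR (M n) -> P n s <= P n r.
Proof.
move=> hd; apply: filterS (f_ge0 hd) => n hf s r sr rr.
apply: (radsol_P_homo (hsd n (ltW (andP hd).2)) _ sr rr) => t ht.
by have /andP[] := hf t ht.
Qed.

Let sub_hyp (c del : R) : 0 < c < sq -> 0 < del < 1 -> \forall n \near \oo,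
  forall r : R, 0 < r < del * expR (M n) -> 0 <= W n r <= 96 / c ^+ 2.
Proof.
move=> /andP[c0 csq] hd.
have h : c ^+ 2 < sq ^+ 2 by rewrite !expr2; apply: ltr_pM => //; exact: ltW.
have c96 : 1 < 96 / c ^+ 2 by rewrite ltr_pdivlMr ?exprn_gt0 // mul1r -sq2.
pose e := Num.min 1 (96 / c ^+ 2 - 1).
have e0 : 0 < e by rewrite lt_min ltr01 subr_gt0.
have e1 : e <= 1 by rewrite ge_min lexx.
have e2 : e <= 96 / c ^+ 2 - 1 by rewrite ge_min lexx orbT.
apply: filterS (W_bounds hd e0) => n h1 r /h1 /andP[? ?]; apply/andP; split; lra.
Qed.

Lemma blowup_sub (c del : R) : 0 < c < sq -> 0 < del < 1 ->
  (\forall n \near \oo, w n 0 < - (8 / c)) ->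
  \forall n \near \oo, forall s r : R, 0 < s <= r -> r <= del * expR (M n) ->
  [/\ g n r <= bubble c r + (w n 0 + 8 / c) * r ^+ 2 / 8, P n s <= P n r,
      P n r - P n s <= 24 * c ^+ 2 / s ^+ 2 ^+ 2 &
      P n r <= bubble_mass c s + expR ((w n 0 + 8 / c) * s ^+ 2 / 2) * (8 - bubble_mass c s)].
Proof.
move=> hc hd hw; have [c0 csq] := andP hc; have [d0 d1] := andP hd.
(* The comparison is made on a larger ball, so that the closed range [r <= del * expR (M n)] lies
   inside. *)
have hd' : 0 < (1 + del) / 2 < 1 by apply/andP; split; lra.
near=> n => s r /andP[s0 sr] rd.
have E0 : 0 < expR (M n) by exact: expR_gt0.
have rd' : r < (1 + del) / 2 * expR (M n).
  by apply: le_lt_trans rd _; rewrite ltr_pM2r //; lra.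
have Wn : forall r : R, 0 < r < (1 + del) / 2 * expR (M n) -> 0 <= W n r <= 96 / c ^+ 2.
  by near: n; exact: sub_hyp.
have wn : w n 0 < - (8 / c) by near: n; exact: hw.
have hsn := hsd n (ltW (andP hd').2).
have key := sol_upper c0 hsn Wn (g0 n) wn.
have hr : 0 < r < (1 + del) / 2 * expR (M n) by rewrite rd' andbT; exact: lt_le_trans sr.
have s0r : 0 <= s <= r by rewrite ltW.
split.
- by have [] := key r hr.
- have h : forall s r : R, 0 <= s <= r -> r < (1 + del) / 2 * expR (M n) -> P n s <= P n r.
    by near: n; exact: P_mono.
  exact: h.
- have hb := radsol_bubble ((1 + del) / 2 * expR (M n)) c0.
  have := radsol_P_sub hsn hb (fun t ht => (key t ht).2) s0r rd'.
  have := bubble_mass_tail c0 s0; have := bubble_mass_le r c0; rewrite /bubble_mass; lra.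
- have s0r' : 0 < s <= r by rewrite s0.
  have := upper_mass c0 hsn Wn (g0 n) wn s0r' rd'.
  move/le_trans; apply; rewrite lerD2l ler_wpM2l ?expR_ge0 // lerD2r.
  exact: bubble_mass_le.
Unshelve. all: by end_near.
Qed.

Lemma blowup_sub_tail (c del e : R) : 0 < c < sq -> 0 < del < 1 -> 0 < e ->
  (\forall n \near \oo, w n 0 < - (8 / c)) -> exists2 R0 : R, 0 < R0 &
  \forall n \near \oo, forall s r : R, R0 <= s <= r -> r <= del * expR (M n) ->
  `|P n r - P n s| <= e.
Proof.
move=> hc hd e0 hw; have [c0 csq] := andP hc.
have p0 : 0 < 24 * c ^+ 2 / e by apply: divr_gt0 => //; apply: mulr_gt0 => //; exact: exprn_gt0.
exists (1 + 24 * c ^+ 2 / e); first by lra.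
apply: filterS (blowup_sub hc hd hw) => n h s r /andP[R0s sr] rd.
have s0 : 0 < s by lra.
have s0r : 0 < s <= r by rewrite s0.
have [_ h1 h2 _] := h s r s0r rd; rewrite ger0_norm ?subr_ge0 //.
have s1 : 1 <= s by lra.
have s2 : s <= s ^+ 2 by rewrite expr2 ler_peMr //; lra.
have s4 : s ^+ 2 <= s ^+ 2 ^+ 2 by rewrite (expr2 (s ^+ 2)) ler_peMr //; lra.
have h3 : 24 * c ^+ 2 / e <= s ^+ 2 ^+ 2 by lra.
apply: le_trans h2 _; rewrite ler_pdivrMr; last by lra.
by move: h3; rewrite ler_pdivrMr // (mulrC e).
Qed.

(** The mass within a small radius [s] is below that of a fixed bubble, and the mass beyond carries
    the factor [exp ((w n 0 + 8 / c) * s ^ 2 / 2)] of [upper_mass], which tends to [0]. *)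
Lemma blowup_oo : - w n 0 @[n --> \oo] --> +oo ->
  (forall r : R, 0 < r -> P n r @[n --> \oo] --> 0) /\
  (forall del : R, 0 < del < 1 -> P n (del * expR (M n)) @[n --> \oo] --> 0).
Proof.
move=> /cvgryPge hw.
have hc : 0 < sq / 2 < sq by rewrite divr_gt0 //= ltr_pdivrMr // ltr_pMr // ltr1n.
have [c0 _] := andP hc; move: (sq / 2) hc c0 => c hc c0.
have wc : \forall n \near \oo, w n 0 < - (8 / c).
  by apply: filterS (hw (8 / c + 1)) => n; lra.
have key (del e : R) : 0 < del < 1 -> 0 < e -> \forall n \near \oo,
    forall r : R, 0 < r <= del * expR (M n) -> 0 <= P n r <= e.
  move=> hd e0; have e2 : 0 < e / 2 by lra.
  pose s := Num.min 1 (e / 2 / (24 / c ^+ 2)).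
  have D0 : 0 < 24 / c ^+ 2 by apply: divr_gt0 => //; exact: exprn_gt0.
  have s0 : 0 < s by rewrite lt_min ltr01 divr_gt0.
  have s1 : s <= 1 by rewrite ge_min lexx.
  have sm : bubble_mass c s <= e / 2.
    apply: le_trans (bubble_mass_small s c0) _.
    have h : s <= e / 2 / (24 / c ^+ 2) by rewrite ge_min lexx orbT.
    move: h; rewrite ler_pdivlMr // => h; apply: le_trans h.
    have -> : 24 * s ^+ 4 / c ^+ 2 = s ^+ 4 * (24 / c ^+ 2) by ring.
    apply: ler_wpM2r; first exact: ltW.
    by rewrite exprS ler_piMr // ?exprn_ile1 // ltW.
  have s20 : 0 < s ^+ 2 by exact: exprn_gt0.
  have [d0 d1] := andP hd.
  near=> n => r /andP[r0 rd].
  have sub : forall s r : R, 0 < s <= r -> r <= del * expR (M n) ->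
    [/\ g n r <= bubble c r + (w n 0 + 8 / c) * r ^+ 2 / 8, P n s <= P n r,
      P n r - P n s <= 24 * c ^+ 2 / s ^+ 2 ^+ 2 &
      P n r <= bubble_mass c s + expR ((w n 0 + 8 / c) * s ^+ 2 / 2) * (8 - bubble_mass c s)].
    by near: n; exact: blowup_sub.
  have mono : forall s r : R, 0 <= s <= r -> r < del * expR (M n) -> P n s <= P n r.
    by near: n; exact: P_mono.
  have P0 : P n 0 = 0 by exact: rs_P00 (hs n).
  have sd : s < del * expR (M n) by near: n; exact: near_ball.
  have wn : 8 / c + 2 * (16 / e) / s ^+ 2 <= - w n 0 by near: n; exact: hw.
  have E : expR ((w n 0 + 8 / c) * s ^+ 2 / 2) <= e / 16.
    have e16 : 0 < 16 / e by exact: divr_gt0.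
    have h : (w n 0 + 8 / c) * s ^+ 2 / 2 <= - (16 / e).
      have : w n 0 + 8 / c <= - (2 * (16 / e)) / s ^+ 2 by rewrite mulNr; lra.
      by rewrite ler_pdivlMr // => h; lra.
    apply: (@le_trans _ _ (expR (- (16 / e)))); first by rewrite ler_expR.
    rewrite expRN -[leRHS]invrK lef_pV2 ?posrE ?expR_gt0 ?invr_gt0 ?divr_gt0 // invf_div.
    by apply: le_trans (expR_ge1Dx _); rewrite lerDr.
  (* The bound concerns radii at least [s]; smaller ones follow because [P n] is nondecreasing. *)
  have Ps : P n (Num.max s r) <= e.
    have hm : 0 < s <= Num.max s r by rewrite s0 le_max lexx.
    have hm2 : Num.max s r <= del * expR (M n) by rewrite ge_max rd ltW.
    have [_ _ _ h] := sub _ _ hm hm2; apply: le_trans h _.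
    have b8 : 8 - bubble_mass c s <= 8 by have := bubble_mass_ge0 s c0; lra.
    have b0 : 0 <= 8 - bubble_mass c s by have := bubble_mass_le s c0; lra.
    by have := ler_pM (expR_ge0 _) b0 E b8; lra.
  apply/andP; split.
    have r20 : 0 <= r / 2 <= r by apply/andP; split; lra.
    have r2 : 0 < r / 2 <= r by apply/andP; split; lra.
    have [_ h _ _] := sub _ _ r2 rd; apply: le_trans h.
    by rewrite -P0; apply: mono; [rewrite lexx; lra|lra].
  apply: le_trans Ps.
  have hm : 0 < r <= Num.max s r by rewrite r0 le_max lexx orbT.
  have hm2 : Num.max s r <= del * expR (M n) by rewrite ge_max rd ltW.
  by have [] := sub _ _ hm hm2.
have h2 : 0 < (2^-1 : R) < 1 by apply/andP; split; lra.
split=> [r r0|del hd]; apply/cvgrPdist_le => e e0; near=> n; rewrite sub0r normrN.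
  have kn : forall r : R, 0 < r <= 2^-1 * expR (M n) -> 0 <= P n r <= e.
    by near: n; exact: key.
  have /andP[? ?] : 0 <= P n r <= e.
    by apply: kn; rewrite r0 ltW //; near: n; apply: near_ball; lra.
  by rewrite ger0_norm.
have kn : forall r : R, 0 < r <= del * expR (M n) -> 0 <= P n r <= e.
  by near: n; exact: key.
have /andP[? ?] : 0 <= P n (del * expR (M n)) <= e.
  by apply: kn; rewrite lexx andbT mulr_gt0 ?expR_gt0 //; have [] := andP hd.
by rewrite ger0_norm.
Unshelve. all: by end_near.
Qed.

(** There is room for a parameter [c < sqrt 96] with [q < - (8 / c)], so a single bubble dominates
    all large indices and controls the tail, the mass and the decay. *)
Lemma blowup_subcritical (q : R) : w n 0 @[n --> \oo] --> q -> q < - (8 / sq) ->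
  exists (Phi : R -> R) (A c k : R),
  [/\ forall r : R, 0 < r -> P n r @[n --> \oo] --> Phi r,
      Phi r @[r --> +oo] --> A,
      forall del : R, 0 < del < 1 -> P n (del * expR (M n)) @[n --> \oo] --> A,
      0 < A < 8 &
      [/\ 0 < c, 0 < k & forall r : R, 0 < r -> \forall n \near \oo,
         g n r <= bubble c r - k * r ^+ 2]].
Proof.
move=> hw hq; have bs0 : 0 < 8 / sq by exact: divr_gt0.
(* Then [q + 8 / c = - 2 * d]; half of this gap is given up to have [w n 0 + 8 / c <= - d] for all
   large [n]. *)
pose d : R := (- q - 8 / sq) / 4; pose c : R := 8 / (8 / sq + 2 * d).
have d0 : 0 < d by rewrite /d; lra.
have D0 : 0 < 8 / sq + 2 * d by lra.
have c0 : 0 < c by exact: divr_gt0.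
have c8 : 8 / c = 8 / sq + 2 * d by rewrite /c invf_div mulrC divfK // gt_eqF.
have hc : 0 < c < sq.
  rewrite c0 /c ltr_pdivrMr // mulrDr mulrC divfK ?gt_eqF // ltrDl.
  by apply: mulr_gt0 => //; apply: mulr_gt0.
have wn1 : \forall n \near \oo, q - 1 <= w n 0.
  by move/cvgr_ge : hw; apply; rewrite gtrBl.
have wn2 : \forall n \near \oo, w n 0 + 8 / c <= - d.
  have hqd : q < q + d by rewrite ltrDl.
  move/cvgr_le : hw => /(_ _ hqd); apply: filterS => n; rewrite c8 /d; lra.
have wc : \forall n \near \oo, w n 0 < - (8 / c).
  by apply: filterS wn2 => n; lra.
clearbody c; clearbody d.
have [Phi hPhi] := blowup_Phi hw.
have [A [hA1 hA2]] := mass_limit hM hPhi (fun del e hd e0 => blowup_sub_tail hc hd e0 wc).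
have h2 : 0 < (2^-1 : R) < 1 by apply/andP; split; lra.
have [h20 _] := andP h2.
exists Phi, A, c, (d / 8); split => //; last first.
  split => //; first by lra.
  move=> r r0; near=> n.
  have sub : forall s r : R, 0 < s <= r -> r <= 2^-1 * expR (M n) ->
    [/\ g n r <= bubble c r + (w n 0 + 8 / c) * r ^+ 2 / 8, P n s <= P n r,
      P n r - P n s <= 24 * c ^+ 2 / s ^+ 2 ^+ 2 &
      P n r <= bubble_mass c s + expR ((w n 0 + 8 / c) * s ^+ 2 / 2) * (8 - bubble_mass c s)].
    by near: n; exact: blowup_sub.
  have rr : 0 < r <= r by rewrite r0 lexx.
  have rd : r <= 2^-1 * expR (M n).
    by apply: ltW; near: n; exact: near_ball.
  have [h _ _ _] := sub _ _ rr rd; apply: le_trans h _; rewrite lerD2l.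
  have wd : w n 0 + 8 / c <= - d by near: n; exact: wn2.
  by have := ler_wpM2r (sqr_ge0 r) wd; lra.
have hA := hA2 _ h2.
have m1 : 0 < 8 - bubble_mass c 1.
  rewrite bubble_mass_compl // expr1n; apply: divr_gt0; last by apply: exprn_gt0; lra.
  by apply: mulr_gt0; [apply: mulr_gt0 => //; exact: exprn_gt0|lra].
have E1 : expR (- d / 2) < 1 by rewrite expR_lt1; lra.
(* Positivity: on the unit ball [g n >= (q - 1) / 8], hence the density is at least
   [exp ((q - 1) / 2) / 2] and [P n 1] at least a quarter of this. The upper bound is [upper_mass]
   at [s = 1]. *)
apply/andP; split.
  have K0 : 0 < expR ((q - 1) / 2) by exact: expR_gt0.
  apply: (@lt_le_trans _ _ (expR ((q - 1) / 2) / 8)); first by lra.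
  apply: (cvgr_to_ge hA); near=> n.
  have E2 : 2 < 2^-1 * expR (M n) by near: n; exact: near_ball.
  have hf : forall r : R, 0 < r < 2^-1 * expR (M n) ->
      expR (4 * g n r) / 2 <= W n r * expR (4 * g n r) by near: n; exact: f_ge.
  have mono : forall s r : R, 0 <= s <= r -> r < 3 / 4 * expR (M n) -> P n s <= P n r.
    by near: n; apply: P_mono; apply/andP; split; lra.
  have hsn : radsol 2 (g n) (a n) (w n) (P n) (fun r => W n r * expR (4 * g n r)).
    by apply: radsol_restrict (hsd n (ltW (andP h2).2)); exact: ltW.
  have l12 : (1 : R) < 2 by lra.
  have hf0 (r : R) : 0 < r < 1 -> 0 <= W n r * expR (4 * g n r).
    move=> /andP[r0 r1]; apply: le_trans (hf r _); last by rewrite r0 /=; lra.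
    by have := expR_gt0 (4 * g n r); lra.
  have qn : q - 1 <= w n 0 by near: n; exact: wn1.
  have hf1 (r : R) : 0 < r < 1 -> expR ((q - 1) / 2) / 2 <= W n r * expR (4 * g n r).
    move=> /andP[r0 r1]; apply: le_trans (hf r _); last by rewrite r0 /=; lra.
    rewrite ler_pM2r ?invr_gt0 // ler_expR.
    have r01 : 0 <= r <= 1 by rewrite !ltW.
    have [_ _ _] := radsol_ge hsn l12 hf0 r01; rewrite g0 !mul0r addr0 add0r => hg.
    have r2 : r ^+ 2 <= 1 by rewrite expr_le1 // ltW.
    have h3 := ler_wpM2r (sqr_ge0 r) qn.
    have q1 : q - 1 <= 0 by lra.
    have := ler_wnM2l q1 r2; lra.
  have r11 : 0 <= (1 : R) <= 1 by apply/andP; split; lra.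
  have [h _ _ _] := radsol_ge hsn l12 hf1 r11; rewrite expr1n in h.
  apply: (@le_trans _ _ (P n 1)); first by lra.
  apply: mono; first by apply/andP; split; lra.
  by rewrite ltr_pM2r ?expR_gt0 //; lra.
apply: (@le_lt_trans _ _ (bubble_mass c 1 + expR (- d / 2) * (8 - bubble_mass c 1))); last first.
  by rewrite -ltrBrDl gtr_pMl.
apply: (cvgr_to_le hA); near=> n.
have sub : forall s r : R, 0 < s <= r -> r <= 2^-1 * expR (M n) ->
  [/\ g n r <= bubble c r + (w n 0 + 8 / c) * r ^+ 2 / 8, P n s <= P n r,
    P n r - P n s <= 24 * c ^+ 2 / s ^+ 2 ^+ 2 &
    P n r <= bubble_mass c s + expR ((w n 0 + 8 / c) * s ^+ 2 / 2) * (8 - bubble_mass c s)].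
  by near: n; exact: blowup_sub.
have E2 : 1 < 2^-1 * expR (M n) by near: n; exact: near_ball.
have s1 : 0 < (1 : R) <= 2^-1 * expR (M n) by rewrite ltr01 ltW.
have [_ _ _] := sub _ _ s1 (lexx _); move/le_trans; apply.
rewrite lerD2l; apply: ler_wpM2r; first exact: ltW.
rewrite ler_expR expr1n mulr1.
have : w n 0 + 8 / c <= - d by near: n; exact: wn2.
lra.
Unshelve. all: by end_near.
Qed.

(** Stability gives convergence to the bubble on bounded sets; the uniform tail estimate asked by
    [mass_limit] comes from [tail_mass], started at a radius where the bubble already has most of
    its mass. *)
Lemma blowup_critical : w n 0 @[n --> \oo] --> - (8 / sq) ->
  [/\ forall r : R, 0 < r -> P n r @[n --> \oo] --> bubble_mass sq r,
      bubble_mass sq r @[r --> +oo] --> (8 : R),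
      forall del : R, 0 < del < 1 -> P n (del * expR (M n)) @[n --> \oo] --> (8 : R) &
      forall r : R, 0 < r -> g n r @[n --> \oo] --> bubble sq r].
Proof.
move=> hw; have h2 : 0 < (2^-1 : R) < 1 by apply/andP; split; lra.
have [h20 _] := andP h2.
have hb (r : R) : radsol r (bubble sq) (fun r => - (2 * r ^+ 4) / (sq + r ^+ 2))
    (fun r => - (8 * sq + 4 * r ^+ 2) / (sq + r ^+ 2) ^+ 2) (bubble_mass sq)
    (fun r => 1 * expR (4 * bubble sq r)).
  apply: radsol_eqf (radsol_bubble r sq0) _ => t _.
  rewrite expR4_bubble // mul1r -sq2; field.
  by rewrite gt_eqF // ltr_wpDr // sqr_ge0.
(* The second family of [radsol_close] is constant, equal to the bubble, with weight 1. *)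
have close (r e : R) : 0 < r -> 0 < e -> exists N : nat, forall n, (N <= n)%N ->
    forall t : R, 0 < t < r -> `|g n t - bubble sq t| <= e /\
    `|W n t * expR (4 * g n t) - 1 * expR (4 * bubble sq t)| <= e.
  move=> r0 e0.
  have [|||||||||N hN] := @radsol_close R r 0 0 (- (8 / sq)) W g a w P
     (fun _ _ => 1) (fun _ => bubble sq) (fun _ r => - (2 * r ^+ 4) / (sq + r ^+ 2))
     (fun _ r => - (8 * sq + 4 * r ^+ 2) / (sq + r ^+ 2) ^+ 2) (fun _ => bubble_mass sq)
     _ _ _ _ _ _ _ _ _ e e0.
  - exact: ltW.
  - near=> n; apply: radsol_restrict (hs n).
    apply: (@le_trans _ _ (2^-1 * expR (M n))); last by rewrite ler_piMl ?expR_ge0 //; lra.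
    by apply: ltW; near: n; exact: near_ball.
  - by near=> n; exact: hb.
  - move=> e' e'0; near=> n => t /andP[t0 tr]; split; last by rewrite subrr normr0 ltW.
    have h : forall t : R, 0 < t < 2^-1 * expR (M n) -> `|W n t - 1| <= e' by near: n; exact: hW.
    apply: h; rewrite t0 (lt_trans tr) //; near: n; exact: near_ball.
  - by under eq_fun do rewrite g0; exact: cvg_cst.
  - by rewrite bubble0 //; exact: cvg_cst.
  - exact: hw.
  - rewrite expr0n /= mulr0 !addr0 (_ : - (8 * sq) / sq ^+ 2 = - (8 / sq)); first exact: cvg_cst.
    by field; rewrite gt_eqF.
  - near=> n => t /andP[t0 tr]; split.
      have h : forall t : R, 0 <= t <= 2^-1 * expR (M n) -> g n t <= 0 by near: n; exact: blowup_le0.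
      apply: h; rewrite ltW //= ltW // (lt_trans tr) //; near: n; exact: near_ball.
    apply: ln_le0; rewrite ler_pdivrMr ?mul1r ?lerDl ?sqr_ge0 //.
    by rewrite ltr_wpDr // sqr_ge0.
  - by exists N => n Nn t ht; have [_ _ h] := hN n N Nn (leqnn _); exact: h.
have cg (r : R) : 0 < r -> g n r @[n --> \oo] --> bubble sq r.
  move=> r0; apply/cvgrPdist_le => e e0.
  have r1 : 0 < r + 1 by lra.
  have [N hN] := close _ _ r1 e0; exists N => // n /= Nn.
  have rr : 0 < r < r + 1 by rewrite r0 ltrDl ltr01.
  by rewrite distrC; have [] := hN n Nn r rr.
have cP (r : R) : 0 < r -> P n r @[n --> \oo] --> bubble_mass sq r.
  move=> r0; apply/cvgrPdist_le => e e0.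
  have r1 : 0 < r + 1 by lra.
  have e1 : 0 < 4 * e / r ^+ 4 by apply: divr_gt0; [lra|exact: exprn_gt0].
  have [N hN] := close _ _ r1 e1; near=> n.
  have hf (t : R) : 0 < t < r + 1 ->
      `|1 * expR (4 * bubble sq t) - W n t * expR (4 * g n t)| <= 4 * e / r ^+ 4.
    have Nn : (N <= n)%N by near: n; exists N.
    by move=> ht; rewrite distrC; have [] := hN n Nn t ht.
  have sn : radsol (r + 1) (g n) (a n) (w n) (P n) (fun r => W n r * expR (4 * g n r)).
    apply: radsol_restrict (hs n); rewrite -[expR _]mul1r.
    by apply: ltW; near: n; exact: near_ball.
  have rr : 0 <= r < r + 1 by apply/andP; split; lra.
  have := radsol_P_dist (hb (r + 1)) sn hf rr.
  by have -> : 4 * e / r ^+ 4 * r ^+ 4 / 4 = e by field; rewrite gt_eqF.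
have c8 : bubble_mass sq r @[r --> +oo] --> (8 : R).
  apply/cvgrPdist_le => e e0; near=> r.
  have r1 : 1 <= r by near: r; apply: nbhs_pinfty_ge; rewrite num_real.
  have re : 24 * 96 / e <= r by near: r; apply: nbhs_pinfty_ge; rewrite num_real.
  rewrite ger0_norm ?subr_ge0 ?bubble_mass_le //.
  have r0 : 0 < r by lra.
  apply: le_trans (bubble_mass_tail sq0 r0) _; rewrite sq2 ler_pdivrMr ?exprn_gt0 //.
  move: re; rewrite ler_pdivrMr // => re; apply: le_trans re _.
  rewrite mulrC ler_pM2l //; have s2 : r <= r ^+ 2 by rewrite expr2 ler_peMr //; lra.
  apply: le_trans s2 _; rewrite (expr2 (r ^+ 2)) ler_peMr //; first exact: sqr_ge0.
  exact: exprn_ege1.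
have tail (del e : R) : 0 < del < 1 -> 0 < e -> exists2 R0 : R, 0 < R0 &
    \forall n \near \oo, forall s r : R, R0 <= s <= r -> r <= del * expR (M n) ->
    `|P n r - P n s| <= e.
  move=> hd e0; have [d0 d1] := andP hd; pose d : R := (1 + del) / 2.
  have dd : 0 < del < d by rewrite d0 /= /d; lra.
  have hd1 : d < 1 by rewrite /d; lra.
  have hd01 : 0 < d < 1 by apply/andP; split; lra.
  have hd' : 0 < (1 + d) / 2 < 1 by apply/andP; split; lra.
  (* The value [7 < 8] leaves a margin over the threshold [6] of [tail_mass] when passing to large
     [n]. *)
  have [R0 R1 m7] : exists2 R0 : R, 1 <= R0 & 7 <= bubble_mass sq R0.
    near (pinfty_nbhs R) => r; exists r; first by near: r; apply: nbhs_pinfty_ge; rewrite num_real.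
    near: r; move/cvgr_ge : c8; apply; lra.
  have R00 : 0 < R0 by lra.
  pose k : R := 8 / sq + 1; pose C := (k + 1) * R0 ^+ 6.
  have [C1 hC1] := blowup_apriori hd01.
  have [K [b [b0 hK]]] := tail_mass C C1 R1 dd hd1.
  (* By [exp x >= 1 + x], beyond radius [exp A0] the bound [K * exp (- b * ln s)] is at most [e]. *)
  pose A0 := `|K| / (e * b).
  have A00 : 0 <= A0 by apply: divr_ge0 => //; apply: mulr_ge0; exact: ltW.
  exists (R0 + expR A0); first by have := expR_gt0 A0; lra.
  near=> n => s r /andP[Rs sr] rd.
  have E0 := expR_gt0 A0.
  have EM : 0 < expR (M n) by exact: expR_gt0.
  have mono : forall s r : R, 0 <= s <= r -> r < (1 + d) / 2 * expR (M n) -> P n s <= P n r.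
    by near: n; exact: P_mono.
  rewrite ger0_norm; last first.
    rewrite subr_ge0; apply: mono; first by apply/andP; split; lra.
    apply: le_lt_trans rd _; rewrite ltr_pM2r //; have [_ ?] := andP dd; lra.
  apply: (@le_trans _ _ (K * expR (- b * ln s))); last first.
    apply: (@le_trans _ _ (`|K| * (1 + b * A0)^-1)).
      apply: (@le_trans _ _ (`|K| * expR (- b * ln s))).
        by apply: ler_wpM2r (ler_norm _); exact: expR_ge0.
      apply: ler_wpM2l => //; rewrite mulNr expRN lef_pV2 ?posrE ?expR_gt0 //; last first.
        by have := mulr_ge0 (ltW b0) A00; lra.
      apply: le_trans (expR_ge1Dx _) _; rewrite ler_expR; apply: ler_wpM2l; first exact: ltW.
      by rewrite -[A0]expRK ler_ln ?posrE //; lra.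
    have bA : b * A0 = `|K| / e by rewrite /A0; field; rewrite !gt_eqF.
    rewrite bA ler_pdivrMr; last by have : 0 <= `|K| / e by [apply: divr_ge0 => //; exact: ltW]; lra.
    by rewrite mulrDr mulr1 mulrC divfK ?gt_eqF // lerDr ltW.
  have sub_f : forall r : R, 0 < r < (1 + d) / 2 * expR (M n) ->
    0 <= W n r * expR (4 * g n r) <= 2 * expR (4 * g n r) by near: n; exact: f_ge0.
  have gle : forall r : R, 0 <= r <= (1 + d) / 2 * expR (M n) -> g n r <= 0.
    by near: n; exact: blowup_le0.
  have R0d : R0 < d * expR (M n) by near: n; apply: near_ball; have [] := andP hd01.
  have dd' : d * expR (M n) < (1 + d) / 2 * expR (M n) by rewrite ltr_pM2r //; lra.
  have hsn := hsd n (ltW (andP hd').2).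
  have R0d' : R0 < (1 + d) / 2 * expR (M n) by exact: lt_trans dd'.
  have fl (t : R) : 0 < t < R0 -> 0 <= W n t * expR (4 * g n t).
    move=> /andP[t0 tR]; have td : 0 < t < (1 + d) / 2 * expR (M n) by rewrite t0 (lt_trans tR).
    by have /andP[] := sub_f t td.
  have fu (t : R) : 0 < t < R0 -> W n t * expR (4 * g n t) <= 2.
    move=> /andP[t0 tR]; have td : t < (1 + d) / 2 * expR (M n) by exact: lt_trans R0d'.
    have /andP[_ h] : 0 <= W n t * expR (4 * g n t) <= 2 * expR (4 * g n t).
      by apply: sub_f; rewrite t0.
    apply: le_trans h _; rewrite -[leRHS]mulr1; apply: ler_wpM2l => //.
    by rewrite expR_le1 pmulr_rle0 // gle // !ltW.
  have wn : `|- (8 / sq) - w n 0| <= 1 by near: n; move/cvgrPdist_le : hw; apply.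
  have wk : `|w n 0| <= k by rewrite /k; exact: dist_le_norm (ltW (divr_gt0 (ltr0n _ 8) sq0)) wn.
  have ff (t : R) (ht : 0 < t < R0) : 0 <= W n t * expR (4 * g n t) <= 2.
    by rewrite fl //= fu.
  have [gC wC aC] := radsol_bounded hsn R1 R0d' ff (g0 n) wk.
  have P6 : 6 <= P n R0.
    near: n; have /cvgr_ge := cP _ R00; apply; lra.
  (* The outer end of the tail: [g n] is nonincreasing there, or the explosion bound applies. *)
  have hor : a n (d * expR (M n)) <= 0 \/ g n (d * expR (M n)) <= C1 - M n.
    have [?|/ltW a0] := leP (a n (d * expR (M n))) 0; [by left|right].
    by move: a0; near: n; exact: hC1.
  have hr0 : R0 <= d * expR (M n) < (1 + d) / 2 * expR (M n) by rewrite dd' andbT ltW.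
  have Rsr : R0 <= s <= r by rewrite sr andbT; apply: le_trans Rs; rewrite lerDl ltW.
  exact: (hK _ _ _ _ _ _ _ hsn sub_f hr0 P6 gC wC aC hor s r Rsr rd).
have [A [hA1 hA2]] := mass_limit hM cP tail.
have A8 : A = 8 by exact: (cvg_unique _ hA1 c8).
by rewrite -A8 in c8 *.
Unshelve. all: by end_near.
Qed.

End blowup.

(* In the variable [r ^+ 2] the profile is convex, since its derivative [a r / (2 * r ^+ 4)] is nondecreasing. *)
Lemma radsol_ratio (R : realType) (rho : R) (g a w P f : R -> R) :
  radsol rho g a w P f -> (forall r : R, 0 < r < rho -> 0 <= f r) -> g 0 = 0 ->
  forall s r : R, 0 < s <= r -> r < rho -> g s / s ^+ 2 <= g r / r ^+ 2.
Proof.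
move=> hs hf g0 s r /andP[s0 sr] rr.
have ins (t : R) : 0 < t <= r -> 0 < t < rho by move=> /andP[? ?]; lra.
pose N t := a t * (t^-1) ^+ 4.
have dN (t : R) : 0 < t <= r -> is_derive t 1 N ((t ^+ 4 * w t - 4 * a t) / t ^+ 5).
  move=> ht; have tn : t != 0 by rewrite gt_eqF //; case/andP: ht.
  have hi := @is_deriveV R (fun x => x) t 1 1 tn (is_derive_id _ _).
  by apply: (is_derive_eq (is_derive_mulX 4 (rs_a hs (ins t ht)) hi)); rewrite /GRing.scale /=; field.
have N_homo (x y : R) : 0 < x -> x <= y -> y <= r -> N x <= N y.
  move=> x0 xy yr; rewrite -subr_ge0.
  have -> : 0 = (fun=> 0 : R) y - (fun=> 0 : R) x by rewrite subr0.
  apply: (@le_of_deriv_cc R (fun=> 0) N (fun=> 0) (fun x => (x ^+ 4 * w x - 4 * a x) / x ^+ 5)) => //.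
  - by move=> t /andP[xt ty]; apply: dN; lra.
  - move=> t /andP[xt ty]; apply: mulr_ge0; last by rewrite invr_ge0 exprn_ge0 //; lra.
    have ht : 0 <= t < rho by lra.
    by have := radsol_a_le hs hf ht; lra.
have dg (t : R) : 0 < t <= r -> is_derive t 1 g (t * N t).
  move=> ht; apply: (is_derive_eq (rs_g hs (ins t ht))); rewrite /N; field.
  by rewrite gt_eqF //; case/andP: ht.
have dq (c t : R) : is_derive t 1 (fun t => c / 2 * t ^+ 2) (t * c).
  by apply: is_derive_eq; rewrite /GRing.scale /=; field.
have h1 : g s <= N s / 2 * s ^+ 2.
  have := @le_of_deriv R g (fun t => N s / 2 * t ^+ 2) (fun t => t * N t) (fun t => t * N s) 0 s (ltW s0).
  rewrite g0 expr0n /= mulr0 !subr0; apply.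
  - by move=> t /andP[t0 ts]; apply: dg; lra.
  - by have := rs_g0 hs; rewrite g0.
  - by have := is_derive_cvg_right (dq (N s) 0); rewrite expr0n /= mulr0.
  - by move=> t /andP[t0 ts]; apply: ler_wpM2l; [exact: ltW|apply: N_homo => //; exact: ltW].
have h2 : N s / 2 * r ^+ 2 - N s / 2 * s ^+ 2 <= g r - g s.
  apply: (@le_of_deriv_cc R (fun t => N s / 2 * t ^+ 2) g (fun t => t * N s) (fun t => t * N t)) => //.
  - by move=> t /andP[st tr]; apply: dg; lra.
  - by move=> t /andP[st tr]; apply: ler_wpM2l; [lra|exact: N_homo].
have s20 : 0 < s ^+ 2 by exact: exprn_gt0.
have r20 : 0 < r ^+ 2 by apply: exprn_gt0; lra.
have sr2 : s ^+ 2 <= r ^+ 2 by rewrite !expr2; apply: ler_pM => //; lra.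
rewrite ler_pdivrMr // mulrAC ler_pdivlMr //.
move: s20 r20 sr2 h1 h2; move: (s ^+ 2) (r ^+ 2) (N s) => S Q n S0 Q0 SQ h1 h2.
have h3 := ler_wpM2r (ltW S0) h2.
have SQ0 : 0 <= Q - S by lra.
have h4 := ler_wpM2r SQ0 h1; lra.
Qed.

(** * Convergence of radial sequences, and rescaling *)

(** [partials_bound] applied to differences: Cauchy data at the origin and uniformly Cauchy
    bilaplacians make all derivatives up to order four Cauchy. *)
Lemma radial_limit (R : realType) (D : set 'rV[R]_4) (J : set R) (v : nat -> 'rV[R]_4 -> R) :
  D = \bigcup_(r in J) eball r ->
  (forall K, compact K -> K `<=` D -> exists2 r, J r & K `<=` eball r) ->
  (forall r, J r -> 0 < r) ->
  (forall r, J r -> \forall n \near \oo, radial_on (eball r) (v n) /\ Ck 4 (eball r) (v n)) ->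
  (forall r e : R, J r -> 0 < e -> exists N : nat, forall m n : nat, (N <= m)%N -> (N <= n)%N ->
     [/\ `|v m 0 - v n 0| <= e, `|laplacian (v m) 0 - laplacian (v n) 0| <= e &
       forall x, eball r x ->
         `|laplacian (laplacian (v m)) x - laplacian (laplacian (v n)) x| <= e]) ->
  exists g, Ck 4 D g /\ Ckloc_cvg 4 D v g.
Proof.
move=> DJ KJ J0 hv hc.
have hC (r : R) : J r -> \forall n \near \oo, Ck 4 (eball r) (v n).
  by move=> /hv; apply: filterS => n [].
suff hcau : forall (r e : R), J r -> 0 < e -> exists N : nat, forall m n, (N <= m)%N -> (N <= n)%N ->
    forall s x, (size s <= 4)%N -> eball r x -> `|partials s (v m) x - partials s (v n) x| <= e.
  by have [g [gC vg _]] := Ckloc_limit DJ KJ hC hcau; exists g.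
move=> r e Jr e0; have r0 := J0 r Jr.
pose B : R := 24 * (1 + r) ^+ 4.
have B0 : 0 < B by apply: mulr_gt0 => //; apply: exprn_gt0; lra.
have e1 : 0 < e / (3 * B) by apply: divr_gt0 => //; exact: mulr_gt0.
have [N hN] := hc r _ Jr e1; have [N' _ hN'] := hv r Jr.
exists (maxn N N') => m n; rewrite !geq_max => /andP[Nm N'm] /andP[Nn N'n] s x s4 xr.
have [rm Cm] := hN' m N'm; have [rn Cn] := hN' n N'n.
have [h0 h1 h2] := hN m n Nm Nn.
have oD := @open_eball R r.
have [hp Cd] := Ck_comb 1 (-1) oD Cm Cn.
have hL := bilaplacian_comb 1 (-1) oD Cm Cn.
have hl := laplacian_comb 1 (-1) oD (Ck_le (isT : (2 <= 4)%N) Cm) (Ck_le (isT : (2 <= 4)%N) Cn).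
have d0 : eball r (0 : 'rV[R]_4) by rewrite /eball /= enorm0.
have rd : radial_on (eball r) (fun x => 1 * v m x + -1 * v n x).
  by move=> y z yr zr yz; rewrite (rm y z) ?(rn y z).
have hE y : eball r y ->
    `|laplacian (laplacian (fun x => 1 * v m x + -1 * v n x)) y| <= e / (3 * B).
  by move=> yr; rewrite hL // mul1r mulN1r; exact: h2.
have := partials_bound r0 rd Cd hE s4 xr.
rewrite hp // hl // !mul1r !mulN1r => h; apply: le_trans h _.
rewrite [leRHS](_ : e = B * (e / (3 * B) + e / (3 * B) + e / (3 * B))); last by field; rewrite gt_eqF.
by apply: ler_wpM2l; [exact: ltW|apply: lerD => //; exact: lerD].
Qed.

Lemma Ckloc_cvg_pointwise (R : realType) (k : nat) (D : set 'rV[R]_4)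
    (f : nat -> 'rV[R]_4 -> R) (g : 'rV[R]_4 -> R) :
  Ckloc_cvg k D f g -> forall x, D x -> f n x @[n --> \oo] --> g x.
Proof.
move=> /Ckloc_cvgP h x Dx; apply/cvgrPdist_lt => e e0.
have sub : [set x] `<=` D by move=> y ->.
have [N _ hN] := h [::] [set x] e isT (@compact_set1 _ x) sub e0.
by exists N => // n /hN /(_ x erefl).
Qed.

Lemma laplacian_cst (R : realType) (c : R) (x : 'rV[R]_4) : laplacian (cst c) x = 0.
Proof.
have [h _] := Ck_cst 2 c (@openT 'rV[R]_4).
rewrite laplacianE; apply/eqP; rewrite oppr_eq0; apply/eqP.
by apply: big1 => i _; rewrite h.
Qed.

Lemma bilaplacian_dil (R : realType) (D D' : set 'rV[R]_4) (f : 'rV[R]_4 -> R) (l : R) :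
  open D -> open D' -> (forall x, D' x -> D (l *: x)) -> Ck 4 D f -> forall x, D' x ->
  laplacian (laplacian (fun x => f (l *: x))) x = l ^+ 4 * laplacian (laplacian f) (l *: x).
Proof.
move=> oD oD' lD fC x Dx.
have f2 : Ck 2 D f by exact: Ck_le fC.
have hL : Ck 2 D (laplacian f) by exact: Ck_laplacian.
have [_ hLl] := Ck_dil oD' lD hL.
have h0 := (Ck_cst 2 (0 : R) oD').2.
(* The zero summand gives a scalar multiple the shape of a linear combination. *)
have e1 y : D' y -> laplacian (fun x => f (l *: x)) y =
    l ^+ 2 * laplacian f (l *: y) + 0 * cst (0 : R) y.
  by move=> /(laplacian_dil oD' lD f2) ->; rewrite mul0r addr0.
apply: etrans (laplacian_ext oD' e1 Dx) _.
apply: etrans (laplacian_comb (l ^+ 2) 0 oD' hLl h0 Dx) _.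
have fin (A B C : R) : A = l ^+ 2 * C -> l ^+ 2 * A + 0 * B = l ^+ 4 * C by move=> ->; ring.
exact: fin (laplacian_dil oD' lD hL Dx).
Qed.

Lemma rescale_ball (R : realType) (c : R) (x : 'rV[R]_4) :
  eball (expR c) x -> eball 1 (expR (- c) *: x).
Proof.
by rewrite /eball /= enormZ ger0_norm ?expR_ge0 // expRN mulrC ltr_pdivrMr ?expR_gt0 // mul1r.
Qed.

Lemma rescale_bilaplacian (R : realType) (f : 'rV[R]_4 -> R) : Ck 4 (eball 1) f ->
  let D := eball (expR (f 0)) in
  [/\ Ck 4 D (rescale f), laplacian (rescale f) 0 = expR (- 2 * f 0) * laplacian f 0 &
      forall x, D x -> laplacian (laplacian (rescale f)) x =
        expR (- 4 * f 0) * laplacian (laplacian f) (expR (- f 0) *: x)].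
Proof.
move=> fC D; have oD : open D by exact: open_eball.
have oB := @open_eball R 1.
pose l := expR (- f 0).
have lD x : D x -> eball 1 (l *: x) by exact: rescale_ball.
have [_ h1] := Ck_dil oD lD fC.
have h2 := (Ck_cst 4 (f 0) oD).2.
have rE : rescale f = (fun x => 1 * f (l *: x) + -1 * cst (f 0) x).
  by apply/funext => x; rewrite mul1r mulN1r.
have f2 : Ck 2 (eball 1) f by exact: Ck_le fC.
have D0 : D 0 by rewrite /D /eball /= enorm0 expR_gt0.
split.
- by rewrite rE; have [] := Ck_comb 1 (-1) oD h1 h2.
- have h12 : Ck 2 D (fun x => f (l *: x)) by exact: Ck_le h1.
  have h22 : Ck 2 D (cst (f 0)) by exact: Ck_le h2.
  rewrite rE (laplacian_comb 1 (-1) oD h12 h22 D0) laplacian_cst mulr0 addr0 mul1r.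
  rewrite (laplacian_dil oD lD f2 D0) scaler0 /l -expRM_natl; congr (expR _ * _).
  by rewrite mulrN mulNr.
move=> x Dx; rewrite rE; apply: etrans (bilaplacian_comb 1 (-1) oD h1 h2 Dx) _.
have hc : laplacian (laplacian (cst (f 0))) x = 0.
  apply: etrans (laplacian_ext oD (g := cst 0) _ Dx) (laplacian_cst 0 x) => y _.
  exact: laplacian_cst.
have fin (A B C : R) : A = l ^+ 4 * C -> B = 0 -> 1 * A + -1 * B = expR (- 4 * f 0) * C.
  by move=> -> ->; rewrite mul1r mulr0 addr0 /l -expRM_natl mulrN mulNr.
exact: fin (bilaplacian_dil oB oD lD fC Dx) hc.
Qed.

Lemma rescale_radial (R : realType) (f : 'rV[R]_4 -> R) :
  radial_on (eball 1) f -> radial_on (eball (expR (f 0))) (rescale f).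
Proof.
move=> fr x y xr yr xy; rewrite /rescale; congr (_ - _).
by apply: fr; [exact: rescale_ball|exact: rescale_ball|rewrite !enormZ xy].
Qed.

(** The limit profile when the mass vanishes: biharmonic, null at the origin, with Laplacian 1 in
    the convention with the minus sign. *)
Lemma quadratic_Ck (R : realType) : let q (x : 'rV[R]_4) := - (enorm x ^+ 2 / 8) in
  [/\ Ck 4 setT q, laplacian q 0 = 1 & forall x, laplacian (laplacian q) x = 0].
Proof.
move=> q.
pose F (s : seq 'I_4) (x : 'rV[R]_4) : R := match s with
  | [::] => q x
  | [:: i] => - (x 0 i / 4)
  | [:: i; j] => - ((i == j)%:R / 4)
  | _ => 0 end.
have dF s i x : (size s < 4)%N -> setT x -> is_derive x (e_ i) (F s) (F (i :: s) x).
  move=> _ _; case: s => [|j [|j' [|? ?]]] /=; last 2 first.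
  - exact: is_derive_cst.
  - exact: is_derive_cst.
  - have -> : F [::] = (fun x => -1 / 8 * \sum_(j < 4) x 0 j * x 0 j).
      by apply/funext => y; rewrite /F /q enorm_sqr; under [in RHS]eq_bigr do rewrite -expr2; ring.
    have hs : is_derive x (e_ i) (fun x : 'rV[R]_4 => \sum_(j < 4) x 0 j * x 0 j) (2 * x 0 i).
      have h (j : 'I_4) := is_derive_mul (is_derive_coord x i j) (is_derive_coord x i j).
      have := is_derive_sum h.
      have -> : \sum_(j < 4) (fun y : 'rV[R]_4 => y 0 j * y 0 j) =
         (fun y : 'rV[R]_4 => \sum_(j < 4) y 0 j * y 0 j).
        by apply/funext => y; rewrite fct_sumE.
      move=> H; apply: (is_derive_eq H); rewrite (bigD1 i) //= eqxx mulr1n !mulr1 big1 ?addr0; first by ring.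
      by move=> j; rewrite eq_sym => /negbTE ->; rewrite mulr0n !mulr0 addr0.
    have H := is_derive_mul (is_derive_cst (-1 / 8 : R) x (e_ i)) hs.
    by apply: (is_derive_eq H); rewrite /cst /= mulr0 addr0; field.
  - have H := is_derive_mul (is_derive_cst (-1 / 4 : R) x (e_ i)) (is_derive_coord x i j).
    have -> : F [:: j] = (fun x : 'rV[R]_4 => -1 / 4 * x 0 j).
      by apply/funext => y; rewrite /F; ring.
    by apply: (is_derive_eq H); rewrite /cst /= mulr0 addr0; field.
have cF s x : (size s <= 4)%N -> setT x -> {for x, continuous (F s)}.
  move=> _ _; case: s => [|i [|j [|? ?]]] /=; try exact: cst_continuous.
  - have -> : F [::] = (fun x => -1 / 8 * (enorm x * enorm x)).
      by apply/funext => y; rewrite /F /q; ring.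
    apply: (@continuousM _ _ (cst (-1 / 8)) (fun x => enorm x * enorm x)); first exact: cst_continuous.
    by apply: (@continuousM _ _ (@enorm R) (@enorm R)); exact: continuous_enorm.
  - have -> : F [:: i] = (fun x : 'rV[R]_4 => -1 / 4 * x 0 i).
      by apply/funext => y; rewrite /F; ring.
    apply: (@continuousM _ _ (cst (-1 / 4)) (fun x : 'rV[R]_4 => x 0 i)); first exact: cst_continuous.
    exact: coord_continuous.
have [hp qC] := Ck_family (@openT 'rV[R]_4) (fun _ _ => erefl) cF dF.
have L1 x : laplacian q x = 1.
  rewrite laplacianE; under eq_bigr do rewrite hp //= eqxx mulr1n.
  by rewrite sumr_const card_ord -mulr_natr; field.
split => // x; rewrite (laplacian_ext (@openT _) (g := cst 1) _ (x := x)) ?laplacian_cst //.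
Qed.

(** * Mass of balls, integrability, tests against continuous functions *)

(** The component [P] before rescaling: for a radial [f], [2 * pi ^ 2 * flux f r] is the integral of
    the bilaplacian over the ball of radius [r]. *)
Definition flux (R : realType) (f : 'rV[R]_4 -> R) (r : R) : R :=
  - (r ^+ 3 * partial 0 (laplacian f) (r *: e_ 0)).

Lemma integral_annulus (R : realType) (F : 'rV[R]_4 -> R) (r s A B : R) :
  r <= s -> measurable_fun (eball s) F -> (forall x, eball s x -> 0 <= F x) ->
  (\int[lebesgue4]_(x in eball s) (F x)%:E = A%:E)%E ->
  (\int[lebesgue4]_(x in eball r) (F x)%:E = B%:E)%E ->
  (\int[lebesgue4]_(x in eball s `\` eball r) (F x)%:E = (A - B)%:E)%E.
Proof.
move=> rs mF F0 hA hB.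
have sub : eball r `<=` @eball R s by exact: subset_eball.
have sU : eball r `|` (eball s `\` eball r) = @eball R s by rewrite setDUK.
have : (\int[lebesgue4]_(x in eball s) (F x)%:E =
    \int[lebesgue4]_(x in eball r) (F x)%:E +
    \int[lebesgue4]_(x in eball s `\` eball r) (F x)%:E)%E.
  rewrite -{1}sU; apply: ge0_integral_setU.
  - exact: measurable_eball.
  - exact: measurableD (measurable_eball s) (measurable_eball r).
  - by rewrite sU; exact/measurable_EFinP.
  - by rewrite sU => x xs; rewrite lee_fin F0.
  - by apply/disj_setPS => x [? []].
rewrite hA hB; case: (\int[_]_(x in _) _)%E => [z| |] //=.
by move=> [->]; rewrite addrAC subrr add0r.
Qed.

(** The mass of the bubble in each ball is explicit and bounded; monotone convergence along the
    balls of integer radius concludes. *)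
Lemma integrable_bubble (R : realType) (c : R) : 0 < c ->
  (@lebesgue4 R).-integrable setT (fun x => ((c / (c + enorm x ^+ 2)) ^+ 4)%:E).
Proof.
move=> c0; set h := fun x : 'rV[R]_4 => (c / (c + enorm x ^+ 2)) ^+ 4.
have D0 (x : 'rV[R]_4) : 0 < c + enorm x ^+ 2 by rewrite ltr_wpDr // sqr_ge0.
have h0 x : 0 <= h x by apply: exprn_ge0; apply: divr_ge0; exact: ltW.
have hc : continuous h.
  have c1 : continuous (fun x : 'rV[R]_4 => c / (c + enorm x ^+ 2)).
    move=> x; apply: (@continuousM _ _ (cst c) (fun x => (c + enorm x ^+ 2)^-1)); first exact: cst_continuous.
    apply: (@continuousV _ _ (fun x => c + enorm x ^+ 2)); first by rewrite gt_eqF.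
    apply: (@continuousD _ _ _ (cst c) (fun x : 'rV[R]_4 => enorm x ^+ 2)); first exact: cst_continuous.
    by apply: (@continuousM _ _ (@enorm R) (@enorm R)); exact: continuous_enorm.
  move=> x; apply: (@continuous_comp _ _ _ (fun x : 'rV[R]_4 => c / (c + enorm x ^+ 2)) (fun y : R => y ^+ 4)).
    exact: c1.
  exact: exprn_continuous.
have hm D : measurable D -> measurable_fun D (EFin \o h).
  move=> mD; apply/measurable_EFinP; apply: (@measurable_funS _ _ _ _ setT) => //.
  by apply: continuous_on_measurable => // [|x _]; [exact: openT|exact: hc].
have hr (r : R) : radial_on (eball r) h by move=> x y _ _ xy; rewrite /h xy.
pose Q r := c ^+ 2 / 96 * bubble_mass c r.
have hQ (r : R) : 0 <= r -> (\int[lebesgue4]_(x in eball r) (h x)%:E = (2 * pi ^+ 2 * Q r)%:E)%E.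
  move=> r0; have r1 : 0 < r + 1 by lra.
  have hb := radsol_bubble (r + 1) c0.
  apply: (@radial_integral R (r + 1) h (hr _) (fun x _ => hc x) (fun x _ => h0 x) Q _ _ _ r).
  - move=> t /andP[t0 t1]; have H := rs_P hb (introT andP (conj t0 t1)).
    have := is_derive_mul (is_derive_cst (c ^+ 2 / 96) t 1) H => H'.
    apply: (is_derive_eq H'); rewrite /h enorm_ray ?ltW // /=.
    have := D0 (t *: e_ 0); rewrite enorm_ray ?ltW // => Dt.
    by field; rewrite gt_eqF.
  - by apply: cvgMr; exact: rs_P0 hb.
  - by rewrite /Q; have := rs_P00 hb; rewrite /bubble_mass => ->; rewrite mulr0.
  - by rewrite r0 ltrDl ltr01.
apply/integrableP; split; first exact: hm.
have -> : (fun x => `|(h x)%:E|%E) = (fun x => (h x)%:E).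
  by apply/funext => x; rewrite abse_EFin ger0_norm.
have UT : \bigcup_n @eball R n%:R = setT.
  apply/seteqP; split => // x _; exists (Num.truncn (enorm x)).+1 => //.
  by rewrite /eball /=; exact: truncnS_gt.
have hl : (\int[lebesgue4]_(x in eball n%:R) (h x)%:E)%E @[n --> \oo] -->
    (\int[lebesgue4]_x (h x)%:E)%E.
  rewrite -UT; apply: ge0_nondecreasing_set_cvg_integral.
  - by move=> m n mn; apply/subsetPset; apply: subset_eball; rewrite ler_nat.
  - by move=> n; exact: measurable_eball.
  - by move=> n; apply: hm; exact: measurable_eball.
  - by move=> n x _; rewrite lee_fin.
apply: (@le_lt_trans _ _ (2 * pi ^+ 2 * (c ^+ 2 / 96 * 8))%:E); last exact: ltry.
apply: (cvge_to_le hl); near=> n; rewrite hQ // lee_fin.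
have p2 : 0 <= 2 * pi ^+ 2 :> R by apply: mulr_ge0 => //; exact: sqr_ge0.
have c2 : 0 <= c ^+ 2 / 96 by apply: divr_ge0 => //; exact: sqr_ge0.
by apply: (ler_wpM2l p2); apply: (ler_wpM2l c2); exact: bubble_mass_le.
Unshelve. all: by end_near.
Qed.

(** On the small ball [phi] is within [e] of [phi 0]; the annulus has mass [A - B], and [phi]
    differs there from [phi 0] by at most [2 * C]. *)
Lemma weak_estimate (R : realType) (F phi : 'rV[R]_4 -> R) (r s C e A B : R) :
  r <= s -> measurable_fun (eball s) F -> (forall x, eball s x -> 0 <= F x) ->
  measurable_fun (eball s) phi ->
  (\int[lebesgue4]_(x in eball s) (F x)%:E = A%:E)%E ->
  (\int[lebesgue4]_(x in eball r) (F x)%:E = B%:E)%E ->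
  0 <= C -> 0 <= e -> (forall x, eball s x -> `|phi x| <= C) -> `|phi 0| <= C ->
  (forall x, eball r x -> `|phi x - phi 0| <= e) ->
  exists I : R, (\int[lebesgue4]_(x in eball s) (phi x * F x)%:E = I%:E)%E /\
    `|I - phi 0 * A| <= e * B + 2 * C * (A - B).
Proof.
move=> rs mF F0 mphi hA hB C0 e0 phiC phi0C phie.
have sub : eball r `<=` @eball R s by exact: subset_eball.
have mS := @measurable_eball R s; have mr := @measurable_eball R r.
have intF : (@lebesgue4 R).-integrable (eball s) (EFin \o F).
  apply/integrableP; split; first exact/measurable_EFinP.
  rewrite (eq_integral (fun x => (F x)%:E)) ?hA ?ltry // => x /set_mem xs.
  by rewrite /= ger0_norm // F0.
have intM (k : R) (psi : 'rV[R]_4 -> R) : measurable_fun (eball s) psi ->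
    (forall x, eball s x -> `|psi x| <= k) ->
    (@lebesgue4 R).-integrable (eball s) (fun x => (psi x * F x)%:E).
  move=> mpsi hk; apply: (@le_integrable _ _ _ _ _ mS _ (fun x => k%:E * (F x)%:E)%E).
  - by apply/measurable_EFinP; exact: measurable_funM.
  - move=> x xs; rewrite -(EFinM k) !abse_EFin lee_fin !normrM ler_wpM2r //.
    by apply: le_trans (hk x xs) _; exact: ler_norm.
  - exact: integrableZl.
have int1 := intM _ _ mphi phiC.
have int2 : (@lebesgue4 R).-integrable (eball s) (fun x => (phi 0 * F x)%:E).
  by apply: (intM C (cst (phi 0))).
have finI : (\int[lebesgue4]_(x in eball s) (phi x * F x)%:E)%E \is a fin_num.
  exact: integrable_fin_num.
exists (fine (\int[lebesgue4]_(x in eball s) (phi x * F x)%:E)%E).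
rewrite fineK //; split => //.
have e2 : (\int[lebesgue4]_(x in eball s) (phi 0 * F x)%:E = (phi 0 * A)%:E)%E.
  under eq_integral do rewrite EFinM.
  by rewrite integralZl // hA.
have diff : (\int[lebesgue4]_(x in eball s) ((phi x - phi 0) * F x)%:E =
   \int[lebesgue4]_(x in eball s) (phi x * F x)%:E - (phi 0 * A)%:E)%E.
  rewrite -e2 -integralB //; apply: eq_integral => x _.
  by rewrite -EFinB mulrBl.
have mD : measurable_fun (eball s) (fun x => (phi x - phi 0) * F x).
  by apply: measurable_funM => //; apply: measurable_funB => //; exact: measurable_cst.
set J := (\int[lebesgue4]_(x in eball s) ((phi x - phi 0) * F x)%:E)%E in diff.
suff hJ : (`|J| <= (e * B + 2 * C * (A - B))%:E)%E.
  move: hJ; rewrite diff -[X in (`|X - _| <= _)%E](fineK finI) -EFinB abse_EFin lee_fin.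
  by [].
apply: le_trans (le_abse_integral _ mS _) _; first exact/measurable_EFinP.
have mA : measurable (eball s `\` @eball R r) by exact: measurableD.
have sU : eball r `|` (eball s `\` eball r) = @eball R s by rewrite setDUK.
pose G x := (`|((phi x - phi 0) * F x)%:E|)%E.
have mG : measurable_fun (eball s) G.
  by apply: measurableT_comp => //; exact/measurable_EFinP.
have bound (E : set 'rV[R]_4) (k z : R) : measurable E -> E `<=` eball s -> 0 <= k ->
    (forall x, E x -> `|phi x - phi 0| <= k) ->
    (\int[lebesgue4]_(x in E) (F x)%:E = z%:E)%E ->
    (\int[lebesgue4]_(x in E) G x <= (k * z)%:E)%E.
  move=> mE Es k0 hk hz.
  have mFE : measurable_fun E (EFin \o F).
    by apply/measurable_EFinP; exact: measurable_funS mF.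
  apply: (@le_trans _ _ (\int[lebesgue4]_(x in E) (k%:E * (F x)%:E))%E); last first.
    by rewrite ge0_integralZl ?hz ?lee_fin // => x Ex; rewrite lee_fin F0 //; exact: Es.
  apply: ge0_le_integral => //.
  - by move=> x _; exact: abse_ge0.
  - exact: measurable_funS mG.
  - by apply: emeasurable_funM => //; exact: measurable_cst.
  - move=> x Ex; rewrite /G abse_EFin normrM -EFinM lee_fin (@ger0_norm _ (F x)); last exact/F0/Es.
    by apply: ler_wpM2r; [exact/F0/Es|exact: hk].
rewrite -sU ge0_integral_setU //; last 2 first.
- by rewrite sU.
- by apply/disj_setPS => x [? []].
rewrite EFinD; apply: leeD; first exact: bound.
apply: bound => //.
- by apply: mulr_ge0.
- move=> x [xs _]; apply: le_trans (ler_normB _ _) _.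
  by have := phiC x xs; lra.
- exact: integral_annulus.
Qed.

Lemma compact_closed_ball (R : realType) (r : R) : compact [set x : 'rV[R]_4 | enorm x <= r].
Proof.
apply: bounded_closed_compact.
  exists `|r|; split; first by rewrite num_real.
  move=> M rM x /= xr; apply: le_trans (mx_norm_le_enorm x) _.
  by rewrite (le_trans xr) // (le_trans (ler_norm _)) // ltW.
have -> : [set x : 'rV[R]_4 | enorm x <= r] = @enorm R @^-1` [set y | y <= r].
  by apply/seteqP; split.
by apply: closed_comp; [move=> x _; exact: continuous_enorm|exact: closed_le].
Qed.

Lemma compact_eball (R : realType) (K : set 'rV[R]_4) (rho : R) : 0 < rho ->
  compact K -> K `<=` eball rho -> exists2 r : R, 0 < r < rho & K `<=` eball r.
Proof.
move=> rho0 cK KD.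
have [->|/set0P K0] := eqVneq K set0.
  by exists (rho / 2) => //; apply/andP; split; lra.
have cont : {within K, continuous (@enorm R)}.
  by apply: continuous_subspaceT; exact: continuous_enorm.
have [c Kc hc] := EVT_max_rV K0 cK cont.
have cr : enorm c < rho by apply: KD; exact: set_mem.
exists ((enorm c + rho) / 2); first by have c0 := enorm_ge0 c; apply/andP; split; lra.
move=> x Kx; rewrite /eball /=; apply: (@le_lt_trans _ _ (enorm c)); last by lra.
by apply: hc; exact: mem_set.
Qed.

Lemma dist_eq (R : realType) (x y x' y' e : R) :
  x = x' -> y = y' -> `|x' - y'| <= e -> `|x - y| <= e.
Proof. by move=> -> ->. Qed.

(** The parabola is affine in [r ^ 2]. If [X] and [Y] are its gaps below [B] at [0] and [d], the gap
    at [r] is at least [th * (X + Y)], and large data force [9 * (X + Y)] to be at least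
    [d ^ 2 * (|p| + |w| - |B|)]. *)
Lemma two_point_bound (R : realType) (B d r th p w : R) : 0 < d <= 1 -> 0 <= th ->
  th * d ^+ 2 <= r ^+ 2 <= (1 - th) * d ^+ 2 -> p <= B -> p + w * d ^+ 2 / 8 <= B ->
  p + w * r ^+ 2 / 8 <= B - th * d ^+ 2 / 9 * (`|p| + `|w| - `|B|).
Proof.
move=> /andP[d0 d1] th0 hr pB qB.
have d2 : 0 < d ^+ 2 by exact: exprn_gt0.
have d21 : d ^+ 2 <= 1 by rewrite exprn_ile1 // ltW.
move: d2 d21 hr qB; move: (d ^+ 2) (r ^+ 2) => D Q D0 D1 /andP[hr1 hr2] qB.
have [X X0 pX] : exists2 X, 0 <= X & p = B - X by exists (B - p); lra.
have [Y Y0 qY] : exists2 Y, 0 <= Y & p + w * D / 8 = B - Y.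
  by exists (B - (p + w * D / 8)); lra.
have wD : w * D = 8 * (X - Y) by lra.
have np : `|p| <= `|B| + X.
  by rewrite pX; apply: le_trans (ler_normB _ _) _; rewrite (ger0_norm X0).
have nw : `|w| * D <= 8 * (X + Y).
  rewrite -{1}(ger0_norm (ltW D0)) -normrM wD normrM (ger0_norm (ler0n _ 8)) ler_pM2l //.
  by apply: le_trans (ler_normB _ _) _; rewrite !ger0_norm.
have hS : D * (`|p| + `|w| - `|B|) <= 9 * (X + Y).
  have h1 : D * (`|p| - `|B|) <= D * X by apply: ler_wpM2l; lra.
  have h2 : D * X <= X by rewrite ler_piMl.
  lra.
have hS' := ler_wpM2l th0 hS.
have key : p * D + w * D * Q / 8 <= D * (B - th * (X + Y)).
  rewrite wD pX; have h1 := ler_wpM2r X0 hr2; have h2 := ler_wpM2r Y0 hr1; lra.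
have : p + w * Q / 8 <= B - th * (X + Y).
  by rewrite -(ler_pM2l D0); move: key; rewrite [leLHS](_ : _ = D * (p + w * Q / 8)) //; ring.
lra.
Qed.

(** * The original sequence, when [u n 0] is bounded above *)

Section sequence.
Context {R : realType}.
Variables V u : nat -> 'rV[R]_4 -> R.
Hypotheses (V_cvg : Ckloc_cvg 0 (eball 1) V (cst 1))
  (u_C4 : forall k, Ck 4 (eball 1) (u k))
  (u_eq : forall k x, eball 1 x -> laplacian (laplacian (u k)) x = V k x * expR (4 * u k x))
  (u_radial : forall k, radial_on (eball 1) (u k)).

Let W n (r : R) := V n (r *: e_ 0).
Let g n (r : R) := u n (r *: e_ 0).
Let a n (r : R) := r ^+ 3 * partial 0 (u n) (r *: e_ 0).
Let w n (r : R) := - laplacian (u n) (r *: e_ 0).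
Let P n (r : R) := - (r ^+ 3 * partial 0 (laplacian (u n)) (r *: e_ 0)).

Lemma V_uniform (del e : R) : del < 1 -> 0 < e ->
  \forall n \near \oo, forall x, eball del x -> `|V n x - 1| <= e.
Proof.
move=> d1 e0; have /Ckloc_cvgP h := V_cvg.
have := h [::] _ e (leqnn 0) (@compact_closed_ball R del) _ e0.
have sub : [set x : 'rV[R]_4 | enorm x <= del] `<=` eball 1.
  by move=> x /= xd; exact: le_lt_trans d1.
move=> /(_ sub); apply: filterS => n hn x xd.
by have := hn x (ltW xd); rewrite /= distrC => /ltW.
Qed.

Lemma sequence_radsol n :
  radsol 1 (g n) (a n) (w n) (P n) (fun r => W n r * expR (4 * g n r)).
Proof.
apply: radsol_eqf (radsol_radial ltr01 (u_radial n) (u_C4 n)) _ => r /andP[r0 r1].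
by apply: u_eq; rewrite /eball /= enorm_ray // ltW.
Qed.

Let ray (del r : R) : 0 < r < del -> eball del (r *: (e_ 0 : 'rV[R]_4)).
Proof. by move=> /andP[r0 rd]; rewrite /eball /= enorm_ray // ltW. Qed.

Let f_ge (del : R) : del < 1 -> \forall n \near \oo,
  forall r : R, 0 < r < del -> expR (4 * g n r) / 2 <= W n r * expR (4 * g n r).
Proof.
move=> d1; have e0 : 0 < (2^-1 : R) by [].
apply: filterS (V_uniform d1 e0) => n h r /ray/h.
rewrite ler_norml => /andP[h1 _]; rewrite mulrC ler_wpM2r ?expR_ge0 // /W; lra.
Qed.

Let f_le (del : R) : del < 1 -> \forall n \near \oo,
  forall r : R, 0 < r < del ->
  0 <= W n r * expR (4 * g n r) <= 2 * expR (4 * g n r).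
Proof.
move=> d1; apply: filterS (V_uniform d1 ltr01) => n h r /ray/h.
rewrite ler_norml => /andP[h1 h2].
by rewrite mulr_ge0 ?expR_ge0 ?ler_wpM2r ?expR_ge0 // /W; lra.
Qed.

(** In [radsol_max] either the value at the centre or the explosion bound dominates, and both are
    bounded in [n]. *)
Lemma sequence_le (C del : R) : (forall n, u n 0 <= C) -> 0 < del < 1 ->
  exists A : R, \forall n \near \oo, forall r : R, 0 <= r <= del -> g n r <= A.
Proof.
move=> hC /andP[d0 d1]; pose l : R := (1 - del) / 2.
have l0 : 0 < l by rewrite /l; lra.
have D0 : 0 < 24 * 16 * 16 / l ^+ 4 by apply: divr_gt0; [rewrite !mulr_gt0|exact: exprn_gt0].
exists (Num.max C (ln (24 * 16 * 16 / l ^+ 4) / 4)).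
have d'1 : (3 + del) / 4 < 1 by lra.
apply: filterS (f_ge d'1) => n hf r /andP[r0 rd].
have hs := radsol_restrict (ltW d'1) (sequence_radsol n).
have rl : r + l < (3 + del) / 4 by rewrite /l; lra.
have [h|h] := radsol_max hs hf r0 l0 rl.
  by rewrite le_max (le_trans h) //= /g scale0r.
rewrite le_max; apply/orP; right; move: h; rewrite -ler_pdivlMr ?exprn_gt0 //.
by rewrite -{1}(lnK D0) ler_expR; lra.
Qed.

Lemma bilaplacian_profile n x : eball 1 x ->
  laplacian (laplacian (u n)) x = W n (enorm x) * expR (4 * g n (enorm x)).
Proof.
move=> x1; have oD := @open_eball R 1.
have hL : Ck 2 (eball 1) (laplacian (u n)) by exact: Ck_laplacian.
have rL : radial_on (eball 1) (laplacian (u n)).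
  by apply: laplacian_radial => //; exact: Ck_le (u_C4 n).
have r0 := enorm_ge0 x.
have x1' : eball 1 (enorm x *: (e_ 0 : 'rV[R]_4)) by exact: eball_ray.
rewrite (laplacian_radial rL hL x1 x1') ?enorm_ray // u_eq //.
Qed.

Lemma continuous_bilaplacian n x : eball 1 x -> {for x, continuous (laplacian (laplacian (u n)))}.
Proof.
have oD := @open_eball R 1; move=> x1.
have h : Ck 0 (eball 1) (laplacian (laplacian (u n))) by do 2 apply: Ck_laplacian => //.
exact: (Ck_continuous (s := [::]) h).
Qed.

Lemma bounded_cvg (C p q : R) : (forall n, u n 0 <= C) ->
  u n 0 @[n --> \oo] --> p -> laplacian (u n) 0 @[n --> \oo] --> q ->
  exists v, Ck 4 (eball 1) v /\ Ckloc_cvg 4 (eball 1) u v.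
Proof.
move=> uC up uq.
apply: (@radial_limit R (eball 1) [set r | 0 < r < 1]).
- apply/seteqP; split=> [x x1|x [r /= /andP[_ r1] xr]]; last exact: lt_trans r1.
  have x0 := enorm_ge0 x; have {}x1 : enorm x < 1 := x1.
  by exists ((1 + enorm x) / 2); rewrite /eball /=; [apply/andP; split|]; lra.
- by move=> K cK KD; have [r hr Kr] := compact_eball ltr01 cK KD; exists r.
- by move=> r /andP[].
- move=> r /andP[_ r1]; have sub := subset_eball (ltW r1).
  near=> n; split; last exact: Ck_subset sub (u_C4 n).
  by move=> x y /sub xr /sub yr; exact: u_radial.
move=> r e /andP[r0 r1] e0.
have [A hA] := sequence_le uC (introT andP (conj r0 r1)).
have hs : \forall n \near \oo, radsol r (g n) (a n) (w n) (P n) (fun t => W n t * expR (4 * g n t)).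
  by near=> n; exact: radsol_restrict (ltW r1) (sequence_radsol n).
have hW (e' : R) : 0 < e' -> \forall n \near \oo, forall t : R, 0 < t < r -> `|W n t - 1| <= e'.
  by move=> e'0; apply: filterS (V_uniform r1 e'0) => n h t /ray/h.
have hg0 : g n 0 @[n --> \oo] --> p by rewrite /g scale0r.
have hw0 : w n 0 @[n --> \oo] --> - q by rewrite /w scale0r; exact: cvgN.
have hA' : \forall n \near \oo, forall t : R, 0 < t < r -> g n t <= A.
  by apply: filterS hA => n h t /andP[t0 tr]; apply: h; rewrite !ltW.
have [N hN] := radsol_cauchy (ltW r0) hs hW hg0 hw0 hA' e0.
exists N => m n Nm Nn; have [h1 h2 h3] := hN m n Nm Nn; split.
- by move: h1; rewrite /g scale0r.
- by move: h2; rewrite /w scale0r; move: (laplacian _ _) (laplacian _ _) => B D; rewrite -opprD normrN.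
have hx x : eball r x -> x != 0 ->
    `|laplacian (laplacian (u m)) x - laplacian (laplacian (u n)) x| <= e.
  move=> xr x0; have x1 : eball 1 x by exact: lt_trans r1.
  have x0' : 0 < enorm x < r by rewrite enorm_gt0.
  exact: dist_eq (bilaplacian_profile m x1) (bilaplacian_profile n x1) (h3 _ x0').
have z1 : eball 1 (0 : 'rV[R]_4) by rewrite /eball /= enorm0.
move=> x xr; have [->|/hx] := eqVneq x 0; last exact.
apply: (continuous_le_at0 (F := fun x => laplacian (laplacian (u m)) x - laplacian (laplacian (u n)) x) r0 _ hx).
apply: (@continuousB _ _ _ (laplacian (laplacian (u m))) (laplacian (laplacian (u n))));
  exact: continuous_bilaplacian.
Unshelve. all: by end_near.
Qed.

(** With the density between [0] and [F], [g n] exceeds the parabola [g n 0 + w n 0 * r ^ 2 / 8] by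
    at least [0] and at most [F / 192]. The parabola is thus bounded above at both [0] and [d], and
    diverging data push it to minus infinity in between. *)
Lemma unbounded_to_Ny (C : R) : (forall n, u n 0 <= C) ->
  `|u n 0| + `|laplacian (u n) 0| @[n --> \oo] --> +oo ->
  forall r1 r2 L : R, 0 < r1 < r2 -> r2 < 1 ->
  \forall n \near \oo, forall r : R, r1 <= r <= r2 -> g n r <= - L.
Proof.
move=> uC /cvgryPge hS r1 r2 L /andP[r10 r12] r21.
pose d : R := (1 + r2) / 2; pose d' : R := (1 + d) / 2.
have d0 : 0 < d by rewrite /d; lra.
have d1 : d < 1 by rewrite /d; lra.
have r2d : r2 < d by rewrite /d; lra.
have dd' : d < d' by rewrite /d'; lra.
have d'1 : d' < 1 by rewrite /d'; lra.
clearbody d'; clearbody d.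
have [A hA] := sequence_le uC (introT andP (conj (lt_trans d0 dd') d'1)).
pose F := 2 * expR (4 * A).
have F0 : 0 < F by apply: mulr_gt0 => //; exact: expR_gt0.
pose B := Num.max A C.
have AB : A <= B by rewrite le_max lexx.
have CB : C <= B by rewrite le_max lexx orbT.
clearbody B.
have d20 : 0 < d ^+ 2 by exact: exprn_gt0.
(* The largest [th] for which [two_point_bound] covers all radii between [r1] and [r2]. *)
pose th := Num.min (r1 ^+ 2 / d ^+ 2) (1 - r2 ^+ 2 / d ^+ 2).
have th0 : 0 < th.
  rewrite lt_min; apply/andP; split; first by apply: divr_gt0 => //; exact: exprn_gt0.
  by rewrite subr_gt0 ltr_pdivrMr // mul1r !expr2; apply: ltr_pM => //; lra.
have th1 : th * d ^+ 2 <= r1 ^+ 2 by rewrite -ler_pdivlMr // ge_min lexx.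
have th2 : r2 ^+ 2 <= (1 - th) * d ^+ 2.
  have thr : th <= 1 - r2 ^+ 2 / d ^+ 2 by rewrite ge_min lexx orbT.
  by rewrite -ler_pdivrMr //; lra.
clearbody th.
pose k := th * d ^+ 2 / 9.
have k0 : 0 < k by apply: divr_gt0 => //; exact: mulr_gt0.
near=> n => r /andP[r1r rr2].
have hAn : forall r : R, 0 <= r <= d' -> g n r <= A by near: n; exact: hA.
have fn : forall r : R, 0 < r < d' -> 0 <= W n r * expR (4 * g n r) <= 2 * expR (4 * g n r).
  by near: n; exact: f_le.
have Sn : (L + `|B| + F) / k + `|B| + `|B| / k <= `|u n 0| + `|laplacian (u n) 0|.
  by near: n; exact: hS.
have hs := radsol_restrict (ltW d'1) (sequence_radsol n).
have fu (t : R) : 0 < t < d -> W n t * expR (4 * g n t) <= F.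
  move=> /andP[t0 td]; have td' : t < d' by exact: lt_trans dd'.
  have /andP[_] : 0 <= W n t * expR (4 * g n t) <= 2 * expR (4 * g n t) by apply: fn; rewrite t0.
  move/le_trans; apply; rewrite ler_pM2l // ler_expR ler_pM2l //.
  by apply: hAn; rewrite !ltW.
have fl (t : R) : 0 < t < d -> 0 <= W n t * expR (4 * g n t).
  move=> /andP[t0 td]; have td' : 0 < t < d' by rewrite t0 (lt_trans td).
  by have /andP[] := fn t td'.
have dd : 0 <= d <= d by rewrite lexx ltW.
have rd : 0 <= r <= d by apply/andP; split; lra.
have [_ _ _ gd] := radsol_ge hs dd' fl dd.
have [_ _ _ gr] := radsol_le hs dd' fu rd.
have gA : g n d <= A by apply: hAn; rewrite !ltW.
have r_gt0 : 0 < r by exact: lt_le_trans r1r.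
have r2_gt0 : 0 < r2 by exact: lt_le_trans rr2.
have r2r : r1 ^+ 2 <= r ^+ 2 by rewrite lerXn2r // ?nnegrE ltW.
have rr22 : r ^+ 2 <= r2 ^+ 2 by rewrite lerXn2r // ?nnegrE ltW.
have hr : th * d ^+ 2 <= r ^+ 2 <= (1 - th) * d ^+ 2 by apply/andP; split; lra.
have d01 : 0 < d <= 1 by rewrite d0 ltW.
have pB : g n 0 <= B by rewrite /g scale0r (le_trans (uC n)).
have qB : g n 0 + w n 0 * d ^+ 2 / 8 <= B by lra.
have := two_point_bound d01 (ltW th0) hr pB qB; rewrite -/k.
have -> : `|g n 0| + `|w n 0| = `|u n 0| + `|laplacian (u n) 0|.
  by rewrite /g /w scale0r normrN.
have kS := ler_wpM2l (ltW k0) Sn.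
have e1 : k * ((L + `|B| + F) / k + `|B| + `|B| / k) = L + `|B| + F + k * `|B| + `|B|.
  by field; rewrite gt_eqF.
have r41 : r ^+ 4 <= 1 by rewrite exprn_ile1 //; lra.
have Fr := ler_wpM2l (ltW F0) r41.
have := ler_norm B; have := normr_ge0 B.
move: (`|u n 0| + _) kS gr => S; rewrite e1; lra.
Unshelve. all: by end_near.
Qed.

(** Below a small radius [s] the density is at most [F]; from [s] to [del] it is at most [e / 2],
    because [g n] tends uniformly to minus infinity there. *)
Lemma unbounded_mass (C : R) : (forall n, u n 0 <= C) ->
  `|u n 0| + `|laplacian (u n) 0| @[n --> \oo] --> +oo ->
  forall del : R, 0 < del < 1 -> P n del @[n --> \oo] --> 0.
Proof.
have fin (x y D S F s e : R) : x - y <= e / 2 * D / 4 - e / 2 * S / 4 -> y <= F * S / 4 ->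
    F * S <= F * s -> F * s <= e -> e * D <= e * 1 -> 0 <= e * S -> 0 <= e -> x <= e by lra.
move=> uC hS del hd; have [d0 d1] := andP hd; apply/cvgrPdist_le => e e0.
have [A hA] := sequence_le uC hd.
have hd' : 0 < (1 + del) / 2 < 1 by apply/andP; split; lra.
pose F := 2 * expR (4 * A).
have F0 : 0 < F by apply: mulr_gt0 => //; exact: expR_gt0.
pose s := Num.min (del / 2) (e / F).
have s0 : 0 < s by rewrite lt_min !divr_gt0.
have sd : s < del.
  by apply: (@le_lt_trans _ _ (del / 2)); [rewrite ge_min lexx|lra].
have sF : F * s <= e by rewrite mulrC -ler_pdivlMr // ge_min lexx orbT.
clearbody s.
pose L := - ln (e / 4) / 4.
have e4 : 0 < e / 4 by lra.
have LE : 2 * expR (4 * (- L)) = e / 2.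
  have -> : 4 * - L = ln (e / 4) by rewrite /L; field.
  by rewrite lnK ?posrE //; field.
have hsd : 0 < s < del by rewrite s0.
near=> n; rewrite sub0r normrN.
have hAn : forall r : R, 0 <= r <= del -> g n r <= A by near: n; exact: hA.
have gL : forall r : R, s <= r <= del -> g n r <= - L.
  by near: n; exact: (unbounded_to_Ny uC hS).
have fn : forall r : R, 0 < r < (1 + del) / 2 ->
    0 <= W n r * expR (4 * g n r) <= 2 * expR (4 * g n r).
  by near: n; apply: f_le; have [] := andP hd'.
have hs := radsol_restrict (ltW (andP hd').2) (sequence_radsol n).
have dd' : del < (1 + del) / 2 by lra.
have sd' : s < (1 + del) / 2 by exact: lt_trans dd'.
have ins (t : R) : 0 < t <= del -> 0 < t < (1 + del) / 2.
  by move=> /andP[-> /le_lt_trans]; exact.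
have fu (t : R) : 0 < t < s -> W n t * expR (4 * g n t) <= F.
  move=> /andP[t0 ts]; have td : t <= del by rewrite ltW // (lt_trans ts).
  have /andP[_] := fn t (ins t (introT andP (conj t0 td))).
  move/le_trans; apply; rewrite ler_pM2l // ler_expR ler_pM2l //.
  by apply: hAn; rewrite ltW.
have ss : 0 <= s <= s by rewrite lexx ltW.
have [Ps _ _ _] := radsol_le hs sd' fu ss.
have f0 (t : R) : 0 < t < (1 + del) / 2 -> 0 <= W n t * expR (4 * g n t).
  by move=> /fn /andP[].
have P0 : 0 <= P n del.
  by rewrite -(rs_P00 hs); apply: (radsol_P_homo hs f0); rewrite ?lexx ?ltW.
have hP : P n del - P n s <= e / 2 * del ^+ 4 / 4 - e / 2 * s ^+ 4 / 4.
  apply: (@le_of_deriv_cc R (P n) (fun t => e / 2 * t ^+ 4 / 4)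
    (fun t => t ^+ 3 * (W n t * expR (4 * g n t))) (fun t => t ^+ 3 * (e / 2)) s del (ltW sd)).
  - by move=> t /andP[st td]; apply: (rs_P hs); apply: ins; rewrite td andbT; exact: lt_le_trans st.
  - by move=> t _; apply: is_derive_eq; rewrite /GRing.scale /=; field.
  - move=> t /andP[st td]; have t0 : 0 < t by exact: lt_le_trans st.
    apply: ler_wpM2l; first by apply: exprn_ge0; exact: ltW.
    have /andP[_] := fn t (ins t (introT andP (conj t0 td))).
    move/le_trans; apply; rewrite -LE ler_pM2l // ler_expR ler_pM2l //.
    by apply: gL; rewrite st.
rewrite ger0_norm //.
have d41 : del ^+ 4 <= 1 by rewrite exprn_ile1 // ltW.
have s40 : 0 <= s ^+ 4 by apply: exprn_ge0; exact: ltW.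
have s4 : s ^+ 4 <= s by rewrite exprS ler_piMr ?exprn_ile1 ?ltW // (lt_trans sd).
have h1 := ler_wpM2l (ltW F0) s4; have h2 := ler_wpM2l (ltW e0) d41.
exact: (fin _ _ _ _ _ _ _ hP Ps h1 sF h2 (mulr_ge0 (ltW e0) s40) (ltW e0)).
Unshelve. all: by end_near.
Qed.

Lemma unbounded_Nycvg (C : R) : (forall n, u n 0 <= C) ->
  `|u n 0| + `|laplacian (u n) 0| @[n --> \oo] --> +oo -> Nycvg_loc (eball 1 `\ 0) u.
Proof.
move=> uC hS K cK KD A.
have K1 : K `<=` eball 1 by move=> x /KD[].
have [r2 /andP[r20 r21] Kr2] := compact_eball ltr01 cK K1.
have [r1 r10 Kr1] : exists2 r1 : R, 0 < r1 & forall x, K x -> r1 <= enorm x.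
  have [->|/set0P K0] := eqVneq K set0; first by exists 1.
  have cont : {within K, continuous (@enorm R)}.
    by apply: continuous_subspaceT; exact: continuous_enorm.
  have [c Kc hc] := EVT_min_rV K0 cK cont.
  exists (enorm c); last by move=> x Kx; apply: hc; exact: mem_set.
  have [_ /= c0] : (eball 1 `\ 0) c by apply: KD; exact: set_mem.
  by apply: enorm_gt0; apply/eqP.
pose s := Num.min r1 (r2 / 2).
have s0 : 0 < s by rewrite lt_min r10 divr_gt0.
have sr1 : s <= r1 by rewrite ge_min lexx.
have sr2 : 0 < s < r2.
  by rewrite s0 /=; apply: (@le_lt_trans _ _ (r2 / 2)); [rewrite ge_min lexx orbT|lra].
apply: filterS (unbounded_to_Ny uC hS (- A) sr2 r21) => n h x Kx.
have xr2 : enorm x < r2 by exact: Kr2.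
have x1 : eball 1 x by exact: K1.
rewrite (u_radial n x1 (eball_ray 0 x1)) ?enorm_ray ?enorm_ge0 //.
rewrite -[A]opprK; apply: h; rewrite (ltW xr2) andbT.
exact: le_trans (Kr1 x Kx).
Qed.

End sequence.

Lemma compact_subset_eball (R : realType) (K : set 'rV[R]_4) : compact K ->
  exists2 r : R, 0 < r & K `<=` eball r.
Proof.
move=> cK; have [->|/set0P K0] := eqVneq K set0; first by exists 1.
have cont : {within K, continuous (@enorm R)}.
  by apply: continuous_subspaceT; exact: continuous_enorm.
have [c Kc hc] := EVT_max_rV K0 cK cont.
exists (enorm c + 1); first by have c0 := enorm_ge0 c; lra.
move=> x Kx; rewrite /eball /=; apply: (@le_lt_trans _ _ (enorm c)); last by rewrite ltrDl.
by apply: hc; exact: mem_set.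
Qed.

(** * The rescaled sequence, when [u n 0] tends to infinity *)

Section blowup_sequence.
Context {R : realType}.
Variables V u : nat -> 'rV[R]_4 -> R.
Hypotheses (V_cvg : Ckloc_cvg 0 (eball 1) V (cst 1))
  (u_C4 : forall k, Ck 4 (eball 1) (u k))
  (u_eq : forall k x, eball 1 x -> laplacian (laplacian (u k)) x = V k x * expR (4 * u k x))
  (u_radial : forall k, radial_on (eball 1) (u k))
  (u_oo : u n 0 @[n --> \oo] --> +oo).

Let l n := expR (- u n 0).
Let W n (r : R) := V n ((l n * r) *: e_ 0).
Let g n (r : R) := u n ((l n * r) *: e_ 0) + - u n 0.
Let a n (r : R) := l n ^- 2 * ((l n * r) ^+ 3 * partial 0 (u n) ((l n * r) *: e_ 0)).
Let w n (r : R) := l n ^+ 2 * - laplacian (u n) ((l n * r) *: e_ 0).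
Let P n (r : R) := - ((l n * r) ^+ 3 * partial 0 (laplacian (u n)) ((l n * r) *: e_ 0)).
Let b n := expR (- 2 * u n 0) * laplacian (u n) 0.

Let l0 n : 0 < l n. Proof. exact: expR_gt0. Qed.
Let lE n : l n * expR (u n 0) = 1. Proof. by rewrite /l -expRD addNr expR0. Qed.

(** Places the sequence in the setting of the section [blowup] with [M n = u n 0]: the unit ball
    becomes the ball of radius [exp (u n 0)]. *)
Lemma rescaled_radsol n : radsol (expR (u n 0)) (g n) (a n) (w n) (P n)
  (fun r => W n r * expR (4 * g n r)).
Proof.
have hs := sequence_radsol u_C4 u_eq u_radial n.
have := radsol_scale (- u n 0) (l0 n) hs.
have -> : 1 / l n = expR (u n 0).
  by apply: (mulfI (lt0r_neq0 (l0 n))); rewrite lE mulrCA divff ?mulr1 // gt_eqF.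
move=> H; apply: radsol_eqf H _ => r _; rewrite /W /g mulrCA; congr (_ * _).
by rewrite /l -expRM_natl -expRD; congr expR; ring.
Qed.

Lemma rescaled_g0 n : g n 0 = 0.
Proof. by rewrite /g mulr0 scale0r subrr. Qed.

Lemma rescaled_w0 n : w n 0 = - b n.
Proof.
rewrite /w /b mulr0 scale0r mulrN /l -expRM_natl.
by have -> : 2 * - u n 0 = - 2 * u n 0 by ring.
Qed.

Lemma rescaled_W (del e : R) : 0 < del < 1 -> 0 < e ->
  \forall n \near \oo, forall r : R, 0 < r < del * expR (u n 0) -> `|W n r - 1| <= e.
Proof.
move=> /andP[d0 d1] e0; apply: filterS (V_uniform V_cvg d1 e0) => n h r /andP[r0 rd].
apply: h; rewrite /eball /= enorm_ray; last by rewrite mulr_ge0 // ltW.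
by rewrite -(ltr_pM2l (l0 n)) in rd; rewrite (lt_le_trans rd) // mulrCA lE mulr1.
Qed.

Lemma rescale0 n : rescale (u n) 0 = 0.
Proof. by rewrite /rescale scaler0 subrr. Qed.

Lemma rescale_ray n (r : R) : rescale (u n) (r *: e_ 0) = g n r.
Proof. by rewrite /rescale scalerA. Qed.

Lemma rescale_profile n x : eball (expR (u n 0)) x -> rescale (u n) x = g n (enorm x).
Proof.
move=> xM; rewrite -rescale_ray; apply: (rescale_radial (u_radial n)) => //.
  exact: eball_ray.
by rewrite enorm_ray ?enorm_ge0.
Qed.

Lemma rescale_bilaplacian_profile n x : eball (expR (u n 0)) x ->
  laplacian (laplacian (rescale (u n))) x = W n (enorm x) * expR (4 * g n (enorm x)).
Proof.
move=> xM; have [_ _ /(_ x xM) H] := rescale_bilaplacian (u_C4 n); apply: etrans H _.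
have x1 := rescale_ball xM.
apply: etrans (congr1 _ (bilaplacian_profile u_C4 u_eq u_radial n x1)) _.
rewrite enormZ ger0_norm ?expR_ge0 // mulrCA /W /g -/(l n); congr (_ * _).
by rewrite -expRD; congr expR; ring.
Qed.

Let nearE (r : R) : \forall n \near \oo, r < expR (u n 0).
Proof. by apply: filterS (near_le_expR r u_oo ltr01) => n; rewrite mul1r. Qed.

Let cauchy (q r e : R) : b n @[n --> \oo] --> q -> 0 < r -> 0 < e ->
  exists N : nat, forall m n : nat, (N <= m)%N -> (N <= n)%N ->
    [/\ `|g m 0 - g n 0| <= e, `|w m 0 - w n 0| <= e &
       forall t : R, 0 < t < r ->
       `|W m t * expR (4 * g m t) - W n t * expR (4 * g n t)| <= e].
Proof.
move=> bq r0 e0.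
have wq : w n 0 @[n --> \oo] --> - q by under eq_fun do rewrite rescaled_w0; exact: cvgN.
exact: (blowup_cauchy u_oo rescaled_radsol rescaled_g0 rescaled_W wq r0 e0).
Qed.

(** After rescaling the value at 0 is [0] and the Laplacian at 0 is [b n], so the convergence of
    [b n] alone fixes the data. *)
Lemma rescale_cvg (q : R) : b n @[n --> \oo] --> q ->
  exists v, Ck 4 setT v /\ Ckloc_cvg 4 setT (fun n => rescale (u n)) v.
Proof.
move=> bq; apply: (@radial_limit R setT [set r | 0 < r]) => //.
- apply/seteqP; split=> // x _; exists (enorm x + 1); rewrite /eball /=.
    by have := enorm_ge0 x; lra.
  by rewrite ltrDl.
- by move=> K cK _; exact: compact_subset_eball.
- move=> r r0; near=> n.
  have sub : eball r `<=` @eball R (expR (u n 0)).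
    by apply: subset_eball; apply: ltW; near: n; exact: nearE.
  have [C _ _] := rescale_bilaplacian (u_C4 n).
  split; last exact: Ck_subset sub C.
  by move=> x y /sub xr /sub yr; exact: (rescale_radial (u_radial n)).
move=> r e r0 e0.
have [N hN] := cauchy bq r0 e0; have [N' _ hN'] := nearE r.
exists (maxn N N') => m n; rewrite !geq_max => /andP[Nm N'm] /andP[Nn N'n].
have [h1 h2 h3] := hN m n Nm Nn.
have rm : r < expR (u m 0) := hN' m N'm; have rn : r < expR (u n 0) := hN' n N'n.
have [Cm lm _] := rescale_bilaplacian (u_C4 m); have [Cn ln _] := rescale_bilaplacian (u_C4 n).
split.
- by rewrite !rescale0 subrr normr0 ltW.
- rewrite lm ln -/(b m) -/(b n); move: h2; rewrite !rescaled_w0.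
  by rewrite -opprD normrN.
have hx x : eball r x -> x != 0 -> `|laplacian (laplacian (rescale (u m))) x -
    laplacian (laplacian (rescale (u n))) x| <= e.
  move=> xr x0; have xm := lt_trans xr rm; have xn := lt_trans xr rn.
  have x0' : 0 < enorm x < r by rewrite enorm_gt0.
  exact: dist_eq (rescale_bilaplacian_profile xm) (rescale_bilaplacian_profile xn) (h3 _ x0').
have cont k : r < expR (u k 0) -> Ck 4 (eball (expR (u k 0))) (rescale (u k)) ->
    {for 0, continuous (laplacian (laplacian (rescale (u k))))}.
  move=> rk Ckk; have oD := @open_eball R (expR (u k 0)).
  have h : Ck 0 (eball (expR (u k 0))) (laplacian (laplacian (rescale (u k)))).
    by do 2 apply: Ck_laplacian => //.
  by apply: (Ck_continuous (s := [::]) h) => //; rewrite /eball /= enorm0 expR_gt0.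
move=> x xr; have [->|/hx] := eqVneq x 0; last exact.
apply: (continuous_le_at0 (F := fun x => laplacian (laplacian (rescale (u m))) x -
   laplacian (laplacian (rescale (u n))) x) r0 _ hx).
apply: (@continuousB _ _ _ (laplacian (laplacian (rescale (u m))))
  (laplacian (laplacian (rescale (u n))))); exact: cont.
Unshelve. all: by end_near.
Qed.

Let rescaled_f2 : \forall n \near \oo, forall x, eball (2^-1 * expR (u n 0)) x ->
  `|laplacian (laplacian (rescale (u n))) x| <= 2.
Proof.
have h2 : 0 < (2^-1 : R) < 1 by apply/andP; split; lra.
have [h20 h21] := andP h2.
near=> n => x xd.
have xM : eball (expR (u n 0)) x.
  by apply: lt_trans xd _; rewrite gtr_pMl ?expR_gt0.
have gn : forall r : R, 0 <= r <= 2^-1 * expR (u n 0) -> g n r <= 0.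
  by near: n; exact: (blowup_le0 u_oo rescaled_radsol rescaled_g0 rescaled_W h2).
have Vn : forall y, eball 2^-1 y -> `|V n y - 1| <= 1.
  by near: n; exact: (V_uniform V_cvg h21 ltr01).
rewrite (rescale_bilaplacian_profile xM) normrM (ger0_norm (expR_ge0 _)) -[leRHS]mulr1.
apply: ler_pM (normr_ge0 _) (expR_ge0 _) _ _.
  have lx : 0 <= l n * enorm x by rewrite mulr_ge0 ?enorm_ge0 // ltW.
  have := Vn ((l n * enorm x) *: e_ 0); rewrite /eball /= enorm_ray //.
  have lxd : l n * enorm x < 2^-1.
    have : l n * enorm x < l n * (2^-1 * expR (u n 0)) by rewrite ltr_pM2l.
    by rewrite mulrCA lE mulr1.
  move=> /(_ lxd).
  by rewrite /W !ler_norml; lra.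
by rewrite expR_le1 pmulr_rle0 // gn // enorm_ge0 ltW.
Unshelve. all: by end_near.
Qed.

(** The difference with the quadratic profile vanishes at 0 together with its Laplacian, and its
    bilaplacian is at most [2 / b n] on a given compact set for large [n]; [partials_bound] does the
    rest. *)
Lemma rescale_quadratic : b n @[n --> \oo] --> +oo ->
  Ckloc_cvg 3 setT (fun n x => rescale (u n) x / b n) (fun x => - (enorm x ^+ 2 / 8)).
Proof.
have fin0 (B e y : R) : 0 < e -> 0 < y -> 1 + 2 * B / e <= y -> B * (y^-1 * 2) < e.
  move=> e0 y0 h; have h1 : 2 * B / e < y by lra.
  have -> : B * (y^-1 * 2) = 2 * B / y by ring.
  by rewrite ltr_pdivrMr // (mulrC e) -ltr_pdivrMr.
move=> /cvgryPge boo; have [qC q1 q2] := quadratic_Ck R.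
move: qC q1 q2; set q := (fun x : 'rV[R]_4 => - (enorm x ^+ 2 / 8)) => qC q1 q2.
have q0 : q 0 = 0 by rewrite /q enorm0 expr0n /= mul0r oppr0.
have qr : forall x y, enorm x = enorm y -> q x = q y by rewrite /q => x y ->.
clearbody q.
apply/Ckloc_cvgP => s K e s3 cK _ e0; have [r r0 Kr] := compact_subset_eball cK.
have oD := @open_eball R r.
pose B : R := 24 * (1 + r) ^+ 4.
have B0 : 0 < B by apply: mulr_gt0 => //; apply: exprn_gt0; lra.
have s4 : (size s <= 4)%N by exact: leq_trans s3 _.
near=> n => x /Kr xr.
have bn : 1 + 2 * B / e <= b n by near: n; exact: boo.
have rM : r < 2^-1 * expR (u n 0) by near: n; exact: near_le_expR.
have rM' : r < expR (u n 0) by near: n; exact: nearE.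
have f2 : forall x, eball (2^-1 * expR (u n 0)) x -> `|laplacian (laplacian (rescale (u n))) x| <= 2.
  by near: n; exact: rescaled_f2.
have Be : 0 < 2 * B / e by apply: divr_gt0 => //; exact: mulr_gt0.
have b0 : 0 < b n by lra.
have [C ln _] := rescale_bilaplacian (u_C4 n).
have C' : Ck 4 (eball r) (rescale (u n)) by apply: Ck_subset C; apply: subset_eball; exact: ltW.
have qC' : Ck 4 (eball r) q by exact: Ck_subset qC.
have [hp Cd] := Ck_comb (b n)^-1 (-1) oD C' qC'.
have [hp' _] := Ck_comb (b n)^-1 0 oD C' qC'.
have hL := bilaplacian_comb (b n)^-1 (-1) oD C' qC'.
have C2 : Ck 2 (eball r) (rescale (u n)) by exact: Ck_le C'.
have q2' : Ck 2 (eball r) q by exact: Ck_le qC'.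
have hl := laplacian_comb (b n)^-1 (-1) oD C2 q2'.
have rd : radial_on (eball r) (fun x => (b n)^-1 * rescale (u n) x + -1 * q x).
  move=> y z yr zr yz; rewrite (qr y z) //; congr (_ * _ + _).
  by apply: (rescale_radial (u_radial n)) => //; [exact: lt_trans rM'|exact: lt_trans rM'].
have hE y : eball r y ->
    `|laplacian (laplacian (fun x => (b n)^-1 * rescale (u n) x + -1 * q x)) y| <= (b n)^-1 * 2.
  move=> yr; have yM : eball (2^-1 * expR (u n 0)) y by exact: lt_trans rM.
  have fin (A D : R) : D = 0 -> `|A| <= 2 -> `|(b n)^-1 * A + -1 * D| <= (b n)^-1 * 2.
    move=> ->; rewrite mulr0 addr0 normrM => A2; have bV : 0 < (b n)^-1 by rewrite invr_gt0.
    by rewrite (gtr0_norm bV) ler_pM2l.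
  by rewrite (hL y yr); exact: fin (q2 y) (f2 y yM).
have z0 : eball r (0 : 'rV[R]_4) by rewrite /eball /= enorm0.
have v0 : `|(b n)^-1 * rescale (u n) 0 + -1 * q 0| = 0.
  by rewrite rescale0 q0 !mulr0 addr0 normr0.
have l0' : `|laplacian (fun x => (b n)^-1 * rescale (u n) x + -1 * q x) 0| = 0.
  have fin (A D : R) : A = b n -> D = 1 -> `|(b n)^-1 * A + -1 * D| = 0.
    by move=> -> ->; rewrite mulVf ?gt_eqF // mulr1 subrr normr0.
  by rewrite (hl 0 z0); exact: fin ln q1.
have := partials_bound r0 rd Cd hE s4 xr.
rewrite (hp s x s4 xr) v0 l0' add0r add0r -/B => hb.
have -> : (fun x => rescale (u n) x / b n) = (fun x => (b n)^-1 * rescale (u n) x + 0 * q x).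
  by apply/funext => y; rewrite mul0r addr0 mulrC.
rewrite (hp' s x s4 xr) mul0r addr0 distrC.
move: hb; rewrite mulN1r => /le_lt_trans; apply.
exact: fin0 e0 b0 bn.
Unshelve. all: by end_near.
Qed.

Let PE n (del : R) : P n (del * expR (u n 0)) = flux (u n) del.
Proof. by rewrite /P /flux mulrCA lE mulr1. Qed.

Let Pflux n (r : R) : P n r = flux (u n) (r * expR (- u n 0)).
Proof. by rewrite (mulrC r). Qed.

Let w_cvg (q : R) : b n @[n --> \oo] --> q -> w n 0 @[n --> \oo] --> - q.
Proof. by move=> bq; under eq_fun do rewrite rescaled_w0; exact: cvgN. Qed.

Let g_cvg (v : 'rV[R]_4 -> R) : Ckloc_cvg 4 setT (fun n => rescale (u n)) v ->
  forall x, g n (enorm x) @[n --> \oo] --> v x.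
Proof.
move=> hv x; have hx := Ckloc_cvg_pointwise hv (I : setT x).
apply: cvg_trans hx; apply: near_eq_cvg; apply: filterS (nearE (enorm x)) => n xn.
exact: rescale_profile.
Qed.

Lemma laplacian_lower (q : R) : b n @[n --> \oo] --> q -> 8 / Num.sqrt 96 <= q.
Proof.
move=> bq; apply/ler_addgt0Pr => e e0; rewrite -lerBlDr.
apply: (cvgr_to_ge bq).
apply: filterS (blowup_laplacian u_oo rescaled_radsol rescaled_g0 rescaled_W e0) => n.
by rewrite rescaled_w0; move: (b n) (8 / _) => B K; lra.
Qed.

(** The missing lower bound that allows a convergent subsequence of [b n] to be extracted once it is
    bounded above. *)
Lemma laplacian_lower_near : \forall n \near \oo, 0 <= b n.
Proof.
have s0 : 0 < 8 / Num.sqrt 96 :> R by rewrite divr_gt0 // sqrtr_gt0.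
apply: filterS (blowup_laplacian u_oo rescaled_radsol rescaled_g0 rescaled_W s0) => n.
by rewrite rescaled_w0; move: (b n) (8 / _) => B K; lra.
Qed.

Lemma critical_outcome : b n @[n --> \oo] --> 8 / Num.sqrt 96 ->
  [/\ exists Phi : R -> R, (forall r : R, 0 < r ->
        flux (u n) (r * expR (- u n 0)) @[n --> \oo] --> Phi r) /\ Phi r @[r --> +oo] --> (8 : R),
      forall del : R, 0 < del < 1 -> flux (u n) del @[n --> \oo] --> (8 : R) &
      Ckloc_cvg 3 setT (fun n => rescale (u n))
        (fun x => ln (Num.sqrt 96 / (Num.sqrt 96 + enorm x ^+ 2)))].
Proof.
move=> bq; have [h1 h2 h3 h4] :=
  blowup_critical u_oo rescaled_radsol rescaled_g0 rescaled_W (w_cvg bq).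
split.
- exists (bubble_mass (Num.sqrt 96)); split; last exact: h2.
  by move=> r r0; under eq_fun do rewrite -Pflux; exact: h1.
- by move=> del hd; under eq_fun do rewrite -PE; exact: h3.
have [v [_ hv]] := rescale_cvg bq.
(* The limit of [rescale_cvg] is identified pointwise; the origin is separate because
   [blowup_critical] concerns positive radii. *)
suff <- : v = (fun x => ln (Num.sqrt 96 / (Num.sqrt 96 + enorm x ^+ 2))) by exact: Ckloc_cvg_le hv.
apply/funext => x; have gx := g_cvg hv (x := x).
have [x0|/enorm_gt0/h4 hx] := eqVneq x 0; last exact: (cvg_unique _ gx hx).
move: gx; rewrite x0 enorm0 => gx.
have -> : ln (Num.sqrt 96 / (Num.sqrt 96 + 0 ^+ 2)) = 0 :> R.
  by rewrite expr0n /= addr0 divff ?ln1 // gt_eqF // sqrtr_gt0.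
move: gx; under eq_fun do rewrite rescaled_g0; move=> gx.
have c0 : (0 : R) @[_ --> \oo] --> (0 : R) by exact: cvg_cst.
exact: (cvg_unique _ gx c0).
Qed.

Lemma infinite_outcome : b n @[n --> \oo] --> +oo ->
  (forall r : R, 0 < r -> flux (u n) (r * expR (- u n 0)) @[n --> \oo] --> (0 : R)) /\
  (forall del : R, 0 < del < 1 -> flux (u n) del @[n --> \oo] --> (0 : R)).
Proof.
move=> boo; have woo : - w n 0 @[n --> \oo] --> +oo.
  by under eq_fun do rewrite rescaled_w0 opprK.
have [h1 h2] := blowup_oo u_oo rescaled_radsol rescaled_g0 rescaled_W woo; split.
- by move=> r r0; under eq_fun do rewrite -Pflux; exact: h1.
- by move=> del hd; under eq_fun do rewrite -PE; exact: h2.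
Qed.

(** The dominating bubble gives integrability and [v <= - k * |x| ^ 2]. The existence of the limit
    of [v / |x| ^ 2] is a monotonicity property: by [radsol_ratio], passed to the limit, this ratio
    is nondecreasing in [|x|], so it tends to its supremum, which is at most [- k]. *)
Lemma subcritical_outcome (q : R) : b n @[n --> \oo] --> q -> 8 / Num.sqrt 96 < q ->
  exists A : R, [/\ 0 < A < 8,
    exists Phi : R -> R, (forall r : R, 0 < r ->
        flux (u n) (r * expR (- u n 0)) @[n --> \oo] --> Phi r) /\ Phi r @[r --> +oo] --> A,
    forall del : R, 0 < del < 1 -> flux (u n) del @[n --> \oo] --> A &
    exists v, [/\ Ck 4 setT v, (@lebesgue4 R).-integrable setT (fun x => (expR (4 * v x))%:E),
      Ckloc_cvg 3 setT (fun n => rescale (u n)) v &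
      exists2 lambda : R, 0 < lambda & v x / enorm x ^+ 2 @[x --> @at_infinity R] --> - lambda]].
Proof.
move=> bq hq; have hq' : - q < - (8 / Num.sqrt 96) by rewrite ltrN2.
have [Phi [A [c [k [h1 h2 h3 hA [c0 k0 hc]]]]]] :=
  blowup_subcritical u_oo rescaled_radsol rescaled_g0 rescaled_W (w_cvg bq) hq'.
exists A; split; first exact: hA.
- exists Phi; split; last exact: h2.
  by move=> r r0; under eq_fun do rewrite -Pflux; exact: h1.
- by move=> del hd; under eq_fun do rewrite -PE; exact: h3.
have [v [vC hv]] := rescale_cvg bq; exists v.
have gv := g_cvg hv.
have v_le x : x != 0 -> v x <= bubble c (enorm x) - k * enorm x ^+ 2.
  by move=> /enorm_gt0/hc hx; exact: (cvgr_to_le (gv x) hx).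
have vb x : v x <= bubble c (enorm x).
  have [->|/v_le h] := eqVneq x 0.
    rewrite enorm0 bubble0 //; apply: (cvgr_to_le (gv 0)).
    by near=> n; rewrite enorm0 rescaled_g0.
  by apply: le_trans h _; rewrite gerBl mulr_ge0 ?sqr_ge0 // ltW.
have ratio x y : x != 0 -> enorm x <= enorm y -> v x / enorm x ^+ 2 <= v y / enorm y ^+ 2.
  move=> /enorm_gt0 x0 xy.
  have cx : g n (enorm x) / enorm x ^+ 2 @[n --> \oo] --> v x / enorm x ^+ 2 by apply: cvgMl; exact: gv.
  have cy : g n (enorm y) / enorm y ^+ 2 @[n --> \oo] --> v y / enorm y ^+ 2 by apply: cvgMl; exact: gv.
  rewrite -subr_ge0; apply: (cvgr_to_ge (cvgB cy cx)).
  have hd : 0 < (2^-1 : R) < 1 by apply/andP; split; lra.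
  near=> n; rewrite /= subr_ge0.
  have Wn : forall r : R, 0 < r < 2^-1 * expR (u n 0) -> `|W n r - 1| <= 1.
    by near: n; exact: rescaled_W.
  have hs : radsol (2^-1 * expR (u n 0)) (g n) (a n) (w n) (P n) (fun r => W n r * expR (4 * g n r)).
    apply: radsol_restrict (rescaled_radsol n); rewrite ler_piMl ?expR_ge0 //.
    by have [_ /ltW] := andP hd.
  apply: (radsol_ratio hs _ (rescaled_g0 n)).
  - move=> r hr; apply: mulr_ge0 (expR_ge0 _).
    by have := Wn r hr; rewrite ler_norml; lra.
  - by rewrite x0.
  - by near: n; apply: near_le_expR => //; have [] := andP hd.
split => //; last first.
- pose S := [set v x / enorm x ^+ 2 | x in [set x | x != 0]].
  have S0 : S !=set0.
    exists (v (e_ 0) / enorm (e_ 0 : 'rV[R]_4) ^+ 2); exists (e_ 0) => //=.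
    by apply/eqP => /(congr1 (@enorm R)); rewrite enorm_e enorm0 => /eqP; rewrite oner_eq0.
  have Sk : ubound S (- k).
    move=> _ [x /= x0 <-]; have x20 : 0 < enorm x ^+ 2 by rewrite exprn_gt0 // enorm_gt0.
    rewrite ler_pdivrMr // mulNr; apply: le_trans (v_le x x0) _.
    rewrite lerBlDr addNr; apply: ln_le0; rewrite ler_pdivrMr ?mul1r ?lerDl ?ltW //.
    by rewrite addr_gt0.
  have hS : has_sup S by split; [exact: S0|exists (- k)].
  exists (- sup S).
    have : sup S <= - k by exact: ge_sup.
    lra.
  rewrite opprK => B /nbhs_ballP[e /= e0 eB].
  have [_ [x0 /= x00 <-] hx0] := sup_adherent e0 hS.
  exists (enorm x0) => // x /= xx; apply: eB; rewrite -ball_normE /=.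
  have r0 := ratio x0 x x00 (ltW xx).
  have x0' : x != 0.
    by apply/eqP => xE; move: xx; rewrite xE enorm0 ltNge enorm_ge0.
  have : v x / enorm x ^+ 2 <= sup S by apply: ub_le_sup; [exists (- k)|exists x].
  move=> hx; rewrite ger0_norm ?subr_ge0 //.
  by move: hx r0 hx0; move: (v x / _) (v x0 / _) (sup S) => X Y Z; lra.
- exact: Ckloc_cvg_le hv.
have vc x : {for x, continuous v} by exact: (Ck_continuous (s := [::]) vC).
apply: (@le_integrable _ _ _ _ _ measurableT _ (fun x => ((c / (c + enorm x ^+ 2)) ^+ 4)%:E)).
- apply/measurable_EFinP; apply: continuous_on_measurable; first exact: openT.
  move=> x _; apply: (@continuous_comp _ _ _ (fun x => 4 * v x) (@expR R)).
    by apply: (@continuousM _ _ (cst 4) v); [exact: cst_continuous|exact: vc].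
  exact: continuous_expR.
- move=> x _; rewrite !abse_EFin lee_fin (ger0_norm (expR_ge0 _)).
  apply: le_trans (ler_norm _); rewrite -expR4_bubble // ler_expR.
  by rewrite ler_pM2l.
- exact: integrable_bubble.
Unshelve. all: by end_near.
Qed.

End blowup_sequence.

(** * Convergence of the densities as measures *)

(** Here [X] is the limit mass, [Y] and [Z] are the masses of the large and the small ball, and [I]
    is the integral against the test function, whose value at 0 is [p]. *)
Lemma weak_arith (R : realType) (I p X Y Z C e N : R) : 0 < e -> 0 <= C -> 0 < N ->
  `|I - p * Y| <= e / 4 / N * Z + 2 * C * (Y - Z) ->
  `|X - Y| <= e / (16 * (C + 1)) -> `|X - Z| <= e / (16 * (C + 1)) -> `|X - Z| <= 1 ->
  `|X| + 1 = N -> `|p| <= C -> `|X * p - I| <= e.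
Proof.
move=> e0 C0 N0 h1 h2 h3 h4 hN hp.
have D0 : 0 < 16 * (C + 1) by lra.
have e10 : 0 < e / 4 / N by apply: divr_gt0 => //; lra.
have w0 : 0 < e / (16 * (C + 1)) by exact: divr_gt0.
have k1 : (C + 1) * (e / (16 * (C + 1))) = e / 16 by field; rewrite gt_eqF //; lra.
move: k1 w0 h2 h3; move: (e / (16 * (C + 1))) => w k1 w0 h2 h3.
have k2 : `|p * (X - Y)| <= (C + 1) * w.
  by rewrite normrM; apply: ler_pM => //; lra.
have k3 : Z <= N by have := ler_norm X; move: h4; rewrite ler_norml; lra.
have k4 : e / 4 / N * Z <= e / 4.
  by apply: le_trans (ler_wpM2l (ltW e10) k3) _; rewrite divfK // gt_eqF.
have YZ : Y - Z <= 2 * w by move: h2 h3; rewrite !ler_norml; lra.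
have k5 := ler_wpM2l C0 YZ.
have -> : X * p - I = p * (X - Y) - (I - p * Y) by ring.
by apply: le_trans (ler_normB _ _) _; lra.
Qed.

Section density.
Context {R : realType}.
Variables V u : nat -> 'rV[R]_4 -> R.
Hypotheses (V_C0 : forall k, Ck 0 (eball 1) (V k))
  (V_cvg : Ckloc_cvg 0 (eball 1) V (cst 1))
  (u_C4 : forall k, Ck 4 (eball 1) (u k))
  (u_eq : forall k x, eball 1 x -> laplacian (laplacian (u k)) x = V k x * expR (4 * u k x))
  (u_radial : forall k, radial_on (eball 1) (u k)).

Let F n x := V n x * expR (4 * u n x).
Let m : R := 2 * pi ^+ 2.

Lemma density_continuous n x : eball 1 x -> {for x, continuous (F n)}.
Proof.
move=> x1; have cV := Ck_continuous (s := [::]) (V_C0 n) isT x1.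
have cu := Ck_continuous (s := [::]) (u_C4 n) isT x1.
apply: (@continuousM _ _ (V n) (fun x => expR (4 * u n x))); first exact: cV.
apply: (@continuous_comp _ _ _ (fun x => 4 * u n x) (@expR R)).
  by apply: (@continuousM _ _ (cst 4) (u n)); [exact: cst_continuous|exact: cu].
exact: continuous_expR.
Qed.

(** The density is a bilaplacian, hence inherits the symmetry of [u n]. *)
Lemma density_radial n : radial_on (eball 1) (F n).
Proof.
have oD := @open_eball R 1.
have hL : Ck 2 (eball 1) (laplacian (u n)) by exact: Ck_laplacian.
have rL : radial_on (eball 1) (laplacian (u n)).
  by apply: laplacian_radial; [exact: u_radial|exact: Ck_le (u_C4 n)].
move=> x y x1 y1 xy; rewrite /F.
exact: etrans (esym (u_eq n x1)) (etrans (laplacian_radial rL hL x1 y1 xy) (u_eq n y1)).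
Qed.

Lemma density_ge0 (del : R) : del < 1 -> \forall n \near \oo, forall x, eball del x -> 0 <= F n x.
Proof.
move=> d1; apply: filterS (V_uniform V_cvg d1 ltr01) => n h x /h.
by rewrite ler_norml => /andP[? _]; apply: mulr_ge0 (expR_ge0 _); lra.
Qed.

Lemma density_measurable n (del : R) : del <= 1 -> measurable_fun (eball del) (F n).
Proof.
move=> d1; apply: continuous_on_measurable; first exact: open_eball.
by move=> x xd; apply: density_continuous; exact: subset_eball xd.
Qed.

Lemma ball_mass (del : R) : 0 < del < 1 -> \forall n \near \oo, forall r : R, 0 <= r <= del ->
  (\int[lebesgue4]_(x in eball r) (F n x)%:E = (m * flux (u n) r)%:E)%E.
Proof.
move=> /andP[d0 d1]; have d1' : (1 + del) / 2 < 1 by lra.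
apply: filterS (density_ge0 d1') => n F0 r /andP[r0 rd].
have hs := radsol_radial ltr01 (u_radial n) (u_C4 n).
have sub := subset_eball (ltW d1').
apply: (@radial_integral R ((1 + del) / 2) (F n) _ _ F0 (flux (u n)) _ (rs_P0 hs) (rs_P00 hs)).
- by move=> x y /sub x1 /sub y1; exact: density_radial.
- by move=> x /sub; exact: density_continuous.
- move=> t /andP[t0 td]; have t1 : 0 < t < 1 by rewrite t0 (lt_trans td).
  have H := rs_P hs t1; apply: (is_derive_eq H).
  congr (_ * _); apply: u_eq; rewrite /eball /= enorm_ray; last exact: ltW.
  by have [_] := andP t1.
- by rewrite r0; lra.
Qed.

(** The annulus has mass [m] times a difference of fluxes, with limit [m * (A - Phi r)], and [Phi]
    tends to the same [A]. *)
Lemma annulus_cvg (A : R) (Phi : R -> R) : u n 0 @[n --> \oo] --> +oo ->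
  (forall r : R, 0 < r -> flux (u n) (r * expR (- u n 0)) @[n --> \oo] --> Phi r) ->
  Phi r @[r --> +oo] --> A ->
  (forall del : R, 0 < del < 1 -> flux (u n) del @[n --> \oo] --> A) ->
  forall del : R, 0 < del < 1 -> exists I : R -> R,
  (forall r : R, 0 < r ->
     (\int[lebesgue4]_(x in eball del `\` eball (r * expR (- u n 0%R))) (F n x)%:E)%E
       @[n --> \oo] --> (I r)%:E) /\ I r @[r --> +oo] --> 0.
Proof.
move=> uoo hPhi PhiA hA del hd; have [d0 d1] := andP hd.
exists (fun r => m * (A - Phi r)); split; last first.
  have h : m * (A - Phi r) @[r --> +oo] --> m * (A - A).
    by apply: cvgMr; apply: cvgB PhiA; exact: cvg_cst.
  by rewrite subrr mulr0 in h.
move=> r r0.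
have eqn : \forall n \near \oo, (\int[lebesgue4]_(x in eball del `\` eball (r * expR (- u n 0%R))) (F n x)%:E =
    (m * flux (u n) del - m * flux (u n) (r * expR (- u n 0)))%:E)%E.
  near=> n.
  have bm : forall r : R, 0 <= r <= del ->
      (\int[lebesgue4]_(x in eball r) (F n x)%:E = (m * flux (u n) r)%:E)%E.
    by near: n; exact: ball_mass.
  have F0 : forall x, eball del x -> 0 <= F n x by near: n; exact: density_ge0.
  have rd : r * expR (- u n 0) <= del.
    rewrite expRN ler_pdivrMr ?expR_gt0 //; apply: ltW; near: n; exact: near_le_expR.
  apply: (integral_annulus rd _ F0 _ _).
  - by apply: density_measurable; exact: ltW.
  - by apply: bm; rewrite lexx ltW.
  - by apply: bm; rewrite rd andbT; apply: mulr_ge0 (expR_ge0 _); exact: ltW.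
apply/fine_cvgP; split; first by apply: filterS eqn => n ->.
have h : m * flux (u n) del - m * flux (u n) (r * expR (- u n 0)) @[n --> \oo] --> m * (A - Phi r).
  rewrite mulrBr; apply: cvgB; apply: cvgMr; [exact: hA|exact: hPhi].
apply: cvg_trans h; apply: near_eq_cvg.
by apply: filterS eqn => n /= ->.
Unshelve. all: by end_near.
Qed.

(** The flux has the same limit at every radius, so no mass remains in any fixed annulus and all of
    it concentrates at the origin. *)
Lemma weak_cvg (A : R) : (forall del : R, 0 < del < 1 -> flux (u n) del @[n --> \oo] --> A) ->
  forall phi : 'rV[R]_4 -> R, test_function (eball 1) phi ->
  (\int[lebesgue4]_(x in eball 1) (phi x * F k x)%:E)%E @[k --> \oo] -->
  ((m * A)%:E * \int[dirac (0%R : 'rV[R]_4)]_(x in eball 1) (phi x)%:E)%E.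
Proof.
move=> hA phi [cphi csupp supp1].
have [s /andP[s0 s1] supps] := compact_eball ltr01 csupp supp1.
have phi0 x : ~ eball s x -> phi x = 0.
  by move=> xs; apply: contrapT => /eqP px; apply: xs; apply: supps; exact: subset_closure.
have [C C0 phiC] : exists2 C : R, 0 <= C & forall x, `|phi x| <= C.
  have cn : {within [set x : 'rV[R]_4 | enorm x <= s], continuous (fun x => `|phi x|)}.
    apply: continuous_subspaceT => x.
    by apply: (@continuous_comp _ _ _ phi (@Num.norm _ R)); [exact: cphi|exact: norm_continuous].
  have ne : [set x : 'rV[R]_4 | enorm x <= s] !=set0 by exists 0; rewrite /= enorm0 ltW.
  have [c _ hc] := EVT_max_rV ne (@compact_closed_ball R s) cn.
  exists `|phi c| => // x; have [xs|/phi0 ->] := pselect (eball s x); last by rewrite normr0.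
  by apply: hc; apply: mem_set => /=; exact: ltW.
have mphi : measurable_fun [set: 'rV[R]_4] phi.
  by apply: continuous_on_measurable => // [|x _]; [exact: openT|exact: cphi].
have -> : (\int[dirac (0%R : 'rV[R]_4)]_(x in eball 1) (phi x)%:E = (phi 0)%:E)%E.
  rewrite integral_dirac //; last first.
  - by apply/measurable_EFinP; exact: measurable_funS mphi.
  - exact: measurable_eball.
  by rewrite diracE mem_set ?mul1e // /eball /= enorm0.
have int_s n : (\int[lebesgue4]_(x in eball 1) (phi x * F n x)%:E =
    \int[lebesgue4]_(x in eball s) (phi x * F n x)%:E)%E.
  rewrite integral_mkcond [RHS]integral_mkcond; congr (integral _ _ _); apply/funext => x.
  rewrite !patchE; case: ifPn => [/set_mem x1|x1]; case: ifPn => [/set_mem xs|xs] //.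
  - by rewrite phi0 ?mul0r // => /mem_set; exact/negP.
  - by move/negP: x1; case; apply: mem_set; exact: subset_eball (ltW s1) _ xs.
have key (e : R) : 0 < e -> \forall n \near \oo, exists I : R,
    (\int[lebesgue4]_(x in eball s) (phi x * F n x)%:E = I%:E)%E /\ `|m * A * phi 0 - I| <= e.
  move=> e0; pose N := `|m * A| + 1.
  have N0 : 0 < N by have := normr_ge0 (m * A); rewrite /N; lra.
  have e10 : 0 < e / 4 / N by apply: divr_gt0 => //; lra.
  have [d d0 hd] : exists2 d : R, 0 < d & forall x, eball d x -> `|phi x - phi 0| <= e / 4 / N.
    have /continuous_atP/(_ _ e10)/nbhs_ballP[d /= d0 hd] := cphi 0.
    exists d => // x xd; rewrite distrC; apply: hd.
    by rewrite -ball_normE /= sub0r normrN; exact: le_lt_trans (mx_norm_le_enorm x) _.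
  pose r := Num.min d s.
  have r0 : 0 < r by rewrite lt_min d0.
  have rs : r <= s by rewrite ge_min lexx orbT.
  have rd : r <= d by rewrite ge_min lexx.
  have hr1 : 0 < r < 1 by rewrite r0 (le_lt_trans rs).
  have hs1 : 0 < s < 1 by rewrite s0.
  have cA : m * flux (u n) s @[n --> \oo] --> m * A by apply: cvgMr; exact: hA.
  have cB : m * flux (u n) r @[n --> \oo] --> m * A by apply: cvgMr; exact: hA.
  have e2 : 0 < e / (16 * (C + 1)) by apply: divr_gt0 => //; apply: mulr_gt0 => //; lra.
  have dist (x : nat -> R) (z e' : R) : 0 < e' -> x n @[n --> \oo] --> z ->
      \forall n \near \oo, `|z - x n| <= e'.
    by move=> e'0 /cvgrPdist_le; apply.
  have nA := dist _ _ _ e2 cA.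
  have nB := dist _ _ _ e2 cB.
  have nB1 := dist _ _ _ ltr01 cB.
  have nF := density_ge0 s1.
  have nb := ball_mass hs1.
  apply: filterS (filterI nA (filterI nB (filterI nB1 (filterI nF nb)))) => n.
  move=> [An [Bn [Bn1 [F0 bm]]]].
  have hs0 : 0 <= s <= s by rewrite lexx ltW.
  have hr0 : 0 <= r <= s by rewrite rs ltW.
  have [I [hI hI2]] := weak_estimate rs (density_measurable n (ltW s1)) F0
    (measurable_funS measurableT (@subsetT _ _) mphi) (bm s hs0) (bm r hr0) C0 (ltW e10)
    (fun x _ => phiC x) (phiC 0) (fun x xr => hd x (subset_eball rd xr)).
  exists I; split => //.
  exact: (weak_arith e0 C0 N0 hI2 An Bn Bn1 erefl (phiC 0)).
rewrite -EFinM; apply/fine_cvgP; split.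
  by apply: filterS (key 1 ltr01) => n [I [hI _]]; rewrite int_s hI.
apply/cvgrPdist_le => e e0; apply: filterS (key e e0) => n [I [hI h]].
by rewrite /= int_s hI.
Qed.

End density.

Theorem theorem1p1 (R : realType) (V u : nat -> 'rV[R]_4 -> R)
    (Lambda : R)
    (V_C0 : forall k, Ck 0 (eball 1) (V k))
    (V_cvg : Ckloc_cvg 0 (eball 1) V (cst 1))
    (u_C4 : forall k, Ck 4 (eball 1) (u k))
    (u_eq : forall k x, eball 1 x ->
       laplacian (laplacian (u k)) x = V k x * expR (4 * u k x))
    (int_def : forall k,
       has_integral lebesgue4 (eball 1)
         (fun x => (V k x * expR (4 * u k x))%:E))
    (int_le : forall k,
       (\int[lebesgue4]_(x in eball 1)
          (V k x * expR (4 * u k x))%:E <= Lambda%:E)%E)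
    (u_blowup : blows_up (eball 1) u)
    (u_radial : forall k, radial_on (eball 1) (u k)) :
  exists (s : nat -> nat) (alpha : R),
    [/\ subsequence s,
        0 <= alpha <= 16 * pi ^+ 2,
        (forall phi : 'rV[R]_4 -> R, test_function (eball 1) phi ->
           (\int[lebesgue4]_(x in eball 1)
              (phi x * (V (s k) x * expR (4 * u (s k) x)))%:E)%E @[k --> \oo] -->
           (alpha%:E * \int[dirac (0%R : 'rV[R]_4)]_(x in eball 1) (phi x)%:E)%E) &
        [/\ exists2 C : R, 0 < C & forall k, u (s k) 0 <= C,
            alpha = 0 &
            Nycvg_loc (eball 1 `\ 0) (u \o s)]
        \/
        [/\ u (s k) 0 @[k --> \oo] --> +oo,
            (forall delta : R, 0 < delta < 1 ->
               exists I : R -> R,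
                 (forall r : R, 0 < r ->
                    (\int[lebesgue4]_(x in
                         eball delta `\` eball (r * expR (- u (s k) 0%R)))
                       (V (s k) x * expR (4 * u (s k) x))%:E)%E @[k --> \oo] -->
                    (I r)%:E) /\
                 I r @[r --> +oo] --> 0),
            (alpha = 16 * pi ^+ 2 ->
               let U x :=
                 ln (Num.sqrt 96 / (Num.sqrt 96 + enorm x ^+ 2)) in
               (forall x, rescale (u (s k)) x @[k --> \oo] --> U x) /\
               Ckloc_cvg 3 setT (fun k => rescale (u (s k))) U),
            (0 < alpha < 16 * pi ^+ 2 ->
               exists v : 'rV[R]_4 -> R,
                 [/\ Ck 4 setT v,
                     lebesgue4.-integrable setT
                       (fun x => (expR (4 * v x))%:E),
                     (forall x, rescale (u (s k)) x @[k --> \oo] --> v x),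
                     Ckloc_cvg 3 setT (fun k => rescale (u (s k))) v &
                     exists2 lambda : R, 0 < lambda &
                       v x / enorm x ^+ 2 @[x --> @at_infinity R] --> - lambda]) &
            (alpha = 0 ->
               let c k := expR (- 2 * u (s k) 0) * laplacian (u (s k)) 0 in
               let w k x := rescale (u (s k)) x / c k in
               let P x := - (enorm x ^+ 2 / 8) in
               [/\ c k @[k --> \oo] --> +oo,
                   (forall x, w k x @[k --> \oo] --> P x) &
                   Ckloc_cvg 3 setT w P])]].

Proof.
pose c n := expR (- 2 * u n 0) * laplacian (u n) 0.
pose U (x : 'rV[R]_4) := ln (Num.sqrt 96 / (Num.sqrt 96 + enorm x ^+ 2)) : R.
have sub_cvg (s : nat -> nat) : subsequence s -> Ckloc_cvg 0 (eball 1) (fun k => V (s k)) (cst 1).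
  by move=> hs; exact: (Ckloc_cvg_subsequence hs V_cvg).
have real_sub (s : nat -> nat) (x : nat -> R) (l : R) : subsequence s ->
    x n @[n --> \oo] --> l -> x (s n) @[n --> \oo] --> l.
  by move=> hs hx; exact: cvg_comp (subsequence_cvg hs) hx.
have oo_sub (s : nat -> nat) (x : nat -> R) : subsequence s ->
    x n @[n --> \oo] --> +oo -> x (s n) @[n --> \oo] --> +oo.
  by move=> hs hx; exact: cvg_comp (subsequence_cvg hs) hx.
(* Everything is first expressed through the limit [A] of the fluxes, that is
   [alpha / (2 * pi ^ 2)], so that [8] stands for [16 * pi ^ 2]. *)
have [s [A [hs hA hflux alt]]] : exists (s : nat -> nat) (A : R), [/\ subsequence s, 0 <= A <= 8,
    (forall del : R, 0 < del < 1 -> flux (u (s n)) del @[n --> \oo] --> A) &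
    [/\ exists2 C : R, 0 < C & forall k, u (s k) 0 <= C, A = 0 & Nycvg_loc (eball 1 `\ 0) (u \o s)] \/
    [/\ u (s k) 0 @[k --> \oo] --> +oo,
      exists Phi : R -> R, (forall r : R, 0 < r ->
        flux (u (s n)) (r * expR (- u (s n) 0)) @[n --> \oo] --> Phi r) /\ Phi r @[r --> +oo] --> A,
      A = 8 -> Ckloc_cvg 3 setT (fun k => rescale (u (s k))) U,
      0 < A < 8 -> exists v, [/\ Ck 4 setT v,
        (@lebesgue4 R).-integrable setT (fun x => (expR (4 * v x))%:E),
        Ckloc_cvg 3 setT (fun k => rescale (u (s k))) v &
        exists2 lambda : R, 0 < lambda & v x / enorm x ^+ 2 @[x --> @at_infinity R] --> - lambda] &
      A = 0 -> c (s k) @[k --> \oo] --> +oo /\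
        Ckloc_cvg 3 setT (fun k x => rescale (u (s k)) x / c (s k)) (fun x => - (enorm x ^+ 2 / 8))]].
  have [[s [C [hs hC]]]|uoo] := subsequence_dichotomy (fun n => u n 0).
    (* If the data at 0 are bounded along a subsequence, two further extractions make them converge,
       and the resulting C^4_loc limit contradicts [u_blowup]. *)
    have [[t [C' [ht hC']]]|hS] := subsequence_dichotomy
        (fun n => `|u (s n) 0| + `|laplacian (u (s n)) 0|).
      exfalso.
      have b1 n : - C' <= u (s (t n)) 0 <= C'.
        by have := hC' n; have := normr_ge0 (laplacian (u (s (t n))) 0); rewrite -ler_norml; lra.
      have b2 n : - C' <= laplacian (u (s (t n))) 0 <= C'.
        by have := hC' n; have := normr_ge0 (u (s (t n)) 0); rewrite -ler_norml; lra.
      have [t1 [p [ht1 hp]]] := bounded_subsequence b1.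
      have [t2 [q [ht2 hq]]] := bounded_subsequence (fun n => b2 (t1 n)).
      have hsig : subsequence (fun n => s (t (t1 (t2 n)))).
        exact: subsequence_comp (subsequence_comp hs ht) (subsequence_comp ht1 ht2).
      have [v [vC hv]] := bounded_cvg (sub_cvg _ hsig) (fun k => u_C4 _) (fun k => @u_eq _)
        (fun k => u_radial _) (fun n => hC _) (real_sub _ _ _ ht2 hp) hq.
      apply: u_blowup; exists (fun n => s (t (t1 (t2 n)))), v; split => //.
        exact: Ck_le vC.
      exact: (@Ckloc_cvg_le _ 3 4 _ _ _ isT hv).
    exists s, 0; split=> //; first by rewrite lexx ler0n.
      exact: (unbounded_mass (sub_cvg _ hs) (fun k => u_C4 _) (fun k => @u_eq _) (fun k => u_radial _) hC hS).
    left; split => //.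
      exists (Num.max C 1); first by rewrite lt_max ltr01 orbT.
      by move=> k; rewrite le_max hC.
    exact: (unbounded_Nycvg (sub_cvg _ hs) (fun k => u_C4 _) (fun k => @u_eq _) (fun k => u_radial _) hC hS).
  have [[s [C [hs hC]]]|coo] := subsequence_dichotomy c.
    have [N _ hN] := laplacian_lower_near V_cvg u_C4 u_eq u_radial uoo.
    (* Shifting by [N] makes the lower bound on the rescaled Laplacian valid for every index. *)
    have hadd : subsequence (fun n => s (N + n)%N).
      by move=> i j ij; apply: hs; rewrite ltn_add2l.
    have b1 n : 0 <= c (s (N + n)%N) <= C.
      rewrite hC andbT; apply: hN => /=.
      exact: leq_trans (leq_addr n N) (subsequence_ge hs _).
    have [t [q [ht hq]]] := bounded_subsequence b1.
    have hsig : subsequence (fun n => s (N + t n)%N) by exact: subsequence_comp hadd ht.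
    pose sg n := s (N + t n)%N.
    have uoo' : u (sg n) 0 @[n --> \oo] --> +oo := oo_sub _ _ hsig uoo.
    have V' := sub_cvg _ hsig.
    have C4' k : Ck 4 (eball 1) (u (sg k)) := u_C4 _.
    have eq' k x : eball 1 x ->
      laplacian (laplacian (u (sg k))) x = V (sg k) x * expR (4 * u (sg k) x) := @u_eq _ x.
    have rad' k : radial_on (eball 1) (u (sg k)) := u_radial _.
    have hq' : c (sg n) @[n --> \oo] --> q := hq.
    have := laplacian_lower V' C4' eq' rad' uoo' hq'; rewrite le_eqVlt => /predU1P[qE|qlt].
      rewrite -qE in hq'.
      have [h1 h2 h3] := critical_outcome V' C4' eq' rad' uoo' hq'.
      exists sg, 8; split=> //; first by rewrite ler0n lexx.
      right; split=> //.
        by rewrite ltxx andbF.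
      by move/eqP; rewrite pnatr_eq0.
    have [A [hA h1 h2 h3]] := subcritical_outcome V' C4' eq' rad' uoo' hq' qlt.
    have [A0 A8] := andP hA.
    exists sg, A; split=> //; first by rewrite !ltW.
    right; split=> // AE.
      by rewrite AE ltxx in A8.
    by rewrite AE ltxx in A0.
  have [h1 h2] := infinite_outcome V_cvg u_C4 u_eq u_radial uoo coo.
  exists id, 0; split=> //; first by rewrite lexx ler0n.
  right; split=> //.
  - by exists (fun=> 0); split; [exact: h1|exact: cvg_cst].
  - by move/esym/eqP; rewrite pnatr_eq0.
  - by rewrite ltxx.
  - by move=> _; split; [exact: coo|exact: (rescale_quadratic V_cvg u_C4 u_eq u_radial uoo coo)].
have V' := sub_cvg _ hs.
have C0' k : Ck 0 (eball 1) (V (s k)) := V_C0 _.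
have C4' k : Ck 4 (eball 1) (u (s k)) := u_C4 _.
have eq' k x : eball 1 x ->
  laplacian (laplacian (u (s k))) x = V (s k) x * expR (4 * u (s k) x) := @u_eq _ x.
have rad' k : radial_on (eball 1) (u (s k)) := u_radial _.
have m0 : 0 < 2 * pi ^+ 2 :> R by apply: mulr_gt0 => //; apply: exprn_gt0; exact: pi_gt0.
have m8 : 16 * pi ^+ 2 = 2 * pi ^+ 2 * 8 :> R by ring.
exists s, (2 * pi ^+ 2 * A); split => //.
- by have [A0 A8] := andP hA; rewrite mulr_ge0 ?(ltW m0) //= m8 ler_pM2l.
- exact: (weak_cvg C0' V' C4' eq' rad' hflux).
case: alt => [[hC A0 hNy]|[uoo [Phi [hPhi PhiA]] h8 hsub h0]]; [left|right].
  by split => //; rewrite A0 mulr0.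
split=> //.
- move=> del hd; exact: (annulus_cvg C0' V' C4' eq' rad' uoo hPhi PhiA hflux hd).
- rewrite m8 => /(mulfI (lt0r_neq0 m0)) /h8 hU; split => // x.
  exact: (Ckloc_cvg_pointwise hU).
- rewrite m8 pmulr_rgt0 // ltr_pM2l // => /hsub[v [vC vint hv hl]].
  by exists v; split => // x; exact: (Ckloc_cvg_pointwise hv).
- move=> /eqP; rewrite mulf_eq0 gt_eqF //= => /eqP /h0[hc hw]; split => // x.
  exact: (Ckloc_cvg_pointwise hw).
Qed.
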